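(* Let $\mu$ be a symmetric probability measure on $\mathbb R$ with unit variance, $L(x)=\log\int e^{xt}\,d\mu(t)$ and $\psi(x)=L(x)/x^2$ (with $\psi(0)=1/2$). Assume that $A:=2\sup_{x\in\mathbb R}\psi(x)<+\infty$, that $A>1$, that the limit $B:=2\lim_{|x|\to+\infty}\psi(x)\ge 0$ exists, and that $x\mapsto L(\sqrt{x})$ is Lipschitz on $[0,+\infty)$. Let $X_N$ be the Wigner matrix associated with $\mu$ and assume that for some $\kappa>0$, $\limsup_{N\to+\infty}\frac1N\log\mathbb P\big(d(\hat\mu_{X_N},\sigma)>N^{-\kappa}\big)=-\infty$. Then for $\theta>0$, $$\overline F(\theta)=\limsup_{\substack{\delta\to0,\,K\to+\infty\\ \delta K\to0}}\ \sup_{\substack{\alpha_1+\alpha_2+\alpha_3=1\\ \alpha_i\ge0}}\ \limsup_{N\to+\infty}\mathcal F^N_{\alpha_1,\alpha_2,\alpha_3}(\delta,K),$$ $$\underline F(\theta)=\sup_{\substack{\alpha_1+\alpha_2+\alpha_3=1\\ \alpha_i\ge0}}\ \liminf_{\substack{\delta\to0,\,K\to+\infty\\ \delta K\to0}}\ \liminf_{N\to+\infty}\mathcal F^N_{\alpha_1,\alpha_2,\alpha_3}(\delta,K),$$ where $$\mathcal F^N_{\alpha_1,\alpha_2,\alpha_3}(\delta,K)=\theta^2(\alpha_1^2+2\alpha_1\alpha_2+B\alpha_3^2)+\sup_{\substack{t_i\in I_2,\ i\le l\\ |\sum_it_i^2-N\alpha_2|\le\delta N}}\ \sup_{\substack{s_i\in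 I_3,\ i\le k\\ |\sum_is_i^2-N\alpha_3|\le\delta N}}\Big\{\frac1N\sum_{i=1}^k\sum_{j=1}^lL\Big(\frac{2\theta s_it_j}{\sqrt N}\Big)+\frac1{2N}\sum_{i,j=1}^lL\Big(\frac{2\theta t_it_j}{\sqrt N}\Big)$$ $$\qquad+\sup_{\substack{\nu_1\in\mathcal P(I_1)\\ \int x^2d\nu_1(x)=\alpha_1}}\Big\{\sum_{i=1}^k\int L\Big(\frac{2\theta s_ix}{\sqrt N}\Big)d\nu_1(x)-H(\nu_1)\Big\}-\frac12\log(2\pi)-\frac12\Big\}.$$ Here the suprema over $t$ and $s$ also range over the numbers $l,k\in\{0,1,2,\dots\}$ of coordinates, $I_1=\{x:|x|\le\delta^{1/2}N^{1/4}\}$, $I_2=\{x:\delta^{1/2}N^{1/4}<|x|\le K^{1/2}N^{1/4}\}$ and $I_3=\{x:K^{1/2}N^{1/4}<|x|\le\sqrt{N\alpha_3}\}$.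
   Context: Wigner matrix associated with $\mu$: $X_N$ is an $N\times N$ real symmetric random matrix with independent entries $(X_{ij})_{i\le j}$ such that $\sqrt N X_{ij}$ has law $\mu$ for $i<j$ and $\sqrt{N/2}\,X_{ii}$ has law $\mu$ for all $i$. $\hat\mu_{X_N}$ is the empirical distribution of its eigenvalues, $\sigma(dx)=\frac1{2\pi}\sqrt{4-x^2}\,\mathbf 1_{|x|\le2}dx$ is the semicircle law, and $d$ is a distance compatible with the weak topology. Annealed spherical integral: for $\theta\ge0$, $F_N(\theta)=\frac1N\log\mathbb E_{X_N}\mathbb E_e[\exp(N\theta\langle e,X_Ne\rangle)]$, where $e$ is uniform on $\mathbb S^{N-1}$ and independent of $X_N$; $\overline F(\theta)=\limsup_NF_N(\theta)$, $\underline F(\theta)=\liminf_NF_N(\theta)$. $\mathcal P(I)$ is the set of probability measures supported on $I$. $H(\nu)=\int\log\frac{d\nu}{dx}\,d\nu(x)$ if $\nu$ is absolutely continuous with respect to Lebesgue measure, and $H(\nu)=+\infty$ otherwise. *)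

(* Defs.v *)
From HB Require Import structures.
From mathcomp Require Import all_boot all_order all_algebra.
From mathcomp Require Import all_classical all_reals all_analysis.

Set Implicit Arguments.
Unset Strict Implicit.
Unset Printing Implicit Defensive.

Import Order.TTheory GRing.Theory Num.Theory.
Import numFieldNormedType.Exports.

Local Open Scope classical_set_scope.
Local Open Scope ring_scope.
Local Open Scope ereal_scope.

Definition probR (R : realType) : Type := probability (measurableTypeR R) R.

(* The logarithmic moment generating function is extended-real valued, so that
   a divergent exponential moment is +oo and is excluded by [A < +oo]. *)
Definition log_mgf (R : realType) (mu : probR R) (x : R) : \bar R :=
  lne (\int[mu]_t (expR (x * t))%:E).

Definition psi (R : realType) (mu : probR R) (x : R) : \bar R :=
  if x == 0%R then (2^-1)%:E else log_mgf mu x * (x ^- 2)%:E.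

Definition psi_bound (R : realType) (mu : probR R) : \bar R :=
  2%:E * ereal_sup (range (psi mu)).

Definition symmetric_law (R : realType) (mu : probR R) : Prop :=
  forall A : set (measurableTypeR R), measurable A -> mu (-%R @^-1` A) = mu A.

Definition unit_variance (R : realType) (mu : probR R) : Prop :=
  'V_mu[(fun x : measurableTypeR R => x : R)] = 1.

Definition has_law (d : measure_display) (T : measurableType d) (R : realType)
    (P : probability T R) (Y : T -> measurableTypeR R) (mu : probR R) : Prop :=
  measurable_fun [set: T] Y /\
  forall A : set (measurableTypeR R), measurable A -> P (Y @^-1` A) = mu A.

Definition mutually_independent (d : measure_display) (T : measurableType d)
    (R : realType) (P : probability T R) (I : finType) (D : {set I})
    (Y : I -> T -> measurableTypeR R) : Prop :=
  forall (J : {set I}) (B : I -> set (measurableTypeR R)),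
    J \subset D -> (forall i, i \in J -> measurable (B i)) ->
    P (\bigcap_(i in [set` J]) (Y i @^-1` B i)) =
    \prod_(i in J) P (Y i @^-1` B i).

Definition wigner_matrix (d : measure_display) (T : measurableType d)
    (R : realType) (P : probability T R) (mu : probR R) (N : nat)
    (X : T -> 'M[R]_N) : Prop :=
  [/\ forall w, ((X w)^T = X w)%R,
      mutually_independent P
        [set p : 'I_N * 'I_N | (p.1 <= p.2)%N]%SET (fun p w => X w p.1 p.2),
      forall i j : 'I_N, (i < j)%N ->
        has_law P (fun w => Num.sqrt N%:R * X w i j)%R mu
    & forall i : 'I_N,
        has_law P (fun w => Num.sqrt (N%:R / 2) * X w i i)%R mu].

(* The eigenvalues with multiplicity, i.e. the roots of a characteristic
   polynomial that splits over R (always the case for symmetric M). *)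
Definition eigenvalues (R : realType) (N : nat) (M : 'M[R]_N) : seq R :=
  xget [::]
    [set s : seq R | char_poly M = (\prod_(a <- s) ('X - a%:P))%R].

(* The normalization divides by the total mass, which is N for symmetric M.
   The second argument of [mnormalize] is used for an empty spectrum only. *)
Definition empirical_measure (R : realType) (N : nat) (M : 'M[R]_N) : probR R :=
  mnormalize
    (msum (fun i => \d_((eigenvalues M)`_i : measurableTypeR R))
          (size (eigenvalues M)))
    (\d_(0%R : measurableTypeR R)).

Definition semicircle_density (R : realType) (x : R) : R :=
  if (`|x| <= 2)%R then ((2 * pi)^-1 * Num.sqrt (4 - x ^+ 2))%R else 0%R.

Definition semicircle_law (R : realType) (sigma : probR R) : Prop :=
  forall A : set (measurableTypeR R), measurable A ->
    sigma A = \int[lebesgue_measure]_(x in A) (semicircle_density x)%:E.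

(* Probabilities are functions on all subsets, so equality of laws is
   agreement on the measurable ones. *)
Definition is_distance (R : realType) (dist : probR R -> probR R -> R) : Prop :=
  [/\ forall P Q, (0 <= dist P Q)%R,
      forall P Q, dist P Q = 0%R <->
        (forall A : set (measurableTypeR R), measurable A -> P A = Q A),
      forall P Q, dist P Q = dist Q P
    & forall P Q S, (dist P S <= dist P Q + dist Q S)%R].

(* Neighborhoods for the topology generated by the maps P |-> \int f dP,
   f bounded continuous. *)
Definition weak_nbhs (R : realType) (P : probR R) : set_system (probR R) :=
  [set V | exists (n : nat) (f : 'I_n -> R -> R) (e : R),
     [/\ forall i, continuous (f i) /\ [bounded f i x | x in [set: R]],
         (0 < e)%R
       & forall Q : probR R,
           (forall i, (`|\int[Q]_x (f i x) - \int[P]_x (f i x)| < e)%R) -> V Q]].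

Definition weak_compatible (R : realType) (dist : probR R -> probR R -> R) :
    Prop :=
  forall (P : probR R) (V : set (probR R)),
    (exists2 e : R, (0 < e)%R & forall Q, (dist P Q < e)%R -> V Q)
    <-> weak_nbhs P V.

Definition unit_sphere (R : realType) (N : nat) :
    set (N.-tuple (measurableTypeR R)) :=
  [set e | (\sum_(i < N) (tnth e i : R) ^+ 2)%R = 1%R].

Definition mx_act (R : realType) (N : nat) (O : 'M[R]_N)
    (e : N.-tuple (measurableTypeR R)) : N.-tuple (measurableTypeR R) :=
  [tuple (\sum_(j < N) O i j * (tnth e j : R))%R | i < N].

(* The uniform law on the sphere is the unique rotation invariant one. *)
Definition uniform_on_sphere (R : realType) (N : nat)
    (U : probability (N.-tuple (measurableTypeR R)) R) : Prop :=
  U (@unit_sphere R N) = 1 /\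
  forall O : 'M[R]_N, (O *m O^T = 1%:M)%R ->
    forall A : set (N.-tuple (measurableTypeR R)), measurable A ->
      U (mx_act O @^-1` A) = U A.

Definition quad_form (R : realType) (N : nat) (M : 'M[R]_N)
    (e : N.-tuple (measurableTypeR R)) : R :=
  (\sum_(i < N) \sum_(j < N) (tnth e i : R) * M i j * (tnth e j : R))%R.

Definition annealed_integral (R : realType) (d : measure_display)
    (T : measurableType d) (N : nat) (P : probability T R) (X : T -> 'M[R]_N)
    (U : probability (N.-tuple (measurableTypeR R)) R) (theta : R) : \bar R :=
  (N%:R^-1)%:E *
  lne (\int[P]_w \int[U]_e (expR (N%:R * theta * quad_form (X w) e))%:E).

Definition entropy (R : realType) (nu : probR R) : \bar R :=
  if `[< nu `<< (@lebesgue_measure R) >] then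
    \int[nu]_x lne (Radon_Nikodym (charge_of_finite_measure nu)
                       (@lebesgue_measure R) x)
  else +oo.

Definition I1 (R : realType) (N : nat) (delta : R) : set R :=
  [set x | (`|x| <= Num.sqrt delta * N%:R `^ 4^-1)%R].

Definition I2 (R : realType) (N : nat) (delta K : R) : set R :=
  [set x | (Num.sqrt delta * N%:R `^ 4^-1 < `|x| <=
            Num.sqrt K * N%:R `^ 4^-1)%R].

Definition I3 (R : realType) (N : nat) (K alpha3 : R) : set R :=
  [set x | (Num.sqrt K * N%:R `^ 4^-1 < `|x| <= Num.sqrt (N%:R * alpha3))%R].

Section variational_functional.
Variables (R : realType) (mu : probR R) (B theta : R) (N : nat).
Variables (alpha1 alpha2 alpha3 delta K : R).

Let L (x : R) : \bar R := log_mgf mu x.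

Definition admissible (I : set R) (alpha : R) (m : nat) (t : 'I_m -> R) : Prop :=
  (forall i, I (t i)) /\
  (`|\sum_(i < m) t i ^+ 2 - N%:R * alpha| <= delta * N%:R)%R.

Definition bulk_sup (k : nat) (s : 'I_k -> R) : \bar R :=
  ereal_sup
    [set (\sum_(i < k) \int[nu]_x L (2 * theta * s i * x / Num.sqrt N%:R)%R)
         - entropy nu
    | nu in [set nu : probR R | nu (I1 N delta) = 1 /\
                                \int[nu]_x (x ^+ 2)%:E = alpha1%:E]].

Definition FN_braces (l k : nat) (t : 'I_l -> R) (s : 'I_k -> R) : \bar R :=
  (N%:R^-1)%:E * (\sum_(i < k) \sum_(j < l)
                    L (2 * theta * s i * t j / Num.sqrt N%:R)%R)
  + ((2 * N%:R)^-1)%:E * (\sum_(i < l) \sum_(j < l)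
                    L (2 * theta * t i * t j / Num.sqrt N%:R)%R)
  + bulk_sup s
  - (2^-1 * ln (2 * pi))%:E - (2^-1)%:E.

(* The numbers l and k of coordinates range over nat, including 0. *)
Definition FN_functional : \bar R :=
  (theta ^+ 2 * (alpha1 ^+ 2 + 2 * alpha1 * alpha2 + B * alpha3 ^+ 2))%:E
  + ereal_sup
      [set y | exists (l : nat) (t : 'I_l -> R),
         admissible (I2 N delta K) alpha2 t /\
         y = ereal_sup
               [set z | exists (k : nat) (s : 'I_k -> R),
                  admissible (I3 N K alpha3) alpha3 s /\
                  z = FN_braces t s]].

End variational_functional.

(* The filter of the limit delta -> 0+, K -> +oo, delta K -> 0 in (delta, K). *)
Definition deltaK_filter (R : realType) : set_system (R * R) :=
  filter_from [set e : R | (0 < e)%R]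
    (fun e => [set p | [/\ (0 < p.1 < e)%R, (e^-1 < p.2)%R
                         & (p.1 * p.2 < e)%R]]).

Definition simplex3 (R : realType) : set (R * R * R) :=
  [set a | [/\ (0 <= a.1.1)%R, (0 <= a.1.2)%R, (0 <= a.2)%R
             & (a.1.1 + a.1.2 + a.2)%R = 1%R]].

(* Main.v *)
(** Averaging over the Wigner matrix first turns the annealed integral into the spherical average of
    exp (Phi e), where Phi e sums values of L over pairs of coordinates of e and differs by o(N) from the
    energy (1/2) sum_{i,j} L (2 theta sqrt N e_i e_j).  After convolution with a narrow Gaussian, rotation
    invariance makes this average comparable, up to the factor (2 pi e)^(N/2), with a sum of exp (energy)
    over the lattice vectors y with |y|^2 close to N.

    Lower bound: freeze the large and the middle coordinates at an admissible configuration (t, s) and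
    let the small ones follow Gibbs weights tilted to have second moment alpha_1; the Gibbs variational
    principle compares their partition function with the supremum over nu_1.

    Upper bound: by pigeonhole there is a light window of scales separating the bulk from the large
    coordinates; the types of the bulk coordinates, of which there are polynomially many, yield a
    measure nu_1.  The configuration found in a fixed dimension M is carried to every large N by scaling
    the large coordinates with sqrt (N/M) and by spreading each middle coordinate over many sites at the
    scale N^(1/4).  Hence the free energy in dimension M is at most the functional in every large
    dimension N, which in turn is at most the free energy in dimension N, up to arbitrarily small errors:
    the free energies converge, and both formulas give the limit. *)

Require Import Defs.
From HB Require Import structures.
From mathcomp Require Import all_boot all_order all_algebra.
From mathcomp Require Import all_classical all_reals all_analysis.
From mathcomp Require Import measurable_realfun.
From mathcomp Require Import ring lra.

Set Implicit Arguments.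
Unset Strict Implicit.
Unset Printing Implicit Defensive.

Import Order.TTheory GRing.Theory Num.Theory.
Import numFieldNormedType.Exports.

Local Open Scope classical_set_scope.
Local Open Scope ring_scope.

(** * Lattice sums and Gaussian sums *)

Section LatticeRiemann.
Variable R : realType.
Local Notation leb := (@lebesgue_measure R).
Implicit Types (g : R -> R) (F : nat -> R).

(** The obstacle is that nothing is known beforehand about convergence in N: the best configuration
    may change from one dimension to the next. Two one-sided comparisons suffice, the functional
    against the free energy in the same dimension, and the free energy in dimension M against the
    functional in all large dimensions.

    A lattice takes the place of the sphere because counting types requires finitely many values per
    coordinate and a norm that is not fixed exactly. Two devices make the transfer possible. The
    extraction works on a shell strictly inside the sphere of radius sqrt N, and the missing mass
    becomes one more large coordinate, so that the three masses add up to exactly 1. A middle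
    coordinate is shared by about sqrt (N / M) sites: the number of pairs of copies and the argument
    of the potential then vary inversely, and the middle-middle energy is preserved. The
    large-middle arguments tend to infinity, so these pairs become linear with slope B / 2, which is
    already nearly their value in dimension M because the light window keeps their arguments
    large. *)

Lemma itv_split_step (a h : R) (n : nat) : 0 <= h ->
  `[a, a + h * n.+1%:R[%classic =
  `[a, a + h * n%:R[%classic `|` `[a + h * n%:R, a + h * n.+1%:R[%classic :> set R.
Proof.
move=> h0; have e1 : a <= a + h * n%:R by rewrite lerDl mulr_ge0.
have e2 : a + h * n%:R <= a + h * n.+1%:R.
  by rewrite lerD2l ler_wpM2l// ler_nat.
apply/seteqP; split=> x /=; rewrite !in_itv /=.
- by move=> /andP[ax xb]; case: (ltP x (a + h * n%:R)) => H; [left|right]; rewrite ?ax ?H.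
- by case=> /andP[p q]; apply/andP; split=> //;
   [exact: lt_le_trans q e2|exact: le_trans e1 p].
Qed.

Lemma itv_disj_step (a h : R) (n : nat) :
  [disjoint `[a, a + h * n%:R[%classic & `[a + h * n%:R, a + h * n.+1%:R[%classic].
Proof.
apply/disj_setPRL => x /=; rewrite !in_itv /= => /andP[p _].
case/andP=> _ q; by move: (lt_le_trans q p); rewrite ltxx.
Qed.

Lemma lebesgue_cell (a h : R) (n : nat) : 0 <= h ->
  leb `[a + h * n%:R, a + h * n.+1%:R[%classic = h%:E.
Proof.
move=> h0; rewrite lebesgue_measure_itv /= lte_fin.
have -> : a + h * n.+1%:R = a + h * n%:R + h by rewrite -natr1; ring.
rewrite ltrDl; case: ltP => [h1|h1]; first by rewrite -EFinB addrC addKr.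
by congr EFin; apply: le_anti; rewrite h0 h1.
Qed.

Lemma integral_le_lattice g (a h : R) F (n : nat) : 0 <= h ->
  measurable_fun setT g -> (forall x, 0 <= g x) ->
  (forall k x, (k < n)%N -> a + h * k%:R <= x < a + h * k.+1%:R -> g x <= F k) ->
  (\int[leb]_(x in `[a, (a + h * n%:R)%R[%classic) (g x)%:E
    <= (\sum_(k < n) h * F k)%R%:E)%E.
Proof.
move=> h0 mg g0; elim: n => [|n IH] H.
  by rewrite mulr0 addr0 set_itvco0 integral_set0 big_ord0.
have mE A : measurable A -> measurable_fun A (EFin \o g).
  by move=> mA; apply/measurable_EFinP; exact: measurable_funS mg.
rewrite itv_split_step// ge0_integral_setU//; last 3 first.
- by apply: mE; apply: measurableU.
- by move=> x _; rewrite lee_fin.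
- exact: itv_disj_step.
rewrite big_ord_recr /= EFinD; apply: leeD.
  by apply: IH => k x kn; apply: H; rewrite ltnS ltnW.
(* An upper bound of [g] is nonnegative only on a nonempty cell; for [h = 0] the cell is empty and
   [F n] may have any sign. *)
have [F0|/eqP h00] : 0 <= F n \/ h = 0.
  have [/eqP -> |hn0] := boolP (h == 0); [by right|left].
  apply: le_trans (g0 (a + h * n%:R)) _; apply: H => //.
  by rewrite lexx /= ltrD2l ltr_pM2l ?ltr_nat// lt_neqAle eq_sym hn0.
- apply: (@le_trans _ _ (\int[leb]_(x in `[(a + h * n%:R)%R, (a + h * n.+1%:R)%R[) (F n)%:E)%E).
    apply: ge0_le_integral => //=.
    + by move=> x _; rewrite lee_fin.
    + exact: mE.
    + by move=> x; rewrite in_itv /= => Hx; rewrite lee_fin; apply: H.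
  by rewrite integral_cst//= [X in (_ * X)%E](lebesgue_cell a n h0) -EFinM mulrC.
- move: h00 => /eqP ->; rewrite !mul0r addr0 set_itvco0 integral_set0; exact: lexx.
Qed.

Lemma lattice_le_integral g (a h : R) F (n : nat) : 0 <= h ->
  measurable_fun setT g -> (forall x, 0 <= g x) ->
  (forall k x, (k < n)%N -> a + h * k%:R <= x < a + h * k.+1%:R -> F k <= g x) ->
  ((\sum_(k < n) h * F k)%R%:E <=
   \int[leb]_(x in `[a, (a + h * n%:R)%R[%classic) (g x)%:E)%E.
Proof.
move=> h0 mg g0; elim: n => [|n IH] H.
  by rewrite mulr0 addr0 set_itvco0 integral_set0 big_ord0.
have mE A : measurable A -> measurable_fun A (EFin \o g).
  by move=> mA; apply/measurable_EFinP; exact: measurable_funS mg.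
rewrite itv_split_step// ge0_integral_setU//; last 3 first.
- by apply: mE; apply: measurableU.
- by move=> x _; rewrite lee_fin.
- exact: itv_disj_step.
rewrite big_ord_recr /= EFinD; apply: leeD.
  by apply: IH => k x kn; apply: H; rewrite ltnS ltnW.
(* The lower value [F n] may be negative, whereas the comparison of integrals is for nonnegative
   functions. *)
apply: (@le_trans _ _ (\int[leb]_(x in `[(a + h * n%:R)%R, (a + h * n.+1%:R)%R[) (Num.max 0 (F n))%:E)%E).
  by rewrite integral_cst//= [X in (_ * X)%E](lebesgue_cell a n h0) -EFinM mulrC lee_fin ler_wpM2r// le_max lexx orbT.
apply: ge0_le_integral => //=.
- by move=> x _; rewrite lee_fin le_max lexx.
- exact: mE.
- by move=> x; rewrite in_itv /= => Hx; rewrite lee_fin ge_max g0 H.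
Qed.

(** The normal density of variance 1 / (2 b) has mass one, and its peak is the inverse of the
    right-hand side. *)
Lemma integral_gauss (b x : R) : 0 < b ->
  (\int[leb]_y (expR (- b * (y - x) ^+ 2))%:E = (Num.sqrt (pi / b))%:E)%E.
Proof.
move=> b0; pose s := Num.sqrt (2 * b)^-1.
have s2 : s ^+ 2 = (2 * b)^-1 by rewrite sqr_sqrtr// invr_ge0 mulr_ge0 ?ltW.
have s0 : s != 0 by rewrite gt_eqF// sqrtr_gt0 invr_gt0 mulr_gt0.
have := integral_normal_pdf x s.
under eq_integral do rewrite normal_pdfE// EFinM.
rewrite ge0_integralZl//=; last 3 first.
- by apply/measurable_EFinP; exact: measurable_normal_fun.
- by move=> y _; rewrite lee_fin normal_fun_ge0.
- by rewrite lee_fin normal_peak_ge0.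
have -> : (fun y => (normal_fun x s y)%:E) = (fun y => (expR (- b * (y - x) ^+ 2))%:E).
  apply/funext => y; rewrite /normal_fun s2; congr (expR _)%:E.
  by field; rewrite lt0r_neq0.
have p0 : 0 < normal_peak s by rewrite normal_peak_gt0.
have E : Num.sqrt (pi / b) = (normal_peak s)^-1.
  rewrite /normal_peak invrK s2; congr Num.sqrt; by field; rewrite lt0r_neq0.
rewrite E; case: (\int[leb]_y _)%E => [r| |] /=.
- by move=> [] H; congr EFin; apply: (mulfI (lt0r_neq0 p0)); rewrite H divff// lt0r_neq0.
- by rewrite gt0_muley.
- by rewrite gt0_muleNy.
Qed.
End LatticeRiemann.

Section LatticeGauss.
Variable R : realType.
Local Notation leb := (@lebesgue_measure R).

(* The points cover [-4N, 4N[, twice the range of the coordinates met below; the step N^-3 is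
   small enough for Riemann sums to be accurate after summing N coordinates. *)
Definition lattice_step (N : nat) : R := (N%:R ^+ 3)^-1.
Definition lattice_size (N : nat) : nat := (8 * N ^ 4)%N.
Definition lattice_pt (N k : nat) : R := - (4 * N%:R) + lattice_step N * k%:R.
Definition gauss_sum (N : nat) (b x : R) : R :=
  \sum_(k < lattice_size N) lattice_step N * expR (- b * (lattice_pt N k - x) ^+ 2).

Lemma lattice_step_ge0 N : 0 <= lattice_step N.
Proof. by rewrite invr_ge0 exprn_ge0. Qed.

Lemma lattice_step_gt0 N : (0 < N)%N -> 0 < lattice_step N.
Proof. by move=> N0; rewrite invr_gt0 exprn_gt0// ltr0n. Qed.

Lemma lattice_span N : (0 < N)%N ->
  lattice_step N * (lattice_size N)%:R = 8 * N%:R :> R.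
Proof.
move=> N0; rewrite /lattice_step /lattice_size natrM natrX.
by field; rewrite pnatr_eq0 -lt0n.
Qed.

Lemma lattice_pt_bound N (k : nat) : (k < lattice_size N)%N ->
  `|lattice_pt N k| <= 4 * N%:R.
Proof.
move=> kq; have N0 : (0 < N)%N.
  by move: kq; rewrite /lattice_size; case: N => [|//]; rewrite exp0n.
rewrite ler_norml /lattice_pt lerDl mulr_ge0 ?lattice_step_ge0//= -lerBrDl opprK.
have -> : 4 * N%:R + 4 * N%:R = lattice_step N * (lattice_size N)%:R.
  by rewrite lattice_span//; ring.
by rewrite ler_wpM2l ?lattice_step_ge0// ler_nat ltnW.
Qed.

Lemma expR_lip (p q : R) : 0 <= p -> 0 <= q -> `|expR (- p) - expR (- q)| <= `|p - q|.
Proof.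
move=> p0 q0; wlog pq : p q p0 q0 / p <= q.
  move=> H; case: (leP p q) => [|/ltW] pq; first exact: H.
  by rewrite distrC (distrC p); apply: H.
rewrite distrC (distrC p) ler0_norm; last by rewrite subr_le0 ler_expR lerN2.
rewrite ger0_norm ?subr_ge0// opprB.
have -> : expR (- p) - expR (- q) = expR (- p) * (1 - expR (- (q - p))).
  by rewrite mulrBr mulr1 -expRD; congr (_ - expR _); ring.
apply: (@le_trans _ _ (1 - expR (- (q - p)))).
  rewrite ler_piMl//; first by rewrite subr_ge0 -expR0 ler_expR oppr_le0 subr_ge0.
  by rewrite -expR0 ler_expR oppr_le0.
by have := expR_ge1Dx (- (q - p)); lra.
Qed.

(** The exponents differ by b times a product: one factor is at most the step, the other at most 14
    N because the lattice point, [y] and [x] are bounded by 4 N, 5 N and 2 N. *)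
Lemma gauss_cell N (b x y : R) (k : nat) : (0 < N)%N -> 0 < b ->
  `|x| <= 2 * N%:R -> (k < lattice_size N)%N ->
  - (4 * N%:R) + lattice_step N * k%:R <= y
    < - (4 * N%:R) + lattice_step N * k.+1%:R ->
  `|expR (- b * (lattice_pt N k - x) ^+ 2) - expR (- b * (y - x) ^+ 2)|
    <= 14 * b * N%:R * lattice_step N.
Proof.
move=> N0 b0 xN kq /andP[y1 y2]; rewrite !mulNr.
have N1 : 1 <= N%:R :> R by rewrite ler1n.
have h0 := lattice_step_ge0 N.
have h1 : lattice_step N <= 1 :> R.
  by rewrite invf_le1 ?exprn_gt0 ?ltr0n// exprn_ege1.
have /ler_normlP[p1 p2] := lattice_pt_bound kq.
have /ler_normlP[x1 x2] := xN.
have e : - (4 * N%:R) + lattice_step N * k.+1%:R = lattice_pt N k + lattice_step N.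
  by rewrite /lattice_pt -natr1; ring.
rewrite e in y2.
have sq z : 0 <= b * z ^+ 2 by rewrite pmulr_rge0// sqr_ge0.
apply: le_trans (expR_lip (sq _) (sq _)) _.
have -> : b * (lattice_pt N k - x) ^+ 2 - b * (y - x) ^+ 2 =
  b * ((lattice_pt N k + y - 2 * x) * (lattice_pt N k - y)) by ring.
rewrite normrM (gtr0_norm b0) normrM.
have -> : 14 * b * N%:R * lattice_step N = b * (14 * N%:R * lattice_step N) by ring.
rewrite ler_wpM2l ?(ltW b0)// ler_pM//.
  by rewrite ler_norml; apply/andP; rewrite /lattice_pt in y2 p1 p2 *; split; lra.
by rewrite ler_norml; apply/andP; rewrite /lattice_pt in y1 y2 *; split; lra.
Qed.

Lemma measurable_gauss (b x : R) :
  measurable_fun setT (fun y : R => expR (- b * (y - x) ^+ 2)).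
Proof.
apply: measurableT_comp => //; apply: measurable_funM => //.
by apply: measurable_funX; apply: measurable_funB.
Qed.

(** An error c N h in each of the 8 N^4 cells of width h = N^-3 adds up to order 1 / N. With c = 14
    b this gives the 112 b / N of the next bounds. *)
Lemma lattice_error N (c : R) : (0 < N)%N ->
  \sum_(k < lattice_size N) lattice_step N * (c * N%:R * lattice_step N) =
  8 * c / N%:R.
Proof.
move=> N0; rewrite sumr_const card_ord -[LHS]mulr_natr.
rewrite (_ : _ * _ = (lattice_step N * (lattice_size N)%:R) * (c * N%:R * lattice_step N)); last by ring.
by rewrite lattice_span// /lattice_step; field; rewrite pnatr_eq0 -lt0n.
Qed.

Lemma gauss_sum_le N (b x : R) : (0 < N)%N -> 0 < b -> `|x| <= 2 * N%:R ->
  gauss_sum N b x <= Num.sqrt (pi / b) + 112 * b / N%:R.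
Proof.
move=> N0 b0 xN.
have := @lattice_le_integral R (fun y : R => expR (- b * (y - x) ^+ 2))
  (- (4 * N%:R)) (lattice_step N)
  (fun k => expR (- b * (lattice_pt N k - x) ^+ 2) - 14 * b * N%:R * lattice_step N)
  (lattice_size N) (lattice_step_ge0 N) (measurable_gauss b x) (fun _ => expR_ge0 _).
have H k y : (k < lattice_size N)%N ->
  - (4 * N%:R) + lattice_step N * k%:R <= y <
    - (4 * N%:R) + lattice_step N * k.+1%:R ->
  expR (- b * (lattice_pt N k - x) ^+ 2) - 14 * b * N%:R * lattice_step N
    <= expR (- b * (y - x) ^+ 2).
  move=> kq yk; have /ler_normlP[_] := gauss_cell N0 b0 xN kq yk; lra.
move=> /(_ H){H} H.
have : ((\sum_(k < lattice_size N) lattice_step N *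
  (expR (- b * (lattice_pt N k - x) ^+ 2) - 14 * b * N%:R * lattice_step N))%:E <=
  (Num.sqrt (pi / b))%:E)%E.
  apply: le_trans H _; rewrite -(integral_gauss x b0).
  apply: ge0_subset_integral => //.
  by apply/measurable_EFinP; exact: measurable_gauss.
rewrite lee_fin; under eq_bigr do rewrite mulrBr.
by rewrite sumrB lattice_error// -/(gauss_sum N b x); lra.
Qed.

(** Outside [-4 N, 4 N[ the distance to [x] is at least 2 N. Half of the exponent yields the factor
    exp (- b N / 2), and the other half keeps the tail integrable. *)
Lemma gauss_sum_ge N (b x : R) : (0 < N)%N -> 0 < b -> `|x| <= 2 * N%:R ->
  Num.sqrt (pi / b) - 112 * b / N%:R - expR (- b / 2 * N%:R) * Num.sqrt (pi / (b / 2))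
   <= gauss_sum N b x.
Proof.
move=> N0 b0 xN; pose f (y : R) := expR (- b * (y - x) ^+ 2).
have N1 : 1 <= N%:R :> R by rewrite ler1n.
have mf : measurable_fun setT (EFin \o f).
  by apply/measurable_EFinP; exact: measurable_gauss.
have b20 : 0 < b / 2 by rewrite divr_gt0.
have H1 : (\int[leb]_(y in `[(- (4 * N%:R))%R, (4 * N%:R)%R[) (f y)%:E <=
   (gauss_sum N b x + 112 * b / N%:R)%:E)%E.
  have := @integral_le_lattice R f
  (- (4 * N%:R)) (lattice_step N)
  (fun k => expR (- b * (lattice_pt N k - x) ^+ 2) + 14 * b * N%:R * lattice_step N)
  (lattice_size N) (lattice_step_ge0 N) (measurable_gauss b x) (fun _ => expR_ge0 _).
  rewrite lattice_span//.
  have -> : - (4 * N%:R) + 8 * N%:R = 4 * N%:R :> R by ring.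
  under eq_bigr do rewrite mulrDr; rewrite big_split/= lattice_error//.
  have -> : 8 * (14 * b) / N%:R = 112 * b / N%:R by ring.
  apply => k y kq yk; rewrite /f; have /ler_normlP[+ _] := gauss_cell N0 b0 xN kq yk; lra.
have H2 : (\int[leb]_(y in ~` `[(- (4 * N%:R))%R, (4 * N%:R)%R[) (f y)%:E <=
   (expR (- b / 2 * N%:R) * Num.sqrt (pi / (b / 2)))%:E)%E.
  rewrite EFinM -(integral_gauss x b20) -ge0_integralZl_EFin ?expR_ge0//; last first.
    by apply/measurable_EFinP; exact: measurable_gauss.
  apply: (@le_trans _ _ (\int[leb]_(y in ~` `[(- (4 * N%:R))%R, (4 * N%:R)%R[)
     ((expR (- b / 2 * N%:R))%:E * (expR (- (b / 2) * (y - x) ^+ 2))%:E))%E); last first.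
    apply: ge0_subset_integral => //.
    - by apply: measurableC.
    - by apply: measurable_funeM; apply/measurable_EFinP; exact: measurable_gauss.
  apply: ge0_le_integral => //.
  - by apply: measurableC.
  - by move=> y _; rewrite lee_fin expR_ge0.
  - exact: measurable_funTS.
  - by apply: measurable_funeM; apply/measurable_EFinP; apply: measurable_funTS; exact: measurable_gauss.
  - move=> y /=; rewrite in_itv/= => /negP yI.
    rewrite -EFinM lee_fin -expRD /f ler_expR.
    have d2 : 2 * N%:R <= `|y - x|.
      have /ler_normlP[x1 x2] := xN.
      rewrite real_ler_normr ?num_real//.
      move: yI; rewrite negb_and -ltNge -leNgt => /orP[H|H]; apply/orP; [right|left]; lra.
    have d4 : 4 * N%:R <= (y - x) ^+ 2.
      rewrite -(real_normK (num_real (y - x))).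
      apply: (@le_trans _ _ ((2 * N%:R) ^+ 2)); first by rewrite expr2; nra.
      by rewrite lerXn2r// nnegrE; lra.
    nra.
have : ((Num.sqrt (pi / b))%:E <= (gauss_sum N b x + 112 * b / N%:R)%:E +
   (expR (- b / 2 * N%:R) * Num.sqrt (pi / (b / 2)))%:E)%E.
  rewrite -(integral_gauss x b0) -(setUv `[(- (4 * N%:R))%R, (4 * N%:R)%R[%classic).
  rewrite ge0_integral_setU//.
  - by apply: leeD.
  - by apply: measurableC.
  - by rewrite setUv.
  - by apply/disj_setPS => y [].
by rewrite -EFinD lee_fin; lra.
Qed.

Lemma gauss_sum_cvg (b e : R) : 0 < b -> 0 < e ->
  \forall N \near \oo, forall x, `|x| <= 2 * N%:R ->
    `|gauss_sum N b x - Num.sqrt (pi / b)| <= e.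
Proof.
move=> b0 e0.
pose c := 112 * b + 2 / b * Num.sqrt (pi / (b / 2)).
have c0 : 0 <= c by rewrite addr_ge0 ?mulr_ge0 ?invr_ge0 ?sqrtr_ge0 ?(ltW b0).
near=> N => x xN.
have N0 : (0 < N)%N by near: N; exact: nbhs_infty_gt.
have Nr : 0 < N%:R :> R by rewrite ltr0n.
have cN : c / N%:R <= e.
  rewrite ler_pdivrMr// -ler_pdivrMl//; near: N; exact: nbhs_infty_ger.
have E : expR (- b / 2 * N%:R) <= 2 / b / N%:R.
  have -> : - b / 2 * N%:R = - (b / 2 * N%:R) by ring.
  have p : 0 < b / 2 * N%:R by rewrite !mulr_gt0.
  have -> : 2 / b / N%:R = (b / 2 * N%:R)^-1 by field; rewrite !lt0r_neq0.
  rewrite expRN lef_pV2 ?posrE ?expR_gt0//.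
  by have := expR_ge1Dx (b / 2 * N%:R); lra.
have S0 : 0 <= Num.sqrt (pi / (b / 2)) by exact: sqrtr_ge0.
have H1 := gauss_sum_le N0 b0 xN.
have H2 := gauss_sum_ge N0 b0 xN.
have E2 : expR (- b / 2 * N%:R) * Num.sqrt (pi / (b / 2)) <= 2 / b * Num.sqrt (pi / (b / 2)) / N%:R.
  by apply: le_trans (ler_wpM2r S0 E) _; rewrite mulrAC.
have cE : c / N%:R = 112 * b / N%:R + 2 / b * Num.sqrt (pi / (b / 2)) / N%:R by rewrite mulrDl.
have E3 : 0 <= 2 / b * Num.sqrt (pi / (b / 2)) / N%:R.
  by rewrite !mulr_ge0 ?invr_ge0 ?(ltW b0) ?(ltW Nr).
have E4 : 0 <= 112 * b / N%:R by rewrite !mulr_ge0 ?invr_ge0 ?(ltW b0) ?(ltW Nr).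
by move: H1 H2 E2 cE E3 E4 cN; rewrite ler_norml; clear -R => *; apply/andP; split; lra.
Unshelve. all: by end_near. Qed.
End LatticeGauss.

(** * Lattice vectors and their Gaussian weights *)

Section LatticeVectors.
Variable R : realType.

Definition lattice_vec (N : nat) := {ffun 'I_N -> 'I_(lattice_size N)}.
Definition coords (N : nat) (y : lattice_vec N) (i : 'I_N) : R := lattice_pt R N (y i).
Definition sqnorm (N : nat) (x : 'I_N -> R) : R := \sum_(i < N) x i ^+ 2.
Definition shell (N : nat) (k r : R) (y : lattice_vec N) : bool :=
  `|sqnorm (coords y) - k * N%:R| <= r * N%:R.
(** The cell volume h^N times an unnormalised Gaussian centred at [x]: its sum over [y] is close to
    (pi / b)^(N/2). *)
Definition kernel_weight (N : nat) (b : R) (y : lattice_vec N) (x : 'I_N -> R) : R :=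
  lattice_step R N ^+ N * expR (- b * sqnorm (fun i => coords y i - x i)).

Lemma sqnorm_ge0 N (x : 'I_N -> R) : 0 <= sqnorm x.
Proof. by apply: sumr_ge0 => i _; exact: sqr_ge0. Qed.

Lemma le_sqnorm N (x : 'I_N -> R) (i : 'I_N) : x i ^+ 2 <= sqnorm x.
Proof.
by rewrite /sqnorm (bigD1 i)//= lerDl; apply: sumr_ge0 => j _; exact: sqr_ge0.
Qed.

Lemma expR_sumr (I : Type) (s : seq I) (P : pred I) (F : I -> R) :
  expR (\sum_(i <- s | P i) F i) = \prod_(i <- s | P i) expR (F i).
Proof. by apply: (big_morph expR); [exact: expRD|exact: expR0]. Qed.

Lemma sqrt_expR (a : R) : Num.sqrt (expR a) = expR (a / 2).
Proof.
rewrite [in LHS](_ : a = a / 2 + a / 2); last by field.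
by rewrite expRD -expr2 sqrtr_sqr ger0_norm// expR_ge0.
Qed.

Lemma lattice_sum_prod N (w : 'I_N -> nat -> R) :
  \sum_(y : lattice_vec N) \prod_(i < N) w i (y i) =
  \prod_(i < N) \sum_(k < lattice_size N) w i k.
Proof. by rewrite bigA_distr_bigA. Qed.

(** Exponential Markov inequality: on [Q] the factor exp (t sum u - c) is at least 1, and once it is
    inserted the sum over all vectors factorises. *)
Lemma lattice_chernoff N (w u : 'I_N -> nat -> R) (t c : R)
    (Q : pred (lattice_vec N)) :
  (forall i k, 0 <= w i k) ->
  (forall y, Q y -> c <= t * \sum_(i < N) u i (y i)) ->
  \sum_(y | Q y) \prod_(i < N) w i (y i) <=
  expR (- c) * \prod_(i < N) \sum_(k < lattice_size N) w i k * expR (t * u i k).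
Proof.
move=> w0 H; rewrite -(lattice_sum_prod (fun i k => w i k * expR (t * u i k))) mulr_sumr.
rewrite big_mkcond; apply: ler_sum => y _.
rewrite big_split/= -expR_sumr -mulr_sumr mulrCA -expRD.
have p0 : 0 <= \prod_(i < N) w i (y i) by apply: prodr_ge0.
case: ifPn => [Qy|_]; last by rewrite mulr_ge0 ?expR_ge0.
by rewrite ler_peMr// -expR0 ler_expR addrC subr_ge0 H.
Qed.

(** The error is put in multiplicative form because N such sums are going to be multiplied. *)
Lemma gauss_sum_expR (b e : R) : 0 < b -> 0 < e ->
  \forall N \near \oo, forall x, `|x| <= 2 * N%:R ->
    Num.sqrt (pi / b) * expR (- e) <= gauss_sum N b x <= Num.sqrt (pi / b) * expR e.
Proof.
move=> b0 e0; set c := Num.sqrt (pi / b).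
have c0 : 0 < c by rewrite sqrtr_gt0 divr_gt0// pi_gt0.
have d0 : 0 < 1 - expR (- e) by rewrite subr_gt0 expR_lt1 oppr_lt0.
have := gauss_sum_cvg b0 (mulr_gt0 c0 d0).
apply: filterS => N H x /H; rewrite -/c ler_norml => /andP[h1 h2].
have : 1 + e <= expR e by exact: expR_ge1Dx.
have : expR (- e) * expR e = 1 by rewrite -expRD addNr expR0.
have := expR_gt0 (- e) => p1 p2 p3.
have q : 1 - expR (- e) <= expR e - 1 by nra.
have q2 : c * (1 - expR (- e)) <= c * (expR e - 1) by rewrite ler_wpM2l// ltW.
by apply/andP; split; lra.
Qed.

(** Completing the square: the tilt exp (t y^2) changes the parameter b into b - t and the centre x
    into b x / (b - t). *)
Lemma gauss_sum_tilt N (b t x : R) : t < b ->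
  \sum_(k < lattice_size N) lattice_step R N * expR (- b * (lattice_pt R N k - x) ^+ 2)
     * expR (t * lattice_pt R N k ^+ 2) =
  expR (x ^+ 2 * (b * t / (b - t))) * gauss_sum N (b - t) (b * x / (b - t)).
Proof.
move=> tb; rewrite /gauss_sum mulr_sumr; apply: eq_bigr => k _.
rewrite -mulrA -expRD [RHS]mulrCA -expRD; congr (_ * expR _); field.
by rewrite subr_eq0 gt_eqF.
Qed.

Lemma kernel_weightE N (b : R) (y : lattice_vec N) (x : 'I_N -> R) :
  kernel_weight b y x =
  \prod_(i < N) (lattice_step R N * expR (- b * (coords y i - x i) ^+ 2)).
Proof.
by rewrite /kernel_weight big_split/= prodr_const card_ord mulr_sumr expR_sumr.
Qed.

Lemma kernel_weight_ge0 N (b : R) (y : lattice_vec N) (x : 'I_N -> R) :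
  0 <= kernel_weight b y x.
Proof. by rewrite mulr_ge0 ?expR_ge0// exprn_ge0// lattice_step_ge0. Qed.

Lemma coord_bound N (m : R) (x : 'I_N -> R) (i : 'I_N) : 0 <= m <= 1 ->
  sqnorm x = m ^+ 2 * N%:R -> `|x i| <= N%:R.
Proof.
move=> /andP[m0 m1] xm; have N1 : 1 <= N%:R :> R by rewrite ler1n (leq_trans _ (ltn_ord i)).
have m2 : m ^+ 2 <= 1 by rewrite expr_le1.
have := le_sqnorm x i; rewrite xm -(real_normK (num_real (x i))) => H.
by rewrite -(@ler_pXn2r _ 2)// ?nnegrE//; nra.
Qed.

Lemma kernel_mass (b e : R) : 0 < b -> 0 < e ->
  \forall N \near \oo, forall (m : R) (x : 'I_N -> R), 0 <= m <= 1 ->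
    sqnorm x = m ^+ 2 * N%:R ->
    (Num.sqrt (pi / b) * expR (- e)) ^+ N <= \sum_(y : lattice_vec N) kernel_weight b y x
      <= (Num.sqrt (pi / b) * expR e) ^+ N.
Proof.
move=> b0 e0; have := gauss_sum_expR b0 e0; apply: filterS => N H m x m01 xm.
under eq_bigr do rewrite kernel_weightE.
rewrite (lattice_sum_prod
  (fun i k => lattice_step R N * expR (- b * (lattice_pt R N k - x i) ^+ 2))).
have xb i : `|x i| <= 2 * N%:R.
  by apply: le_trans (coord_bound i m01 xm) _; rewrite ler_peMl// ler1n.
have cE (a : R) : a ^+ N = \prod_(i < N) a by rewrite prodr_const card_ord.
rewrite !cE.
have s0 : 0 <= Num.sqrt (pi / b) * expR (- e) by rewrite mulr_ge0 ?sqrtr_ge0 ?expR_ge0.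
apply/andP; split; apply: ler_prod => i _; have /andP[h1 h2] := H _ (xb i).
  by rewrite s0 h1.
by rewrite h2 andbT (le_trans s0).
Qed.

(** Under the kernel, |y|^2 has mean close to (m^2 + 1 / (2 b)) N. The exponential Markov inequality
    with tilt [t] gains |t| r to first order and loses (t / b)^2 (2 b + 1) to second order; the sign
    of [t] selects the tail. *)
Lemma kernel_tail (b m r t e : R) : 0 < b -> 0 <= m <= 1 -> 0 < r -> 0 < e ->
  `|t| <= b / 2 ->
  \forall N \near \oo, forall (x : 'I_N -> R), sqnorm x = m ^+ 2 * N%:R ->
    \sum_(y : lattice_vec N | t * ((m ^+ 2 + (2 * b)^-1) * N%:R) + `|t| * r * N%:R
            <= t * sqnorm (coords y)) kernel_weight b y x
      <= (Num.sqrt (pi / b) * expR (e + (t / b) ^+ 2 * (2 * b + 1) - `|t| * r)) ^+ N.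
Proof.
move=> b0 m01 r0 e0 tb; have /andP[m0 m1] := m01.
have /ler_normlP[t1 t2] := tb.
have bt0 : 0 < b - t by lra.
have := gauss_sum_expR bt0 e0; apply: filterS => N H x xm.
have xb i : `|b * x i / (b - t)| <= 2 * N%:R.
  have xN := coord_bound i m01 xm.
  rewrite normrM normfV (gtr0_norm bt0) ler_pdivrMr// normrM (gtr0_norm b0).
  have N0 : 0 <= N%:R :> R by [].
  by nra.
have [s tE] : exists s, t = b * s by exists (t / b); rewrite mulrC divfK// lt0r_neq0.
have tbs : t / b = s by rewrite tE mulrC mulKf// lt0r_neq0.
rewrite tbs.
have s1 : 1 / 2 <= 1 - s.
  by have : s <= 1 / 2 by [rewrite -tbs ler_pdivrMr//; lra]; lra.
under eq_bigr do rewrite kernel_weightE.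
apply: le_trans (lattice_chernoff (t := t)
  (w := fun i k => lattice_step R N * expR (- b * (lattice_pt R N k - x i) ^+ 2))
  (u := fun _ k => lattice_pt R N k ^+ 2)
  (c := t * ((m ^+ 2 + (2 * b)^-1) * N%:R) + `|t| * r * N%:R) _ _) _ => //.
  by move=> i k; rewrite mulr_ge0 ?expR_ge0// lattice_step_ge0.
have bt' : t < b by rewrite -subr_gt0.
under eq_bigr do rewrite gauss_sum_tilt//.
rewrite big_split/= -expR_sumr -mulr_suml -/(sqnorm x) xm [leLHS]mulrA -expRD.
have q : Num.sqrt (pi / (b - t)) <= Num.sqrt (pi / b) * expR (s / (1 - s) / 2).
  have -> : expR (s / (1 - s) / 2) = Num.sqrt (expR (s / (1 - s))).
    by rewrite sqrt_expR.
  rewrite -sqrtrM ?divr_ge0 ?pi_ge0 ?(ltW b0)//; apply: ler_wsqrtr.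
  have -> : pi / (b - t) = pi / b * (1 + s / (1 - s)).
    rewrite tE; field; rewrite lt0r_neq0//=; last by lra.
    by rewrite (_ : b - b * s = b * (1 - s)) ?mulf_neq0 ?lt0r_neq0//; [lra|ring].
  by rewrite ler_wpM2l ?expR_ge1Dx// divr_ge0 ?pi_ge0 ?(ltW b0).
set z := Num.sqrt (pi / (b - t)) in H.
have g : \prod_(i < N) gauss_sum N (b - t) (b * x i / (b - t)) <=
   (Num.sqrt (pi / b) * expR (s / (1 - s) / 2 + e)) ^+ N.
  have -> (a : R) : a ^+ N = \prod_(i < N) a by rewrite prodr_const card_ord.
  apply: ler_prod => i _.
  have /andP[h1 h2] := H _ (xb i).
  rewrite (le_trans _ h1) ?mulr_ge0 ?sqrtr_ge0 ?expR_ge0//=.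
  by apply: le_trans h2 _; rewrite expRD mulrA ler_wpM2r ?expR_ge0.
apply: le_trans (ler_wpM2l (expR_ge0 _) g) _.
rewrite !exprMn mulrCA ler_wpM2l ?exprn_ge0 ?sqrtr_ge0// -!expRM_natr -expRD ler_expR.
have -> : b * t / (b - t) = b * (s / (1 - s)).
  rewrite tE; field; rewrite lt0r_neq0//=; last by lra.
  by rewrite (_ : b - b * s = b * (1 - s)) ?mulf_neq0 ?lt0r_neq0//; [lra|ring].
have s2 : s / (1 - s) <= s + 2 * s ^+ 2.
  by rewrite ler_pdivrMr; move: s1; clear -R => *; [nra|lra].
have mm : m ^+ 2 <= 1 by rewrite expr_le1.
rewrite tE.
have ib : (2 * b)^-1 * b = 1 / 2 by field; rewrite lt0r_neq0.
set ab := `|b * s|.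
rewrite -subr_ge0; set w := s / (1 - s) in s2 *.
have -> : (e + s ^+ 2 * (2 * b + 1) - ab * r) * N%:R -
   (- (b * s * ((m ^+ 2 + (2 * b)^-1) * N%:R) + ab * r * N%:R) +
   m ^+ 2 * N%:R * (b * w) + (w / 2 + e) * N%:R) =
   (s ^+ 2 * (2 * b + 1) + b * m ^+ 2 * (s - w) + (s * ((2 * b)^-1 * b) - w / 2)) * N%:R by ring.
rewrite mulr_ge0// ib.
have bm : 0 <= b * m ^+ 2 by rewrite pmulr_rge0// sqr_ge0.
have e1 : b * m ^+ 2 * (- (2 * s ^+ 2)) <= b * m ^+ 2 * (s - w) by rewrite ler_wpM2l//; move: s2; clear -R => *; lra.
have e2 : b * m ^+ 2 * s ^+ 2 <= b * 1 * s ^+ 2 by rewrite ler_wpM2r ?sqr_ge0// ler_wpM2l// ltW.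
by move: e1 e2 s2; clear -R => *; lra.
Qed.

Lemma shell_complement (b m r : R) : 0 < b -> 0 <= m <= 1 -> 0 < r ->
  exists2 c : R, 0 < c & \forall N \near \oo, forall (x : 'I_N -> R),
    sqnorm x = m ^+ 2 * N%:R ->
    \sum_(y : lattice_vec N | ~~ shell (m ^+ 2 + (2 * b)^-1) r y) kernel_weight b y x
      <= (Num.sqrt (pi / b)) ^+ N * (2 * expR (- c * N%:R)).
Proof.
move=> b0 m01 r0.
(* The tilts are b s and - b s. The second term of the minimum makes the quadratic loss at most half
   of the gain b s r, and [c] is a quarter of that gain. *)
pose s := Num.min (1 / 2) (b * r / (2 * (2 * b + 1))).
have s0 : 0 < s by rewrite lt_min !divr_gt0 ?mulr_gt0 ?addr_gt0 ?mulr_gt0.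
have s1 : s <= 1 / 2 by rewrite ge_min lexx.
have s2 : s * (2 * b + 1) <= b * r / 2.
  have : s <= b * r / (2 * (2 * b + 1)) by rewrite ge_min lexx orbT.
  have p : 0 < 2 * (2 * b + 1) by rewrite !(mulr_gt0, addr_gt0).
  by rewrite ler_pdivlMr//; lra.
pose c := s * b * r / 4; have c0 : 0 < c by rewrite !mulr_gt0 ?invr_gt0.
exists c => //.
have nbs : `|b * s| = b * s by rewrite gtr0_norm// mulr_gt0.
have t1 : `|b * s| <= b / 2 by rewrite nbs; nra.
have t2 : `|- (b * s)| <= b / 2 by rewrite normrN.
have sb (d : R) : d = s \/ d = - s -> c + d ^+ 2 * (2 * b + 1) - b * s * r <= - c.
  have br : 0 < b * r by rewrite mulr_gt0.
  by case=> ->; rewrite ?sqrrN /c; nra.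
have := kernel_tail b0 m01 r0 c0 t1; have := kernel_tail b0 m01 r0 c0 t2.
apply: filterS2 => N H1 H2 x xm; have {}H1 := H1 x xm; have {}H2 := H2 x xm.
have D : \sum_(y : lattice_vec N | ~~ shell (m ^+ 2 + (2 * b)^-1) r y) kernel_weight b y x
  <= \sum_(y : lattice_vec N | b * s * ((m ^+ 2 + (2 * b)^-1) * N%:R) + `|b * s| * r * N%:R
            <= b * s * sqnorm (coords y)) kernel_weight b y x
  + \sum_(y : lattice_vec N | - (b * s) * ((m ^+ 2 + (2 * b)^-1) * N%:R) + `|- (b * s)| * r * N%:R
            <= - (b * s) * sqnorm (coords y)) kernel_weight b y x.
  rewrite (big_mkcond (fun y => ~~ _)) [X in _ <= X + _]big_mkcond [X in _ <= _ + X]big_mkcond/= -big_split/=; apply: ler_sum => y _.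
  have K := kernel_weight_ge0 b y x.
  have [sh|nsh] := boolP (shell _ _ _) => /=.
    by rewrite addr_ge0//; case: ifP.
  rewrite normrN nbs.
  have bs0 : 0 < b * s by rewrite mulr_gt0.
  case: ifPn => h1; first by rewrite lerDl; case: ifP.
  rewrite add0r ifT//; move: h1 nsh; rewrite /shell real_ler_norml ?num_real//.
  set Q := sqnorm _; set k := m ^+ 2 + _ => h1; rewrite negb_and -!ltNge => h.
  have {}h1 : Q < k * N%:R + r * N%:R by rewrite -(ltr_pM2l bs0); move: h1; rewrite -ltNge; clear -R => *; lra.
  have /(ler_wpM2l (ltW bs0)) : Q <= k * N%:R - r * N%:R by case/orP: h; move: h1; clear -R => *; lra.
  by rewrite mulNr; clear -R => *; lra.
apply: le_trans D _.
have F (t : R) : b * s = t \/ - (b * s) = t -> (Num.sqrt (pi / b) * expR (c + (t / b) ^+ 2 * (2 * b + 1) - `|t| * r)) ^+ N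
    <= Num.sqrt (pi / b) ^+ N * expR (- c * N%:R).
  move=> tE; rewrite exprMn ler_wpM2l ?exprn_ge0 ?sqrtr_ge0// -expRM_natr ler_expR ler_wpM2r//.
  have -> : `|t| = b * s by case: tE => <-; rewrite ?normrN nbs.
  apply: sb; case: tE => <-; [left|right]; rewrite ?mulNr; field; exact: lt0r_neq0.
have -> : Num.sqrt (pi / b) ^+ N * (2 * expR (- c * N%:R)) =
  Num.sqrt (pi / b) ^+ N * expR (- c * N%:R) + Num.sqrt (pi / b) ^+ N * expR (- c * N%:R) by ring.
by apply: lerD; [apply: le_trans H2 _|apply: le_trans H1 _]; apply: F; [left|right].
Qed.

Lemma shell_mass (b m r e : R) : 0 < b -> 0 <= m <= 1 -> 0 < r -> 0 < e ->
  \forall N \near \oo, forall (x : 'I_N -> R), sqnorm x = m ^+ 2 * N%:R ->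
    Num.sqrt (pi / b) ^+ N * expR (- e * N%:R) <=
    \sum_(y : lattice_vec N | shell (m ^+ 2 + (2 * b)^-1) r y) kernel_weight b y x.
Proof.
move=> b0 m01 r0 e0; have [c c0 H1] := shell_complement b0 m01 r0.
(* The total mass loses at most exp (- d N), while the complement of the shell has relative mass at
   most 2 exp (- 2 d N). *)
pose d := Num.min (e / 2) (c / 2).
have d0 : 0 < d by rewrite lt_min !divr_gt0.
have de : d <= e / 2 by rewrite ge_min lexx.
have dc : d <= c / 2 by rewrite ge_min lexx orbT.
have H2 := kernel_mass b0 d0.
near=> N => x xm.
have H1' : forall (x : 'I_N -> R),
    sqnorm x = m ^+ 2 * N%:R ->
    \sum_(y : lattice_vec N | ~~ shell (m ^+ 2 + (2 * b)^-1) r y) kernel_weight b y x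
      <= (Num.sqrt (pi / b)) ^+ N * (2 * expR (- c * N%:R)).
  by near: N; exact: H1.
have {}H1' := H1' _ xm.
have H2' : forall (m : R) (x : 'I_N -> R), 0 <= m <= 1 ->
    sqnorm x = m ^+ 2 * N%:R ->
    (Num.sqrt (pi / b) * expR (- d)) ^+ N <= \sum_(y : lattice_vec N) kernel_weight b y x
      <= (Num.sqrt (pi / b) * expR d) ^+ N.
  by near: N; exact: H2.
have /andP[{}H2' _] := H2' _ _ m01 xm.
have H3 : 2 / d <= N%:R by near: N; exact: nbhs_infty_ger.
move: H2'; rewrite (bigID (shell (m ^+ 2 + (2 * b)^-1) r))/= exprMn -expRM_natr.
move=> H2'.
have a0 : 0 <= Num.sqrt (pi / b) ^+ N by rewrite exprn_ge0 ?sqrtr_ge0.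
suff : expR (- e * N%:R) <= expR (- d * N%:R) - 2 * expR (- c * N%:R).
  by move=> /(ler_wpM2l a0); lra.
have q1 : expR (- d * N%:R) * 3 <= 1.
  rewrite mulNr expRN ler_pdivrMl ?expR_gt0// mulr1.
  by apply: le_trans (expR_ge1Dx _); move: H3; rewrite ler_pdivrMr// mulrC; lra.
have q2 : expR (- e * N%:R) <= expR (- d * N%:R) ^+ 2.
  by rewrite -expRM_natl ler_expR; have : 0 <= N%:R :> R by []; nra.
have q3 : expR (- c * N%:R) <= expR (- d * N%:R) ^+ 2.
  by rewrite -expRM_natl ler_expR; have : 0 <= N%:R :> R by []; nra.
by have := expR_gt0 (- d * N%:R); move: q1 q2 q3; clear -R => *; nra.
Unshelve. all: by end_near. Qed.

(** For the kernel centred at the origin with b = 1 / (2 k), the mass sits on the shell, where the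
    Gaussian equals exp (- N / 2) up to a factor exp (r N / (2 k)). Dividing the mass by this value
    leaves the volume. *)
Lemma shell_volume (k r e : R) : 0 < k -> 0 < r -> 0 < e ->
  \forall N \near \oo,
    expR (N%:R / 2 * (ln (2 * pi * k) + 1) - (r / (2 * k) + e) * N%:R) <=
    \sum_(y : lattice_vec N | shell k r y) lattice_step R N ^+ N <=
    expR (N%:R / 2 * (ln (2 * pi * k) + 1) + (r / (2 * k) + e) * N%:R).
Proof.
move=> k0 r0 e0; pose b := (2 * k)^-1.
have b0 : 0 < b by rewrite invr_gt0 mulr_gt0.
have bk : b * k = 1 / 2 by rewrite /b; field; rewrite lt0r_neq0.
have z01 : 0 <= (0 : R) <= 1 by rewrite lexx ler01.
have kE : 0 ^+ 2 + (2 * b)^-1 = k by rewrite /b; field; rewrite lt0r_neq0.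
have H1 := shell_mass b0 z01 r0 e0; rewrite kE in H1.
have H2 := kernel_mass b0 e0.
move: H1 H2; apply: filterS2 => N H1 H2.
have x0 : sqnorm (fun _ : 'I_N => (0 : R)) = 0 ^+ 2 * N%:R.
  by rewrite /sqnorm big1 ?expr0n ?mul0r// => i _; rewrite expr0n.
have {}H1 := H1 _ x0; have /andP[_ {}H2] := H2 _ _ z01 x0.
have pk : 0 < 2 * pi * k by rewrite !mulr_gt0// pi_gt0.
have sE : Num.sqrt (pi / b) = expR (ln (2 * pi * k) / 2).
  by rewrite -sqrt_expR lnK ?posrE// /b invrK; congr Num.sqrt; ring.
have h0 : 0 <= lattice_step R N ^+ N by rewrite exprn_ge0 ?lattice_step_ge0.
have rb : r / (2 * k) = r * b by [].
have W y : kernel_weight b y (fun=> 0) =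
  lattice_step R N ^+ N * expR (- b * sqnorm (@coords N y)).
  by rewrite /kernel_weight /sqnorm; congr (_ * expR (_ * _)); apply: eq_bigr => i _; rewrite subr0.
rewrite sE -!expRM_natr -?expRD in H1; rewrite sE -expRD -expRM_natr in H2.
have Sh y : shell k r y -> (k - r) * N%:R <= sqnorm (@coords N y) <= (k + r) * N%:R.
  by rewrite /shell ler_norml => /andP[p q]; apply/andP; split; lra.
apply/andP; split.
- have : \sum_(y : lattice_vec N | shell k r y) kernel_weight b y (fun=> 0) <=
    expR (- b * ((k - r) * N%:R)) * \sum_(y : lattice_vec N | shell k r y) lattice_step R N ^+ N.
    rewrite mulr_sumr; apply: ler_sum => y /Sh/andP[p _]; rewrite W mulrC ler_wpM2r//.
    by rewrite ler_expR !mulNr lerN2 ler_wpM2l// ltW.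
  move=> /(le_trans H1); rewrite (mulNr b) expRN ler_pdivlMl ?expR_gt0// -expRD; apply: le_trans.
  rewrite ler_expR -subr_ge0 rb.
  have -> : b * ((k - r) * N%:R) = (b * k - r * b) * N%:R by ring.
  by rewrite bk le_eqVlt; apply/orP; left; apply/eqP; field.
- have : expR (- b * ((k + r) * N%:R)) * \sum_(y : lattice_vec N | shell k r y) lattice_step R N ^+ N
     <= \sum_(y : lattice_vec N) kernel_weight b y (fun=> 0).
    rewrite mulr_sumr big_mkcond; apply: ler_sum => y _; case: ifPn => [/Sh/andP[_ p]|_].
      by rewrite W mulrC ler_wpM2l// ler_expR !mulNr lerN2 ler_wpM2l// ltW.
    exact: kernel_weight_ge0.
  move=> /le_trans/(_ H2); rewrite (mulNr b) expRN ler_pdivrMl ?expR_gt0// -expRD.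
  move=> H; apply: le_trans H _.
  rewrite ler_expR -subr_ge0 rb.
  have -> : b * ((k + r) * N%:R) = (b * k + r * b) * N%:R by ring.
  by rewrite bk le_eqVlt; apply/orP; left; apply/eqP; field.
Qed.

End LatticeVectors.

(** * The uniform law on the sphere and lattice sums *)

Section SphereMean.
Variables (R : realType) (N : nat).
Local Notation T := (N.-tuple (measurableTypeR R)).
Local Notation S := (@unit_sphere R N).
Variable U : probability T R.
Hypothesis U_unif : uniform_on_sphere U.

Definition sphere_mean (F : T -> R) : R := fine (\int[U]_(e in S) (F e)%:E).

(** What makes the integral over the sphere finite, so that [fine] in [sphere_mean] loses
    nothing. *)
Definition sphere_bounded (F : T -> R) : Prop :=
  [/\ measurable_fun setT F, (forall e, 0 <= F e) &
      exists C, forall e, S e -> F e <= C].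

Lemma measurable_tnthR (i : 'I_N) : measurable_fun setT (fun e : T => tnth e i : R).
Proof. exact: (@measurable_tnth _ (measurableTypeR R) N i). Qed.

Lemma measurable_sphere : measurable S.
Proof.
rewrite (_ : S = (fun e : T => \sum_(i < N) (tnth e i : R) ^+ 2) @^-1` [set 1]) //.
rewrite -[X in measurable X]setTI.
suff : measurable_fun setT (fun e : T => \sum_(i < N) (tnth e i : R) ^+ 2) by apply.
apply: measurable_sum => i; apply: measurable_funX; exact: measurable_tnthR.
Qed.

Lemma sphere_bounded_EFin F : sphere_bounded F ->
  (\int[U]_(e in S) (F e)%:E = (sphere_mean F)%:E)%E.
Proof.
move=> [mF F0 [C FC]]; rewrite fineK// ge0_fin_numE; last first.
  by apply: integral_ge0 => e _; rewrite lee_fin.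
apply: (@le_lt_trans _ _ (\int[U]_(e in S) (C%:E))%E).
  apply: ge0_le_integral => //.
  - exact: measurable_sphere.
  - by move=> e _; rewrite lee_fin.
  - by apply: measurable_funTS; apply/measurable_EFinP.
rewrite integral_cst; last exact: measurable_sphere.
by rewrite [X in (_ * X)%E](proj1 U_unif) mule1 ltry.
Qed.

Lemma sphere_mean_ge0 F : (forall e, 0 <= F e) -> 0 <= sphere_mean F.
Proof. by move=> F0; apply: fine_ge0; apply: integral_ge0 => e _; rewrite lee_fin. Qed.

Lemma sphere_mean_le F G : sphere_bounded F -> sphere_bounded G ->
  (forall e, S e -> F e <= G e) -> sphere_mean F <= sphere_mean G.
Proof.
move=> nF nG FG; rewrite -lee_fin -!sphere_bounded_EFin//.
have [mF F0 _] := nF; have [mG G0 _] := nG.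
apply: ge0_le_integral => //.
- exact: measurable_sphere.
- by move=> e _; rewrite lee_fin.
- by apply: measurable_funTS; apply/measurable_EFinP.
- by apply: measurable_funTS; apply/measurable_EFinP.
Qed.

Lemma sphere_mean_cst (c : R) : 0 <= c -> sphere_mean (fun=> c) = c.
Proof.
move=> c0; rewrite /sphere_mean integral_cst; last exact: measurable_sphere.
by rewrite [X in (_ * X)%E](proj1 U_unif) mule1.
Qed.

Lemma sphere_boundedM F G : sphere_bounded F -> sphere_bounded G ->
  sphere_bounded (fun e => F e * G e).
Proof.
move=> [mF F0 [C FC]] [mG G0 [D GD]]; split.
- exact: measurable_funM.
- by move=> e; rewrite mulr_ge0.
- by exists (C * D) => e Se; rewrite ler_pM// ?FC ?GD.
Qed.

Lemma sphere_bounded_cst (c : R) : 0 <= c -> sphere_bounded (fun=> c).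
Proof. by move=> c0; split=> //; exists c. Qed.

Lemma sphere_bounded_sum (I : finType) (Q : pred I) (F : I -> T -> R) :
  (forall i, sphere_bounded (F i)) -> sphere_bounded (fun e => \sum_(i | Q i) F i e).
Proof.
move=> H; split.
- rewrite (_ : (fun _ => _) = fun e => \sum_i (if Q i then F i e else 0)).
    by apply: measurable_sum => i; case: (Q i) => //; case: (H i).
  by apply/funext => e; rewrite big_mkcond.
- by move=> e; apply: sumr_ge0 => i _; case: (H i).
- have /choice[C HC] i : exists C, forall e, S e -> F i e <= C by case: (H i).
  by exists (\sum_(i | Q i) C i) => e Se; apply: ler_sum => i _; exact: HC.
Qed.

Lemma sphere_mean_sum (I : finType) (Q : pred I) (F : I -> T -> R) :
  (forall i, sphere_bounded (F i)) ->
  sphere_mean (fun e => \sum_(i | Q i) F i e) = \sum_(i | Q i) sphere_mean (F i).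
Proof.
move=> H; apply: EFin_inj; rewrite -sphere_bounded_EFin; last exact: sphere_bounded_sum.
rewrite -sumEFin; under [RHS]eq_bigr do rewrite -sphere_bounded_EFin//.
under eq_integral do rewrite -sumEFin big_mkcond.
rewrite ge0_integral_sum//; last 3 first.
- exact: measurable_sphere.
- move=> i; case: (Q i) => //; apply: measurable_funTS; apply/measurable_EFinP.
  by case: (H i).
- by move=> i e _; case: ifP => // _; rewrite lee_fin; case: (H i).
rewrite [RHS]big_mkcond; apply: eq_bigr => i _; case: ifP => // _.
by rewrite integral0.
Qed.

Lemma sphere_meanZ (c : R) F : 0 <= c -> sphere_bounded F ->
  sphere_mean (fun e => c * F e) = c * sphere_mean F.
Proof.
move=> c0 H; have H' := sphere_boundedM (sphere_bounded_cst c0) H.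
apply: EFin_inj; rewrite -sphere_bounded_EFin// EFinM -sphere_bounded_EFin//.
have [mF F0 _] := H.
under eq_integral do rewrite EFinM.
rewrite ge0_integralZl_EFin//.
- exact: measurable_sphere.
- by move=> e _; rewrite lee_fin.
- by apply: measurable_funTS; apply/measurable_EFinP.
Qed.

Lemma mx_act_dot (O : 'M[R]_N) (x : 'I_N -> R) (e : T) :
  \sum_(i < N) x i * (tnth (mx_act O e) i : R) =
  \sum_(j < N) (\sum_(i < N) x i * O i j) * (tnth e j : R).
Proof.
under eq_bigr do rewrite tnth_mktuple mulr_sumr.
rewrite exchange_big/=; apply: eq_bigr => j _; rewrite mulr_suml.
by apply: eq_bigr => i _; rewrite mulrA.
Qed.

Lemma mx_act_sphere (O : 'M[R]_N) : O *m O^T = 1%:M -> mx_act O @^-1` S = S.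
Proof.
move=> /mulmx1C O1; apply/seteqP.
suff H (e : T) : \sum_(i < N) (tnth (mx_act O e) i : R) ^+ 2 = \sum_(i < N) (tnth e i : R) ^+ 2.
  by split=> e; rewrite /unit_sphere /= H.
under eq_bigr do rewrite expr2; rewrite mx_act_dot.
apply: eq_bigr => j _; rewrite expr2; congr (_ * _).
under eq_bigr do rewrite tnth_mktuple mulr_suml.
rewrite exchange_big/=.
have E k : \sum_(i < N) O i k * tnth e k * O i j = tnth e k * (k == j)%:R.
  under eq_bigr do rewrite mulrAC; rewrite -mulr_suml mulrC; congr (_ * _).
  move/matrixP/(_ k j): O1; rewrite !mxE => <-.
  by apply: eq_bigr => i _; rewrite mxE.
under eq_bigr do rewrite E.
rewrite (bigD1 j)//= eqxx mulr1 big1 ?addr0// => k kj.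
by rewrite (negbTE kj) mulr0.
Qed.

Lemma measurable_mx_act (O : 'M[R]_N) : measurable_fun setT (@mx_act R N O).
Proof.
apply/measurable_fun_tnthP => i; rewrite (_ : _ \o _ = fun e : T => \sum_(j < N) O i j * (tnth e j : R)).
  by apply: measurable_sum => j; apply: measurable_funM => //; exact: measurable_tnthR.
by apply/funext => e /=; rewrite tnth_mktuple.
Qed.

Lemma sphere_mean_rot (O : 'M[R]_N) F : O *m O^T = 1%:M -> sphere_bounded F ->
  sphere_mean (F \o mx_act O) = sphere_mean F.
Proof.
move=> O1 [mF F0 _]; congr fine; case: U_unif => _ /(_ O O1) inv.
rewrite -[in LHS](mx_act_sphere O1).
have := ge0_integral_pushforward (measurable_mx_act O) U measurable_sphere
  (f := fun e => (F e)%:E).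
rewrite /= => <-.
- apply: eq_measure_integral => [|mO A mA _]; [exact: measurable_mx_act|exact: inv].
- by apply: measurable_funTS; apply/measurable_EFinP.
- by move=> e _; rewrite lee_fin.
Qed.

End SphereMean.

Section Householder.
Variables (R : realType) (N : nat).

Lemma sqnorm_eq0 (x : 'I_N -> R) : sqnorm x = 0 -> x = fun=> 0.
Proof.
move=> H; apply/funext => i; apply/eqP; rewrite -sqrf_eq0 eq_le sqr_ge0 andbT.
by rewrite -H le_sqnorm.
Qed.

(** Rotation invariance enters only through this lemma: the reflection along [x - y] exchanges two
    vectors of equal norm (the identity serves when they coincide). *)
Lemma householder (x y : 'I_N -> R) : sqnorm x = sqnorm y ->
  exists2 O : 'M[R]_N, O *m O^T = 1%:M & forall j, \sum_(i < N) x i * O i j = y j.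
Proof.
move=> xy; have [v0|v0] := eqVneq (sqnorm (fun i => x i - y i)) 0.
  exists 1%:M; first by rewrite trmx1 mulmx1.
  move=> j; rewrite (bigD1 j)//= big1 ?addr0.
    rewrite mxE eqxx mulr1; apply/eqP; rewrite -subr_eq0; apply/eqP.
    exact: (congr1 (fun f => f j) (sqnorm_eq0 v0)).
  by move=> i ij; rewrite mxE (negbTE ij) mulr0.
pose v : 'cV[R]_N := \col_i (x i - y i).
pose s := sqnorm (fun i => x i - y i).
have vv : v^T *m v = s%:M.
  apply/matrixP => i j; rewrite !ord1 !mxE eqxx mulr1n.
  by apply: eq_bigr => k _; rewrite !mxE expr2.
pose O := 1%:M - (2 / s) *: (v *m v^T).
have OT : O^T = O by rewrite /O linearB/= linearZ/= trmx1 trmx_mul trmxK.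
exists O.
  rewrite OT /O mulmxBl mul1mx mulmxBr mulmx1 -!scalemxAl -!scalemxAr.
  have -> : v *m v^T *m (v *m v^T) = s *: (v *m v^T).
    by rewrite mulmxA -(mulmxA v) vv mul_mx_scalar -scalemxAl.
  rewrite scalerA scalerA.
  have -> : (2 / s * (2 / s) * s) *: (v *m v^T) = (2 / s) *: (v *m v^T) + (2 / s) *: (v *m v^T).
    by rewrite -scalerDl; congr (_ *: _); field; exact: v0.
  by rewrite opprB addrK subrK.
move=> j; rewrite /O.
under eq_bigr => i _ do rewrite !mxE big_ord1 !mxE mulrBr.
rewrite sumrB (bigD1 j)//= eqxx mulr1 big1 ?addr0; last first.
  by move=> i ij; rewrite (negbTE ij) mulr0.
have -> : \sum_(i < N) x i * (2 / s * ((x i - y i) * (x j - y j))) =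
   2 / s * (\sum_(i < N) x i * (x i - y i)) * (x j - y j).
  by rewrite mulr_sumr mulr_suml; apply: eq_bigr => i _; ring.
have sE : s = 2 * \sum_(i < N) x i * (x i - y i).
  have -> : s = sqnorm x + sqnorm y - 2 * \sum_(i < N) x i * y i.
    rewrite /s /sqnorm -big_split/= mulr_sumr -sumrB; apply: eq_bigr => i _; ring.
  rewrite -xy; under [in RHS]eq_bigr do rewrite mulrBr -expr2.
  by rewrite sumrB -/(sqnorm x); ring.
have -> : 2 / s * (\sum_(i < N) x i * (x i - y i)) = 1.
  by rewrite mulrAC -sE divff.
ring.
Qed.

End Householder.

Section FlatKernel.
Variable R : realType.

Lemma flat_dev (b m sN p q d : R) : 0 < b -> 0 <= m <= 1 -> 0 < sN -> 0 < p -> 0 < q ->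
  sN / 2 <= p -> sN / 2 <= q -> `|p ^+ 2 - q ^+ 2| <= d -> `|p / q - 1| * (2 * b * m * sN * q) <= 2 * b * d.
Proof.
move=> b0 /andP[m0 m1] sNp pp qp ph qh YZ.
have Dn : `|p - q| * sN <= d.
  apply: le_trans YZ; rewrite subr_sqr normrM ler_wpM2l//.
  by rewrite ger0_norm ?addr_ge0 ?(ltW pp) ?(ltW qp)// (splitr sN) lerD.
have d0 : 0 <= d by rewrite (le_trans _ YZ).
have -> : p / q - 1 = (p - q) / q by field; rewrite lt0r_neq0.
have -> : `|(p - q) / q| * (2 * b * m * sN * q) = 2 * b * m * (`|p - q| * sN).
  by rewrite normrM normfV (gtr0_norm qp); field; rewrite lt0r_neq0.
apply: (@le_trans _ _ (2 * b * m * d)).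
  by rewrite ler_wpM2l// !mulr_ge0// ltW.
have b20 : 0 <= 2 * b by rewrite mulr_ge0// ltW.
by rewrite ler_wpM2r// ler_piMr.
Qed.

(** The Gaussian prefactor changes by at most exp (b d) and the Laplace factor by at most exp (2 b
    d), well within exp (5 b d). *)
Lemma flat_kernel (b h Y Z d k LZ LP : R) : `|Y - Z| <= d -> LP <= expR (2 * b * d) * LZ ->
  0 < b -> 0 <= h -> 0 <= LZ ->
  h * expR (- b * (Y + k)) * LP <= expR (5 * b * d) * (h * expR (- b * (Z + k)) * LZ).
Proof.
move=> YZ e1 b0 h0 LZ0.
have e2 : expR (- b * (Y + k)) * expR (2 * b * d) <= expR (5 * b * d) * expR (- b * (Z + k)).
  have d0 : 0 <= d by rewrite (le_trans _ YZ).
  rewrite -!expRD ler_expR; move: YZ; rewrite ler_norml => /andP[z1 z2].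
  have : b * (Z - Y) <= b * d by rewrite ler_wpM2l ?(ltW b0)// -opprB lerNl.
  have : 0 <= b * d by rewrite mulr_ge0// ltW.
  by clear; lra.
have := ler_wpM2l (mulr_ge0 h0 (expR_ge0 (- b * (Y + k)))) e1.
move=> /le_trans; apply.
rewrite [leLHS](_ : _ = h * (expR (- b * (Y + k)) * expR (2 * b * d)) * LZ); last by ring.
rewrite [leRHS](_ : _ = h * (expR (5 * b * d) * expR (- b * (Z + k))) * LZ); last by ring.
by rewrite ler_wpM2r// ler_wpM2l.
Qed.

End FlatKernel.

Section SphereLattice.
Variables (R : realType) (N : nat).
Local Notation T := (N.-tuple (measurableTypeR R)).
Local Notation S := (@unit_sphere R N).
Variable U : probability T R.
Hypothesis U_unif : uniform_on_sphere U.

Definition dilate (m : R) (e : T) (i : 'I_N) : R := m * Num.sqrt N%:R * tnth e i.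

Lemma sqnorm_dilate m e : S e -> sqnorm (dilate m e) = m ^+ 2 * N%:R.
Proof.
move=> Se; rewrite /sqnorm /dilate; under eq_bigr do rewrite exprMn.
by rewrite -mulr_sumr [X in _ * X]Se mulr1 exprMn sqr_sqrtr.
Qed.

(** Cauchy-Schwarz, from the expansion of |q x - p y|^2 >= 0 where p and q are the norms of x and
    y. *)
Lemma dot_le_sqrt_sqnorm (x y : 'I_N -> R) :
  \sum_(i < N) x i * y i <= Num.sqrt (sqnorm x) * Num.sqrt (sqnorm y).
Proof.
have [x0|x0] := eqVneq (sqnorm x) 0.
  rewrite x0 sqrtr0 mul0r big1// => i _; rewrite (sqnorm_eq0 x0) mul0r//.
have xp : 0 < sqnorm x by rewrite lt_neqAle eq_sym x0 sqnorm_ge0.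
set p := Num.sqrt (sqnorm x); set q := Num.sqrt (sqnorm y).
have p0 : 0 < p by rewrite sqrtr_gt0.
have pp : sqnorm x = p ^+ 2 by rewrite sqr_sqrtr// sqnorm_ge0.
have qq : sqnorm y = q ^+ 2 by rewrite sqr_sqrtr// sqnorm_ge0.
set d := \sum_(i < N) x i * y i.
have H : 0 <= \sum_(i < N) (q * x i - p * y i) ^+ 2 by apply: sumr_ge0 => i _; exact: sqr_ge0.
have [q0|q0] := eqVneq q 0.
  rewrite q0 mulr0 /d big1// => i _.
  by rewrite (@sqnorm_eq0 _ _ y) ?mulr0// qq q0 expr0n.
have qp : 0 < q by rewrite lt_neqAle eq_sym q0 sqrtr_ge0.
have E : \sum_(i < N) (q * x i - p * y i) ^+ 2 = q ^+ 2 * sqnorm x + p ^+ 2 * sqnorm y - 2 * (p * q) * d.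
  rewrite /sqnorm !mulr_sumr -big_split/= -sumrB; apply: eq_bigr => i _; ring.
rewrite E pp qq in H; have : 0 < p * q by rewrite mulr_gt0.
by nra.
Qed.

Lemma sphere_bounded_laplace (x : 'I_N -> R) :
  sphere_bounded (fun e : T => expR (\sum_(i < N) x i * (tnth e i : R))).
Proof.
split.
- apply: measurableT_comp => //; apply: measurable_sum => i.
  by apply: measurable_funM => //; exact: measurable_tnthR.
- by move=> e; exact: expR_ge0.
- exists (expR (Num.sqrt (sqnorm x))) => e Se; rewrite ler_expR.
  apply: le_trans (dot_le_sqrt_sqnorm _ _) _.
  by rewrite [X in _ * Num.sqrt X](_ : _ = 1) ?sqrtr1 ?mulr1//; exact: Se.
Qed.

Definition sphere_laplace (x : 'I_N -> R) : R :=
  sphere_mean U (fun e : T => expR (\sum_(i < N) x i * (tnth e i : R))).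

Lemma sphere_laplace_rot (x y : 'I_N -> R) : sqnorm x = sqnorm y ->
  sphere_laplace x = sphere_laplace y.
Proof.
move=> /householder[Q Q1 H]; rewrite /sphere_laplace.
rewrite -(sphere_mean_rot U_unif Q1 (sphere_bounded_laplace x)); congr sphere_mean.
apply/funext => e /=; rewrite mx_act_dot; congr expR.
by apply: eq_bigr => i _; rewrite H.
Qed.

Lemma sphere_laplace_dilate (x : 'I_N -> R) (a : R) :
  sphere_laplace (fun i => a * x i) <=
  expR (`|a - 1| * Num.sqrt (sqnorm x)) * sphere_laplace x.
Proof.
rewrite /sphere_laplace -sphere_meanZ ?expR_ge0//; last exact: sphere_bounded_laplace.
apply: sphere_mean_le => //.
- exact: sphere_bounded_laplace.
- apply: sphere_boundedM; last exact: sphere_bounded_laplace.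
  by apply: sphere_bounded_cst; exact: expR_ge0.
move=> e Se; rewrite -expRD ler_expR -lerBlDr -sumrB.
under eq_bigr => i _ do rewrite -mulrBl -[X in _ - X]mul1r -mulrBl.
apply: le_trans (dot_le_sqrt_sqnorm _ _) _.
rewrite [X in _ * Num.sqrt X](_ : _ = 1) ?sqrtr1 ?mulr1; last exact: Se.
rewrite /sqnorm.
under eq_bigr do rewrite exprMn.
by rewrite -mulr_sumr sqrtrM ?sqr_ge0// sqrtr_sqr.
Qed.

Definition kernel_mean (b m : R) (y : lattice_vec N) : R :=
  sphere_mean U (fun e => kernel_weight b y (dilate m e)).

Lemma sphere_bounded_kernel b m (y : lattice_vec N) : 0 < b ->
  sphere_bounded (fun e : T => kernel_weight b y (dilate m e)).
Proof.
move=> b0; have h0 : 0 <= lattice_step R N ^+ N by rewrite exprn_ge0 ?lattice_step_ge0.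
split.
- apply: measurable_funM => //; apply: measurableT_comp => //.
  apply: measurable_funM => //; apply: measurable_sum => i.
  apply: measurable_funX; apply: measurable_funB => //; apply: measurable_funM => //.
  exact: measurable_tnthR.
- by move=> e; exact: kernel_weight_ge0.
- exists (lattice_step R N ^+ N) => e _; rewrite /kernel_weight ler_piMr//.
  by rewrite -expR0 ler_expR mulNr oppr_le0 pmulr_rge0// sqnorm_ge0.
Qed.

(** When the square is expanded, |dilate m e|^2 is constant on the sphere, so only the inner product
    with [y] remains under the mean. *)
Lemma kernel_meanE b m (y : lattice_vec N) : 0 < b ->
  kernel_mean b m y = lattice_step R N ^+ N *
    expR (- b * (sqnorm (@coords R N y) + m ^+ 2 * N%:R)) *
    sphere_laplace (fun i => 2 * b * m * Num.sqrt N%:R * coords R y i).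
Proof.
move=> b0; have h0 : 0 <= lattice_step R N ^+ N by rewrite exprn_ge0 ?lattice_step_ge0.
rewrite /kernel_mean /sphere_laplace -(sphere_meanZ U_unif); [|exact: mulr_ge0 h0 (expR_ge0 _)|exact: sphere_bounded_laplace].
rewrite /kernel_mean; have eqm F G : sphere_bounded F -> sphere_bounded G -> (forall e, S e -> F e = G e) ->
  sphere_mean U F = sphere_mean U G.
  move=> nF nG FG; apply: le_anti; rewrite !sphere_mean_le//.
  - by move=> e /FG ->.
  - by move=> e /FG ->.
apply: eqm.
- exact: sphere_bounded_kernel.
- apply: sphere_boundedM; last exact: sphere_bounded_laplace.
  by apply: sphere_bounded_cst; rewrite mulr_ge0 ?expR_ge0.
move=> e Se; rewrite /kernel_weight -mulrA -expRD; congr (_ * expR _).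
rewrite -(sqnorm_dilate m Se) /sqnorm -big_split/= !mulr_sumr -big_split/=.
apply: eq_bigr => i _; rewrite /dilate; ring.
Qed.

(** The mean of the kernel over the sphere depends on [y] only through its norm, hence is almost
    constant on a thin shell. This is what lets counting on the shell replace the uniform law. *)
Lemma kernel_mean_flat b m (y z : lattice_vec N) (d : R) :
  0 < b -> 0 <= m <= 1 ->
  4^-1 * N%:R <= sqnorm (@coords R N y) -> 4^-1 * N%:R <= sqnorm (@coords R N z) ->
  `|sqnorm (@coords R N y) - sqnorm (@coords R N z)| <= d ->
  kernel_mean b m y <= expR (5 * b * d) * kernel_mean b m z.
Proof.
move=> b0 /andP[m0 m1] hy hz YZ.
have [N0|N0] := posnP N.
  have -> : y = z by apply/ffunP => -[i iN]; exfalso; move: iN; rewrite N0.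
  rewrite ler_peMl//; first by apply: sphere_mean_ge0 => e; exact: kernel_weight_ge0.
  by rewrite -expR0 ler_expR !mulr_ge0 ?(ltW b0)// (le_trans _ YZ).
rewrite !kernel_meanE//; move: hy hz YZ; set Y := sqnorm _; set Z := sqnorm (coords R z) => hy hz YZ.
have Nr : 0 < N%:R :> R by rewrite ltr0n.
have Yp : 0 < Y by nra.
have Zp : 0 < Z by nra.
set sN := Num.sqrt N%:R.
have sNp : 0 < sN by rewrite sqrtr_gt0.
have sN2 : N%:R = sN ^+ 2 by rewrite sqr_sqrtr// ltW.
set p := Num.sqrt Y; set q := Num.sqrt Z.
have pp : 0 < p by rewrite sqrtr_gt0.
have qp : 0 < q by rewrite sqrtr_gt0.
have Ep : Y = p ^+ 2 by rewrite sqr_sqrtr// ltW.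
have Eq : Z = q ^+ 2 by rewrite sqr_sqrtr// ltW.
have ph : sN / 2 <= p.
  rewrite -(@ler_pXn2r _ 2)// ?nnegrE ?divr_ge0 ?(ltW sNp) ?(ltW pp)// -Ep.
  by apply: le_trans hy; rewrite sN2 exprMn; lra.
have qh : sN / 2 <= q.
  rewrite -(@ler_pXn2r _ 2)// ?nnegrE ?divr_ge0 ?(ltW sNp) ?(ltW qp)// -Eq.
  by apply: le_trans hz; rewrite sN2 exprMn; lra.
pose c := 2 * b * m * sN; have c0 : 0 <= c by rewrite !mulr_ge0 ?(ltW b0) ?(ltW sNp).
rewrite -/sN -/c.
have cE : c = 2 * b * m * sN by []; clearbody c.
have R1 : sphere_laplace (fun i => c * coords R y i) = sphere_laplace (fun i => p / q * (c * coords R z i)).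
  apply: sphere_laplace_rot; rewrite /sqnorm.
  under eq_bigr do rewrite exprMn; under [RHS]eq_bigr do rewrite !exprMn.
  rewrite -!mulr_sumr -/(sqnorm (coords R y)) -/(sqnorm (coords R z)) -/Y -/Z Ep Eq.
  by field; rewrite lt0r_neq0.
have R2 := sphere_laplace_dilate (fun i => c * coords R z i) (p / q).
have sE : Num.sqrt (sqnorm (fun i => c * coords R z i)) = c * q.
  rewrite /sqnorm; under eq_bigr do rewrite exprMn.
  by rewrite -mulr_sumr (sqrtrM _ (sqr_ge0 c)) sqrtr_sqr (ger0_norm c0).
rewrite sE in R2.
have E1 : `|p / q - 1| * (c * q) <= 2 * b * d.
  by rewrite cE; apply: flat_dev; rewrite -?Ep -?Eq ?m0 ?m1.
have L0 : 0 <= sphere_laplace (fun i => c * coords R z i).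
  by apply: sphere_mean_ge0 => e; exact: expR_ge0.
rewrite R1; apply: (@flat_kernel _ b _ Y Z d _ _ _ YZ _ b0 _ L0).
  by apply: le_trans R2 _; apply: ler_wpM2r; [exact: L0|rewrite ler_expR].
by apply: exprn_ge0; exact: lattice_step_ge0.
Qed.

End SphereLattice.

Section SphereCore.
Variables (R : realType) (N : nat).
Local Notation T := (N.-tuple (measurableTypeR R)).
Local Notation S := (@unit_sphere R N).

(** A modulus of continuity in the form that a Gaussian kernel absorbs: |x - y|^2 / t is paid by
    lowering the parameter of the kernel, and t N is a small exponential rate. The two points may
    have different norms. *)
Definition regular (C : R) (Phi : ('I_N -> R) -> R) : Prop :=
  forall (x y : 'I_N -> R) (t : R), sqnorm x = N%:R -> sqnorm y <= 2 * N%:R -> 0 < t ->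
    `|Phi x - Phi y| <= C / 2 * (t * N%:R + sqnorm (fun i => x i - y i) / t).

Variable U : probability T R.
Hypothesis U_unif : uniform_on_sphere U.
Variables (C : R) (Phi : ('I_N -> R) -> R).
Hypothesis Phi_meas : measurable_fun setT (fun e : T => Phi (dilate 1 e)).
Hypothesis Phi_reg : regular C Phi.

Definition sphere_exp : R := sphere_mean U (fun e : T => expR (Phi (dilate 1 e))).

Lemma sphere_bounded_exp : sphere_bounded (fun e : T => expR (Phi (dilate 1 e))).
Proof.
split.
- exact: measurableT_comp.
- by move=> e; exact: expR_ge0.
- exists (expR (Phi (fun=> 0) + C * N%:R)) => e Se; rewrite ler_expR.
  have s1 := sqnorm_dilate 1 Se; rewrite expr1n mul1r in s1.
  have s0 : sqnorm (fun _ : 'I_N => (0 : R)) <= 2 * N%:R.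
    by rewrite /sqnorm big1 ?mulr_ge0// => i _; rewrite expr0n.
  have := Phi_reg s1 s0 ltr01; rewrite ler_norml => /andP[_].
  have -> : sqnorm (fun i => dilate 1 e i - 0) = N%:R.
    by rewrite -s1; apply: eq_bigr => i _; rewrite subr0.
  lra.
Qed.

Lemma sqnorm_triangle (m : R) (x y : 'I_N -> R) :
  sqnorm (fun i => x i - y i) <=
  2 * sqnorm (fun i => y i - m * x i) + 2 * (1 - m) ^+ 2 * sqnorm x.
Proof.
rewrite /sqnorm !mulr_sumr -big_split/=; apply: ler_sum => i _.
rewrite -subr_ge0 (_ : _ - _ = (y i - m * x i + (1 - m) * x i) ^+ 2); first exact: sqr_ge0.
ring.
Qed.

Lemma Phi_kernel (m w : R) (e : T) (y : lattice_vec N) : S e ->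
  sqnorm (@coords R N y) <= 2 * N%:R -> 0 < w -> 0 <= C ->
  `|Phi (dilate 1 e) - Phi (coords R y)| <=
  C / 2 * (w + 2 * (1 - m) ^+ 2 / w) * N%:R
   + C / w * sqnorm (fun i => coords R y i - dilate m e i).
Proof.
move=> Se y2 w0 C0; have s1 := sqnorm_dilate 1 Se; rewrite expr1n mul1r in s1.
apply: le_trans (Phi_reg s1 y2 w0) _.
have := sqnorm_triangle m (dilate 1 e) (coords R y); rewrite s1.
have -> : sqnorm (fun i => coords R y i - m * dilate 1 e i) =
   sqnorm (fun i => coords R y i - dilate m e i).
  by apply: eq_bigr => i _; rewrite /dilate mul1r mulrA.
set q := sqnorm (fun i => coords R y i - _); set s := sqnorm _ => H.
have -> : C / 2 * (w + 2 * (1 - m) ^+ 2 / w) * N%:R + C / w * q =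
  C / 2 * (w * N%:R + (2 * q + 2 * (1 - m) ^+ 2 * N%:R) / w) by field; rewrite lt0r_neq0.
have C2 : 0 <= C / 2 by rewrite divr_ge0.
by rewrite ler_wpM2l// lerD2l ler_wpM2r// invr_ge0 ltW.
Qed.

(** Double counting of pairs formed by a shell vector and a point of the sphere, weighted by the
    kernel and by exp Phi. Summing over the shell first gives [sphere_exp] times [c1] or [c2];
    integrating over the sphere first gives Z / V, since the mean kernel is flat on the shell. *)
Lemma sphere_core (m w k r c1 c2 : R) :
  let b := (2 * w ^+ 2)^-1 in let b' := b - C / w in
  let L := C / 2 * (w + 2 * (1 - m) ^+ 2 / w) in
  let V := \sum_(y : lattice_vec N | shell k r y) lattice_step R N ^+ N in
  let Z := \sum_(y : lattice_vec N | shell k r y) lattice_step R N ^+ N * expR (Phi (coords R y)) in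
  0 < w -> 0 <= C -> 0 < b' -> 0 <= m <= 1 -> 4^-1 <= k - r -> k + r <= 2 ->
  0 <= c1 -> 0 <= c2 -> 0 <= r ->
  (forall x : 'I_N -> R, sqnorm x = m ^+ 2 * N%:R ->
    c1 <= \sum_(y : lattice_vec N | shell k r y) kernel_weight b y x) ->
  (forall x : 'I_N -> R, sqnorm x = m ^+ 2 * N%:R ->
    \sum_(y : lattice_vec N) kernel_weight b' y x <= c2) ->
  c1 * V * sphere_exp <= expR ((10 * b * r + L) * N%:R) * c2 * Z /\
  c1 * Z <= expR ((10 * b * r + L) * N%:R) * c2 * V * sphere_exp.
Proof.
move=> b b' L; set h := lattice_step R N ^+ N => V Z w0 C0 b'0 m01 k1 k2 c10 c20 r0 K1 K2.
have Cw : 0 <= C / w by rewrite divr_ge0// ltW.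
have b0 : 0 < b by rewrite invr_gt0 mulr_gt0// exprn_gt0.
have b'b : b' <= b by rewrite gerBl.
have h0 : 0 <= h by rewrite exprn_ge0 ?lattice_step_ge0.
have N0 : 0 <= N%:R :> R by [].
have Sh y : shell k r y -> 4^-1 * N%:R <= sqnorm (@coords R N y) <= 2 * N%:R.
  rewrite /shell ler_norml => /andP[p q].
  have : 4^-1 * N%:R <= (k - r) * N%:R by rewrite ler_wpM2r.
  have : (k + r) * N%:R <= 2 * N%:R by rewrite ler_wpM2r.
  by lra.
have E0 x : 0 <= expR x :> R by exact: expR_ge0.
(* The Gaussian of parameter b' absorbs the modulus of continuity of Phi. *)
have X e y : S e -> shell k r y ->
  expR (Phi (dilate 1 e)) * kernel_weight b y (dilate m e) <=
    expR (L * N%:R) * expR (Phi (coords R y)) * kernel_weight b' y (dilate m e) /\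
  expR (Phi (coords R y)) * kernel_weight b y (dilate m e) <=
    expR (L * N%:R) * expR (Phi (dilate 1 e)) * kernel_weight b' y (dilate m e).
  move=> Se /Sh/andP[_ y2]; have := Phi_kernel m Se y2 w0 C0.
  rewrite ler_norml -/L /kernel_weight -/h => /andP[p q].
  set s := sqnorm (fun i => coords R y i - _) in p q *.
  split; rewrite mulrCA [leRHS]mulrCA ler_wpM2l// -!expRD ler_expR /b'; move: p q; clear -U_unif Phi_meas Phi_reg => *; lra.
have nK b1 y : 0 < b1 -> sphere_bounded (fun e : T => kernel_weight b1 y (dilate m e)).
  by move=> ?; exact: sphere_bounded_kernel.
have nF := sphere_bounded_exp.
have nc c : 0 <= c -> sphere_bounded (fun _ : T => c) by exact: sphere_bounded_cst.
have sm e : S e -> sqnorm (dilate m e) = m ^+ 2 * N%:R by exact: sqnorm_dilate.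
(* Two shell vectors have squared norms within 2 r N of each other, and 5 b (2 r N) = 10 b r N. *)
have flat b1 y z : 0 < b1 -> b1 <= b -> shell k r y -> shell k r z ->
   kernel_mean U b1 m y <= expR (10 * b * r * N%:R) * kernel_mean U b1 m z.
  move=> b10 b1b yS zS; have /andP[y1 _] := Sh _ yS; have /andP[z1 _] := Sh _ zS.
  have D : `|sqnorm (@coords R N y) - sqnorm (@coords R N z)| <= 2 * r * N%:R.
    by move: yS zS; rewrite /shell !ler_norml; clear -U_unif Phi_meas Phi_reg => /andP[? ?] /andP[? ?]; apply/andP; split; lra.
  apply: le_trans (kernel_mean_flat U_unif b10 m01 y1 z1 D) _.
  rewrite ler_wpM2r//; first by apply: sphere_mean_ge0 => e; exact: kernel_weight_ge0.
  rewrite ler_expR (_ : 5 * b1 * (2 * r * N%:R) = b1 * (10 * r * N%:R)); last by ring.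
  rewrite (_ : 10 * b * r * N%:R = b * (10 * r * N%:R)); last by ring.
  by rewrite ler_wpM2r// !mulr_ge0.
set E10 := expR (10 * b * r * N%:R) in flat *.
have EE : expR ((10 * b * r + L) * N%:R) = E10 * expR (L * N%:R).
  by rewrite mulrDl expRD.
have E100 : 0 <= E10 by exact: E0.
(* The mean kernel at [y] is nearly its average over the shell, which the total mass [c2] bounds. *)
have W2 y : shell k r y -> kernel_mean U b' m y * V <= h * (E10 * c2).
  move=> yS; rewrite /V mulr_sumr.
  apply: (@le_trans _ _ (\sum_(z | shell k r z) h * (E10 * kernel_mean U b' m z))).
    by apply: ler_sum => z zS; rewrite mulrC ler_wpM2l// flat.
  rewrite -mulr_sumr ler_wpM2l// -mulr_sumr ler_wpM2l//.
  rewrite -(sphere_mean_cst U_unif c20) -sphere_mean_sum//; last by move=> z; exact: nK.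
  apply: sphere_mean_le => //.
  - by apply: sphere_bounded_sum => z; exact: nK.
  - exact: nc.
  - move=> e Se; apply: le_trans (K2 _ (sm e Se)).
    rewrite big_mkcond; apply: ler_sum => z _; case: ifP => // _.
    exact: kernel_weight_ge0.
have W1 y : shell k r y -> h * c1 <= E10 * (V * kernel_mean U b m y).
  move=> yS; rewrite /V mulr_suml mulr_sumr.
  apply: (@le_trans _ _ (\sum_(z | shell k r z) h * kernel_mean U b m z)); last first.
    by apply: ler_sum => z zS; rewrite mulrCA ler_wpM2l// flat.
  rewrite -mulr_sumr ler_wpM2l//.
  rewrite -(sphere_mean_cst U_unif c10) -sphere_mean_sum//; last by move=> z; exact: nK.
  apply: sphere_mean_le => //.
  - exact: nc.
  - by apply: sphere_bounded_sum => z; exact: nK.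
  - by move=> e Se; exact: K1 (sm e Se).
have V0 : 0 <= V by apply: sumr_ge0.
split.
- have H1 : c1 * sphere_exp <= \sum_(y | shell k r y)
      expR (L * N%:R) * expR (Phi (coords R y)) * kernel_mean U b' m y.
    rewrite -sphere_meanZ//.
    have -> : \sum_(y | shell k r y) expR (L * N%:R) * expR (Phi (coords R y)) * kernel_mean U b' m y
      = sphere_mean U (fun e => \sum_(y | shell k r y) expR (L * N%:R) * expR (Phi (coords R y)) *
           kernel_weight b' y (dilate m e)).
      rewrite sphere_mean_sum//; last first.
        by move=> y; apply: sphere_boundedM; [apply: nc; rewrite mulr_ge0|exact: nK].
      by apply: eq_bigr => y _; rewrite sphere_meanZ ?mulr_ge0//; exact: nK.
    apply: sphere_mean_le => //.
    + by apply: sphere_boundedM => //; exact: nc.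
    + apply: sphere_bounded_sum => y.
      by apply: sphere_boundedM; [apply: nc; rewrite mulr_ge0|exact: nK].
    + move=> e Se; apply: (@le_trans _ _ (\sum_(y | shell k r y)
         expR (Phi (dilate 1 e)) * kernel_weight b y (dilate m e))).
        by rewrite -mulr_sumr mulrC ler_wpM2l// K1// sm.
      by apply: ler_sum => y yS; case: (X e y Se yS).
  rewrite mulrAC; apply: le_trans (ler_wpM2r V0 H1) _.
  rewrite mulr_suml /Z mulr_sumr; apply: ler_sum => y yS; rewrite EE.
  have -> : expR (L * N%:R) * expR (Phi (coords R y)) * kernel_mean U b' m y * V =
     expR (L * N%:R) * expR (Phi (coords R y)) * (kernel_mean U b' m y * V) by ring.
  have -> : E10 * expR (L * N%:R) * c2 * (h * expR (Phi (coords R y))) =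
     expR (L * N%:R) * expR (Phi (coords R y)) * (h * (E10 * c2)) by ring.
  by rewrite ler_wpM2l ?mulr_ge0// W2.
- have H1 : \sum_(y | shell k r y) expR (Phi (coords R y)) * kernel_mean U b m y <=
     expR (L * N%:R) * c2 * sphere_exp.
    rewrite -sphere_meanZ ?mulr_ge0//.
    have -> : \sum_(y | shell k r y) expR (Phi (coords R y)) * kernel_mean U b m y
      = sphere_mean U (fun e => \sum_(y | shell k r y) expR (Phi (coords R y)) *
           kernel_weight b y (dilate m e)).
      rewrite sphere_mean_sum//; last first.
        by move=> y; apply: sphere_boundedM; [exact: nc|exact: nK].
      by apply: eq_bigr => y _; rewrite sphere_meanZ//; exact: nK.
    apply: sphere_mean_le => //.
    + apply: sphere_bounded_sum => y.
      by apply: sphere_boundedM; [exact: nc|exact: nK].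
    + by apply: sphere_boundedM => //; apply: nc; rewrite mulr_ge0.
    + move=> e Se; apply: (@le_trans _ _ (\sum_(y | shell k r y)
         expR (L * N%:R) * expR (Phi (dilate 1 e)) * kernel_weight b' y (dilate m e))).
        by apply: ler_sum => y yS; case: (X e y Se yS).
      rewrite -mulr_sumr mulrAC ler_wpM2r// ler_wpM2l//.
      apply: le_trans (K2 _ (sm e Se)).
      rewrite big_mkcond; apply: ler_sum => z _; case: ifP => // _.
      exact: kernel_weight_ge0.
  apply: (@le_trans _ _ (\sum_(y | shell k r y) E10 * V * (expR (Phi (coords R y)) * kernel_mean U b m y))).
    rewrite /Z mulr_sumr; apply: ler_sum => y yS.
    have -> : c1 * (h * expR (Phi (coords R y))) = expR (Phi (coords R y)) * (h * c1) by ring.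
    have -> : E10 * V * (expR (Phi (coords R y)) * kernel_mean U b m y) =
      expR (Phi (coords R y)) * (E10 * (V * kernel_mean U b m y)) by ring.
    by rewrite ler_wpM2l// W1.
  rewrite -mulr_sumr EE.
  have -> : E10 * expR (L * N%:R) * c2 * V * sphere_exp = E10 * V * (expR (L * N%:R) * c2 * sphere_exp) by ring.
  by rewrite ler_wpM2l ?mulr_ge0.
Qed.
End SphereCore.

(** * Exponential equivalence of spherical averages and lattice sums *)

Section SphereAsymptotics.
Variable R : realType.

Definition sphere_entropy (N : nat) : R := N%:R / 2 * (ln (2 * pi) + 1).

Lemma inv_1B_le_expR (s : R) : 0 <= s <= 1 / 2 -> (1 - s)^-1 <= expR (2 * s).
Proof.
move=> /andP[s0 s1]; apply: le_trans (expR_ge1Dx _).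
by rewrite -[leLHS]mul1r ler_pdivrMr; [nra|lra].
Qed.

(** [w] is the standard deviation per coordinate of the smoothing Gaussian. Smoothing costs a rate
    of order C w and flatness a rate 10 b r = 5 r / w^2, so [r] has to be chosen after [w] and small
    compared with w^2. *)
Lemma sphere_lattice_compare (C w k r t : R) : 0 <= C -> 0 < w -> w <= 1 / 2 -> 2 * C * w <= 1 / 2 ->
  1 / 2 <= k <= 1 -> 1 - k <= w ^+ 2 -> 0 < r <= 1 / 4 -> 0 < t ->
  let b := (2 * w ^+ 2)^-1 in
  \forall N \near \oo, forall (U : probability (N.-tuple (measurableTypeR R)) R),
    uniform_on_sphere U -> forall Phi : ('I_N -> R) -> R,
    measurable_fun setT (fun e : N.-tuple (measurableTypeR R) => Phi (dilate 1 e)) ->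
    regular C Phi ->
    let V := \sum_(y : lattice_vec N | shell k r y) lattice_step R N ^+ N in
    let Z := \sum_(y : lattice_vec N | shell k r y)
       lattice_step R N ^+ N * expR (Phi (coords R y)) in
    V * sphere_exp U Phi <= expR ((10 * b * r + 4 * C * w + 2 * t) * N%:R) * Z /\
    Z <= expR ((10 * b * r + 4 * C * w + 2 * t) * N%:R) * V * sphere_exp U Phi.
Proof.
move=> C0 w0 w1 Cw /andP[k1 k2] kw /andP[r0 r1] t0 b.
have ww : w ^+ 2 <= 1 / 4 by rewrite expr2; nra.
have w20 : 0 < w ^+ 2 by rewrite exprn_gt0.
(* The sphere is shrunk so that m^2 plus the variance w^2 of the noise is exactly [k]: the noisy
   points concentrate in the middle of the shell. *)
pose m := Num.sqrt (k - w ^+ 2).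
have m2 : m ^+ 2 = k - w ^+ 2 by rewrite sqr_sqrtr//; lra.
have m0 : 0 <= m by exact: sqrtr_ge0.
have m1 : m <= 1 by rewrite -(@ler_pXn2r _ 2)// ?nnegrE// m2 expr1n; lra.
have m01 : 0 <= m <= 1 by rewrite m0 m1.
have b0 : 0 < b by rewrite invr_gt0 mulr_gt0.
have kE : m ^+ 2 + (2 * b)^-1 = k.
  by rewrite m2 /b; field; rewrite lt0r_neq0.
pose b' := b - C / w.
have b'E : b' = b * (1 - 2 * C * w) by rewrite /b' /b; field; rewrite lt0r_neq0.
have b'0 : 0 < b' by rewrite b'E mulr_gt0//; lra.
(* Since 1 - m <= 1 - m^2 <= 2 w^2, shrinking the sphere costs no more than the smoothing. *)
have L4 : C / 2 * (w + 2 * (1 - m) ^+ 2 / w) <= 2 * C * w.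
  have mm : 1 - m <= 2 * w ^+ 2 by nra.
  have m3 : (1 - m) ^+ 2 <= 4 * w ^+ 4.
    apply: (@le_trans _ _ ((2 * w ^+ 2) ^+ 2)); last by rewrite exprMn -exprM; clear -R; lra.
    by rewrite lerXn2r ?nnegrE//; move: m1 w20; clear -R => *; lra.
  have : 2 * (1 - m) ^+ 2 / w <= 2 * w.
    rewrite ler_pdivrMr// -mulrA -expr2 ler_wpM2l//; apply: le_trans m3 _.
    by rewrite (_ : 4 * w ^+ 4 = w ^+ 2 * (4 * w ^+ 2)); [rewrite ler_piMr ?(ltW w20)//; lra|ring].
  have : 0 <= C / 2 by rewrite divr_ge0.
  nra.
set g := Num.sqrt (pi / b).
have g0 : 0 <= g by exact: sqrtr_ge0.
have gp : 0 < g by rewrite sqrtr_gt0 divr_gt0// pi_gt0.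
have g' : Num.sqrt (pi / b') <= g * expR (2 * C * w).
  have -> : pi / b' = pi / b * (1 - 2 * C * w)^-1.
    by rewrite b'E; field; rewrite !lt0r_neq0//; lra.
  rewrite sqrtrM ?divr_ge0 ?pi_ge0 ?(ltW b0)// ler_wpM2l//.
  have -> : 2 * C * w = 2 * (2 * C * w) / 2 by field.
  rewrite -sqrt_expR; apply: ler_wsqrtr.
  have Cw0 : 0 <= 2 * C * w by rewrite !mulr_ge0 ?(ltW w0).
  have -> : 2 * (2 * C * w) / 2 = 2 * C * w by field.
  by apply: inv_1B_le_expR; rewrite Cw0.
have := shell_mass b0 m01 r0 t0; rewrite kE => H1.
have H2 := kernel_mass b'0 t0.
move: H1 H2; apply: filterS2 => N H1 H2 U U_unif Phi mPhi rPhi.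
set V := \sum_(y | _) lattice_step R N ^+ N; set Z := \sum_(y | _) _ * expR _.
pose c1 := g ^+ N * expR (- t * N%:R).
pose c2 := g ^+ N * expR ((2 * C * w + t) * N%:R).
have gN : 0 < g ^+ N by rewrite exprn_gt0.
have c10 : 0 < c1 by rewrite mulr_gt0 ?expR_gt0.
have c20 : 0 <= c2 by rewrite mulr_ge0 ?expR_ge0// ltW.
have K2 (x : 'I_N -> R) : sqnorm x = m ^+ 2 * N%:R -> \sum_(y : lattice_vec N) kernel_weight b' y x <= c2.
  move=> xm; have /andP[_ h] := H2 m x m01 xm; apply: le_trans h _.
  rewrite /c2 expRM_natr -exprMn expRD mulrA lerXn2r ?nnegrE ?mulr_ge0 ?expR_ge0 ?sqrtr_ge0//.
  by rewrite ler_wpM2r ?expR_ge0.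
have k3 : 4^-1 <= k - r by move: k1 r1; clear -R => *; lra.
have k4 : k + r <= 2 by move: k2 r1; clear -R => *; lra.
have [A1 A2] := sphere_core U_unif mPhi rPhi w0 C0 b'0 m01 k3 k4 (ltW c10) c20 (ltW r0) H1 K2.
rewrite -/b -/V -/Z in A1 A2.
have N0 : 0 <= N%:R :> R by [].
have Z0 : 0 <= Z by apply: sumr_ge0 => y _; rewrite mulr_ge0 ?expR_ge0// exprn_ge0 ?lattice_step_ge0.
have V0 : 0 <= V by apply: sumr_ge0 => y _; rewrite exprn_ge0 ?lattice_step_ge0.
have S0 : 0 <= sphere_exp U Phi by apply: sphere_mean_ge0 => e; exact: expR_ge0.
have E : expR ((10 * b * r + C / 2 * (w + 2 * (1 - m) ^+ 2 / w)) * N%:R) * c2 <=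
   c1 * expR ((10 * b * r + 4 * C * w + 2 * t) * N%:R).
  rewrite /c1 /c2 mulrCA -[leRHS]mulrA ler_wpM2l ?(ltW gN)// -!expRD ler_expR.
  by rewrite -!mulrDl ler_wpM2r//; move: L4; clear -R => *; lra.
split; rewrite -(ler_pM2l c10).
- by rewrite mulrA; apply: le_trans A1 _; rewrite [leRHS]mulrA ler_wpM2r.
- apply: le_trans A2 _; rewrite [leRHS]mulrA [X in _ <= X * _]mulrA.
  by rewrite ler_wpM2r// ler_wpM2r.
Qed.

Lemma sphere_lower (C e : R) : 0 <= C -> 0 < e ->
  exists2 r0 : R, 0 < r0 & forall r, 0 < r <= r0 ->
  \forall N \near \oo, forall (U : probability (N.-tuple (measurableTypeR R)) R),
    uniform_on_sphere U -> forall Phi : ('I_N -> R) -> R,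
    measurable_fun setT (fun e : N.-tuple (measurableTypeR R) => Phi (dilate 1 e)) ->
    regular C Phi ->
    \sum_(y : lattice_vec N | shell 1 r y) lattice_step R N ^+ N * expR (Phi (coords R y)) <=
    expR (sphere_entropy N + e * N%:R) * sphere_exp U Phi.
Proof.
move=> C0 e0.
(* The bound with 16 makes 4 C w at most e / 4, and the one with 4 makes 2 C w at most 1 / 2. *)
pose w := Num.min (1 / 2) (Num.min (e / (16 * (C + 1))) (1 / (4 * (C + 1)))).
have C1 : 0 < C + 1 by rewrite ltr_wpDl.
have w0 : 0 < w by rewrite !lt_min !divr_gt0 ?mulr_gt0.
have w1 : w <= 1 / 2 by rewrite ge_min lexx.
have w2 : w * (16 * (C + 1)) <= e.
  by rewrite -ler_pdivlMr ?mulr_gt0// /w !ge_min lexx orbT.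
have w3 : w * (4 * (C + 1)) <= 1.
  by rewrite -ler_pdivlMr ?mulr_gt0// /w !ge_min lexx !orbT.
pose b := (2 * w ^+ 2)^-1.
have b0 : 0 < b by rewrite invr_gt0 mulr_gt0// exprn_gt0.
have b1 : 0 < 4 * (10 * b + 1) by rewrite mulr_gt0// addr_gt0// mulr_gt0.
exists (Num.min (1 / 4) (e / (4 * (10 * b + 1)))).
  by rewrite lt_min !divr_gt0.
move=> r /andP[r0]; rewrite le_min => /andP[r1 r2].
rewrite ler_pdivlMr// in r2.
have t0 : 0 < e / 12 by rewrite divr_gt0.
have r01 : 0 < r <= 1 / 4 by rewrite r0.
have k1 : 1 / 2 <= (1 : R) <= 1 by rewrite lexx andbT; lra.
have k2 : 1 - 1 <= w ^+ 2 by rewrite subrr sqr_ge0.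
have Cw : 2 * C * w <= 1 / 2 by nra.
have H1 := sphere_lattice_compare C0 w0 w1 Cw k1 k2 r01 t0.
have H2 := shell_volume (ltr01 : 0 < (1 : R)) r0 t0.
move: H1 H2; apply: filterS2 => N H1 /andP[_ H2] U U_unif Phi mPhi rPhi.
have [_ h] := H1 U U_unif Phi mPhi rPhi; apply: le_trans h _.
rewrite ler_wpM2r//; first by apply: sphere_mean_ge0 => z; exact: expR_ge0.
apply: le_trans (ler_wpM2l (expR_ge0 _) H2) _.
rewrite -expRD ler_expR !mulr1 -/b /sphere_entropy addrC -addrA lerD2l -mulrDl.
rewrite ler_wpM2r//; move: w2 r2 b0 r0 w0 e0; clear -R => *; nra.
Qed.

Lemma sphere_upper (C e : R) : 0 <= C -> 0 < e ->
  exists k r : R, [/\ 0 < r, k + r < 1, 1 - e < k - r &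
  \forall N \near \oo, forall (U : probability (N.-tuple (measurableTypeR R)) R),
    uniform_on_sphere U -> forall Phi : ('I_N -> R) -> R,
    measurable_fun setT (fun e : N.-tuple (measurableTypeR R) => Phi (dilate 1 e)) ->
    regular C Phi ->
    sphere_exp U Phi <= expR (- sphere_entropy N + e * N%:R) *
    \sum_(y : lattice_vec N | shell k r y) lattice_step R N ^+ N * expR (Phi (coords R y))].
Proof.
move=> C0 e0.
pose w := Num.min (1 / 2) (Num.min (e / (16 * (C + 1))) (1 / (4 * (C + 1)))).
have C1 : 0 < C + 1 by rewrite ltr_wpDl.
have w0 : 0 < w by rewrite !lt_min !divr_gt0 ?mulr_gt0.
have w1 : w <= 1 / 2 by rewrite ge_min lexx.
have w2 : w * (16 * (C + 1)) <= e.
  by rewrite -ler_pdivlMr ?mulr_gt0// /w !ge_min lexx orbT.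
have w3 : w * (4 * (C + 1)) <= 1.
  by rewrite -ler_pdivlMr ?mulr_gt0// /w !ge_min lexx !orbT.
pose b := (2 * w ^+ 2)^-1.
have w20 : 0 < w ^+ 2 by rewrite exprn_gt0.
have b0 : 0 < b by rewrite invr_gt0 mulr_gt0.
have b1 : 0 < 4 * (10 * b + 4) by rewrite mulr_gt0// addr_gt0// mulr_gt0.
pose r := Num.min (w ^+ 2 / 2) (Num.min (1 / 8) (e / (4 * (10 * b + 4)))).
have r0 : 0 < r by rewrite !lt_min !divr_gt0.
have r1 : r <= w ^+ 2 / 2 by rewrite ge_min lexx.
have r2 : r <= 1 / 8 by rewrite /r !ge_min lexx orbT.
have r3 : r * (4 * (10 * b + 4)) <= e.
  by rewrite -ler_pdivlMr// /r !ge_min lexx !orbT.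
have t0 : 0 < e / 12 by rewrite divr_gt0.
(* With this [k] both k + r < 1 and 1 - k <= w^2 hold: the shell is strictly inside the sphere, yet
   the smoothing still reaches it. *)
pose k := 1 - 2 * r.
have rb : 0 < r * b by rewrite mulr_gt0.
exists k, r; split => //; [by rewrite /k; move: r0 r2; clear -R => *; lra|by rewrite /k; move: r0 rb r3; clear -R => *; lra|].
have r01 : 0 < r <= 1 / 4 by rewrite r0; move: r2; clear -R => *; lra.
have k1 : 1 / 2 <= k <= 1 by rewrite /k; move: r0 r2; clear -R => *; apply/andP; split; lra.
have k2 : 1 - k <= w ^+ 2 by rewrite /k; move: r1; clear -R => *; lra.
have kp : 0 < k by rewrite /k; move: r2; clear -R => *; lra.
have Cw : 2 * C * w <= 1 / 2 by move: w3 w0; clear -R => *; nra.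
have H1 := sphere_lattice_compare C0 w0 w1 Cw k1 k2 r01 t0.
have H2 := shell_volume kp r0 t0.
move: H1 H2; apply: filterS2 => N H1 /andP[H2 _] U U_unif Phi mPhi rPhi.
have [h _] := H1 U U_unif Phi mPhi rPhi.
set Z := \sum_(y | _) (_ * expR _) in h *.
have Z0 : 0 <= Z by apply: sumr_ge0 => y _; rewrite mulr_ge0 ?expR_ge0// exprn_ge0 ?lattice_step_ge0.
have S0 : 0 <= sphere_exp U Phi by apply: sphere_mean_ge0 => z; exact: expR_ge0.
have lnk : ln (2 * pi * k) >= ln (2 * pi) - 4 * r.
  have p2 : 0 < 2 * pi :> R by rewrite mulr_gt0// pi_gt0.
  rewrite [leRHS]lnM ?posrE// lerD2l -[leRHS]opprK lerN2 -lnV ?posrE//.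
  rewrite -ler_expR lnK ?posrE ?invr_gt0//.
  have -> : 4 * r = 2 * (2 * r) by ring.
  by apply: inv_1B_le_expR; apply/andP; split; move: r01 => /andP[]; clear -R => *; lra.
have rk : r / (2 * k) <= r.
  by rewrite ler_pdivrMr ?mulr_gt0// ler_peMr ?(ltW r0)// /k; move: r01 => /andP[]; clear -R => *; lra.
have N0 : 0 <= N%:R :> R by [].
have := le_trans (ler_wpM2r S0 H2) h.
rewrite -ler_pdivlMl ?expR_gt0// -expRN [leRHS]mulrA -expRD => /le_trans; apply.
rewrite ler_wpM2r// ler_expR /sphere_entropy -/b -subr_ge0.
set lk := ln (2 * pi * k) in lnk *; set l1 := ln (2 * pi) in lnk *; set rr := r / (2 * k) in rk *.
rewrite (_ : _ - _ = (e + (lk - l1) / 2 - rr - e / 12 - (10 * b * r + 4 * C * w + 2 * (e / 12))) * N%:R); last by field.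
rewrite mulr_ge0//; move: lnk rk r3 w2 r0 b0 w0 e0; clear -R => *; nra.
Qed.
End SphereAsymptotics.

(** * Pair potentials and their energy *)

Section PairPotential.
Variable R : realType.

(* l stands for x |-> L (sqrt x), and B / 2 for the limit of l x / x at infinity. *)
Definition pair_potential (l : R -> R) (La B : R) : Prop :=
  [/\ forall x, 0 <= x -> 0 <= l x,
      forall x y, 0 <= x -> 0 <= y -> `|l x - l y| <= La * `|x - y|,
      l 0 = 0,
      forall e, 0 < e -> exists2 d, 0 < d & forall x, 0 <= x <= d -> `|l x - x / 2| <= e * x
    & forall e, 0 < e -> exists2 M, 0 < M & forall x, M <= x -> `|l x - B / 2 * x| <= e * x].

(** [u i] stands for a squared coordinate; with c = 4 theta^2 the argument of [l] is the square of 2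
    theta y_i y_j / sqrt N. *)
Definition energy (l : R -> R) (c : R) (N : nat) (u : 'I_N -> R) : R :=
  2^-1 * \sum_(i < N) \sum_(j < N) l (c * u i * u j / N%:R).

Variables (l : R -> R) (La B c : R).
Hypothesis lP : pair_potential l La B.
Hypothesis La0 : 0 <= La.
Hypothesis c0 : 0 <= c.

Lemma potential_le x : 0 <= x -> 0 <= l x <= La * x.
Proof.
move=> x0; have [l0 lip l00 _ _] := lP; rewrite l0//=.
have := lip x 0 x0 (lexx _); rewrite l00 !subr0 (ger0_norm x0).
by apply: le_trans; exact: ler_norm.
Qed.

Lemma energy_ge0 N (u : 'I_N -> R) : (forall i, 0 <= u i) -> 0 <= energy l c u.
Proof.
move=> u0; rewrite mulr_ge0 ?invr_ge0//; do 2 (apply: sumr_ge0 => ? _).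
by have [l0 _ _ _ _] := lP; rewrite l0// !mulr_ge0 ?invr_ge0.
Qed.

Lemma energy_diff N (u v : 'I_N -> R) : (forall i, 0 <= u i) -> (forall i, 0 <= v i) ->
  `|energy l c u - energy l c v| <=
  La * c / 2 * (\sum_(i < N) u i + \sum_(i < N) v i) / N%:R * \sum_(i < N) `|u i - v i|.
Proof.
move=> u0 v0; have [l0 lip _ _ _] := lP.
rewrite /energy -mulrBr -sumrB normrM ger0_norm ?invr_ge0//.
under eq_bigr do rewrite -sumrB.
have H i j : `|l (c * u i * u j / N%:R) - l (c * v i * v j / N%:R)| <=
   La * c / N%:R * (u i * `|u j - v j| + `|u i - v i| * v j).
  apply: le_trans (lip _ _ _ _) _; rewrite ?mulr_ge0 ?invr_ge0//.
  have -> : c * u i * u j / N%:R - c * v i * v j / N%:R =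
    c / N%:R * (u i * (u j - v j) + (u i - v i) * v j) by ring.
  rewrite normrM (ger0_norm (divr_ge0 c0 (ler0n _ _))) -!mulrA ler_wpM2l//.
  rewrite ler_wpM2l// ler_wpM2l ?invr_ge0//; apply: le_trans (ler_normD _ _) _.
  by rewrite !normrM (ger0_norm (u0 i)) (ger0_norm (v0 j)).
apply: (@le_trans _ _ (2^-1 * \sum_i \sum_j La * c / N%:R * (u i * `|u j - v j| + `|u i - v i| * v j))).
  rewrite ler_wpM2l ?invr_ge0//; apply: le_trans (ler_norm_sum _ _ _) _.
  by apply: ler_sum => i _; apply: le_trans (ler_norm_sum _ _ _) _; apply: ler_sum.
under eq_bigr do rewrite -mulr_sumr big_split/= -mulr_sumr -mulr_sumr.
rewrite -mulr_sumr big_split/= -mulr_suml -mulr_suml.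
set A := \sum_i `|_|; set X := \sum_i u i; set Y := \sum_i v i.
by rewrite le_eqVlt; apply/orP; left; apply/eqP; ring.
Qed.

(** |x^2 - y^2| = |x - y| |x + y|, and Young's inequality with weight [t] splits this product into
    the two terms that [regular] allows. *)
Lemma energy_regular N :
  @regular R N (9 * La * c) (fun y => energy l c (fun i => y i ^+ 2)).
Proof.
move=> x y t x1 y2 t0.
have sq0 (z : 'I_N -> R) i : 0 <= z i ^+ 2 by exact: sqr_ge0.
have [N0|N0] := posnP N.
  have E0 (v : 'I_N -> R) : energy l c v = 0.
    by rewrite /energy big1 ?mulr0// => -[i iN] _; exfalso; move: iN; rewrite N0.
  rewrite !E0 subrr normr0.
  by rewrite !(mulr_ge0, addr_ge0, invr_ge0, sqnorm_ge0)// ltW.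
have Np : 0 < N%:R :> R by rewrite ltr0n.
apply: le_trans (energy_diff (sq0 x) (sq0 y)) _.
rewrite -/(sqnorm x) -/(sqnorm y) x1.
have D : \sum_(i < N) `|x i ^+ 2 - y i ^+ 2| <=
    3 * t * N%:R + sqnorm (fun i => x i - y i) / (2 * t).
  apply: (@le_trans _ _ (t * (sqnorm x + sqnorm y) + sqnorm (fun i => x i - y i) / (2 * t))).
    rewrite /sqnorm -big_split/= mulr_sumr mulr_suml -big_split/=; apply: ler_sum => i _.
    rewrite subr_sqr normrM.
    have A : `|x i - y i| * `|x i + y i| <= t / 2 * (x i + y i) ^+ 2 + (x i - y i) ^+ 2 / (2 * t).
      rewrite -[in leRHS](real_normK (num_real (x i + y i))) -[in leRHS](real_normK (num_real (x i - y i))).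
      set p := `|x i - y i|; set q := `|x i + y i|.
      rewrite -subr_ge0 (_ : _ - _ = (p - t * q) ^+ 2 / (2 * t)); last by field; rewrite lt0r_neq0.
      by rewrite divr_ge0 ?sqr_ge0// mulr_ge0// ltW.
    apply: le_trans A _; rewrite lerD2r -mulrA ler_wpM2l ?(ltW t0)//.
    by have := sqr_ge0 (x i - y i); rewrite -subr_ge0 => H; rewrite -subr_ge0 (_ : _ - _ = (x i - y i) ^+ 2 / 2); [rewrite divr_ge0 ?sqr_ge0|field].
  by rewrite x1 lerD2r; have := ltW t0; nra.
set s := \sum_i `|_| in D *; set q := sqnorm (fun i => _) in D *.
have q0 : 0 <= q by exact: sqnorm_ge0.
have Lc : 0 <= La * c by rewrite mulr_ge0.
have s0 : 0 <= s by apply: sumr_ge0.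
apply: (@le_trans _ _ (La * c * (3 / 2) * s)).
  rewrite (_ : La * c / 2 * _ / _ * s = La * c * ((N%:R + sqnorm y) / (2 * N%:R)) * s); last by field; rewrite lt0r_neq0.
  rewrite ler_wpM2r// ler_wpM2l// ler_pdivrMr ?mulr_gt0//; lra.
rewrite (_ : 9 * La * c / 2 * _ = La * c * (3 / 2) * (3 * t * N%:R + 3 * (q / t))); last by field; rewrite lt0r_neq0.
rewrite ler_wpM2l ?mulr_ge0//; apply: le_trans D _; rewrite lerD2l.
have -> : q / (2 * t) = q / t / 2 by field; rewrite lt0r_neq0.
by have : 0 <= q / t by [rewrite divr_ge0// ltW]; lra.
Qed.

Lemma sum_class3 N (P Q : pred 'I_N) (F : 'I_N -> R) : (forall i, P i -> ~~ Q i) ->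
  \sum_(i < N) F i = \sum_(i | P i) F i + \sum_(i | Q i) F i + \sum_(i | ~~ P i && ~~ Q i) F i.
Proof.
move=> PQ; rewrite (bigID P)/= -addrA; congr (_ + _).
rewrite (bigID Q)/=; congr (_ + _); apply: eq_bigl => i.
by case: (boolP (Q i)) => Qi; rewrite ?andbT ?andbF// (contraL (PQ i)) ?negbK.
Qed.

Lemma sum_mul2 N (P Q : pred 'I_N) (a : R) (u v : 'I_N -> R) :
  \sum_(i | P i) \sum_(j | Q j) a * u i * v j = a * (\sum_(i | P i) u i) * (\sum_(j | Q j) v j).
Proof. by under eq_bigr do rewrite -mulr_sumr; rewrite -mulr_suml -mulr_sumr. Qed.

(** [P] holds the large sites, [Q] the middle ones and [O] the rest. Pairs inside [P] have slope B /
    2, pairs O-O and Q-O have slope 1 / 2, and the other pairs are kept exactly. Each replacement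
    errs by at most e times the argument, and all arguments together sum to c (sum u)^2 / N. *)
Lemma energy_class3 N (P Q : pred 'I_N) (u : 'I_N -> R) (e d M : R) :
  let O i := ~~ P i && ~~ Q i in
  (forall i, P i -> ~~ Q i) -> (forall i, 0 <= u i) -> 0 <= e ->
  (forall x, 0 <= x <= d -> `|l x - x / 2| <= e * x) ->
  (forall x, M <= x -> `|l x - B / 2 * x| <= e * x) ->
  (forall i j, O i -> O j -> c * u i * u j / N%:R <= d) ->
  (forall i j, Q i -> O j -> c * u i * u j / N%:R <= d) ->
  (forall i j, P i -> P j -> M <= c * u i * u j / N%:R) ->
  `|energy l c u -
   (c / N%:R * ((\sum_(i | O i) u i) ^+ 2 / 4 + (\sum_(i | Q i) u i) * (\sum_(i | O i) u i) / 2 +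
                B / 4 * (\sum_(i | P i) u i) ^+ 2) +
    \sum_(i | P i) \sum_(j | Q j) l (c * u i * u j / N%:R) +
    2^-1 * \sum_(i | Q i) \sum_(j | Q j) l (c * u i * u j / N%:R) +
    \sum_(i | O i) \sum_(j | P j) l (c * u j * u i / N%:R))| <=
  e * c / 2 * (\sum_i u i) ^+ 2 / N%:R.
Proof.
move=> O PQ u0 e0 ld lM hOO hQO hPP.
pose x i j := c * u i * u j / N%:R.
have x0 i j : 0 <= x i j by rewrite !mulr_ge0 ?invr_ge0.
have xC i j : x i j = x j i by rewrite /x; ring.
(* The model interaction: linear where one of the two asymptotics of [l] applies, exact
   elsewhere. *)
pose m i j : R := if P i then (if P j then B / 2 * x i j else l (x i j))
   else if Q i then (if P j || Q j then l (x i j) else x i j / 2)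
   else if P j then l (x i j) else x i j / 2.
have mlx i j : `|l (x i j) - m i j| <= e * x i j.
  have z : `|l (x i j) - l (x i j)| <= e * x i j by rewrite subrr normr0 mulr_ge0.
  rewrite /m; case: (boolP (P i)) => Pi; case: (boolP (P j)) => Pj //.
  - by apply: lM; exact: hPP.
  - by case: ifP.
  - case: (boolP (Q i)) => Qi; case: (boolP (Q j)) => Qj //=; apply: ld; rewrite x0/=.
    + by apply: hQO; rewrite /O ?Pj.
    + by rewrite xC; apply: hQO => //; rewrite /O Pi.
    + by apply: hOO; rewrite /O ?Pi ?Pj.
have E : `|energy l c u - 2^-1 * \sum_i \sum_j m i j| <= e * c / 2 * (\sum_i u i) ^+ 2 / N%:R.
  rewrite /energy -mulrBr -sumrB normrM ger0_norm ?invr_ge0//.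
  under eq_bigr do rewrite -sumrB.
  have -> : e * c / 2 * (\sum_i u i) ^+ 2 / N%:R = 2^-1 * \sum_i \sum_j e * x i j.
    have -> : \sum_i \sum_j e * x i j = \sum_i \sum_j e * c / N%:R * u i * u j.
      by apply: eq_bigr => i _; apply: eq_bigr => j _; rewrite /x; ring.
    by rewrite sum_mul2; ring.
  rewrite ler_wpM2l ?invr_ge0//; apply: le_trans (ler_norm_sum _ _ _) _.
  by apply: ler_sum => i _; apply: le_trans (ler_norm_sum _ _ _) _; apply: ler_sum => j _; exact: mlx.
apply: le_trans E; rewrite le_eqVlt; apply/orP; left; apply/eqP; congr (`|_ - _|).
have S1 (I J : pred 'I_N) (a : R) (f : 'I_N -> 'I_N -> R) :
    (forall i j, I i -> J j -> f i j = a * x i j) ->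
    \sum_(i | I i) \sum_(j | J j) f i j = a * c / N%:R * (\sum_(i | I i) u i) * (\sum_(j | J j) u j).
  move=> H; rewrite -sum_mul2; apply: eq_bigr => i Ii; apply: eq_bigr => j Jj.
  by rewrite H// /x; ring.
have S2 (I J : pred 'I_N) (f : 'I_N -> 'I_N -> R) : (forall i j, I i -> J j -> f i j = l (x i j)) ->
    \sum_(i | I i) \sum_(j | J j) f i j = \sum_(i | I i) \sum_(j | J j) l (x i j).
  by move=> H; apply: eq_bigr => i Ii; apply: eq_bigr => j Jj; rewrite H.
have S3 (I : pred 'I_N) (f : 'I_N -> 'I_N -> R) : \sum_(i | I i) \sum_(j < N) f i j =
    \sum_(i | I i) \sum_(j | P j) f i j + \sum_(i | I i) \sum_(j | Q j) f i j +
    \sum_(i | I i) \sum_(j | O j) f i j.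
  by rewrite -!big_split/=; apply: eq_bigr => i _; rewrite (sum_class3 _ PQ).
have nO i : O i -> (P i = false) * (Q i = false).
  by rewrite /O => /andP[/negbTE -> /negbTE ->].
have nQ i : Q i -> P i = false by move=> Qi; apply/negbTE/negP => /PQ; rewrite Qi.
rewrite (sum_class3 _ PQ) !S3.
rewrite (S1 P P (B / 2) m); last by move=> i j Pi Pj; rewrite /m Pi Pj.
rewrite (S2 P Q m); last by move=> i j Pi Qj; rewrite /m Pi (nQ _ Qj).
rewrite (S2 P O m); last by move=> i j Pi Oj; rewrite /m Pi !nO.
rewrite (S2 Q P m); last by move=> i j Qi Pj; rewrite /m (nQ _ Qi) Qi Pj.
rewrite (S2 Q Q m); last by move=> i j Qi Qj; rewrite /m (nQ _ Qi) Qi Qj orbT.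
rewrite (S1 Q O 2^-1 m); last by move=> i j Qi Oj; rewrite /m (nQ _ Qi) Qi !nO//= mulrC.
rewrite (S2 O P m); last by move=> i j Oi Pj; rewrite /m !(nO _ Oi) Pj.
rewrite (S1 O Q 2^-1 m); last by move=> i j Oi Qj; rewrite /m !(nO _ Oi) (nQ _ Qj) mulrC.
rewrite (S1 O O 2^-1 m); last by move=> i j Oi Oj; rewrite /m !(nO _ Oi) !(nO _ Oj) mulrC.
have X1 (I J : pred 'I_N) : \sum_(i | I i) \sum_(j | J j) l (x i j) =
   \sum_(i | J i) \sum_(j | I j) l (x i j).
  by rewrite exchange_big; apply: eq_bigr => i _; apply: eq_bigr => j _; rewrite xC.
rewrite (X1 Q P) (X1 P O).
have -> : \sum_(i | O i) \sum_(j | P j) l (c * u j * u i / N%:R) = \sum_(i | O i) \sum_(j | P j) l (x i j).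
  by apply: eq_bigr => i _; apply: eq_bigr => j _; rewrite xC.
rewrite /x; by move: (N%:R^-1) => r; field.
Qed.
End PairPotential.

(** * Entropy of laws with a density *)

Section Entropy.
Variable R : realType.
Local Notation leb := (@lebesgue_measure R).
Local Open Scope ereal_scope.
Variable nu : probR R.

Lemma support_ae (I : set R) : measurable I -> nu I = 1 -> {ae nu, forall x, I x}.
Proof.
move=> mI nI; exists (~` I); split=> //; first exact: measurableC.
by rewrite probability_setC// [X in 1 - X](nI) subee.
Qed.

Hypothesis nu_leb : nu `<< leb.

Definition rn_density (x : R) : R :=
  fine (Radon_Nikodym (charge_of_finite_measure nu) leb x).

Lemma rn_densityE x : Radon_Nikodym (charge_of_finite_measure nu) leb x = (rn_density x)%:E.
Proof. by rewrite fineK// Radon_Nikodym_fin_num. Qed.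

Lemma measurable_rn_density : measurable_fun setT rn_density.
Proof.
apply/measurable_EFinP; rewrite (_ : _ \o _ = Radon_Nikodym (charge_of_finite_measure nu) leb).
  exact: (measurable_int leb (Radon_Nikodym_integrable (nu := charge_of_finite_measure nu) nu_leb)).
by apply/funext => x /=; rewrite -rn_densityE.
Qed.

Lemma rn_integrable : leb.-integrable setT (EFin \o rn_density).
Proof.
rewrite (_ : _ \o _ = Radon_Nikodym (charge_of_finite_measure nu) leb).
  exact: (Radon_Nikodym_integrable (nu := charge_of_finite_measure nu) nu_leb).
by apply/funext => x /=; rewrite -rn_densityE.
Qed.

Lemma rn_integral (A : set R) : measurable A -> nu A = \int[leb]_(x in A) (rn_density x)%:E.
Proof.
move=> mA; have := Radon_Nikodym_integral (nu := charge_of_finite_measure nu) nu_leb mA.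
rewrite /= => ->.
by apply: eq_integral => x _; rewrite rn_densityE.
Qed.

Lemma ge0_rn_change (f : R -> \bar R) (E : set R) : (forall x, 0 <= f x) ->
  measurable E -> measurable_fun E f ->
  \int[nu]_(x in E) f x = \int[leb]_(x in E) (f x * (rn_density x)%:E).
Proof.
move=> f0 mE mf; rewrite -(Radon_Nikodym_SigmaFinite.change_of_variables nu_leb f0 mE mf).
apply: ae_eq_integral => //.
- apply: emeasurable_funM => //; apply: measurable_funTS.
  by apply: measurable_int (Radon_Nikodym_SigmaFinite.f_integrable _).
- apply: emeasurable_funM => //; apply/measurable_EFinP.
  by apply: measurable_funTS; exact: measurable_rn_density.
- apply: ae_eqe_mul2l.
  have := ae_eq_Radon_Nikodym_SigmaFinite nu_leb mE.
  by apply: filterS => x + Ex => /(_ Ex) ->; rewrite rn_densityE.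
Qed.

Lemma rn_density_gt0_ae : {ae nu, forall x, (0 < rn_density x)%R}.
Proof.
pose Z := [set x | (rn_density x <= 0)%R].
have mZ : measurable Z.
  have := measurable_fun_ler measurable_rn_density (@measurable_cst _ _ _ _ setT (0%R : R)).
  by move=> /(_ measurableT [set true] I); rewrite setTI.
exists Z; split => //; last by move=> x /= /negP; rewrite -leNgt.
apply: le_anti; rewrite measure_ge0 andbT (rn_integral mZ).
apply: (@le_trans _ _ (\int[leb]_(x in Z) 0)); last by rewrite integral0.
apply: le_integral => //.
- by apply: (integrableS measurableT) => //; exact: rn_integrable.
- exact: integrable0.
- by move=> x; rewrite inE => Zx; rewrite lee_fin.
Qed.

Lemma entropyE : entropy nu = \int[nu]_x lne ((rn_density x)%:E).
Proof.
rewrite /entropy; case: asboolP => // _.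
by apply: eq_integral => x _; rewrite rn_densityE.
Qed.

Lemma measurable_lne_density : measurable_fun setT (fun x => lne ((rn_density x)%:E)).
Proof.
rewrite (_ : (fun _ => _) = fun x => if (0 < rn_density x)%R then (ln (rn_density x))%:E else -oo).
  apply: measurable_fun_ifT => //.
  - by apply: measurable_fun_ltr => //; exact: measurable_rn_density.
  - apply/measurable_EFinP; apply: measurableT_comp; first exact: measurable_ln.
    exact: measurable_rn_density.
apply/funext => x; case: ltP => h; first by rewrite lne_EFin.
by rewrite le0_lneNy.
Qed.

(** Positive and negative parts are compared separately, so no integrability is required: the
    logarithm of a density may have an infinite integral. *)
Lemma ae_le_integral_measurable (f1 f2 : R -> \bar R) :
  measurable_fun setT f1 -> measurable_fun setT f2 -> {ae nu, forall x, f1 x <= f2 x} ->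
  \int[nu]_x f1 x <= \int[nu]_x f2 x.
Proof.
move=> m1 m2 f12; rewrite integralE [leRHS]integralE; apply: leeB.
- apply: ae_ge0_le_integral => //; [exact: measurable_funepos|exact: measurable_funepos|].
  by apply: (@filterS _ _ (ae_filter_ringOfSetsType nu)) f12 => x f12 _; rewrite !funeposE le_max2.
- apply: ae_ge0_le_integral => //; [exact: measurable_funeneg|exact: measurable_funeneg|].
  by apply: (@filterS _ _ (ae_filter_ringOfSetsType nu)) f12 => x f12 _; rewrite !funenegE le_max2// leeN2.
Qed.

Lemma integrable_bounded (g : R -> R) (C : R) : measurable_fun setT g ->
  (forall x, `|g x| <= C)%R -> nu.-integrable setT (EFin \o g).
Proof.
move=> mg gC; apply: measurable_bounded_integrable => //.
  by rewrite [X in X < _](@probability_setT _ _ _ nu) ltry.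
exists C; split; first by rewrite num_real.
by move=> M CM x _; exact: le_trans (gC x) (ltW CM).
Qed.
End Entropy.

Section GibbsVariational.
Variable R : realType.
Local Notation leb := (@lebesgue_measure R).
Local Open Scope ereal_scope.

(** Let r be the density of [nu]. The inequality 1 + t <= exp t at t = g - ln r - ln Z is integrated
    against [nu]; the exponential term contributes at most 1. If [nu] has no density, its entropy is
    infinite and the left-hand side is -oo. *)
Lemma gibbs_variational (nu : probR R) (I : set R) (g : R -> R) (Z C : R) :
  measurable I -> nu I = 1 -> measurable_fun setT g -> (forall x, `|g x| <= C)%R ->
  (0 < Z)%R -> \int[leb]_(x in I) (expR (g x))%:E <= Z%:E ->
  \int[nu]_x (g x)%:E - entropy nu <= (ln Z)%:E.
Proof.
move=> mI nI mg gC Z0 gZ; have ig := integrable_bounded nu mg gC.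
have fg : \int[nu]_x (g x)%:E \is a fin_num by exact: integrable_fin_num.
have [nl|nl] := pselect (nu `<< leb); last first.
  by rewrite /entropy; case: asboolP => // _; rewrite addeNy leNye.
pose r := rn_density nu; have mr : measurable_fun setT r := measurable_rn_density nl.
pose E := I `&` [set x | (0 < r x)%R].
have mE : measurable E.
  apply: measurableI => //.
  have := measurable_fun_ltr (@measurable_cst _ _ _ _ setT (0%R : R)) mr.
  by move=> /(_ measurableT [set true] Logic.I); rewrite setTI.
(* exp g divided by the density, where the density is positive: its integral against [nu] is at most
   the Lebesgue integral of exp g over [I]. *)
pose q x := (expR (g x - ln (r x)) * \1_E x)%R.
have q0 x : (0 <= q x)%R by rewrite /q mulr_ge0 ?expR_ge0// indicE.
have mq : measurable_fun setT q.
  apply: measurable_funM; last exact: (@measurable_indic _ _ _ setT).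
  apply: measurableT_comp => //; apply: measurable_funB => //.
  exact: measurableT_comp (@measurable_ln R) mr.
have qZ : \int[nu]_x (q x)%:E <= Z%:E.
  rewrite (@ge0_rn_change _ nu nl (fun x => (q x)%:E) setT)//; last exact/measurable_EFinP.
  apply: le_trans gZ.
  apply: (@le_trans _ _ (\int[leb]_(x in E) (expR (g x))%:E)); last first.
    apply: ge0_subset_integral => //; last by move=> x [].
    by apply/measurable_EFinP; apply: measurable_funTS; exact: measurableT_comp.
  rewrite [leRHS]integral_mkcond le_eqVlt; apply/orP; left; apply/eqP.
  apply: eq_integral => x _; rewrite patchE /q indicE.
  have [xE|xE] := boolP (x \in E); rewrite ?mulr0 ?mul0e// mulr1 -EFinM.
  move: xE; rewrite inE => -[_ /= rx].
  by rewrite expRD expRN lnK ?posrE// divfK// lt0r_neq0.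
have fq : \int[nu]_x (q x)%:E \is a fin_num.
  rewrite ge0_fin_numE; first by apply: le_lt_trans qZ _; rewrite ltry.
  by apply: integral_ge0 => x _; rewrite lee_fin.
have iq : nu.-integrable setT (EFin \o q).
  apply/integrableP; split; first exact/measurable_EFinP.
  under eq_integral do rewrite /= ger0_norm//.
  by apply: le_lt_trans qZ _; rewrite ltry.
pose c := (1 - ln Z)%R.
have ic : nu.-integrable setT (EFin \o (fun=> c)).
  by apply: (@integrable_bounded _ nu _ `|c|%R).
have iZ : nu.-integrable setT (fun x => Z^-1%:E * (q x)%:E) by exact: integrableZl.
have H : \int[nu]_x (g x)%:E + c%:E - Z^-1%:E * \int[nu]_x (q x)%:E <= entropy nu.
  rewrite (entropyE nl) -integralZl//.
  have -> : c%:E = \int[nu]_x c%:E.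
    by rewrite integral_cst// [X in _ * X](@probability_setT _ _ _ nu) mule1.
  rewrite -integralD// -integralB//; last exact: integrableD.
  apply: ae_le_integral_measurable.
  - apply: measurable_int (integrableB _ (integrableD _ ig ic) iZ) => //.
  - exact: measurable_lne_density.
  have := rn_density_gt0_ae nl; have := support_ae mI nI.
  apply: (@filterS2 _ _ (ae_filter_ringOfSetsType nu)) => x Ix rx.
  rewrite lne_EFin//.
  have -> : (g x)%:E + c%:E - Z^-1%:E * (q x)%:E = (g x + c - Z^-1 * q x)%:E by [].
  rewrite lee_fin.
  have xE : x \in E by rewrite inE; split.
  rewrite /q indicE xE mulr1 -/(r x) /c.
  have := expR_ge1Dx (g x - ln (r x) - ln Z).
  have -> : expR (g x - ln (r x) - ln Z) = (Z^-1 * expR (g x - ln (r x)))%R.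
    by rewrite expRD expRN lnK ?posrE// mulrC.
  lra.
have q1 : Z^-1%:E * \int[nu]_x (q x)%:E <= 1.
  rewrite -(fineK fq) -EFinM lee_fin ler_pdivrMl// mulr1 -lee_fin fineK//.
move: H q1; rewrite -(fineK fg) -(fineK fq).
set G := fine _; set Q := fine _; rewrite -!EFinM.
have -> : G%:E + c%:E - (Z^-1 * Q)%:E = (G + c - Z^-1 * Q)%:E by [].
rewrite lee_fin => H q1.
case: (entropy nu) H => [h| |].
- by rewrite -EFinB !lee_fin /c; lra.
- by rewrite addeNy leNye.
- by rewrite leeNy_eq.
Qed.
End GibbsVariational.

Section DensityLaw.
Variables (R : realType) (d : R -> R).
Local Notation leb := (@lebesgue_measure R).
Hypotheses (md : measurable_fun setT d) (d0 : forall x, 0 <= d x).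
Hypothesis d1 : (\int[leb]_x (d x)%:E = 1)%E.

Definition density_measure (A : set (measurableTypeR R)) : \bar R :=
  (\int[leb]_(x in A) (d x)%:E)%E.

Let density0 : density_measure set0 = 0%E.
Proof. by rewrite /density_measure integral_set0. Qed.

Let density_ge0 A : (0 <= density_measure A)%E.
Proof. by apply: integral_ge0 => x _; rewrite lee_fin. Qed.

Let density_sigma_additive : semi_sigma_additive density_measure.
Proof.
move=> A mA tA mUA; rewrite /density_measure ge0_integral_bigcup//.
- apply: is_cvg_ereal_nneg_natsum_cond => n _ _; exact: density_ge0.
- by apply/measurable_EFinP; exact: measurable_funTS.
- by move=> x _; rewrite lee_fin.
Qed.

HB.instance Definition _ := isMeasure.Build _ _ _
  density_measure density0 density_ge0 density_sigma_additive.

HB.instance Definition _ :=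
  @Measure_isProbability.Build _ _ R density_measure d1.

Definition density_law : probR R := density_measure.
End DensityLaw.

Section DensityLawTheory.
Variables (R : realType) (d : R -> R).
Local Notation leb := (@lebesgue_measure R).
Local Open Scope ereal_scope.
Hypotheses (md : measurable_fun setT d) (d0 : forall x, (0 <= d x)%R).
Hypothesis d1 : \int[leb]_x (d x)%:E = 1.
Let nu : probR R := density_law md d0 d1.

Lemma density_law_dominates : nu `<< leb.
Proof.
apply/null_content_dominatesP => A mA A0.
by apply: null_set_integral => //; apply/measurable_EFinP; exact: measurable_funTS.
Qed.

Lemma density_law_rn : {ae leb, forall x, rn_density nu x = d x}.
Proof.
have nl := density_law_dominates.
have mE : measurable_fun setT (EFin \o d) by exact/measurable_EFinP.
have : ae_eq leb setT (EFin \o rn_density nu) (EFin \o d).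
  apply: integral_ae_eq => //; first exact: rn_integrable.
  by move=> A _ mA; rewrite -(rn_integral nl mA).
by apply: (@filterS _ _ (ae_filter_ringOfSetsType leb)) => x /= /(_ I) [].
Qed.

Lemma density_law_change (f : R -> \bar R) : (forall x, 0 <= f x) -> measurable_fun setT f ->
  \int[nu]_x f x = \int[leb]_x (f x * (d x)%:E).
Proof.
move=> f0 mf; have nl := density_law_dominates.
rewrite (ge0_rn_change nl f0 measurableT mf).
apply: ae_eq_integral => //.
- by apply: emeasurable_funM => //; apply/measurable_EFinP; exact: measurable_rn_density.
- by apply: emeasurable_funM => //; apply/measurable_EFinP.
- by have := density_law_rn; apply: (@filterS _ _ (ae_filter_ringOfSetsType leb)) => x -> _.
Qed.

Lemma density_law_entropy : entropy nu = \int[nu]_x lne ((d x)%:E).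
Proof.
have nl := density_law_dominates; rewrite (entropyE nl).
have m1 := measurable_lne_density nl.
have m2 : measurable_fun setT (fun x => lne ((d x)%:E)).
  rewrite (_ : (fun _ => _) = fun x => if (0 < d x)%R then (ln (d x))%:E else -oo).
    apply: measurable_fun_ifT => //; first exact: measurable_fun_ltr.
    by apply/measurable_EFinP; exact: measurableT_comp (@measurable_ln R) md.
  apply/funext => x; case: ltP => h; first by rewrite lne_EFin.
  by rewrite le0_lneNy.
have ae : {ae nu, forall x, rn_density nu x = d x}.
  have [N [mN N0 NP]] := density_law_rn; exists N; split => //.
  by move/null_content_dominatesP : nl; exact.
apply: le_anti; apply/andP; split; apply: ae_le_integral_measurable => //.
- by move: ae; apply: (@filterS _ _ (ae_filter_ringOfSetsType nu)) => x ->.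
- by move: ae; apply: (@filterS _ _ (ae_filter_ringOfSetsType nu)) => x ->.
Qed.
End DensityLawTheory.

(** * Gibbs weights on the lattice *)

Section GibbsMatch.
Variable R : realType.

(** The partition function a -> sum_k p_k exp (- a v_k) is convex and lies above its tangent at
    [b]. *)
Lemma gibbs_tangent (q : nat) (p v : 'I_q -> R) (a b : R) : (forall k, 0 <= p k) ->
  \sum_k p k * expR (- b * v k) - (a - b) * \sum_k v k * (p k * expR (- b * v k))
    <= \sum_k p k * expR (- a * v k).
Proof.
move=> p0; rewrite mulr_sumr -sumrB; apply: ler_sum => k _.
have -> : p k * expR (- a * v k) = p k * expR (- b * v k) * expR (- ((a - b) * v k)).
  by rewrite -mulrA -expRD; congr (_ * expR _); ring.
have w0 : 0 <= p k * expR (- b * v k) by rewrite mulr_ge0 ?expR_ge0.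
have := ler_wpM2l w0 (expR_ge1Dx (- ((a - b) * v k))); lra.
Qed.

(** A convex partition function that is smaller at [l0] than at both ends has a critical point
    between them, where its value is at most the one at [l0]. *)
Lemma gibbs_match (q : nat) (p v : 'I_q -> R) (lm l0 l1 : R) : (forall k, 0 <= p k) ->
  lm < l0 -> l0 < l1 ->
  \sum_k p k * expR (- l0 * v k) < \sum_k p k * expR (- lm * v k) ->
  \sum_k p k * expR (- l0 * v k) < \sum_k p k * expR (- l1 * v k) ->
  exists a, [/\ lm <= a <= l1, \sum_k v k * (p k * expR (- a * v k)) = 0 &
    \sum_k p k * expR (- a * v k) <= \sum_k p k * expR (- l0 * v k)].
Proof.
move=> p0 lm0 l01 H1 H2.
pose f a := \sum_k v k * (p k * expR (- a * v k)).
have f1 : f l1 < 0.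
  have := gibbs_tangent v l0 l1 p0; rewrite -/(f l1) => T.
  have : (l1 - l0) * f l1 < 0 by lra.
  by rewrite pmulr_rlt0// subr_gt0.
have fm : 0 < f lm.
  have := gibbs_tangent v l0 lm p0; rewrite -/(f lm) => T.
  have : 0 < (l0 - lm) * f lm by lra.
  by rewrite pmulr_rgt0// subr_gt0.
have cf : continuous f.
  apply: (@continuous_big R 'I_q +%R 0 xpredT) => [|k _].
    exact: add_continuous.
  move=> a; apply: cvgM; first exact: cvg_cst.
  apply: cvgM; first exact: cvg_cst.
  apply: continuous_comp; last exact: continuous_expR.
  by apply: cvgM; [apply: cvgN; exact: cvg_id|exact: cvg_cst].
have lm1 : lm <= l1 by rewrite (ltW (lt_trans lm0 l01)).
have [] := @IVT R f lm l1 0 lm1 (continuous_subspaceT cf).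
  by rewrite ge_min le_max (ltW f1) (ltW fm) orbT.
move=> a; rewrite in_itv/= => al fa; exists a; split => //.
by have := gibbs_tangent v l0 a p0; rewrite -/(f a) fa mulr0 subr0.
Qed.

Lemma lattice_count N (a b : R) : (0 < N)%N -> - (4 * N%:R) <= a -> a <= b -> b <= 3 * N%:R ->
  b - a - lattice_step R N <=
  \sum_(k < lattice_size N) (if a <= lattice_pt R N k <= b then lattice_step R N else 0).
Proof.
move=> N0 aN ab bN; set h := lattice_step R N.
have Nr : 1 <= N%:R :> R by rewrite ler1n.
have h0 : 0 < h by exact: lattice_step_gt0.
have [hab|hab] := leP (b - a - h) 0.
  by apply: le_trans hab _; apply: sumr_ge0 => k _; case: ifP => // _; exact: ltW.
(* The interval loses one step on the left because the lattice point of a cell is its left end. *)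
pose g (x : R) : R := \1_(`[a + h, b]%classic) x.
have mg : measurable_fun setT g by exact: measurable_indic.
have g0 x : 0 <= g x by rewrite /g indicE.
have := @integral_le_lattice R g (- (4 * N%:R)) h
  (fun k => if a <= lattice_pt R N k <= b then 1 else 0) (lattice_size N) (ltW h0) mg g0.
have cell k x : (k < lattice_size N)%N ->
  - (4 * N%:R) + h * k%:R <= x < - (4 * N%:R) + h * k.+1%:R ->
  g x <= (if a <= lattice_pt R N k <= b then 1 else 0).
  move=> _ /andP[x1 x2]; rewrite /g indicE; have [|] := boolP (x \in _); last by case: ifP.
  rewrite inE /= in_itv/= => /andP[y1 y2]; rewrite ifT//.
  by rewrite /lattice_pt -/h; rewrite -natr1 in x2; apply/andP; split; lra.
move=> /(_ cell); rewrite lattice_span//.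
have -> : - (4 * N%:R) + 8 * N%:R = 4 * N%:R :> R by ring.
have -> : (\int[@lebesgue_measure R]_(x in `[(- (4 * N%:R))%R, (4 * N%:R)%R[) (g x)%:E)%E =
   (b - a - h)%:E.
  rewrite /g integral_indic// setIidl; last first.
    by move=> x /=; rewrite !in_itv/= => /andP[u1 u2]; apply/andP; split; lra.
  rewrite [LHS]lebesgue_measure_itv/= lte_fin ifT; last by lra.
  by rewrite -EFinB; congr EFin; ring.
rewrite lee_fin => /le_trans; apply; apply: ler_sum => k _.
by case: ifP => _; rewrite ?mulr1 ?mulr0.
Qed.
End GibbsMatch.

Section BulkChernoff.
Variables (R : realType) (N : nat).
Variables (F : pred 'I_N) (kap : 'I_N -> 'I_(lattice_size N)).
Variables (w u : nat -> R) (Z D v t r : R).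
Hypothesis w0 : forall k, 0 <= w k.
Hypothesis wZ : \sum_(k < lattice_size N) w k = Z.
Hypothesis Z0 : 0 < Z.
Hypothesis wu : \sum_(k < lattice_size N) w k * u k = 0.
Hypothesis uD : forall k, 0 < w k -> `|u k| <= D.
Hypothesis wv : \sum_(k < lattice_size N) w k * u k ^+ 2 <= v * Z.
Hypotheses (t0 : 0 < t) (tD : t * D <= 1 / 2) (v0 : 0 <= v).
Hypothesis small : 4 * expR (2 * t ^+ 2 * v * N%:R - t * (r * N%:R)) <= 1.

(** The sites of [F] are frozen at [kap], and the free ones satisfy the constraint encoded by [u] up
    to r N. *)
Definition bulk_good (y : lattice_vec N) : bool :=
  [forall i, F i ==> (y i == kap i)] && (`|\sum_(i | ~~ F i) u (y i)| <= r * N%:R).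

(** A frozen site receives a point mass, so that the product over all N sites factorises. *)
Let W i k : R := if F i then (k == kap i :> nat)%:R else w k.
Let uF i k : R := if F i then 0 else u k.

(** The free sites are independent under the weights [w], with [u] centred by [wu]. The Chernoff
    bounds with tilts t and - t each remove at most a quarter of the total mass, so at least half of
    it is left. *)
Lemma bulk_goodW : Z ^+ #|[pred i | ~~ F i]| / 2 <=
  \sum_(y | bulk_good y) \prod_(i | ~~ F i) w (y i).
Proof.
pose n := #|[pred i | ~~ F i]|.
have W0 i k : 0 <= W i k by rewrite /W; case: ifP => // _; rewrite ler0n.
have WS i : \sum_(k < lattice_size N) W i k = if F i then 1 else Z.
  rewrite /W; case: ifP => _; last exact: wZ.
  rewrite (bigD1 (kap i))//= eqxx big1 ?addr0// => k kk.
  by rewrite (_ : (k == kap i :> nat) = false)//; apply/negbTE.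
have prodZ (c : R) : \prod_(i < N) (if F i then 1 else c) = c ^+ n.
  rewrite (bigID F)/= big1 ?mul1r; last by move=> i ->.
  rewrite (eq_bigr (fun=> c)); last by move=> i /negbTE ->.
  by rewrite prodr_const.
have tot : \sum_(y : lattice_vec N) \prod_(i < N) W i (y i) = Z ^+ n.
  by rewrite lattice_sum_prod -(prodZ Z); apply: eq_bigr => i _; exact: WS.
have nN : n%:R <= N%:R :> R by rewrite ler_nat (leq_trans (max_card _)) ?card_ord.
have tail (s : R) : s = t \/ s = - t ->
    \sum_(y : lattice_vec N | t * (r * N%:R) <= s * \sum_(i < N) uF i (y i)) \prod_(i < N) W i (y i)
    <= Z ^+ n / 4.
  move=> st; have s2 : s ^+ 2 = t ^+ 2 by case: st => ->; rewrite ?sqrrN.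
  apply: le_trans (lattice_chernoff (t := s) (u := uF) (c := t * (r * N%:R)) W0 _) _ => //.
  have S i : \sum_(k < lattice_size N) W i k * expR (s * uF i k) <=
      if F i then 1 else Z * expR (2 * t ^+ 2 * v).
    have := WS i; rewrite /uF; case: ifP => Fi WSi.
      by under eq_bigr do rewrite mulr0 expR0 mulr1; rewrite WSi.
    rewrite /W Fi.
    apply: (@le_trans _ _ (\sum_(k < lattice_size N) (w k + s * (w k * u k) + 2 * t ^+ 2 * (w k * u k ^+ 2)))).
      apply: ler_sum => k _; have [w1|w1] := ltP 0 (w k); last first.
        have -> : w k = 0 by apply: le_anti; rewrite w1 w0.
        by rewrite !mul0r !mulr0 !addr0.
      have su : `|s * u k| <= 1 / 2.
        rewrite normrM; apply: le_trans tD.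
        have -> : `|s| = t by case: st => ->; rewrite ?normrN gtr0_norm.
        by rewrite ler_wpM2l// ?(ltW t0)// uD.
      have /ler_normlP[su1 su2] := su.
      (* From exp (- x) >= 1 - x, exp x <= 1 / (1 - x), which is at most 1 + x + 2 x^2 for |x| <= 1
         / 2; the linear term then averages to zero. *)
      have : expR (s * u k) <= 1 + s * u k + 2 * (s * u k) ^+ 2.
        have := expR_ge1Dx (- (s * u k)); rewrite expRN => E1.
        have E0 := expR_gt0 (s * u k).
        have : (1 - s * u k) * expR (s * u k) <= 1 by rewrite -ler_pdivlMr// div1r.
        by nra.
      move=> /(ler_wpM2l (w0 k)) /le_trans; apply.
      by rewrite exprMn s2 le_eqVlt; apply/orP; left; apply/eqP; ring.
    rewrite !big_split/= -!mulr_sumr wZ wu mulr0 addr0.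
    have t2 : 0 <= 2 * t ^+ 2 by rewrite mulr_ge0 ?sqr_ge0.
    have := ler_wpM2l t2 wv; have := ler_wpM2l (ltW Z0) (expR_ge1Dx (2 * t ^+ 2 * v)); lra.
  apply: (@le_trans _ _ (expR (- (t * (r * N%:R))) * (Z * expR (2 * t ^+ 2 * v)) ^+ n)).
    rewrite ler_wpM2l ?expR_ge0// -prodZ; apply: ler_prod => i _; rewrite S andbT.
    by apply: sumr_ge0 => k _; rewrite mulr_ge0 ?expR_ge0.
  rewrite exprMn mulrCA ler_wpM2l ?exprn_ge0 ?(ltW Z0)// -expRM_natr -expRD.
  rewrite -[leRHS]div1r ler_pdivlMr// mulrC; apply: le_trans small.
  rewrite ler_wpM2l// ler_expR addrC lerD2r.
  by rewrite ler_wpM2l// mulr_ge0// mulr_ge0// sqr_ge0.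
have T1 := tail t (or_introl erefl); have T2 := tail (- t) (or_intror erefl).
have uFE y : \sum_(i < N) uF i (y i) = \sum_(i | ~~ F i) u (y i).
  rewrite /uF [LHS](bigID F)/= big1 ?add0r; last by move=> i ->.
  by apply: eq_bigr => i /negbTE ->.
have P0 (y : lattice_vec N) : 0 <= \prod_(i < N) W i (y i) by apply: prodr_ge0.
have key : \sum_(y : lattice_vec N) \prod_(i < N) W i (y i) <=
   \sum_(y | bulk_good y) \prod_(i | ~~ F i) w (y i) + (Z ^+ n / 4 + Z ^+ n / 4).
  apply: le_trans (lerD (lexx _) (lerD T1 T2)).
  rewrite (big_mkcond bulk_good) [X in _ <= _ + (X + _)]big_mkcond [X in _ <= _ + (_ + X)]big_mkcond -!big_split/=.
  apply: ler_sum => y _; rewrite uFE.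
  have b0 (b : bool) : 0 <= if b then \prod_(i < N) W i (y i) else 0 by case: b.
  have [g|ng] := boolP (bulk_good y).
    have -> : \prod_(i < N) W i (y i) = \prod_(i | ~~ F i) w (y i).
      move/andP: g => [/forallP g _]; rewrite [LHS](bigID F)/= big1 ?mul1r; last first.
        by move=> i Fi; rewrite /W Fi; have := g i; rewrite Fi => /eqP ->; rewrite eqxx.
      by apply: eq_bigr => i /negbTE Fi; rewrite /W Fi.
    rewrite lerDl addr_ge0//.
      by case: ifP => // _; apply: prodr_ge0.
    by case: ifP => // _; apply: prodr_ge0.
  rewrite add0r.
  have [/forallP h|] := boolP [forall i, F i ==> (y i == kap i)]; last first.
    rewrite negb_forall => /existsP[i]; rewrite negb_imply => /andP[Fi yi].
    have -> : \prod_(i < N) W i (y i) = 0.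
      rewrite (bigD1 i)//= /W Fi (_ : (y i == kap i :> nat) = false) ?mul0r//.
      exact/negbTE.
    by case: ifP; case: ifP.
  move: ng; rewrite /bulk_good negb_and => /orP[/negP[]|]; first exact/forallP.
  rewrite -ltNge => big.
  have : (t * (r * N%:R) <= t * \sum_(i | ~~ F i) u (y i)) || (t * (r * N%:R) <= - t * \sum_(i | ~~ F i) u (y i)).
    rewrite mulNr -mulrN !ler_pM2l//; move: big; set q := \sum_(i | _) _.
    by rewrite real_ltr_normr ?num_real// => /orP[/ltW ->|/ltW ->]; rewrite ?orbT.
  case/orP => ->; first by rewrite lerDl.
  by rewrite lerDr.
move: key; rewrite tot -/n; have := exprn_ge0 n (ltW Z0); lra.
Qed.

End BulkChernoff.

Section GibbsLattice.
Variable R : realType.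

(** [V] is the field created by the large coordinates and [a] the multiplier of the second moment
    constraint. Centring the tilt at [al] makes the critical points of the partition function in [a]
    the tilts of second moment [al]. *)
Definition gibbs_weight (N : nat) (b : R) (V : R -> R) (a al : R) (k : nat) : R :=
  if `|lattice_pt R N k| <= b
  then lattice_step R N * expR (V (lattice_pt R N k)) * expR (- a * (lattice_pt R N k ^+ 2 - al))
  else 0.

Lemma gibbs_weight_ge0 N b V a al k : 0 <= gibbs_weight N b V a al k.
Proof. by rewrite /gibbs_weight; case: ifP => // _; rewrite !mulr_ge0 ?expR_ge0 ?lattice_step_ge0. Qed.

(** [A] depends on [C] and [al] only: the multiplier is bounded uniformly in N, in the cutoff and in
    the field. It comes from [gibbs_match] between two explicit multipliers; the cutoff 3 keeps the
    points of [2, 3] available. *)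
Lemma gibbs_lattice (C al : R) : 0 <= C -> 0 < al <= 1 ->
  exists2 A : R, 0 < A & \forall N \near \oo, forall (b : R) (V : R -> R),
   3 <= b -> (forall x, 0 <= V x <= C * x ^+ 2) ->
   exists a, [/\ `|a| <= A,
     \sum_(k < lattice_size N) gibbs_weight N b V a al k * (lattice_pt R N k ^+ 2 - al) = 0,
     0 < \sum_(k < lattice_size N) gibbs_weight N b V a al k &
     \sum_(k < lattice_size N) gibbs_weight N b V a al k <= expR A].
Proof.
move=> C0 /andP[al0 al1].
(* Bound of the partition function at the multiplier C + 1, which beats the growth V <= C x^2 and
   leaves a Gaussian sum of parameter 1. *)
pose P0 : R := expR (C + 1) * (Num.sqrt (pi / 1) * expR 1).
have P00 : 0 < P0 by rewrite !mulr_gt0 ?expR_gt0// sqrtr_gt0 divr_gt0// pi_gt0.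
pose tau := al / 2.
have tau0 : 0 < tau by rewrite divr_gt0.
pose l1 := C + 2 + 2 * P0 / (al * tau).
have l1p : C + 1 < l1.
  have : 0 < 2 * P0 / (al * tau) by rewrite divr_gt0// mulr_gt0.
  by rewrite /l1; lra.
pose A := l1 + P0 + 1; exists A; first by rewrite /A; lra.
near=> N => b V b3 VC.
have N0 : (0 < N)%N by near: N; exact: nbhs_infty_gt.
have Nr : 1 <= N%:R :> R by rewrite ler1n.
have htau : lattice_step R N <= tau.
  rewrite /lattice_step -[leLHS]div1r ler_pdivrMr ?exprn_gt0 ?ltr0n//.
  have : tau^-1 <= N%:R by near: N; exact: nbhs_infty_ger.
  rewrite -[leLHS]div1r ler_pdivrMr// mulrC => h; apply: le_trans h _.
  by rewrite ler_wpM2l ?(ltW tau0)// exprS ler_peMr// exprn_ege1.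
have h1 : lattice_step R N <= 1 / 2 by apply: le_trans htau _; rewrite /tau; lra.
have h0 : 0 < lattice_step R N by exact: lattice_step_gt0.
have G : forall x : R, `|x| <= 2 * N%:R ->
    Num.sqrt (pi / 1) * expR (- 1) <= gauss_sum N 1 x <= Num.sqrt (pi / 1) * expR 1.
  by near: N; apply: gauss_sum_expR.
have z2 : `|0 : R| <= 2 * N%:R by rewrite normr0 mulr_ge0.
have /andP[_ G0] := G 0 z2.
pose x (k : 'I_(lattice_size N)) := lattice_pt R N k.
pose p (k : 'I_(lattice_size N)) := if `|x k| <= b then lattice_step R N * expR (V (x k)) else 0.
pose v k := x k ^+ 2 - al.
have p0 k : 0 <= p k by rewrite /p; case: ifP => // _; rewrite mulr_ge0 ?expR_ge0// ltW.
have wE a (k : 'I_(lattice_size N)) : gibbs_weight N b V a al k = p k * expR (- a * v k).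
  by rewrite /gibbs_weight /p -/(x k); case: ifP => // _; rewrite mul0r.
have S0 : \sum_k p k * expR (- (C + 1) * v k) <= P0.
  have h2 : expR (C + 1) * gauss_sum N 1 0 <= P0 by rewrite /P0 ler_wpM2l ?expR_ge0.
  apply: le_trans h2; rewrite /gauss_sum mulr_sumr; apply: ler_sum => k _.
  rewrite /p -/(x k) subr0; case: ifP => _; last by rewrite mul0r !mulr_ge0 ?expR_ge0// ltW.
  rewrite -mulrA -expRD mulrCA -expRD ler_wpM2l ?(ltW h0)// ler_expR /v.
  have /andP[_ Vk] := VC (x k); nra.
(* At a large multiplier the points of [- al / 2, al / 2], where x^2 - al <= - al / 2, already weigh
   more than [P0]. *)
have S1 : P0 < \sum_k p k * expR (- l1 * v k).
  have c := lattice_count (a := - tau) (b := tau) N0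
    ltac:(rewrite /tau; move: Nr al0 al1; clear -R => *; lra) ltac:(move: tau0; clear -R => *; lra)
    ltac:(rewrite /tau; move: Nr al0 al1; clear -R => *; lra).
  have l10 : 0 < l1 by lra.
  apply: (@lt_le_trans _ _ (expR (l1 * (al / 2)) * tau)).
    have e1 := expR_ge1Dx (l1 * (al / 2)).
    have e2 : P0 <= l1 * (al / 2) * tau.
      have -> : P0 = 2 * P0 / (al * tau) * (al / 2) * tau by field; rewrite !lt0r_neq0.
      by rewrite ler_wpM2r ?(ltW tau0)// ler_wpM2r ?divr_ge0 ?(ltW al0)// /l1; move: C0; clear -R => *; lra.
    by apply: le_lt_trans e2 _; rewrite ltr_pM2r//; move: e1; clear -R => *; lra.
  apply: (@le_trans _ _ (expR (l1 * (al / 2)) * (tau - - tau - lattice_step R N))).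
    by rewrite ler_wpM2l ?expR_ge0//; move: htau; clear -R => *; lra.
  apply: le_trans (ler_wpM2l (expR_ge0 _) c) _.
  rewrite mulr_sumr; apply: ler_sum => k _; case: ifP => [/andP[k1 k2]|_]; last first.
    by rewrite mulr0 mulr_ge0 ?expR_ge0.
  have kb : `|x k| <= b by rewrite ler_norml /x; apply/andP; split; rewrite /tau in k1 k2; move: k1 k2 b3 al0 al1; clear -R => *; lra.
  rewrite /p kb mulrC -mulrA ler_wpM2l ?(ltW h0)// -expRD ler_expR.
  have /andP[Vk _] := VC (x k).
  have xk : x k ^+ 2 <= al / 2.
    have : x k ^+ 2 <= tau ^+ 2 by rewrite /x; move: k1 k2 tau0; clear -R => *; nra.
    by rewrite /tau; move: al0 al1; clear -R => *; nra.
  by rewrite /v; move: Vk xk l10; clear -R => *; nra.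
(* At a very negative multiplier the points of [2, 3] do, since there x^2 - al >= 3. *)
have Sm : P0 < \sum_k p k * expR (- (- (P0 + 1)) * v k).
  have c := lattice_count (a := 2) (b := 3) N0
    ltac:(move: Nr; clear -R => *; lra) ltac:(clear -R; lra) ltac:(move: Nr; clear -R => *; lra).
  apply: (@lt_le_trans _ _ (expR (3 * (P0 + 1)) * (1 / 2))).
    by have := expR_ge1Dx (3 * (P0 + 1)); move: P00; clear -R => *; lra.
  apply: (@le_trans _ _ (expR (3 * (P0 + 1)) * (3 - 2 - lattice_step R N))).
    by rewrite ler_wpM2l ?expR_ge0//; move: h1; clear -R => *; lra.
  apply: le_trans (ler_wpM2l (expR_ge0 _) c) _.
  rewrite mulr_sumr; apply: ler_sum => k _; case: ifP => [/andP[k1 k2]|_]; last first.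
    by rewrite mulr0 mulr_ge0 ?expR_ge0.
  have kb : `|x k| <= b by rewrite ler_norml /x; apply/andP; split; move: k1 k2 b3; clear -R => *; lra.
  rewrite /p kb mulrC -mulrA ler_wpM2l ?(ltW h0)// -expRD ler_expR.
  have /andP[Vk _] := VC (x k).
  have xk : 4 <= x k ^+ 2 by rewrite /x; move: k1 k2; clear -R => *; nra.
  by rewrite /v; move: Vk xk al1 P00; clear -R => *; nra.
have mm : - (P0 + 1) < C + 1 by move: P00 C0; clear -R => *; lra.
have [a [/andP[a1 a2] az aP]] := gibbs_match p0 mm l1p (le_lt_trans S0 Sm) (le_lt_trans S0 S1).
exists a; split.
- by rewrite ler_norml /A; apply/andP; split; move: a1 a2 P00 l1p C0; clear -R => *; lra.
- by rewrite -[RHS]az; apply: eq_bigr => k _; rewrite wE -/(x k) -/(v k) mulrC.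
- under eq_bigr do rewrite wE.
  have c := lattice_count (a := 2) (b := 3) N0
    ltac:(move: Nr; clear -R => *; lra) ltac:(clear -R; lra) ltac:(move: Nr; clear -R => *; lra).
  rewrite lt_neqAle sumr_ge0 ?andbT; last by move=> k _; rewrite mulr_ge0 ?expR_ge0.
  apply/eqP => E; suff : \sum_(k < lattice_size N) (if 2 <= lattice_pt R N k <= 3 then lattice_step R N else 0) = 0 by move: c h1; clear -R => c h1 S; rewrite S in c; lra.
  apply: big1 => k _; case: ifP => // /andP[k1 k2].
  have kb : `|x k| <= b by rewrite ler_norml /x; apply/andP; split; move: k1 k2 b3; clear -R => *; lra.
  have : 0 < \sum_k p k * expR (- a * v k).
    rewrite (bigD1 k)//= ltr_wpDr ?sumr_ge0//; first by move=> ? _; rewrite mulr_ge0 ?expR_ge0.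
    by rewrite mulr_gt0 ?expR_gt0// /p kb mulr_gt0 ?expR_gt0.
  by rewrite -E ltxx.
- under eq_bigr do rewrite wE; apply: le_trans aP _; apply: le_trans S0 _.
  by have := expR_ge1Dx A; rewrite /A; move: l1p C0; clear -R => *; lra.
Unshelve. all: by end_near. Qed.
End GibbsLattice.

(** * Lower bound for the lattice partition function *)

Lemma rel_dev (R : realType) (n s q p d : R) : 0 < n -> s = n * (q + p) ->
  `|s - n * q| <= d * n -> - d <= p <= d.
Proof.
move=> n0 ->; rewrite mulrDr addrAC subrr add0r (mulrC n) normrM (gtr0_norm n0).
by rewrite ler_pM2r// ler_norml.
Qed.

Lemma quadratic_lower (R : realType) (a1 a2 a3 p1 p2 p3 B d : R) :
  0 <= a1 -> 0 <= a2 -> 0 <= a3 -> a1 + a2 + a3 = 1 -> 0 <= B -> 0 <= d <= 1 ->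
  - d <= p1 <= d -> - d <= p2 <= d -> - d <= p3 <= d ->
  (a1 ^+ 2 / 4 + a1 * a2 / 2 + B / 4 * a3 ^+ 2) - d * (2 + B) <=
  (a1 + p1) ^+ 2 / 4 + (a2 + p2) * (a1 + p1) / 2 + B / 4 * (a3 + p3) ^+ 2.
Proof.
move=> a10 a20 a30 asum B0 /andP[d0 d1] /andP[p11 p12] /andP[p21 p22] /andP[p31 p32].
have B1 : B * (a3 ^+ 2 - 2 * d) <= B * (a3 + p3) ^+ 2.
  by rewrite ler_wpM2l//; clear -a10 a20 a30 asum d0 p31 p32; nra.
have q1 : a1 ^+ 2 - 2 * d <= (a1 + p1) ^+ 2 by clear -a10 a20 a30 asum d0 p11 p12; nra.
have q2 : - d <= a1 * p2 by clear -a10 a20 a30 asum d0 p21 p22; nra.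
have q3 : - d <= a2 * p1 by clear -a10 a20 a30 asum d0 p11 p12; nra.
have q4 : - d <= p1 * p2 by clear -d0 d1 p11 p12 p21 p22; nra.
have : 0 <= B * d by rewrite mulr_ge0.
by clear -B1 q1 q2 q3 q4; lra.
Qed.

Lemma lower_chain (R : realType) (y x g g' q1 q2 v e m k j : R) :
  - (y - x) <= m -> - (x - (g + q1 + q2 + v)) <= e -> e <= k -> g' - j <= g ->
  g' + q1 + q2 + v - (m + k + j) <= y.
Proof. by lra. Qed.

Lemma sqr_near (R : realType) (x z h n : R) : h <= 1 -> 1 <= n -> `|x - z| <= h ->
  `|z| <= 2 * n -> `|x ^+ 2 - z ^+ 2| <= 5 * n * h.
Proof.
move=> h1 n1 xz zn; rewrite subr_sqr normrM mulrC; apply: ler_pM => //.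
rewrite (_ : x + z = (x - z) + 2 * z); last by ring.
by apply: le_trans (ler_normD _ _) _; rewrite normrM (ger0_norm (ler0n _ 2)); lra.
Qed.

Lemma bulk_dev (R : realType) (s n f a N d r : R) : N = n + f -> 0 <= a <= 1 ->
  0 <= f <= d / 2 * N -> r * N <= d / 2 * N -> `|s - a * n| <= r * N ->
  `|s - N * a| <= d * N.
Proof.
move=> NE /andP[a0 a1] /andP[f0 fd] rd H.
have fa : 0 <= f * a <= f by rewrite mulr_ge0//= ler_piMr.
rewrite (_ : s - N * a = (s - a * n) - f * a); last by rewrite NE; ring.
apply: le_trans (ler_normB _ _) _; rewrite (ger0_norm (mulr_ge0 f0 a0)).
by case/andP: fa => _ fa; lra.
Qed.

Lemma shell_dev (R : realType) (q s1 s2 s3 N a1 a2 a3 d k : R) :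
  a1 + a2 + a3 = 1 -> `|s1 - N * a1| <= d * N -> `|s2 - N * a2| <= d * N ->
  `|s3 - N * a3| <= d * N -> k <= d * N -> `|q - (s3 + s2 + s1)| <= k ->
  `|q - N| <= 4 * d * N.
Proof.
move=> aE H1 H2 H3 kd Hq.
rewrite (_ : q - N = (q - (s3 + s2 + s1)) + ((s1 - N * a1) + (s2 - N * a2) + (s3 - N * a3))); last first.
  by rewrite -[in LHS](mulr1 N) -aE; ring.
apply: le_trans (ler_normD _ _) _; have := ler_normD (s1 - N * a1 + (s2 - N * a2)) (s3 - N * a3).
have := ler_normD (s1 - N * a1) (s2 - N * a2); lra.
Qed.

Section LatticeLower.
Variable R : realType.
Variables (l : R -> R) (La B c : R).
Hypothesis lP : pair_potential l La B.
Hypotheses (La0 : 0 <= La) (c0 : 0 <= c) (B0 : 0 <= B).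

(** Interaction of a coordinate of size [x] with the large ones; its quadratic bound is what allows
    it as the [V] of [gibbs_weight]. *)
Definition field (N : nat) (P : pred 'I_N) (z : 'I_N -> R) (x : R) : R :=
  \sum_(j | P j) l (c * z j ^+ 2 * x ^+ 2 / N%:R).

Lemma field_bound N (P : pred 'I_N) (z : 'I_N -> R) (x : R) :
  0 <= field P z x <= La * c * (\sum_(j | P j) z j ^+ 2) / N%:R * x ^+ 2.
Proof.
have y0 j : 0 <= c * z j ^+ 2 * x ^+ 2 / N%:R by rewrite divr_ge0// mulr_ge0 ?sqr_ge0// mulr_ge0 ?sqr_ge0.
apply/andP; split.
  by apply: sumr_ge0 => j _; have /andP[] := potential_le lP (y0 j).
rewrite mulr_sumr !mulr_suml; apply: ler_sum => j _.
have /andP[_] := potential_le lP (y0 j); move/le_trans; apply.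
by rewrite le_eqVlt; apply/orP; left; apply/eqP; ring.
Qed.

Lemma field_diff N (P : pred 'I_N) (z : 'I_N -> R) (x y : R) :
  `|field P z x - field P z y| <=
  La * c * (\sum_(j | P j) z j ^+ 2) / N%:R * `|x ^+ 2 - y ^+ 2|.
Proof.
have [_ lip _ _ _] := lP.
rewrite /field -sumrB mulr_sumr !mulr_suml; apply: le_trans (ler_norm_sum _ _ _) _.
apply: ler_sum => j _; have y0 (x' : R) : 0 <= c * z j ^+ 2 * x' ^+ 2 / N%:R.
  by rewrite divr_ge0// mulr_ge0 ?sqr_ge0// mulr_ge0 ?sqr_ge0.
apply: le_trans (lip _ _ (y0 x) (y0 y)) _.
have -> : c * z j ^+ 2 * x ^+ 2 / N%:R - c * z j ^+ 2 * y ^+ 2 / N%:R =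
  c * z j ^+ 2 / N%:R * (x ^+ 2 - y ^+ 2) by ring.
rewrite normrM ger0_norm; last by rewrite divr_ge0// mulr_ge0 ?sqr_ge0.
by rewrite le_eqVlt; apply/orP; left; apply/eqP; ring.
Qed.

Lemma lattice_round N (z : R) : (0 < N)%N -> `|z| <= 3 * N%:R ->
  exists k : 'I_(lattice_size N), `|lattice_pt R N k - z| <= lattice_step R N.
Proof.
move=> N0; rewrite ler_norml => /andP[z1 z2].
have h0 : 0 < lattice_step R N by exact: lattice_step_gt0.
have Nr : 1 <= N%:R :> R by rewrite ler1n.
pose m := Num.truncn ((z + 4 * N%:R) / lattice_step R N).
have y0 : 0 <= (z + 4 * N%:R) / lattice_step R N by rewrite divr_ge0 ?(ltW h0)//; lra.
have /andP[m1 m2] := truncn_itv y0; rewrite -/m in m1 m2.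
have mq : (m < lattice_size N)%N.
  rewrite -(ltr_nat R); apply: le_lt_trans m1 _; rewrite ltr_pdivrMr//.
  by rewrite [ltRHS]mulrC lattice_span//; lra.
exists (Ordinal mq); rewrite /lattice_pt /=.
move: m1 m2; rewrite ler_pdivlMr// ltr_pdivrMr// -natr1 => m1 m2.
by rewrite ler_norml; apply/andP; split; lra.
Qed.

Variables (N : nat) (P Q : pred 'I_N) (z : 'I_N -> R).
Let O i := ~~ P i && ~~ Q i.
Let F i := P i || Q i.
Let V := field P z.
Let f := #|[pred i | F i]|.
Let h := lattice_step R N.

Variables (a1 a2 a3 d e1 dl M b a A t r : R).
Hypothesis N0 : (0 < N)%N.
Hypothesis PQ : forall i, P i -> ~~ Q i.
Hypotheses (a10 : 0 <= a1) (a20 : 0 <= a2) (a30 : 0 <= a3) (a123 : a1 + a2 + a3 = 1).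
Hypotheses (d0 : 0 < d) (d1 : d <= 1 / 4) (e10 : 0 <= e1).
Hypothesis SP : `|\sum_(i | P i) z i ^+ 2 - N%:R * a3| <= d * N%:R.
Hypothesis SQ : `|\sum_(i | Q i) z i ^+ 2 - N%:R * a2| <= d * N%:R.
Hypothesis fN : f%:R <= d / 2 * N%:R.
Hypotheses (r0 : 0 <= r) (rd : r <= d / 2) (N5 : 5 <= d * N%:R).
Let w := gibbs_weight N b V a a1.
Let Z := \sum_(k < lattice_size N) w k.
Hypothesis aA : `|a| <= A.
Hypothesis wu : \sum_(k < lattice_size N) w k * (lattice_pt R N k ^+ 2 - a1) = 0.
Hypotheses (Z0 : 0 < Z) (ZA : Z <= expR A).
Hypotheses (t0 : 0 < t) (tD : t * (b ^+ 2 + 1) <= 1 / 2).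
Hypothesis tsmall : 4 * expR (2 * t ^+ 2 * (2 * (b ^+ 2 + 1)) * N%:R - t * (r * N%:R)) <= 1.
Hypothesis ld : forall x, 0 <= x <= dl -> `|l x - x / 2| <= e1 * x.
Hypothesis lM : forall x, M <= x -> `|l x - B / 2 * x| <= e1 * x.
Hypothesis hOO : forall x y, `|x| <= b -> `|y| <= b -> c * x ^+ 2 * y ^+ 2 / N%:R <= dl.
Hypothesis hQO : forall i y, Q i -> `|y| <= b -> c * z i ^+ 2 * y ^+ 2 / N%:R <= dl.
Hypothesis hPP : forall i j, P i -> P j -> M <= c * z i ^+ 2 * z j ^+ 2 / N%:R.

Definition lower_error : R :=
  5 * La * c + 2 * e1 * c * N%:R + c * d * (2 + B) * N%:R.

Ltac numeric := clear -lP La0 c0 B0 O F V f h w Z N0 PQ a10 a20 a30 a123 d0 d1 e10 SP SQ fN r0 rd N5 aA wu Z0 ZA t0 tD tsmall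
  ld lM hOO hQO hPP.

Lemma lattice_lower_fixed :
  expR (c / 4 * (a1 ^+ 2 + 2 * a1 * a2 + B * a3 ^+ 2) * N%:R +
    \sum_(i | P i) \sum_(j | Q j) l (c * z i ^+ 2 * z j ^+ 2 / N%:R) +
    2^-1 * \sum_(i | Q i) \sum_(j | Q j) l (c * z i ^+ 2 * z j ^+ 2 / N%:R)) * Z ^+ N <=
  2 * expR (f%:R * A + A * r * N%:R + lower_error) * (h ^+ f)^-1 *
  \sum_(y : lattice_vec N | shell 1 (4 * d) y)
     h ^+ N * expR (energy l c (fun i => coords R y i ^+ 2)).
Proof.
move: (a10) (a20) (a30) (a123) (d0) (d1) (N5) (rd) (r0) (fN) (B0) (e10).
move=> a1p a2p a3p asum dp d4 N5' rd' rp fN' Bp e1p.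
have d01 : 0 <= d <= 1 by apply/andP; split; move: dp d4; numeric => *; lra.
have Nr : 1 <= N%:R :> R by rewrite ler1n.
have h0 : 0 < h by exact: lattice_step_gt0.
have Np : 0 < N%:R :> R by exact: lt_le_trans Nr.
have sq0 (x : R) : 0 <= x ^+ 2 by exact: sqr_ge0.
move: SP SQ; set sP := \sum_(i | P i) z i ^+ 2; set sQ := \sum_(i | Q i) z i ^+ 2.
move=> /ler_normlP[SP1 SP2] /ler_normlP[SQ1 SQ2].
have a31 : a3 <= 1 by move: a1p a2p asum; numeric => *; lra.
have a21 : a2 <= 1 by move: a1p a3p asum; numeric => *; lra.
have a11 : a1 <= 1 by move: a2p a3p asum; numeric => *; lra.
have aN3 : N%:R * a3 <= N%:R by rewrite ler_piMr.
have aN2 : N%:R * a2 <= N%:R by rewrite ler_piMr.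
have dN : d * N%:R <= 1 / 4 * N%:R by rewrite ler_wpM2r.
have zF i : F i -> z i ^+ 2 <= 2 * N%:R.
  case/orP => Hi.
    apply: (@le_trans _ _ sP); last by move: SP2 dN aN3 Nr; numeric => *; lra.
    by rewrite /sP (bigD1 i)//= lerDl; apply: sumr_ge0.
  apply: (@le_trans _ _ sQ); last by move: SQ2 dN aN2 Nr; numeric => *; lra.
  by rewrite /sQ (bigD1 i)//= lerDl; apply: sumr_ge0.
have zF2 i : F i -> `|z i| <= 2 * N%:R.
  move=> /zF; rewrite -(real_normK (num_real (z i))) => H.
  rewrite -(@ler_pXn2r _ 2)// ?nnegrE ?mulr_ge0//; apply: le_trans H _; move: Nr; numeric => *; nra.
have /choice[kap kapP] i : exists k : 'I_(lattice_size N), F i -> `|lattice_pt R N k - z i| <= h.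
  have [Fi|Fi] := boolP (F i); last first.
    have q0 : (0 < lattice_size N)%N by rewrite /lattice_size muln_gt0 expn_gt0 N0.
    by exists (Ordinal q0).
  have z3 : `|z i| <= 3 * N%:R by have := zF2 i Fi; move: Nr; numeric => *; lra.
  by have [k kP] := lattice_round N0 z3; exists k.
pose u k := lattice_pt R N k ^+ 2 - a1.
have w0 k : 0 <= w k by exact: gibbs_weight_ge0.
have wB k : 0 < w k -> `|lattice_pt R N k| <= b.
  by rewrite /w /gibbs_weight; case: ifP => //; rewrite ltxx.
have uD k : 0 < w k -> `|u k| <= b ^+ 2 + 1.
  move=> /wB xb; have x2 : lattice_pt R N k ^+ 2 <= b ^+ 2.
    by rewrite -(real_normK (num_real (lattice_pt R N k))) lerXn2r// nnegrE// (le_trans _ xb).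
  have := sq0 (lattice_pt R N k); rewrite /u ler_norml; move: x2 a1p a11; numeric => *; apply/andP; split; lra.
have b20 : 0 <= b ^+ 2 by exact: sqr_ge0.
(* Since u >= - a1, |u| <= u + 2 a1, and [u] has mean zero. The variance is thus of order b^2 and
   not b^4, which is what lets the cutoff grow like N^(1/4). *)
have wv : \sum_(k < lattice_size N) w k * u k ^+ 2 <= 2 * (b ^+ 2 + 1) * Z.
  have E : \sum_(k < lattice_size N) w k * (u k + 2 * a1) = 2 * a1 * Z.
    by under eq_bigr do rewrite mulrDr; rewrite big_split/= wu add0r -mulr_suml mulrC.
  apply: (@le_trans _ _ ((b ^+ 2 + 1) * \sum_(k < lattice_size N) w k * (u k + 2 * a1))); last first.
    rewrite E mulrA ler_wpM2r ?(ltW Z0)// (mulrC 2 (b ^+ 2 + 1)) ler_wpM2l//; move: a11 b20; numeric => *; lra.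
  rewrite mulr_sumr; apply: ler_sum => k _; rewrite [leRHS]mulrCA.
  have [w1|w1] := ltP 0 (w k); last first.
    by have -> : w k = 0; [apply: le_anti; rewrite w1 w0|rewrite !mul0r].
  rewrite ler_wpM2l ?(ltW w1)//.
  have U1 := uD k w1; have : `|u k| <= u k + 2 * a1.
    have := sq0 (lattice_pt R N k); rewrite /u ler_norml; move: a1p; numeric => *; apply/andP; split; lra.
  rewrite -(real_normK (num_real (u k))) expr2; have := normr_ge0 (u k); move: U1 b20; numeric => *; nra.
have v0 : 0 <= 2 * (b ^+ 2 + 1) by rewrite mulr_ge0// addr_ge0.
have good := @bulk_goodW R N F kap w u Z _ _ t r w0 erefl Z0 wu uD wv t0 tD v0 tsmall.
set n := #|_| in good.
have nf : (n + f = N)%N.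
  rewrite addnC /n /f -[RHS](card_ord N) -(cardC (mem [pred i | F i])); congr addn.
have OE i : O i = ~~ F i by rewrite /O /F negb_or.
pose base := c / 4 * (a1 ^+ 2 + 2 * a1 * a2 + B * a3 ^+ 2) * N%:R +
    \sum_(i | P i) \sum_(j | Q j) l (c * z i ^+ 2 * z j ^+ 2 / N%:R) +
    2^-1 * \sum_(i | Q i) \sum_(j | Q j) l (c * z i ^+ 2 * z j ^+ 2 / N%:R).
rewrite -/base.
have key (y : lattice_vec N) : bulk_good F kap u r y -> (forall i, ~~ F i -> `|coords R y i| <= b) ->
   shell 1 (4 * d) y /\
   base + \sum_(i | ~~ F i) V (coords R y i) - lower_error <=
     energy l c (fun i => coords R y i ^+ 2).
  move=> /andP[/forallP yk]; rewrite /u sumrB sumr_const -/n => yr yb.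
  (* [x] undoes the rounding: the class sums are computed at [x], where they are those of [z] on P
     and Q. *)
  pose x i := if F i then z i else coords R y i.
  have xz i : F i -> x i = z i by rewrite /x => ->.
  have xy i : ~~ F i -> x i = coords R y i by rewrite /x => /negbTE ->.
  have D i : `|coords R y i ^+ 2 - x i ^+ 2| <= if F i then 5 * N%:R * h else 0.
    rewrite /x; case: ifP => Fi; last by rewrite subrr normr0.
    have yE : coords R y i = lattice_pt R N (kap i).
      by have := yk i; rewrite Fi => /eqP; rewrite /coords => ->.
    have h1 : h <= 1 by rewrite /h /lattice_step invf_le1 ?exprn_gt0// exprn_ege1.
    by rewrite yE; apply: sqr_near => //; [exact: kapP|exact: zF2].
  have DS : \sum_(i < N) `|coords R y i ^+ 2 - x i ^+ 2| <= 5 / N%:R.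
    apply: (@le_trans _ _ (\sum_(i < N) 5 * N%:R * h)).
      apply: ler_sum => i _; apply: le_trans (D i) _; case: ifP => // _.
      by rewrite !mulr_ge0// ltW.
    rewrite sumr_const card_ord -[leLHS]mulr_natr /h /lattice_step.
    by rewrite le_eqVlt; apply/orP; left; apply/eqP; field; rewrite lt0r_neq0.
  have N55 : 5 / N%:R <= d.
    by rewrite ler_pdivrMr.
  have sO : \sum_(i | O i) x i ^+ 2 = \sum_(i | ~~ F i) coords R y i ^+ 2.
    by apply: eq_big => i; [exact: OE|rewrite OE => /xy ->].
  have sPE : \sum_(i | P i) x i ^+ 2 = sP by apply: eq_bigr => i Pi; rewrite xz// /F Pi.
  have sQE : \sum_(i | Q i) x i ^+ 2 = sQ by apply: eq_bigr => i Qi; rewrite xz// /F Qi orbT.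
  set so := \sum_(i | ~~ F i) coords R y i ^+ 2 in sO.
  have so1 : `|so - N%:R * a1| <= d * N%:R.
    have nN : N%:R = n%:R + f%:R :> R by rewrite -natrD nf.
    have rN : r * N%:R <= d / 2 * N%:R by rewrite ler_wpM2r.
    have a01 : 0 <= a1 <= 1 by rewrite a1p.
    have f01 : (0 <= f%:R :> R) && (f%:R <= d / 2 * N%:R) by apply/andP; split; [exact: ler0n|exact: fN].
    move: yr; rewrite -/so -[a1 *+ n]mulr_natr => yr.
    exact: (bulk_dev nN a01 f01 rN yr).
  have sx : \sum_(i < N) x i ^+ 2 = sP + sQ + so.
    by rewrite (sum_class3 (fun i => x i ^+ 2) PQ) sPE sQE -sO.
  have dN5 : 5 / N%:R <= d * N%:R by apply: le_trans N55 _; rewrite ler_peMr// ltW.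
  have sy : `|sqnorm (coords R y) - \sum_(i < N) x i ^+ 2| <= 5 / N%:R.
    rewrite /sqnorm -sumrB; apply: le_trans (ler_norm_sum _ _ _) DS.
  have sh : shell 1 (4 * d) y.
    by rewrite /shell mul1r; apply: (shell_dev a123 so1 SQ SP dN5); rewrite -sx.
  have sS : sP + sQ + so <= 2 * N%:R.
    have dN0 : 0 <= d * N%:R by rewrite mulr_ge0// ltW.
    have : `|sP + sQ + so - (sP + sQ + so)| <= 0 by rewrite subrr normr0.
    by move=> /(shell_dev a123 so1 SQ SP dN0) /ler_normlP[_]; move: dN; numeric => *; lra.
  split=> //.
  have x0 i : 0 <= x i ^+ 2 by [].
  have ED := energy_diff lP La0 c0 (fun i => sq0 (coords R y i)) x0.
  have E1 : `|energy l c (fun i => coords R y i ^+ 2) - energy l c (fun i => x i ^+ 2)| <= 5 * La * c.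
    apply: le_trans ED _.
    have Lc : 0 <= La * c / 2 by rewrite divr_ge0// mulr_ge0.
    have yx : 0 <= \sum_(i < N) coords R y i ^+ 2 + \sum_(i < N) x i ^+ 2.
      by rewrite addr_ge0//; apply: sumr_ge0.
    have yx2 : \sum_(i < N) coords R y i ^+ 2 + \sum_(i < N) x i ^+ 2 <= 5 * N%:R.
      move: sy; rewrite sx -/(sqnorm (coords R y)) => /ler_normlP[_]; move: sS dN dN5 Nr; numeric => *; lra.
    apply: (@le_trans _ _ (La * c / 2 * (5 * N%:R) / N%:R * (5 / N%:R))).
      apply: ler_pM => //; first by rewrite !mulr_ge0 ?invr_ge0.
        by apply: sumr_ge0.
      by rewrite ler_wpM2r ?invr_ge0// ler_wpM2l.
    have -> : La * c / 2 * (5 * N%:R) / N%:R * (5 / N%:R) = La * c * (25 / 2 / N%:R) by field; rewrite lt0r_neq0.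
    rewrite [leRHS](_ : _ = La * c * 5); last by ring.
    by rewrite ler_wpM2l ?mulr_ge0// ler_pdivrMr//; move: N5' dN; numeric => *; lra.
  have E2 := energy_class3 (l := l) (B := B) (c := c) (P := P) (Q := Q) c0 (u := fun i => x i ^+ 2)
     (d := dl) (M := M) PQ x0 e10 ld lM.
  have /E2 {}E2 : forall i j, O i -> O j -> c * x i ^+ 2 * x j ^+ 2 / N%:R <= dl.
    by move=> i j; rewrite !OE => Oi Oj; rewrite !xy//; apply: hOO; exact: yb.
  have /E2 {}E2 : forall i j, Q i -> O j -> c * x i ^+ 2 * x j ^+ 2 / N%:R <= dl.
    move=> i j Qi; rewrite !OE => Oj; rewrite xz ?/F ?Qi ?orbT// xy//; apply: hQO => //; exact: yb.
  have /E2 {}E2 : forall i j, P i -> P j -> M <= c * x i ^+ 2 * x j ^+ 2 / N%:R.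
    by move=> i j Pi Pj; rewrite !xz ?/F ?Pi ?Pj//; exact: hPP.
  move: E2; rewrite sO sPE sQE sx.
  have -> : \sum_(i | P i) \sum_(j | Q j) l (c * x i ^+ 2 * x j ^+ 2 / N%:R) =
     \sum_(i | P i) \sum_(j | Q j) l (c * z i ^+ 2 * z j ^+ 2 / N%:R).
    apply: eq_bigr => i Pi; apply: eq_bigr => j Qj.
    by rewrite !xz ?/F ?Pi ?Qj ?orbT.
  have -> : \sum_(i | Q i) \sum_(j | Q j) l (c * x i ^+ 2 * x j ^+ 2 / N%:R) =
     \sum_(i | Q i) \sum_(j | Q j) l (c * z i ^+ 2 * z j ^+ 2 / N%:R).
    apply: eq_bigr => i Qi; apply: eq_bigr => j Qj.
    by rewrite !xz ?/F ?Qi ?Qj ?orbT.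
  have -> : \sum_(i | ~~ P i && ~~ Q i) \sum_(j | P j) l (c * x j ^+ 2 * x i ^+ 2 / N%:R) =
     \sum_(i | ~~ F i) V (coords R y i).
    apply: eq_big => i; [exact: OE|rewrite -/(O i) OE => Fi].
    by apply: eq_bigr => j Pj; rewrite (xy i Fi) (xz j)// /F Pj.
  rewrite /base.
  set pq := \sum_(i | P i) _; set qq := \sum_(i | Q i) _; set vv := \sum_(i | ~~ F i) _.
  move=> E2; have {E2}/ler_normlP[E2 _] := E2; have {E1}/ler_normlP[E1 _] := E1.
  have T : e1 * c / 2 * (sP + sQ + so) ^+ 2 / N%:R <= 2 * e1 * c * N%:R.
    have ss : (sP + sQ + so) ^+ 2 <= (2 * N%:R) ^+ 2.
      rewrite lerXn2r ?nnegrE//.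
      by rewrite !addr_ge0//; apply: sumr_ge0.
    rewrite ler_pdivrMr//.
    have -> : 2 * e1 * c * N%:R * N%:R = e1 * c / 2 * (2 * N%:R) ^+ 2 by field.
    by rewrite ler_wpM2l// divr_ge0// mulr_ge0.
  pose p1 := so / N%:R - a1; pose p2 := sQ / N%:R - a2; pose p3 := sP / N%:R - a3.
  have soE : so = N%:R * (a1 + p1) by rewrite /p1; field; rewrite lt0r_neq0.
  have sQE' : sQ = N%:R * (a2 + p2) by rewrite /p2; field; rewrite lt0r_neq0.
  have sPE' : sP = N%:R * (a3 + p3) by rewrite /p3; field; rewrite lt0r_neq0.
  have P1 := rel_dev Np soE so1.
  have P2 := rel_dev Np sQE' SQ.
  have P3 := rel_dev Np sPE' SP.
  have G : c / 4 * (a1 ^+ 2 + 2 * a1 * a2 + B * a3 ^+ 2) * N%:R - c * d * (2 + B) * N%:R <=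
      c / N%:R * (so ^+ 2 / 4 + sQ * so / 2 + B / 4 * sP ^+ 2).
    have -> : c / N%:R * (so ^+ 2 / 4 + sQ * so / 2 + B / 4 * sP ^+ 2) =
       c * N%:R * ((a1 + p1) ^+ 2 / 4 + (a2 + p2) * (a1 + p1) / 2 + B / 4 * (a3 + p3) ^+ 2).
      by rewrite soE sQE' sPE'; field; rewrite lt0r_neq0.
    have -> : c / 4 * (a1 ^+ 2 + 2 * a1 * a2 + B * a3 ^+ 2) * N%:R - c * d * (2 + B) * N%:R =
       c * N%:R * ((a1 ^+ 2 / 4 + a1 * a2 / 2 + B / 4 * a3 ^+ 2) - d * (2 + B)) by field.
    rewrite ler_wpM2l ?mulr_ge0//; exact: quadratic_lower.
  exact: lower_chain E1 E2 T G.
have eA : 0 <= A by exact: le_trans (normr_ge0 a) aA.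
pose X := \sum_(y : lattice_vec N | shell 1 (4 * d) y)
     h ^+ N * expR (energy l c (fun i => coords R y i ^+ 2)).
rewrite -/X.
have H1 : \sum_(y | bulk_good F kap u r y) \prod_(i | ~~ F i) w (y i) <=
   expR (A * r * N%:R + lower_error - base) * (h ^+ f)^-1 * X.
  rewrite /X mulr_sumr big_mkcond [leRHS]big_mkcond; apply: ler_sum => y _.
  have X0 : 0 <= expR (A * r * N%:R + lower_error - base) / h ^+ f * (h ^+ N * expR (energy l c (fun i => coords R y i ^+ 2))).
    by rewrite !mulr_ge0 ?expR_ge0 ?invr_ge0 ?exprn_ge0// ltW.
  case: ifPn => gy; last by case: ifP.
  have [/existsP[i /andP[Fi yi]]|] := boolP [exists i, ~~ F i && (b < `|coords R y i|)].
    rewrite (bigD1 i)//= {1}/w /gibbs_weight ifF ?mul0r; first by case: ifP.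
    by apply/negbTE; rewrite -ltNge.
  rewrite negb_exists => /forallP yb.
  have {}yb i : ~~ F i -> `|coords R y i| <= b.
    by move=> Fi; have := yb i; rewrite Fi/= -leNgt.
  have [sh E] := key y gy yb; rewrite sh.
  have -> : \prod_(i | ~~ F i) w (y i) = h ^+ n *
      expR (\sum_(i | ~~ F i) V (coords R y i) - a * \sum_(i | ~~ F i) u (y i)).
    transitivity (\prod_(i | ~~ F i) (h * expR (V (coords R y i) - a * u (y i)))).
      apply: eq_bigr => i Fi; rewrite /w /gibbs_weight -/(coords R y i) yb//.
      by rewrite -mulrA -expRD mulNr.
    by rewrite big_split/= prodr_const -expR_sumr sumrB -mulr_sumr.
  have hN : h ^+ N = h ^+ n * h ^+ f by rewrite -exprD nf.
  rewrite hN (_ : _ / _ * _ = h ^+ n * (expR (A * r * N%:R + lower_error - base) *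
      expR (energy l c (fun i => coords R y i ^+ 2)))); last first.
    by field; rewrite expf_neq0// lt0r_neq0.
  rewrite ler_wpM2l ?exprn_ge0 ?(ltW h0)// -expRD ler_expR.
  have : - (a * \sum_(i | ~~ F i) u (y i)) <= A * r * N%:R.
    move/andP: gy => [_ yr]; apply: le_trans (ler_norm _) _; rewrite normrN normrM -mulrA.
    by apply: ler_pM.
  by move: E; numeric => *; lra.
have ZnN : Z ^+ N <= Z ^+ n * expR (f%:R * A).
  rewrite -nf exprD ler_wpM2l ?exprn_ge0 ?(ltW Z0)// mulrC expRM_natr.
  by rewrite lerXn2r ?nnegrE ?expR_ge0 ?(ltW Z0).
have H2 := le_trans good H1.
apply: (@le_trans _ _ (expR base * (Z ^+ n * expR (f%:R * A)))).
  by rewrite ler_wpM2l ?expR_ge0.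
have H3 : Z ^+ n <= 2 * (expR (A * r * N%:R + lower_error - base) / h ^+ f * X) by move: H2; numeric => *; lra.
apply: (@le_trans _ _ (expR base * (2 * (expR (A * r * N%:R + lower_error - base) / h ^+ f * X) * expR (f%:R * A)))).
  by rewrite ler_wpM2l ?expR_ge0// ler_wpM2r ?expR_ge0.
rewrite (_ : expR base * _ = 2 * (expR base * expR (A * r * N%:R + lower_error - base) * expR (f%:R * A)) / h ^+ f * X); last by ring.
rewrite -!expRD le_eqVlt; apply/orP; left; apply/eqP; congr (2 * expR _ / _ * X); ring.
Qed.

End LatticeLower.


(** * Variational functional below the spherical integral *)

Section BulkEntropy.
Variable R : realType.
Local Notation leb := (@lebesgue_measure R).

(** [gibbs_variational] is applied to the field plus the tilt, whose exponential oscillates by at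
    most a factor exp e in a lattice cell. The cutoff [b] exceeds [b0] by a step so that every cell
    meeting the support of [nu] is counted in the lattice sum. *)
Lemma gibbs_lattice_entropy (nu : probR R) (N : nat) (V : R -> R) (b0 b a al C A e : R) :
  (0 < N)%N -> 0 <= b0 -> b0 + lattice_step R N <= b -> b0 <= N%:R ->
  measurable_fun setT V -> (forall x, 0 <= V x <= C * x ^+ 2) ->
  (forall x y, `|V x - V y| <= C * `|x ^+ 2 - y ^+ 2|) ->
  0 <= C -> `|a| <= A -> (C + A) * ((2 * b0 + 1) * lattice_step R N) <= e -> 0 <= e ->
  nu [set x | `|x| <= b0] = 1%E -> (\int[nu]_x (x ^+ 2)%:E = al%:E)%E ->
  0 < \sum_(k < lattice_size N) gibbs_weight N b V a al k ->
  (\int[nu]_x (V x)%:E - entropy nu <=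
   (ln (\sum_(k < lattice_size N) gibbs_weight N b V a al k) + e)%:E)%E.
Proof.
move=> N0 b00 b0b b0N mV Vb VL C0 aA eb e0 nI n2 Z0.
have A0 : 0 <= A by exact: le_trans (normr_ge0 a) aA.
have h0 : 0 < lattice_step R N by exact: lattice_step_gt0.
have h1 : lattice_step R N <= 1 by rewrite /lattice_step invf_le1 ?exprn_gt0 ?ltr0n// exprn_ege1// ler1n.
set Z := \sum_(k < _) _ in Z0 *.
pose I := [set x : R | `|x| <= b0].
have IE : I = `[- b0, b0]%classic by apply/seteqP; split=> x; rewrite /I /= in_itv/= ler_norml.
have mI : measurable I by rewrite IE; exact: measurable_itv.
pose q x := V x - a * (x ^+ 2 - al).
have msq : measurable_fun setT (fun x : R => x ^+ 2) by apply: measurable_funX.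
have mq : measurable_fun setT q.
  by apply: measurable_funB => //; apply: measurable_funM => //; apply: measurable_funB.
(* The exponent is cut off outside the support so as to be bounded on the whole line. *)
pose g x := q x * \1_I x.
have mg : measurable_fun setT g by apply: measurable_funM => //; exact: (@measurable_indic _ _ _ setT).
have gI x : I x -> g x = q x by move=> Ix; rewrite /g indicE mem_set// mulr1.
have sqI x : `|x| <= b0 -> x ^+ 2 <= b0 ^+ 2.
  by move=> xb; rewrite -(real_normK (num_real x)) lerXn2r// nnegrE.
have gC x : `|g x| <= C * b0 ^+ 2 + A * (b0 ^+ 2 + `|al|).
  have [Ix|nIx] := pselect (I x); last first.
    rewrite /g indicE memNset// mulr0 normr0 addr_ge0 ?mulr_ge0 ?sqr_ge0// addr_ge0 ?sqr_ge0//.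
  rewrite gI// /q; apply: le_trans (ler_normB _ _) _.
  have /andP[V0 V1] := Vb x; rewrite (ger0_norm V0) lerD//.
    by apply: le_trans V1 _; rewrite ler_wpM2l//; exact: sqI.
  rewrite normrM ler_pM//; apply: le_trans (ler_normB _ _) _.
  by rewrite lerD2r ger0_norm ?sqr_ge0//; exact: sqI.
have IZ : (\int[leb]_(x in I) (expR (g x))%:E <= (expR e * Z)%:E)%E.
  pose g' x := expR (g x) * \1_I x.
  have mg' : measurable_fun setT g'.
    by apply: measurable_funM; [exact: measurableT_comp|exact: (@measurable_indic _ _ _ setT)].
  have g'0 x : 0 <= g' x by rewrite /g' mulr_ge0 ?expR_ge0// indicE.
  have cell k x : (k < lattice_size N)%N ->
      - (4 * N%:R) + lattice_step R N * k%:R <= x < - (4 * N%:R) + lattice_step R N * k.+1%:R ->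
      g' x <= expR e * (gibbs_weight N b V a al k / lattice_step R N).
    move=> _ /andP[x1 x2]; have w0 := gibbs_weight_ge0 N b V a al k.
    have [Ix|nIx] := pselect (I x); last first.
      by rewrite /g' indicE memNset// mulr0 mulr_ge0 ?expR_ge0// divr_ge0// ltW.
    rewrite /g' indicE mem_set// mulr1 gI// /gibbs_weight.
    set xk := lattice_pt R N k; have d1 : 0 <= x - xk <= lattice_step R N.
      by move: x1 x2; rewrite /xk /lattice_pt -natr1; clear -R => *; apply/andP; split; lra.
    have /andP[d2 d3] := d1; have Ixb : `|x| <= b0 by [].
    have [i1 i2] : - b0 <= x /\ x <= b0 by move: Ixb; rewrite ler_norml => /andP[].
    have xkb : `|xk| <= b.
      by move: d2 d3 i1 i2 b0b b00; rewrite ler_norml; clear -R => *; apply/andP; split; lra.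
    rewrite xkb -[_ * _ * expR _]mulrA [X in _ * X]mulrAC divff ?lt0r_neq0// mul1r -!expRD ler_expR.
    have sqd : `|x ^+ 2 - xk ^+ 2| <= (2 * b0 + 1) * lattice_step R N.
      rewrite subr_sqr normrM mulrC; apply: ler_pM => //.
        by move: d2 d3 i1 i2 h1; rewrite ler_norml; clear -R => *; apply/andP; split; lra.
      by rewrite ger0_norm.
    have q1 : V x - V xk <= C * `|x ^+ 2 - xk ^+ 2| by apply: le_trans (VL _ _); exact: ler_norm.
    have q2 : - a * (x ^+ 2 - xk ^+ 2) <= A * `|x ^+ 2 - xk ^+ 2|.
      by apply: le_trans (ler_norm _) _; rewrite normrM normrN ler_wpM2r.
    have q3 : (C + A) * `|x ^+ 2 - xk ^+ 2| <= e.
      by apply: le_trans eb; rewrite ler_wpM2l// addr_ge0.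
    by rewrite /q; move: q1 q2 q3; clear -R => *; lra.
  have := integral_le_lattice (ltW h0) mg' g'0 cell.
  have -> : \sum_(k < lattice_size N) lattice_step R N * (expR e * (gibbs_weight N b V a al k / lattice_step R N)) = expR e * Z.
    by rewrite /Z mulr_sumr; apply: eq_bigr => k _; field; rewrite lt0r_neq0.
  apply: le_trans; rewrite integral_mkcond [leRHS]integral_mkcond.
  rewrite le_eqVlt; apply/orP; left; apply/eqP; apply: eq_integral => x _.
  rewrite !patchE; have [xI|xI] := boolP (x \in I); rewrite /g' indicE ?(negbTE xI) ?xI ?mulr1 ?mulr0.
    rewrite ifT//; move: xI; rewrite !inE /I /= lattice_span// in_itv/= ler_norml => /andP[i1 i2].
    have Nr : 1 <= N%:R :> R by rewrite ler1n.
    by move: i1 i2 b0N Nr; clear -R => *; apply/andP; split; lra.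
  by case: ifP.
have eZ0 : 0 < expR e * Z by rewrite mulr_gt0 ?expR_gt0.
have := gibbs_variational mI nI mg gC eZ0 IZ.
rewrite lnM ?posrE ?expR_gt0// expRK [e + _]addrC; congr (_ - _ <= _)%E.
(* The second moment constraint removes the tilt. *)
have i2 : nu.-integrable setT (fun x : R => (x ^+ 2)%:E).
  apply/integrableP; split; first exact/measurable_EFinP.
  under eq_integral do rewrite /= ger0_norm ?sqr_ge0//.
  by rewrite n2 ltry.
have iV : nu.-integrable setT (EFin \o V).
  apply: (le_integrable measurableT _ _ (integrableZl measurableT C i2)).
    exact/measurable_EFinP.
  move=> x _ /=; have /andP[V0 V1] := Vb x.
  by rewrite lee_fin !ger0_norm// mulr_ge0 ?sqr_ge0.
have ic : nu.-integrable setT (EFin \o (fun=> al)) by apply: (@integrable_bounded _ nu _ `|al|).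
transitivity (\int[nu]_x ((V x)%:E - (a%:E * ((x ^+ 2)%:E - al%:E))))%E.
  apply: ae_eq_integral => //.
  - exact/measurable_EFinP.
  - exact/measurable_EFinP.
  - by apply: (@filterS _ _ (ae_filter_ringOfSetsType nu)) (support_ae mI nI) => x Ix _; rewrite gI.
have i3 : nu.-integrable setT (fun x : R => (x ^+ 2)%:E - al%:E)%E by exact: integrableB.
rewrite integralB//; last exact: integrableZl.
have nT : (\int[nu]_x al%:E = al%:E)%E.
  by rewrite integral_cst// [X in (_ * X)%E](@probability_setT _ _ _ nu) mule1.
by rewrite integralZl// integralB// n2 nT subee// mule0 sube0.
Qed.

End BulkEntropy.


Section Embedding.
Variable R : realType.

(** The first k sites carry [s] and the next l carry [t]. Class sums are given for arbitrary [F] so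
    that double sums can be rewritten one index at a time. *)
Lemma embed_sites (k l N : nat) (s : 'I_k -> R) (t : 'I_l -> R) : (k + l <= N)%N ->
  exists (P Q : pred 'I_N) (z : 'I_N -> R),
  [/\ forall i, P i -> ~~ Q i, #|[pred i | P i || Q i]| = (k + l)%N,
      (forall F : R -> R, \sum_(i | P i) F (z i) = \sum_(j < k) F (s j)) /\
      (forall F : R -> R, \sum_(i | Q i) F (z i) = \sum_(j < l) F (t j)),
      forall i, P i -> exists j, z i = s j & forall i, Q i -> exists j, z i = t j].
Proof.
move=> klN; have kN : (k <= N)%N by apply: leq_trans klN; exact: leq_addr.
pose P (i : 'I_N) := (i < k)%N; pose Q (i : 'I_N) := (k <= i)%N && (i < k + l)%N.
pose z (i : 'I_N) : R := match insub (i : nat) : option 'I_k with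
  | Some j => s j
  | None => if insub (i - k)%N is Some j then t j else 0 end.
have zP (i : 'I_N) (ik : (i < k)%N) : z i = s (Ordinal ik) by rewrite /z insubT.
have zQ (i : 'I_N) (ik : (k <= i)%N) (il : (i - k < l)%N) : z i = t (Ordinal il).
  by rewrite /z insubN ?insubT// -leqNgt.
exists P, Q, z; split.
- by move=> i; rewrite /P /Q ltnNge => /negbTE ->.
- rewrite -sum1_card (eq_bigl (fun i : 'I_N => (i < k + l)%N)); last first.
    by move=> i; rewrite !inE /P /Q; case: (leqP k i) => //= ik; rewrite ltn_addr.
  by rewrite (big_ord_narrow klN) sum1_card card_ord.
- split=> F.
    rewrite /P (big_ord_narrow kN); apply: eq_bigr => j _.
    by rewrite (@zP (widen_ord kN j) (ltn_ord j)); congr (F (s _)); apply: val_inj.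
  rewrite /Q (big_ord_narrow_cond klN) big_mkcond/= big_split_ord/= big1 ?add0r; last first.
    by move=> j _; rewrite leqNgt ltn_ord.
  apply: eq_bigr => j _; rewrite leq_addr.
  have il : (widen_ord klN (rshift k j) - k < l)%N by rewrite /= addnC addnK.
  rewrite (@zQ _ _ il) ?leq_addr//; congr (F (t _)); apply: val_inj => /=.
  by rewrite addnC addnK.
- by move=> i Pi; exists (Ordinal Pi); rewrite zP.
- move=> i /andP[ki il]; have il' : (i - k < l)%N by rewrite ltn_subLR.
  by exists (Ordinal il'); exact: zQ.
Qed.

Lemma card_le_moment (m : nat) (x : 'I_m -> R) (q S : R) :
  (forall i, q <= x i ^+ 2) -> \sum_(i < m) x i ^+ 2 <= S -> m%:R * q <= S.
Proof.
move=> xq; apply: le_trans; rewrite -[m in m%:R]card_ord mulr_natl -sumr_const.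
by apply: ler_sum.
Qed.

Lemma quartic_root_sqr (N : nat) : ((N%:R : R) `^ 4^-1) ^+ 4 = N%:R.
Proof. by rewrite -powR_mulrn ?powR_ge0// -powRrM mulVf// powRr1. Qed.

Lemma quartic_root_near (x : R) : \forall N \near \oo, x <= (N%:R : R) `^ 4^-1.
Proof.
have : \forall N \near \oo, `|x| ^+ 4 <= N%:R by exact: nbhs_infty_ger.
apply: filterS => N; rewrite -{1}(quartic_root_sqr N) => H.
apply: le_trans (ler_norm x) _; rewrite -(@ler_pXn2r _ 4) ?nnegrE ?powR_ge0//.
Qed.

Lemma quartic_root_sqr_near (x : R) : \forall N \near \oo, x <= ((N%:R : R) `^ 4^-1) ^+ 2.
Proof.
have := quartic_root_near `|x|; have := quartic_root_near 1.
apply: filterS2 => N N1 Nx; apply: le_trans (ler_norm x) _; apply: le_trans Nx _.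
by rewrite expr2 ler_peMr// (le_trans _ N1).
Qed.

End Embedding.


Section ConfigArith.
Variable R : realType.

(** With Q = sqrt N, a middle coordinate has square above delta Q and a large one at least K Q,
    while each family has total at most 2 N: there are only O(sqrt N) such coordinates. *)
Lemma config_counts (N m k : nat) (t : 'I_m -> R) (s : 'I_k -> R) (delta K a2 a3 : R) :
  0 < delta <= 1 / 4 -> 0 < K -> 1 <= (N%:R : R) `^ 4^-1 -> a2 <= 1 -> a3 <= 1 ->
  admissible N delta (I2 N delta K) a2 t -> admissible N delta (I3 N K a3) a3 s ->
  let Q := ((N%:R : R) `^ 4^-1) ^+ 2 in
  [/\ forall j, t j ^+ 2 <= K * Q, forall j, K * Q <= s j ^+ 2,
     \sum_(j < k) s j ^+ 2 <= 2 * N%:R & (k + m)%:R <= (2 / K + 2 / delta) * Q].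
Proof.
move=> /andP[dp d4] K0 q1 a21 a31; have NQ4 := quartic_root_sqr R N.
move: q1 NQ4; rewrite /I2 /I3 /admissible /=.
set q : R := N%:R `^ 4^-1 => q1 NQ4 [tI tS] [sI sS].
pose Q := q ^+ 2; rewrite -/Q.
have NQ : N%:R = Q ^+ 2 :> R by rewrite -NQ4 /Q -exprM.
have Q0 : 0 < Q by rewrite exprn_gt0// (lt_le_trans _ q1).
have q0 : 0 <= q by apply: le_trans q1.
have sd2 : Num.sqrt delta ^+ 2 = delta by rewrite sqr_sqrtr// ltW.
have KQ : K * Q = (Num.sqrt K * q) ^+ 2 by rewrite exprMn sqr_sqrtr// ltW.
have t2 j : delta * Q < t j ^+ 2 /\ t j ^+ 2 <= K * Q.
  have /andP[u1 u2] := tI j; rewrite -(real_normK (num_real (t j))).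
  have -> : delta * Q = (Num.sqrt delta * q) ^+ 2 by rewrite exprMn sd2.
  have sq0 : 0 <= Num.sqrt delta * q by rewrite mulr_ge0// sqrtr_ge0.
  by rewrite KQ; split; [rewrite ltrXn2r|rewrite lerXn2r// nnegrE mulr_ge0// sqrtr_ge0].
have s2 j : K * Q <= s j ^+ 2.
  have /andP[u1 u2] := sI j; rewrite -(real_normK (num_real (s j))).
  have sq0 : 0 <= Num.sqrt K * q by rewrite mulr_ge0// sqrtr_ge0.
  by rewrite KQ lerXn2r ?nnegrE// (ltW u1).
have moment (al S : R) : al <= 1 -> `|S - N%:R * al| <= delta * N%:R -> S <= 2 * N%:R.
  move=> al1 /ler_normlP[_]; have : N%:R * al <= N%:R by rewrite ler_piMr.
  have : delta * N%:R <= 1 / 4 * N%:R by rewrite ler_wpM2r.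
  have : 0 <= N%:R :> R by [].
  by clear; lra.
have sM := moment _ _ a31 sS.
split=> //; first by move=> j; have [] := t2 j.
have kQ : k%:R <= 2 / K * Q.
  have := card_le_moment s2 sM; rewrite NQ => H.
  rewrite -(ler_pM2r (mulr_gt0 K0 Q0)); apply: le_trans H _.
  by rewrite le_eqVlt; apply/orP; left; apply/eqP; field; rewrite lt0r_neq0.
have mQ : m%:R <= 2 / delta * Q.
  have := card_le_moment (fun j => ltW (t2 j).1) (moment _ _ a21 tS); rewrite NQ => H.
  rewrite -(ler_pM2r (mulr_gt0 dp Q0)); apply: le_trans H _.
  by rewrite le_eqVlt; apply/orP; left; apply/eqP; field; rewrite lt0r_neq0.
by rewrite natrD mulrDl lerD.
Qed.

Lemma config_arith (NN g p qq lZ lS S e eps ln2pi fA ArN low f3 ln2 : R) : 0 < NN ->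
  eps = 16 * e -> S = NN / 2 * (ln2pi + 1) ->
  g * NN + p + 2^-1 * qq + NN * lZ <= ln2 + fA + ArN + low + f3 + S + e * NN + lS ->
  fA <= e * NN -> ArN <= e * NN -> low + ln2 <= 4 * e * NN -> f3 <= e * NN -> 0 < e ->
  lZ + e <= NN^-1 * lS + 2^-1 * ln2pi + 2^-1 + eps - g - NN^-1 * p - (2 * NN)^-1 * qq.
Proof.
move=> N0 -> -> H h1 h2 h3 h4 e0.
have eN : 0 < e * NN by rewrite mulr_gt0.
rewrite -(ler_pM2l N0).
rewrite (_ : NN * (NN^-1 * lS + 2^-1 * ln2pi + 2^-1 + 16 * e - g - NN^-1 * p - (2 * NN)^-1 * qq) =
  lS + NN / 2 * (ln2pi + 1) + 16 * (e * NN) - g * NN - p - 2^-1 * qq); last by field; rewrite lt0r_neq0.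
rewrite mulrDr (mulrC NN e); lra.
Qed.

(** The smallness condition of [bulk_goodW] at the tilt tau / Q with Q = sqrt N. The gain is tau r
    Q; the variance costs 16 delta tau^2 Q, at most half of the gain, plus a constant. The remaining
    half exceeds that constant by 3, and 4 exp (- 3) <= 1. *)
Lemma tilt_small (tau r delta Q NN b2 : R) : 0 < Q -> NN = Q ^+ 2 -> 0 < tau -> 0 < r -> 0 < delta ->
  b2 = 4 * delta * Q -> 32 * delta * tau <= r -> (4 * tau ^+ 2 + 3) / (tau * r / 2) <= Q ->
  4 * expR (2 * (tau / Q) ^+ 2 * (2 * (b2 + 1)) * NN - tau / Q * (r * NN)) <= 1.
Proof.
move=> Q0 -> tau0 r0 d0 -> tr; rewrite ler_pdivrMr ?divr_gt0 ?mulr_gt0// => H.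
have -> : 2 * (tau / Q) ^+ 2 * (2 * (4 * delta * Q + 1)) * Q ^+ 2 - tau / Q * (r * Q ^+ 2) =
   4 * tau ^+ 2 + (16 * delta * tau) * (tau * Q) - r * (tau * Q) by field; rewrite lt0r_neq0.
have tQ : 0 < tau * Q by rewrite mulr_gt0.
have : 32 * delta * tau * (tau * Q) <= r * (tau * Q) by rewrite ler_wpM2r// ltW.
move=> h; have : expR (4 * tau ^+ 2 + 16 * delta * tau * (tau * Q) - r * (tau * Q)) <= expR (- 3).
  by rewrite ler_expR; lra.
have : expR (-3) * 4 <= 1 :> R.
  by rewrite expRN mulrC ler_pdivrMr ?expR_gt0// mul1r; have := @expR_ge1Dx R 3; lra.
lra.
Qed.

Lemma mul3_le (c x y X Y : R) : 0 <= c -> 0 <= x -> 0 <= y -> x <= X -> y <= Y -> c * x * y <= c * X * Y.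
Proof. by move=> c0 x0 y0 xX yY; rewrite ler_pM ?(mulr_ge0 c0 x0)// ler_wpM2l. Qed.

Lemma log_compare (N : nat) (u v w Z S : R) : 0 < Z ->
  expR u * Z ^+ N <= 2 * expR v * (expR w * S) -> u + N%:R * ln Z <= ln 2 + v + w + ln S.
Proof.
move=> Z0 H; have S0 : 0 < S.
  have : 0 < 2 * expR v * (expR w * S) by apply: lt_le_trans H; rewrite mulr_gt0 ?expR_gt0 ?exprn_gt0.
  by rewrite -mulrA pmulr_rgt0// pmulr_rgt0 ?expR_gt0// pmulr_rgt0 ?expR_gt0.
have -> : N%:R * ln Z = ln (Z ^+ N) by rewrite lnXn// mulr_natl.
by rewrite -ler_expR !expRD !lnK ?posrE ?exprn_gt0// -[leRHS]mulrA.
Qed.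

Lemma half_le (x q d : R) : 2 * x <= q * d -> x <= d / 2 * q.
Proof. by lra. Qed.

(** The f frozen coordinates cost a volume factor N^(3 f). As f = O(q^2) and ln N <= 4 q, its
    logarithm is O(q^3), against N = q^4. *)
Lemma config_log (f NN q Kf e : R) : NN = q ^+ 4 -> 1 <= q -> f <= Kf * q ^+ 2 -> 0 < Kf -> 0 < e -> 0 <= f ->
  12 * Kf / e <= q -> 3 * f * ln NN <= e * NN.
Proof.
move=> -> q1 fK K0 e0 f0; rewrite ler_pdivrMr// => H.
have q0 : 0 < q by lra.
have lq : ln q <= q by have := ln_sublinear q0; exact: ltW.
have lq0 : 0 <= ln q by rewrite ln_ge0.
rewrite lnXn// -[ln q *+ 4]mulr_natl.
apply: (@le_trans _ _ (3 * (Kf * q ^+ 2) * (4 * q))).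
  by rewrite ler_pM ?mulr_ge0// ?ler_wpM2l.
rewrite (_ : 3 * _ * _ = 12 * Kf * (q * q ^+ 2)); last by ring.
have : 12 * Kf * (q * q ^+ 2) <= (q * e) * (q * q ^+ 2).
  by rewrite ler_wpM2r// mulr_ge0 ?exprn_ge0// ltW.
by rewrite (_ : q * e * (q * q ^+ 2) = e * q ^+ 4); last by ring.
Qed.

Lemma config_round (N : nat) (CA b0 e : R) : (0 < N)%N -> 0 <= CA -> 0 <= b0 <= N%:R -> 0 < e ->
  3 * CA / e <= N%:R -> CA * ((2 * b0 + 1) * lattice_step R N) <= e.
Proof.
move=> N0 CA0 /andP[b00 bN] e0; rewrite ler_pdivrMr// => H.
have N1 : 1 <= N%:R :> R by rewrite ler1n.
have N3 : 0 < N%:R ^+ 3 :> R by rewrite exprn_gt0 ?ltr0n.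
rewrite /lattice_step mulrA ler_pdivrMr//.
apply: (@le_trans _ _ (CA * (3 * N%:R))); first by rewrite ler_wpM2l//; lra.
apply: (@le_trans _ _ (N%:R * e * N%:R)); first by rewrite mulrA (mulrC CA) ler_wpM2r.
rewrite (_ : _ * e * _ = e * (N%:R ^+ 2 * 1)); last by ring.
by rewrite [N%:R ^+ 3]exprSr ler_wpM2l ?(ltW e0)// ler_wpM2l// sqr_ge0.
Qed.

Lemma config_low (NN x y z e : R) : 0 < NN -> 0 < e -> (1 + x) / e <= NN -> y <= e -> z <= e ->
  x + y * NN + z * NN + ln 2 <= 4 * e * NN.
Proof.
move=> N0 e0; rewrite ler_pdivrMr// => H ye ze.
have l2 : ln 2 <= 1 :> R.
  by rewrite -[leRHS](@expRK R) ler_ln ?posrE ?expR_gt0//; have := @expR_ge1Dx R 1; lra.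
have : y * NN <= e * NN by rewrite ler_wpM2r// ltW.
have : z * NN <= e * NN by rewrite ler_wpM2r// ltW.
have : 0 < e * NN by rewrite mulr_gt0.
rewrite (mulrC NN) in H; lra.
Qed.

End ConfigArith.

Section ConfigUpper.
Variable R : realType.
Variables (l : R -> R) (La B c : R).
Hypothesis lP : pair_potential l La B.
Hypotheses (La0 : 0 <= La) (c0 : 0 < c) (B0 : 0 <= B).
Local Notation sq_energy := (fun y => energy l c (fun i => y i ^+ 2)).

Lemma measurable_potential : measurable_fun setT (fun x : R => l `|x|).
Proof.
have [_ lip _ _ _] := lP.
suff : continuous (fun x : R => l `|x|) by exact: continuous_measurable_fun.
move=> x; apply/cvgrPdist_le => e e0.
have La1 : 0 < La + 1 by move: La0 => h; lra.
near=> y; apply: le_trans (lip _ _ (normr_ge0 x) (normr_ge0 y)) _.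
apply: (@le_trans _ _ ((La + 1) * `|x - y|)).
  by rewrite ler_pM// ?lerDl//; exact: ler_dist_dist.
rewrite mulrC -ler_pdivlMr//.
by near: y; apply: cvgr_dist_le => //; rewrite divr_gt0.
Unshelve. all: by end_near. Qed.

Lemma measurable_potential_comp d (T : measurableType d) (f : T -> R) :
  (forall x, 0 <= f x) -> measurable_fun setT f -> measurable_fun setT (fun x => l (f x)).
Proof.
move=> f0 mf; rewrite (_ : (fun x => l (f x)) = (fun x : R => l `|x|) \o f).
  exact: measurableT_comp measurable_potential mf.
by apply/funext => x /=; rewrite ger0_norm.
Qed.

Lemma measurable_sq_energy N :
  measurable_fun setT (fun e : N.-tuple (measurableTypeR R) => sq_energy (dilate 1 e)).
Proof.
apply: measurable_funM => //; apply: measurable_sum => i; apply: measurable_sum => j.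
have mt k : measurable_fun setT (fun e : N.-tuple (measurableTypeR R) => dilate 1 e k ^+ 2).
  by apply: measurable_funX; apply: measurable_funM => //; exact: measurable_tnthR.
apply: measurable_potential_comp => [e|].
  by rewrite divr_ge0// mulr_ge0 ?sqr_ge0// mulr_ge0 ?sqr_ge0// ltW.
by apply: measurable_funM => //; apply: measurable_funM => //; apply: measurable_funM.
Qed.

(** [e0] depends on [eps] alone. The threshold on N may depend on the masses, because the bound on
    the multiplier needs a fixed a1 > 0, but not on the configuration, over which the functional
    takes a supremum. *)
Lemma config_upper (eps : R) : 0 < eps -> exists2 e0 : R, 0 < e0 <= 1 &
  forall delta K, 0 < delta < e0 -> e0^-1 < K -> delta * K < e0 ->
  forall a1 a2 a3, 0 < a1 -> 0 <= a2 -> 0 <= a3 -> a1 + a2 + a3 = 1 ->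
  \forall N \near \oo, forall (U : probability (N.-tuple (measurableTypeR R)) R),
  uniform_on_sphere U -> forall (m k : nat) (t : 'I_m -> R) (s : 'I_k -> R) (nu : probR R),
  admissible N delta (I2 N delta K) a2 t -> admissible N delta (I3 N K a3) a3 s ->
  nu (I1 N delta) = 1%E -> (\int[nu]_x (x ^+ 2)%:E = a1%:E)%E ->
  (\int[nu]_x (\sum_(i < k) l (c * s i ^+ 2 * x ^+ 2 / N%:R))%:E - entropy nu <=
   (N%:R^-1 * ln (sphere_exp U sq_energy) + 2^-1 * ln (2 * pi) + 2^-1 + eps
    - c / 4 * (a1 ^+ 2 + 2 * a1 * a2 + B * a3 ^+ 2)
    - N%:R^-1 * \sum_(i < k) \sum_(j < m) l (c * s i ^+ 2 * t j ^+ 2 / N%:R)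
    - (2 * N%:R)^-1 * \sum_(i < m) \sum_(j < m) l (c * t i ^+ 2 * t j ^+ 2 / N%:R))%:E)%E.
Proof.
move=> eps0; move: (La0) (c0) (B0) => Lp cp Bp.
have c0' : 0 <= c by exact: ltW.
pose e := eps / 16; have ep : 0 < e by rewrite /e; lra.
pose e1 := e / (2 * c + 1).
have e1p : 0 < e1 by rewrite /e1 divr_gt0//; lra.
have e1c : 2 * e1 * c <= e.
  rewrite /e1 (_ : 2 * _ * c = e * (2 * c / (2 * c + 1))); last by field; lra.
  rewrite ler_piMr ?(ltW ep)// ler_pdivrMr; lra.
have [_ _ _ /(_ _ e1p)[dl dl0 ld] /(_ _ e1p)[M M0 lM]] := lP.
have C9 : 0 <= 9 * La * c by rewrite !mulr_ge0.
have [r0 r00 SL] := sphere_lower C9 ep.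
(* r0 / 4 admits a shell of width 4 delta; dl / (4 c + 1) puts bulk-bulk and bulk-middle arguments
   where [l] is close to x / 2; the term with B pays for the errors in the masses; c / M puts
   large-large arguments above [M]. *)
pose e0 := Num.min (r0 / 4) (Num.min (1 / 4) (Num.min (dl / (4 * c + 1))
   (Num.min (e / (c * (2 + B) + 1)) (c / M)))).
have cB : 0 <= c * (2 + B) by rewrite mulr_ge0//; move: Bp; clear -lP La0 c0 B0 => *; lra.
have e0p : 0 < e0.
  rewrite /e0 !lt_min !divr_gt0//; lra.
have e0r : e0 <= r0 / 4 by rewrite /e0 !ge_min lexx.
have e04 : e0 <= 1 / 4 by rewrite /e0 !ge_min lexx !orbT.
have e0d : e0 <= dl / (4 * c + 1) by rewrite /e0 !ge_min lexx !orbT.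
have e0B : e0 <= e / (c * (2 + B) + 1) by rewrite /e0 !ge_min lexx !orbT.
have e0M : e0 <= c / M by rewrite /e0 !ge_min lexx !orbT.
clearbody e0.
exists e0; first by apply/andP; split=> //; move: e04; clear -lP La0 c0 B0 => *; lra.
move=> delta K /andP[dp de] Ke dK a1 a2 a3 a1p a2p a3p asum.
have d4 : delta <= 1 / 4 by move: de e04; clear -lP La0 c0 B0 => *; lra.
have K1 : 1 < K.
  by apply: le_lt_trans Ke; rewrite invf_ge1//; move: e04; clear -lP La0 c0 B0 => *; lra.
have KM : M <= c * K ^+ 2.
  have : M / c <= K.
    apply: le_trans (ltW Ke); rewrite -[M / c]invf_div lef_pV2 ?posrE ?divr_gt0//.
  rewrite ler_pdivrMr// => MK; apply: le_trans MK _.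
  rewrite mulrC ler_wpM2l//; move: K1; clear -lP La0 c0 B0 => *; nra.
have cdl : 4 * c * e0 <= dl.
  have : e0 * (4 * c + 1) <= dl by rewrite -ler_pdivlMr//; move: (c0); clear -lP La0 c0 B0 => *; lra.
  by move: e0p; clear -lP La0 c0 B0 => *; lra.
have cdB : c * delta * (2 + B) <= e.
  have : e0 * (c * (2 + B) + 1) <= e by rewrite -ler_pdivlMr//; move: cB; clear -lP La0 c0 B0 => *; lra.
  by move: de e0p cB; clear -lP La0 c0 B0 => *; nra.
(* The field is at most La c x^2 times the relative mass of the large coordinates, which is below
   2. *)
pose C := 2 * La * c; have Cp : 0 <= C by rewrite !mulr_ge0.
have a11 : 0 < a1 <= 1 by apply/andP; split=> //; move: a2p a3p asum; clear -lP La0 c0 B0 => *; lra.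
have [A Ap GL] := gibbs_lattice Cp a11.
pose r := Num.min (delta / 2) (e / A).
have rp : 0 < r by rewrite /r lt_min !divr_gt0.
have rd : r <= delta / 2 by rewrite /r ge_min lexx.
have rA : A * r <= e by rewrite mulrC -ler_pdivlMr// /r ge_min lexx orbT.
clearbody r.
pose tau := Num.min (1 / 4) (r / (32 * delta)).
have taup : 0 < tau by rewrite /tau lt_min !divr_gt0// mulr_gt0.
have tau4 : tau <= 1 / 4 by rewrite /tau ge_min lexx.
have taur : 32 * delta * tau <= r.
  by rewrite mulrC -ler_pdivlMr ?mulr_gt0// /tau ge_min lexx orbT.
clearbody tau.
pose Kf := 2 / K + 2 / delta.
have K0 : 0 < K by apply: lt_trans K1.
have Kfp : 0 < Kf by rewrite addr_gt0 ?divr_gt0.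
have r4 : 0 < 4 * delta <= r0 by apply/andP; split; move: dp de e0r; clear -lP La0 c0 B0 => *; lra.
have dp4 : 0 < delta <= 1 / 4 by rewrite dp.
have a21 : a2 <= 1 by move: a1p a3p asum; clear -lP La0 c0 B0 => *; lra.
have a31 : a3 <= 1 by move: a1p a2p asum; clear -lP La0 c0 B0 => *; lra.
have d1 : delta / 2 <= 1 by move: d4; clear -lP La0 c0 B0 => *; lra.
have d41 : 4 * delta <= 1 by move: d4; clear -lP La0 c0 B0 => *; lra.
have sd1 : Num.sqrt delta <= 1 by rewrite -sqrtr1 ler_sqrt//; move: d4; clear -lP La0 c0 B0 => *; lra.
near=> N => U Uu m k t s nu tP sP nI n2.
have q1 : 1 <= N%:R `^ 4^-1 :> R by near: N; exact: quartic_root_near.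
have qn1 : 3 / Num.sqrt delta <= N%:R `^ 4^-1 by near: N; exact: quartic_root_near.
have qn3 : 2 * Kf / delta <= (N%:R `^ 4^-1) ^+ 2 by near: N; exact: quartic_root_sqr_near.
have qn4 : Kf * A / e <= (N%:R `^ 4^-1) ^+ 2 by near: N; exact: quartic_root_sqr_near.
have qn5 : 12 * Kf / e <= N%:R `^ 4^-1 by near: N; exact: quartic_root_near.
have qn7 : (4 * tau ^+ 2 + 3) / (tau * r / 2) <= (N%:R `^ 4^-1) ^+ 2 by near: N; exact: quartic_root_sqr_near.
have n2' : 5 / delta <= N%:R by near: N; exact: nbhs_infty_ger.
have n6 : (1 + 5 * La * c) / e <= N%:R by near: N; exact: nbhs_infty_ger.
have n8 : 3 * (C + A) / e <= N%:R by near: N; exact: nbhs_infty_ger.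
have N0 : (0 < N)%N by near: N; exact: nbhs_infty_gt.
have GLN : forall (b : R) (V : R -> R),
   3 <= b -> (forall x, 0 <= V x <= C * x ^+ 2) ->
   exists a, [/\ `|a| <= A,
     \sum_(k < lattice_size N) gibbs_weight N b V a a1 k * (lattice_pt R N k ^+ 2 - a1) = 0,
     0 < \sum_(k < lattice_size N) gibbs_weight N b V a a1 k &
     \sum_(k < lattice_size N) gibbs_weight N b V a a1 k <= expR A] by near: N; exact: GL.
have SLN : \sum_(y : lattice_vec N | shell 1 (4 * delta) y)
      lattice_step R N ^+ N * expR (energy l c (fun i => coords R y i ^+ 2)) <=
      expR (sphere_entropy R N + e * N%:R) * sphere_exp U sq_energy.
  have H : forall U : probability (N.-tuple (measurableTypeR R)) R, uniform_on_sphere U ->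
    forall Phi : ('I_N -> R) -> R,
    measurable_fun setT (fun e : N.-tuple (measurableTypeR R) => Phi (dilate 1 e)) ->
    regular (9 * La * c) Phi ->
    \sum_(y : lattice_vec N | shell 1 (4 * delta) y) lattice_step R N ^+ N * expR (Phi (coords R y)) <=
    expR (sphere_entropy R N + e * N%:R) * sphere_exp U Phi by near: N; exact: SL.
  exact: (H U Uu sq_energy (@measurable_sq_energy N) (@energy_regular _ _ _ _ _ lP La0 c0' N)).
have NQ4 := quartic_root_sqr R N.
have [tK sK sM fQ] := config_counts dp4 K0 q1 a21 a31 tP sP.
move: nI; rewrite /I1 /=.
set q : R := N%:R `^ 4^-1 in q1 qn1 qn3 qn4 qn5 qn7 NQ4 tK sK fQ *.
rewrite -/Kf in fQ; pose Q := q ^+ 2; rewrite -/Q in qn3 qn4 qn7 tK sK fQ * => nI.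
have NQ : N%:R = Q ^+ 2 :> R by rewrite -NQ4 /Q -exprM.
have Np : 0 < N%:R :> R by rewrite ltr0n.
have N1 : 1 <= N%:R :> R by rewrite ler1n.
have Q1 : 1 <= Q by rewrite exprn_ege1.
have Q0 : 0 < Q by apply: lt_le_trans Q1.
have q0 : 0 <= q by apply: le_trans q1.
have QN : Q <= N%:R by rewrite NQ expr2 ler_peMr// ltW.
have qQ : q <= Q by rewrite /Q expr2 ler_peMr.
have sd0 : 0 < Num.sqrt delta by rewrite sqrtr_gt0.
have sd2 : Num.sqrt delta ^+ 2 = delta by rewrite sqr_sqrtr// ltW.
have fN : (k + m)%:R <= delta / 2 * N%:R.
  apply: le_trans fQ _; rewrite NQ expr2 [leRHS]mulrA; apply: ler_wpM2r; first exact: ltW.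
  move: qn3; rewrite ler_pdivrMr// => H.
  exact: half_le.
have kmN : (k + m <= N)%N.
  rewrite -(ler_nat R); apply: le_trans fN _.
  by rewrite -[leRHS]mul1r ler_wpM2r// ltW.
have [P [P' [z [PP' cP [sumP sumP'] zP zP']]]] := embed_sites s t kmN.
(* Twice the range of [I1]: room for the lattice step beyond the support of the bulk law. *)
pose b := 2 * Num.sqrt delta * q.
have b2 : b ^+ 2 = 4 * delta * Q by rewrite /b !exprMn sd2 /Q; ring.
pose b0 := Num.sqrt delta * q.
have b03 : 3 <= b0 by move: qn1; rewrite ler_pdivrMr// /b0 mulrC.
have b00 : 0 <= b0 by rewrite mulr_ge0// ltW.
have bE : b = b0 + b0 by rewrite /b /b0; ring.
have b3 : 3 <= b by rewrite bE -[leLHS]addr0 lerD.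
have b0N : b0 <= N%:R.
  by apply: le_trans QN; apply: le_trans qQ; rewrite /b0 ler_piMl.
have sPz : \sum_(i | P i) z i ^+ 2 = \sum_(i < k) s i ^+ 2 := sumP (fun u => u ^+ 2).
have sQz : \sum_(i | P' i) z i ^+ 2 = \sum_(i < m) t i ^+ 2 := sumP' (fun u => u ^+ 2).
have LaC : La * c * (\sum_(i | P i) z i ^+ 2) / N%:R <= C.
  rewrite ler_pdivrMr// sPz /C (_ : 2 * La * c * N%:R = La * c * (2 * N%:R)); last by ring.
  by apply: ler_wpM2l => //; exact: mulr_ge0.
pose V := field l c P z.
have VC x : 0 <= V x <= C * x ^+ 2.
  have /andP[v0 v1] := field_bound lP c0' P z x.
  by rewrite v0/=; apply: le_trans v1 _; rewrite ler_wpM2r// sqr_ge0.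
have VL x y : `|V x - V y| <= C * `|x ^+ 2 - y ^+ 2|.
  by apply: le_trans (field_diff lP c0' P z x y) _; rewrite ler_wpM2r.
have mV : measurable_fun setT V.
  rewrite /V /field; under eq_fun do rewrite big_mkcond/=.
  apply: measurable_sum => j; case: (P j) => //.
  apply: measurable_potential_comp => [x|].
    by rewrite divr_ge0// mulr_ge0 ?sqr_ge0// mulr_ge0 ?sqr_ge0.
  by apply: measurable_funM => //; apply: measurable_funM => //; apply: measurable_funX.
have [a [aA wu Z0 ZA]] := GLN b V b3 VC.
set Z := \sum_(k < lattice_size N) _ in Z0 ZA.
have h1 : lattice_step R N <= 1 by rewrite /lattice_step invf_le1 ?exprn_gt0// exprn_ege1.
have b0b : b0 + lattice_step R N <= b.
  by rewrite bE lerD2l (le_trans h1)// (le_trans _ b03)// ler1n.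
have CAe : (C + A) * ((2 * b0 + 1) * lattice_step R N) <= e.
  by apply: config_round => //; [rewrite addr_ge0// ltW|rewrite b00].
have ent := gibbs_lattice_entropy N0 b00 b0b b0N mV VC VL Cp aA CAe (ltW ep) nI n2 Z0.
rewrite -/Z in ent.
have -> : (\int[nu]_x (\sum_(i < k) l (c * s i ^+ 2 * x ^+ 2 / N%:R))%:E = \int[nu]_x (V x)%:E)%E.
  by apply: eq_integral => x _; rewrite /V /field (sumP (fun u => l (c * u ^+ 2 * x ^+ 2 / N%:R))).
apply: le_trans ent _; rewrite lee_fin.
have PQE : \sum_(i | P i) \sum_(j | P' j) l (c * z i ^+ 2 * z j ^+ 2 / N%:R) =
    \sum_(i < k) \sum_(j < m) l (c * s i ^+ 2 * t j ^+ 2 / N%:R).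
  under eq_bigr => i _ do rewrite (sumP' (fun u => l (c * z i ^+ 2 * u ^+ 2 / N%:R))).
  by rewrite (sumP (fun v => \sum_(j < m) l (c * v ^+ 2 * t j ^+ 2 / N%:R))).
have QQE : \sum_(i | P' i) \sum_(j | P' j) l (c * z i ^+ 2 * z j ^+ 2 / N%:R) =
    \sum_(i < m) \sum_(j < m) l (c * t i ^+ 2 * t j ^+ 2 / N%:R).
  under eq_bigr => i _ do rewrite (sumP' (fun u => l (c * z i ^+ 2 * u ^+ 2 / N%:R))).
  by rewrite (sumP' (fun v => \sum_(j < m) l (c * v ^+ 2 * t j ^+ 2 / N%:R))).
have tD : tau / Q * (b ^+ 2 + 1) <= 1 / 2.
  rewrite mulrAC ler_pdivrMr// b2; apply: (@le_trans _ _ (1 / 4 * (Q + Q))).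
    rewrite ler_pM ?(ltW taup)// ?addr_ge0 ?mulr_ge0 ?(ltW dp) ?(ltW Q0)//.
    by rewrite lerD// ler_piMl// ltW.
  by rewrite le_eqVlt; apply/orP; left; apply/eqP; field.
have sqb (x : R) : `|x| <= b -> x ^+ 2 <= 4 * delta * Q.
  by move=> xb; rewrite -b2 -(real_normK (num_real x)) lerXn2r// nnegrE// (le_trans _ xb).
have cdK : 4 * c * (delta * K) <= dl by apply: le_trans cdl; rewrite ler_wpM2l ?mulr_ge0// ltW.
have hOO : forall x y, `|x| <= b -> `|y| <= b -> c * x ^+ 2 * y ^+ 2 / N%:R <= dl.
  move=> x y /sqb xb /sqb yb; rewrite ler_pdivrMr//.
  apply: (@le_trans _ _ (c * (4 * delta * Q) * (4 * delta * Q))).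
    by apply: mul3_le => //; exact: sqr_ge0.
  rewrite (_ : c * _ * _ = 4 * c * (delta * (4 * delta)) * Q ^+ 2); last by ring.
  rewrite -NQ ler_wpM2r ?(ltW Np)//; apply: le_trans cdl; rewrite ler_wpM2l ?mulr_ge0//.
  by apply: le_trans (ltW de); rewrite ler_piMr// ltW.
have hQO : forall i y, P' i -> `|y| <= b -> c * z i ^+ 2 * y ^+ 2 / N%:R <= dl.
  move=> i y /zP'[j ->] /sqb yb; rewrite ler_pdivrMr//.
  apply: (@le_trans _ _ (c * (K * Q) * (4 * delta * Q))).
    by apply: mul3_le => //; exact: sqr_ge0.
  rewrite (_ : c * _ * _ = 4 * c * (delta * K) * Q ^+ 2); last by ring.
  by rewrite -NQ ler_wpM2r ?(ltW Np).
have hPP : forall i j, P i -> P j -> M <= c * z i ^+ 2 * z j ^+ 2 / N%:R.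
  move=> i j /zP[i' ->] /zP[j' ->]; rewrite ler_pdivlMr//.
  apply: (@le_trans _ _ (c * (K * Q) * (K * Q))); last first.
    by apply: mul3_le => //; rewrite mulr_ge0// ltW.
  rewrite (_ : c * _ * _ = c * K ^+ 2 * Q ^+ 2); last by ring.
  by rewrite -NQ ler_wpM2r ?(ltW Np).
have SPz : `|\sum_(i | P i) z i ^+ 2 - N%:R * a3| <= delta * N%:R by rewrite sPz; case: sP.
have SQz : `|\sum_(i | P' i) z i ^+ 2 - N%:R * a2| <= delta * N%:R by rewrite sQz; case: tP.
have fN' : #|[pred i | P i || P' i]|%:R <= delta / 2 * N%:R by rewrite cP.
have N5 : 5 <= delta * N%:R by move: n2'; rewrite ler_pdivrMr// mulrC.
have ts := tilt_small Q0 NQ taup rp dp b2 taur qn7.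
have t0 : 0 < tau / Q by rewrite divr_gt0.
have := lattice_lower_fixed lP La0 c0' B0 N0 PP' (ltW a1p) a2p a3p asum dp d4 (ltW e1p)
  SPz SQz fN' (ltW rp) rd N5 aA wu Z0 ZA t0 tD ts ld lM hOO hQO hPP.
rewrite cP PQE QQE -/Z => H.
set SE := sphere_exp U _ in SLN *.
have hE : (lattice_step R N ^+ (k + m))^-1 = expR (3 * (k + m)%:R * ln N%:R).
  rewrite /lattice_step exprVn invrK -exprM -natrM [RHS](_ : _ = expR (ln N%:R * (3 * (k + m))%:R)).
    by rewrite expRM_natr lnK// posrE.
  by rewrite mulrC.
rewrite hE in H.
have {H} := le_trans H (ler_wpM2l _ SLN).
rewrite -[2 * expR _ * expR _]mulrA -expRD => /(_ ltac:(by rewrite mulr_ge0// expR_ge0)).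
move=> /(log_compare Z0) H.
apply: (config_arith (lS := ln SE) (S := sphere_entropy R N) (ln2 := ln 2) (fA := (k + m)%:R * A)
  (ArN := A * r * N%:R) (low := lower_error La B c N delta e1) (f3 := 3 * (k + m)%:R * ln N%:R) Np) => //.
- by rewrite /e mulrC divfK.
- by move: H; rewrite !addrA.
- rewrite NQ expr2 mulrA; apply: le_trans (ler_wpM2r (ltW Ap) fQ) _.
  rewrite mulrAC ler_wpM2r ?(ltW Q0)//.
  by move: qn4; rewrite ler_pdivrMr// (mulrC Q).
- by rewrite ler_wpM2r// ltW.
- by rewrite /lower_error; apply: config_low.
- exact: (config_log (esym NQ4) q1 fQ Kfp ep).
Unshelve. all: by end_near. Qed.


End ConfigUpper.


Section FunctionalUpper.
Variable R : realType.
Variables (mu : probR R) (l : R -> R) (La B theta : R).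
Hypothesis lP : pair_potential l La B.
Hypotheses (La0 : 0 <= La) (theta0 : 0 < theta) (B0 : 0 <= B).
Hypothesis LE : forall u, log_mgf mu u = (l (u ^+ 2))%:E.
Let c : R := 4 * theta ^+ 2.
Local Notation sq_energy := (fun y => energy l c (fun i => y i ^+ 2)).

Let c0 : 0 < c.
Proof. by rewrite mulr_gt0// exprn_gt0. Qed.

Let arg_ge0 (N : nat) (x y : R) : 0 <= c * x ^+ 2 * y ^+ 2 / N%:R.
Proof. by rewrite divr_ge0// mulr_ge0 ?sqr_ge0// mulr_ge0 ?sqr_ge0// ltW. Qed.

Lemma pair_logE (N : nat) (x y : R) :
  log_mgf mu (2 * theta * x * y / Num.sqrt N%:R) = (l (c * x ^+ 2 * y ^+ 2 / N%:R))%:E.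
Proof.
rewrite LE; congr (l _)%:E.
by rewrite !exprMn exprVn sqr_sqrtr// /c; ring.
Qed.

Lemma bulk_integralE (N k : nat) (s : 'I_k -> R) (nu : probR R) :
  (\sum_(i < k) \int[nu]_x log_mgf mu (2 * theta * s i * x / Num.sqrt N%:R)%R =
   \int[nu]_x (\sum_(i < k) l (c * s i ^+ 2 * x ^+ 2 / N%:R))%:E)%E.
Proof.
under eq_bigr do under eq_integral do rewrite pair_logE.
under [RHS]eq_integral do rewrite -sumEFin.
rewrite ge0_integral_sum//.
  move=> i; apply/measurable_EFinP; apply: (measurable_potential_comp lP La0) => //.
  by apply: measurable_funM => //; apply: measurable_funM => //; apply: measurable_funX.
move=> i x _; rewrite lee_fin.
by have /andP[] := potential_le lP (arg_ge0 N (s i) x).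
Qed.

Lemma FN_bracesE (N : nat) (a1 delta : R) (m k : nat) (t : 'I_m -> R) (s : 'I_k -> R) :
  FN_braces mu theta N a1 delta t s =
  ((N%:R^-1 * \sum_(i < k) \sum_(j < m) l (c * s i ^+ 2 * t j ^+ 2 / N%:R) +
    (2 * N%:R)^-1 * \sum_(i < m) \sum_(j < m) l (c * t i ^+ 2 * t j ^+ 2 / N%:R))%:E +
   bulk_sup mu theta N a1 delta s - (2^-1 * ln (2 * pi))%:E - (2^-1)%:E)%E.
Proof.
rewrite /FN_braces; do 2 congr (_ - _)%E; congr (_ + _)%E.
under eq_bigr do under eq_bigr do rewrite pair_logE.
under [X in (_ + _ * X)%E]eq_bigr do under eq_bigr do rewrite pair_logE.
under eq_bigr do rewrite sumEFin.
under [X in (_ + _ * X)%E]eq_bigr do rewrite sumEFin.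
by rewrite !sumEFin.
Qed.

(** A vanishing second moment forces the point mass at 0, which has no density and hence infinite
    entropy. This settles alpha_1 = 0, where no multiplier exists. *)
Lemma bulk_sup0 (N : nat) (delta : R) (k : nat) (s : 'I_k -> R) :
  bulk_sup mu theta N 0 delta s = -oo%E.
Proof.
apply/eqP; rewrite -leeNy_eq; apply/ereal_supP => _ [nu [nI n2] <-].
have x0 : {ae nu, forall x : R, x = 0}.
  have : {ae nu, forall x : R, setT x -> (x ^+ 2)%:E = 0%E}.
    apply/ae_eq_integral_abs => //.
      by apply/measurable_EFinP; apply: measurable_funX.
    by under eq_integral do rewrite abse_EFin ger0_norm ?sqr_ge0//.
  apply: (@filterS _ _ (ae_filter_ringOfSetsType nu)) => x /(_ Logic.I) [].
  by move/eqP; rewrite sqrf_eq0 => /eqP.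
have -> : entropy nu = +oo%E.
  rewrite /entropy; case: asboolP => // ll.
  have n0 : nu [set (0 : measurableTypeR R)]%R = 0%E.
    have /null_content_dominatesP D := ll.
    have m0 : measurable [set (0 : measurableTypeR R)] by exact: measurable_set1.
    by apply: (D _ m0); exact: lebesgue_measure_set1.
  have [A [mA A0 sA]] := x0.
  have : (nu setT <= nu A + nu [set (0 : measurableTypeR R)]%R)%E.
    apply: le_trans (measureU2 _ _ _) => //; apply: le_measure; rewrite ?inE//.
      exact: measurableU.
    by move=> x _; have [->|x1] := pselect (x = 0); [right|left; apply: sA].
  by rewrite (_ : nu setT = 1%E) ?probability_setT// A0 n0 adde0 lee_fin ler10.
rewrite bulk_integralE.
suff : (\int[nu]_x (\sum_(i < k) l (c * s i ^+ 2 * x ^+ 2 / N%:R))%:E < +oo)%E.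
  by case: (\int[nu]_x _)%E => [r| |].
pose C := La * c * (\sum_(j < k) s j ^+ 2) / N%:R.
apply: (@le_lt_trans _ _ (\int[nu]_x (C%:E * (x ^+ 2)%:E))%E).
  apply: ge0_le_integral => //.
  - move=> x _; rewrite lee_fin sumr_ge0// => i _.
    by have /andP[] := potential_le lP (arg_ge0 N (s i) x).
  - apply/measurable_EFinP; apply: measurable_sum => i.
    apply: (measurable_potential_comp lP La0) => //.
    by apply: measurable_funM => //; apply: measurable_funM => //; apply: measurable_funX.
  - by apply: measurable_funeM; apply/measurable_EFinP; apply: measurable_funX.
  - move=> x _; rewrite -EFinM lee_fin /C mulr_sumr !mulr_suml; apply: ler_sum => i _.
    have /andP[_ h] := potential_le lP (arg_ge0 N (s i) x); apply: le_trans h _.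
    by rewrite le_eqVlt; apply/orP; left; apply/eqP; ring.
rewrite integralZl//; first by rewrite n2 mule0 ltry.
apply/integrableP; split; first by apply/measurable_EFinP; apply: measurable_funX.
by under eq_integral do rewrite abse_EFin ger0_norm ?sqr_ge0//; rewrite n2 ltry.
Qed.

Lemma FN_upper (eps : R) : 0 < eps -> exists2 e0 : R, 0 < e0 <= 1 &
  forall delta K, 0 < delta < e0 -> e0^-1 < K -> delta * K < e0 ->
  forall a, @simplex3 R a ->
  \forall N \near \oo, forall (U : probability (N.-tuple (measurableTypeR R)) R),
  uniform_on_sphere U ->
  (FN_functional mu B theta N a.1.1 a.1.2 a.2 delta K <=
    (N%:R^-1 * ln (sphere_exp U sq_energy) + eps)%:E)%E.
Proof.
move=> eps0; have [e0 e01 H] := config_upper lP La0 c0 B0 eps0; exists e0 => //.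
move=> delta K de Ke dK [[a1 a2] a3] [/= a10 a20 a30 asum].
have [a1p|a1n] := ltP 0 a1; last first.
  have -> : a1 = 0 by apply: le_anti; rewrite a1n.
  apply: nearW => N U Uu; rewrite /FN_functional.
  rewrite (_ : ereal_sup _ = -oo%E) ?addeNy ?leNye//.
  apply/eqP; rewrite -leeNy_eq; apply/ereal_supP => _ [m [t [tP ->]]].
  apply/ereal_supP => _ [k [s [sP ->]]].
  by rewrite FN_bracesE bulk_sup0.
apply: filterS (H delta K de Ke dK a1 a2 a3 a1p a20 a30 asum) => N HN U Uu.
rewrite /FN_functional -leeBrDl//; apply/ereal_supP => _ [m [t [tP ->]]].
apply/ereal_supP => _ [k [s [sP ->]]].
rewrite FN_bracesE.
set x := (_ * _ + _ * _).
have W : (bulk_sup mu theta N a1 delta s <= (N%:R^-1 * ln (sphere_exp U sq_energy) +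
    2^-1 * ln (2 * pi) + 2^-1 + eps - c / 4 * (a1 ^+ 2 + 2 * a1 * a2 + B * a3 ^+ 2) - x)%:E)%E.
  apply/ereal_supP => _ [nu [nI n2] <-].
  rewrite bulk_integralE; apply: le_trans (HN U Uu m k t s nu tP sP nI n2) _.
  by rewrite lee_fin /x opprD addrA.
apply: le_trans (leeD2r _ (leeD2r _ (leeD2l _ W))) _.
set w := (_ + _ - _ - x); rewrite (_ : _ - _ - _ = (x + w - 2^-1 * ln (2 * pi) - 2^-1)%:E)%E//.
rewrite -EFinB lee_fin /w /c; lra.
Qed.

End FunctionalUpper.


(** * Transfer of a configuration to larger dimensions *)

Section Transfer.
Variable R : realType.
Variables (mu : probR R) (l : R -> R) (La B theta : R).
Hypothesis lP : pair_potential l La B.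
Hypotheses (La0 : 0 <= La) (theta0 : 0 < theta) (B0 : 0 <= B).
Hypothesis LE : forall u, log_mgf mu u = (l (u ^+ 2))%:E.
Let c : R := 4 * theta ^+ 2.

Let c0 : 0 < c.
Proof. by rewrite mulr_gt0// exprn_gt0. Qed.

Lemma potential_large_sum (I : finType) (k : I -> R) (e : R) : (forall i, 0 < k i) -> 0 < e ->
  exists z0 : R, forall z, z0 <= z -> 0 < z ->
    B / 2 * (\sum_i k i) - e <= z^-1 * \sum_i l (k i * z).
Proof.
move=> k0 e0; set S := \sum_i k i; have S0 : 0 <= S by apply: sumr_ge0 => i _; exact: ltW.
have [_ _ _ _ lB] := lP.
have e'0 : 0 < e / (S + 1) by rewrite divr_gt0//; lra.
have [M M0 lM] := lB _ e'0.
(* The sum serves as a common upper bound of the thresholds M / k i. *)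
exists (\sum_i M / k i) => z zz z0; rewrite ler_pdivlMl// mulrBr.
apply: (@le_trans _ _ (\sum_i (B / 2 * (k i * z) - e / (S + 1) * (k i * z)))).
  have -> : \sum_i (B / 2 * (k i * z) - e / (S + 1) * (k i * z)) = B / 2 * (S * z) - e / (S + 1) * (S * z).
    by rewrite sumrB -!mulr_sumr -mulr_suml.
  have : e / (S + 1) * S * z <= e * z.
    by rewrite ler_wpM2r ?(ltW z0)// mulrAC ler_pdivrMr ?ler_wpM2l ?(ltW e0)//; lra.
  lra.
apply: ler_sum => i _; have /lM : M <= k i * z.
  rewrite mulrC -ler_pdivrMr//; apply: le_trans zz; rewrite (bigD1 i)//= lerDl.
  by apply: sumr_ge0 => j _; rewrite divr_ge0 ?(ltW (k0 j))// ltW.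
by move=> /ler_normlP[]; lra.
Qed.

(** r -> r l (g / r) is Lipschitz away from 0. This pays for replacing 1 / n0 by M^2 / N when sqrt
    (N / n0) is truncated to the integer M. *)
Lemma potential_ratio (g ra r0 : R) : 0 <= g -> 0 < ra -> ra <= r0 ->
  r0 * l (g / r0) - 2 * La * g * ((r0 - ra) / ra) <= ra * l (g / ra).
Proof.
move=> g0 ra0 rr; have [_ lip _ _ _] := lP; have r00 : 0 < r0 by lra.
have x0 : 0 <= g / ra by rewrite divr_ge0// ltW.
have y0 : 0 <= g / r0 by rewrite divr_ge0// ltW.
have /ler_normlP[_ h1] := lip _ _ y0 x0.
have /andP[h2 h3] := potential_le lP x0.
have E : `|g / r0 - g / ra| = g * ((r0 - ra) / ra) / r0.
  rewrite ler0_norm ?subr_le0; last by rewrite ler_wpM2l// lef_pV2 ?posrE.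
  by field; rewrite !lt0r_neq0.
have H1 : r0 * l (g / r0) <= r0 * l (g / ra) + La * g * ((r0 - ra) / ra).
  have : r0 * (l (g / r0) - l (g / ra)) <= r0 * (La * (g * ((r0 - ra) / ra) / r0)).
    by rewrite ler_wpM2l ?(ltW r00)// -E.
  rewrite (_ : r0 * (La * _) = La * g * ((r0 - ra) / ra)); last by field; rewrite !lt0r_neq0.
  lra.
have H2 : (r0 - ra) * l (g / ra) <= La * g * ((r0 - ra) / ra).
  have : (r0 - ra) * l (g / ra) <= (r0 - ra) * (La * (g / ra)) by rewrite ler_wpM2l// subr_ge0.
  by rewrite (_ : (r0 - ra) * (La * _) = La * g * ((r0 - ra) / ra)); last by field; rewrite lt0r_neq0.
lra.
Qed.

Lemma sum_copies (m M : nat) (F : 'I_m -> R) :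
  \sum_(p < #|{: 'I_m * 'I_M}|) F (enum_val p).1 = M%:R * \sum_j F j.
Proof.
rewrite -(big_enum_val (op := +%R) (fun p : 'I_m * 'I_M => F p.1)) /=.
rewrite -(pair_big xpredT xpredT (fun (j : 'I_m) (_ : 'I_M) => F j))/= mulr_sumr.
by apply: eq_bigr => j _; rewrite sumr_const card_ord mulr_natl.
Qed.

Lemma trunc_ratio (x : R) : 1 <= x -> let M := (Num.truncn x)%:R in
  [/\ 1 <= M, M <= x, x <= 2 * M & (x ^+ 2 - M ^+ 2) / M ^+ 2 <= 3 / M].
Proof.
move=> x1 M; have x0 : 0 <= x by lra.
have /andP[M1 M2] := truncn_itv x0; rewrite -natr1 -/M in M1 M2.
have m1 : 1 <= M by rewrite ler1n truncn_gt0.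
have M0 : 0 < M by lra.
split=> //; first by lra.
rewrite ler_pdivrMr ?exprn_gt0// (_ : 3 / M * M ^+ 2 = 3 * M); last by field; rewrite lt0r_neq0.
have : x ^+ 2 <= (M + 1) ^+ 2 by rewrite lerXn2r ?nnegrE//; lra.
rewrite sqrrD expr1n mulr1; lra.
Qed.

Variables (k m : nat) (r : 'I_k -> R) (v : 'I_m -> R) (nu : probR R) (Mb n0 a1 W : R).
Hypotheses (r0 : forall i, 0 < r i) (v0 : forall j, 0 < v j) (n00 : 0 < n0).
Hypotheses (nuM : nu [set x | `|x| <= Mb] = 1%E) (nu2 : (\int[nu]_x (x ^+ 2)%:E = a1%:E)%E).
Let a2 := \sum_j v j.
Let a3 := \sum_i r i.
Hypothesis WP : (W%:E <= \int[nu]_x (\sum_(i < k) l (c * r i * x ^+ 2))%:E - entropy nu)%E.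

(** What the functional tends to along the transferred configurations: large-middle pairs have
    become linear and give B / 2 c a2 a3, whereas middle-middle pairs keep their form of dimension
    [n0]. *)
Definition transfer_value : R :=
  theta ^+ 2 * (a1 ^+ 2 + 2 * a1 * a2 + B * a3 ^+ 2) + B / 2 * c * a2 * a3 +
  (2 * n0)^-1 * \sum_i \sum_j l (c * n0 * v i * v j) + W - 2^-1 * ln (2 * pi) - 2^-1.

Ltac numeric := clear -lP La0 theta0 B0 LE c0 r0 v0 n00 nuM nu2 a2 a3 WP.

(** The large coordinates are sqrt (r i N), and each middle mass is shared by M copies of size sqrt
    (v j N / M). A copy has square between v j sqrt n0 sqrt N and twice that, the factor 2 coming
    from the truncation; hence the conditions on [delta] and [K]. *)
Lemma FN_lower_fixed (N : nat) (delta K eta : R) :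
  let q : R := N%:R `^ 4^-1 in
  let M := Num.truncn (Num.sqrt (N%:R / n0)) in
  (0 < N)%N -> 1 <= N%:R / n0 -> 0 < delta -> 0 < K -> Mb <= Num.sqrt delta * q ->
  (forall i, K < r i * q ^+ 2) ->
  (forall j, delta < v j * Num.sqrt n0) -> (forall j, 2 * v j * Num.sqrt n0 <= K) ->
  B / 2 * (\sum_(p : 'I_k * 'I_m) c * r p.1 * v p.2) - eta / 2 <=
    (N%:R / M%:R)^-1 * \sum_(p : 'I_k * 'I_m) l (c * r p.1 * v p.2 * (N%:R / M%:R)) ->
  3 * La * c * a2 ^+ 2 / M%:R <= eta / 2 ->
  ((transfer_value - eta)%:E <= FN_functional mu B theta N a1 a2 a3 delta K)%E.
Proof.
move=> q M N0 Nn d0 K0 Mbq rK vd vK HB He.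
have Np : 0 < N%:R :> R by rewrite ltr0n.
have q4 : q ^+ 4 = N%:R by exact: quartic_root_sqr.
have q0 : 0 <= q by exact: powR_ge0.
pose x := Num.sqrt (N%:R / n0).
have x1 : 1 <= x by rewrite -sqrtr1 ler_sqrt// divr_ge0// ltW.
have [M1 M2 M3 M4] := trunc_ratio x1; rewrite -/M in M1 M2 M3 M4.
have xE : x ^+ 2 = N%:R / n0 by rewrite sqr_sqrtr// divr_ge0// ltW.
have Mp : 0 < M%:R :> R by lra.
have qE : q ^+ 2 = Num.sqrt n0 * x.
  by rewrite /x -sqrtrM ?(ltW n00)// mulrC divfK ?lt0r_neq0// -q4 -[4%N]/(2 * 2)%N exprM sqrtr_sqr ger0_norm// sqr_ge0.
pose t (p : 'I_(#|{: 'I_m * 'I_M}|)) := Num.sqrt (v (enum_val p).1 * N%:R / M%:R).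
pose s i := Num.sqrt (r i * N%:R).
have t2 p : t p ^+ 2 = v (enum_val p).1 * N%:R / M%:R.
  by rewrite sqr_sqrtr// divr_ge0// mulr_ge0// ltW.
have s2 i : s i ^+ 2 = r i * N%:R by rewrite sqr_sqrtr// mulr_ge0// ltW.
have tS : \sum_p t p ^+ 2 = N%:R * a2.
  under eq_bigr do rewrite t2.
  rewrite (sum_copies M (fun j => v j * N%:R / M%:R)) -mulr_suml -mulr_suml -/a2.
  by field; rewrite lt0r_neq0.
have sS : \sum_i s i ^+ 2 = N%:R * a3.
  by under eq_bigr do rewrite s2; rewrite -mulr_suml mulrC.
have qs : q = Num.sqrt (q ^+ 2) by rewrite sqrtr_sqr ger0_norm.
have rootM (y : R) : 0 <= y -> Num.sqrt y * q = Num.sqrt (y * q ^+ 2) by move=> y0; rewrite sqrtrM// -qs.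
have xM1 : 1 <= x / M%:R by rewrite ler_pdivlMr// mul1r.
have xM0 : 0 < x / M%:R by exact: lt_le_trans xM1.
have xM2 : x / M%:R <= 2 by rewrite ler_pdivrMr.
have NM : N%:R / M%:R = Num.sqrt n0 * (x / M%:R) * q ^+ 2.
  rewrite qE (_ : _ * _ * _ = (Num.sqrt n0) ^+ 2 * x ^+ 2 / M%:R); last by ring.
  by rewrite xE sqr_sqrtr ?(ltW n00)// (mulrC n0) divfK// lt0r_neq0.
have sn0 : 0 < Num.sqrt n0 by rewrite sqrtr_gt0.
have q20 : 0 < q ^+ 2 by rewrite qE mulr_gt0//; exact: lt_le_trans x1.
have tP : admissible N delta (I2 N delta K) a2 t.
  split=> [p|]; last by rewrite tS subrr normr0 mulr_ge0// ltW.
  rewrite /I2 /= ger0_norm ?sqrtr_ge0// !rootM ?(ltW d0) ?(ltW K0)//.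
  rewrite /t; set vp := v _; have vp0 : 0 < vp by exact: v0.
  have tE : vp * N%:R / M%:R = vp * Num.sqrt n0 * (x / M%:R) * q ^+ 2 by rewrite -mulrA NM; ring.
  rewrite tE.
  apply/andP; split.
    rewrite ltr_sqrt; last by do 2 apply: mulr_gt0 => //; exact: mulr_gt0.
    rewrite ltr_pM2r//; apply: lt_le_trans (vd (enum_val p).1) _; rewrite -/vp.
    by rewrite ler_peMr// mulr_ge0// ltW.
  rewrite ler_sqrt ?mulr_ge0 ?(ltW K0) ?(ltW q20)// ler_pM2r//.
  apply: le_trans (vK (enum_val p).1); rewrite -/vp -[2 * _ * _]mulrA (mulrC 2).
  by apply: ler_wpM2l => //; rewrite mulr_ge0// ltW.
have sP : admissible N delta (I3 N K a3) a3 s.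
  split=> [i|]; last by rewrite sS subrr normr0 mulr_ge0// ltW.
  rewrite /I3 /= ger0_norm ?sqrtr_ge0// rootM ?(ltW K0)//; apply/andP; split.
    rewrite ltr_sqrt ?mulr_gt0// -q4 (_ : r i * q ^+ 4 = r i * q ^+ 2 * q ^+ 2); last by ring.
    by rewrite ltr_pM2r.
  rewrite ler_sqrt; last by rewrite mulr_ge0// sumr_ge0// => j _; exact: ltW.
  rewrite (mulrC (r i)) ler_wpM2l// /a3 (bigD1 i)//= lerDl sumr_ge0// => j _; exact: ltW.
have nuI : nu (I1 N delta) = 1%E.
  have mI (b : R) : measurable [set x : R | `|x| <= b].
    rewrite (_ : [set x : R | `|x| <= b] = `[- b, b]%classic); first exact: measurable_itv.
    by apply/seteqP; split=> y; rewrite /= in_itv/= ler_norml.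
  apply/eqP; rewrite eq_le; apply/andP; split.
    by apply: probability_le1; exact: mI.
  rewrite -[X in (X <= _)%E]nuM; apply: le_measure; rewrite ?inE; [exact: mI|exact: mI|].
  by move=> y; rewrite /I1 /= => /le_trans; apply.
have BW : (W%:E <= bulk_sup mu theta N a1 delta s)%E.
  apply: le_trans WP _; apply: ereal_sup_ubound; exists nu => //.
  rewrite (bulk_integralE lP La0 theta0 LE); congr (_ - _)%E; apply: eq_integral => y _.
  congr EFin; apply: eq_bigr => i _; rewrite s2; congr l.
  by rewrite /c; field; rewrite lt0r_neq0.
have FE : ((transfer_value - eta)%:E <= (theta ^+ 2 * (a1 ^+ 2 + 2 * a1 * a2 + B * a3 ^+ 2))%:E +
    FN_braces mu theta N a1 delta t s)%E.
  rewrite (FN_bracesE _ LE) -/c.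
  set y := (N%:R^-1 * _ + _); apply: le_trans (leeD2l _ (leeD2r _ (leeD2r _ (leeD2l _ BW)))).
  rewrite (_ : (_ + _)%E = (theta ^+ 2 * (a1 ^+ 2 + 2 * a1 * a2 + B * a3 ^+ 2) +
     (y + W - 2^-1 * ln (2 * pi) - 2^-1))%:E)//.
  rewrite lee_fin /transfer_value.
  suff : B / 2 * c * a2 * a3 + (2 * n0)^-1 * (\sum_i \sum_j l (c * n0 * v i * v j)) - eta <= y by numeric => *; lra.
  set m2 := \sum_i \sum_j _.
  have y1 : B / 2 * c * a2 * a3 - eta / 2 <= N%:R^-1 * \sum_(i < k) \sum_(p < #|{: 'I_m * 'I_M}|) l (c * s i ^+ 2 * t p ^+ 2 / N%:R).
    have E : N%:R^-1 * \sum_(i < k) \sum_(p < #|{: 'I_m * 'I_M}|) l (c * s i ^+ 2 * t p ^+ 2 / N%:R) =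
       (N%:R / M%:R)^-1 * \sum_(p : 'I_k * 'I_m) l (c * r p.1 * v p.2 * (N%:R / M%:R)).
      rewrite -(pair_big xpredT xpredT (fun i j => l (c * r i * v j * (N%:R / M%:R))))/=.
      rewrite invf_div -mulrA mulrCA; congr (_ * _); rewrite mulr_sumr; apply: eq_bigr => i _.
      rewrite -(sum_copies M (fun j => l (c * r i * v j * (N%:R / M%:R)))).
      apply: eq_bigr => p _; rewrite s2 t2; congr l.
      by field; rewrite !lt0r_neq0.
    rewrite E; apply: le_trans HB; rewrite lerD2r.
    rewrite -(pair_big xpredT xpredT (fun i j => c * r i * v j))/=.
    under eq_bigr do rewrite -mulr_sumr -/a2.
    by rewrite -mulr_suml -mulr_sumr -/a3 le_eqVlt; apply/orP; left; apply/eqP; ring.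
  have y2 : (2 * n0)^-1 * m2 - eta / 2 <= (2 * N%:R)^-1 * \sum_(p < #|{: 'I_m * 'I_M}|) \sum_(p' < #|{: 'I_m * 'I_M}|) l (c * t p ^+ 2 * t p' ^+ 2 / N%:R).
    (* There are M^2 pairs of copies for each pair of masses, with argument c v_i v_j N / M^2: [ra]
       plays the role of 1 / n0. *)
    pose ra := M%:R ^+ 2 / N%:R : R.
    have ra0 : 0 < ra by rewrite divr_gt0// exprn_gt0.
    have E : (2 * N%:R)^-1 * \sum_(p < #|{: 'I_m * 'I_M}|) \sum_(p' < #|{: 'I_m * 'I_M}|) l (c * t p ^+ 2 * t p' ^+ 2 / N%:R) =
       2^-1 * \sum_i \sum_j ra * l (c * v i * v j / ra).
      rewrite (_ : 2^-1 * _ = (2 * N%:R)^-1 * \sum_i M%:R * (M%:R * \sum_j l (c * v i * v j / ra))).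
        congr (_ * _); rewrite -mulr_sumr.
        rewrite -(sum_copies M (fun i => M%:R * \sum_j l (c * v i * v j / ra))).
        apply: eq_bigr => p _; rewrite -(sum_copies M (fun j => l (c * v (enum_val p).1 * v j / ra))).
        apply: eq_bigr => p' _; rewrite !t2; congr l; rewrite /ra.
        by field; rewrite !lt0r_neq0.
      rewrite !mulr_sumr; apply: eq_bigr => i _; rewrite -mulr_sumr /ra.
      by field; rewrite lt0r_neq0.
    have rr : ra <= n0^-1.
      by rewrite /ra ler_pdivrMr// mulrC -xE lerXn2r ?nnegrE//; exact: le_trans ler01 x1.
    have rE : (n0^-1 - ra) / ra <= 3 / M%:R.
      apply: le_trans M4; rewrite xE /ra le_eqVlt; apply/orP; left; apply/eqP.
      by field; rewrite !lt0r_neq0.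
    rewrite E; apply: (@le_trans _ _ (2^-1 * \sum_i \sum_j (n0^-1 * l (c * n0 * v i * v j) - 2 * La * c * (3 / M%:R) * (v i * v j)))).
      rewrite (_ : \sum_i \sum_j _ = n0^-1 * m2 - 2 * La * c * (3 / M%:R) * a2 ^+ 2).
        have -> : (2 * n0)^-1 = 2^-1 * n0^-1 by rewrite invfM.
        have : La * c * (3 / M%:R) * a2 ^+ 2 = 3 * La * c * a2 ^+ 2 / M%:R by ring.
        by move: He; numeric => *; lra.
      under eq_bigr do rewrite sumrB -!mulr_sumr.
      rewrite sumrB -!mulr_sumr -/m2 -mulr_suml -/a2 expr2.
      by [].
    apply: ler_wpM2l => //; apply: ler_sum => i _; apply: ler_sum => j _.
    have g0 : 0 <= c * v i * v j by rewrite !mulr_ge0// ltW.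
    apply: le_trans (potential_ratio g0 ra0 rr).
    rewrite invrK (_ : c * v i * v j * n0 = c * n0 * v i * v j); last by ring.
    rewrite lerD2l lerN2 (_ : 2 * La * c * (3 / M%:R) * (v i * v j) = 2 * La * (c * v i * v j) * (3 / M%:R)); last by ring.
    by rewrite ler_wpM2l// mulr_ge0// mulr_ge0.
  by rewrite /y; move: y1 y2; numeric => *; lra.
apply: le_trans FE _; rewrite /FN_functional leeD2l//.
apply: le_trans (ereal_sup_ubound _); last first.
  by exists #|{: 'I_m * 'I_M}|, t; split; [exact: tP|reflexivity].
by apply: ereal_sup_ubound; exists k, s; split.
Qed.

Lemma FN_lower_near : exists2 e0 : R, 0 < e0 &
  forall delta K, 0 < delta < e0 -> e0^-1 < K -> forall eta, 0 < eta ->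
  \forall N \near \oo,
    ((transfer_value - eta)%:E <= FN_functional mu B theta N a1 a2 a3 delta K)%E.
Proof.
have sn0 : 0 < Num.sqrt n0 by rewrite sqrtr_gt0.
pose w j := v j * Num.sqrt n0.
have w0 j : 0 < w j by exact: mulr_gt0.
(* A common bound of all 1 / w j and 2 w j, so that delta < 1 / D and K > D put every copy in
   [I2]. *)
pose D := \sum_j ((w j)^-1 + 2 * w j) + 1.
have wD0 j : 0 <= (w j)^-1 + 2 * w j by rewrite addr_ge0 ?mulr_ge0 ?invr_ge0// ltW.
have D0 : 0 < D by rewrite ltr_wpDl// sumr_ge0.
have wD j : (w j)^-1 + 2 * w j <= D.
  by rewrite /D (bigD1 j)//= -addrA lerDl addr_ge0// sumr_ge0.
exists D^-1; first by rewrite invr_gt0.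
rewrite invrK => delta K /andP[d0 dD] DK eta eta0.
have K0 : 0 < K by exact: lt_trans DK.
have vd j : delta < v j * Num.sqrt n0.
  apply: lt_le_trans dD _; rewrite -/(w j) -[leRHS]invrK lef_pV2 ?posrE ?invr_gt0//.
  by apply: le_trans (wD j); rewrite lerDl mulr_ge0// ltW.
have vK j : 2 * v j * Num.sqrt n0 <= K.
  apply: le_trans (ltW DK); rewrite -mulrA -/(w j).
  by apply: le_trans (wD j); rewrite lerDr invr_ge0 ltW.
have kp (p : 'I_k * 'I_m) : 0 < c * r p.1 * v p.2 by rewrite mulr_gt0// mulr_gt0.
have eta2 : 0 < eta / 2 by rewrite divr_gt0.
have [z0 z0P] := potential_large_sum kp eta2.
have sd0 : 0 < Num.sqrt delta by rewrite sqrtr_gt0.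
near=> N.
have Np : (0 < N)%N by near: N; exact: nbhs_infty_gt.
have N0 : 0 < N%:R :> R by rewrite ltr0n.
have Q1 : 2 * Num.sqrt n0 + 12 * La * c * a2 ^+ 2 * Num.sqrt n0 / eta <= (N%:R `^ 4^-1) ^+ 2.
  by near: N; exact: quartic_root_sqr_near.
have Q2 : z0 / Num.sqrt n0 <= (N%:R `^ 4^-1) ^+ 2 by near: N; exact: quartic_root_sqr_near.
have Q3 : Mb / Num.sqrt delta <= N%:R `^ 4^-1 by near: N; exact: quartic_root_near.
have Q4 : \sum_i (K / r i) + 1 <= (N%:R `^ 4^-1) ^+ 2 by near: N; exact: quartic_root_sqr_near.
have NQ : N%:R = ((N%:R `^ 4^-1) ^+ 2) ^+ 2 :> R by rewrite -exprM quartic_root_sqr.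
set Q := (N%:R `^ 4^-1) ^+ 2 in Q1 Q2 Q4 NQ.
have Q0 : 0 <= Q by exact: sqr_ge0.
have Ce : 0 <= 12 * La * c * a2 ^+ 2 * Num.sqrt n0 / eta.
  apply: divr_ge0; last exact: ltW.
  apply: mulr_ge0; last exact: ltW.
  by apply: mulr_ge0; [rewrite !mulr_ge0// ltW|exact: sqr_ge0].
have xE : Num.sqrt (N%:R / n0) = Q / Num.sqrt n0.
  by rewrite sqrtrM// NQ sqrtr_sqr (ger0_norm Q0) sqrtrV// ltW.
have x2 : 2 <= Num.sqrt (N%:R / n0) by rewrite xE ler_pdivlMr//; move: Q1 Ce; numeric => *; lra.
have x1 : 1 <= Num.sqrt (N%:R / n0) by move: x2; numeric => *; lra.
have [M1 M2 M3 M4] := trunc_ratio x1.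
set M := Num.truncn _ in M1 M2 M3 M4.
have M0 : 0 < M%:R :> R by exact: lt_le_trans M1.
apply: FN_lower_fixed => //.
- have : 1 <= Num.sqrt (N%:R / n0) ^+ 2 by rewrite exprn_ege1.
  by rewrite sqr_sqrtr// divr_ge0// ltW.
- by rewrite mulrC -ler_pdivrMr.
- move=> i; rewrite -/Q mulrC -ltr_pdivrMr//; apply: lt_le_trans Q4.
  rewrite (bigD1 i)//= -addrA ltrDl ltr_wpDl// sumr_ge0// => j _.
  by rewrite divr_ge0// ltW.
- apply: z0P; rewrite -/M; last by rewrite divr_gt0.
  rewrite ler_pdivlMr//; apply: (@le_trans _ _ (Num.sqrt n0 * Q * (Q / Num.sqrt n0))); last first.
    by rewrite NQ le_eqVlt; apply/orP; left; apply/eqP; field; rewrite lt0r_neq0.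
  rewrite xE in M2; have [z00|z00] := leP z0 0.
    by apply: (@le_trans _ _ 0); rewrite ?mulr_ge0 ?invr_ge0 ?(ltW sn0)// mulr_le0_ge0// ltW.
  by apply: ler_pM; [exact: ltW|exact: ltW|rewrite mulrC -ler_pdivrMr|exact: M2].
- rewrite -/M ler_pdivrMr//.
  have h : 12 * La * c * a2 ^+ 2 * Num.sqrt n0 / eta <= 2 * M%:R * Num.sqrt n0.
    apply: (@le_trans _ _ Q); first by move: Q1 sn0; numeric => *; lra.
    by rewrite -ler_pdivrMr// -xE.
  move: h; rewrite ler_pdivrMr// => h.
  have : (12 * La * c * a2 ^+ 2) * Num.sqrt n0 <= (2 * M%:R * eta) * Num.sqrt n0 by move: h; numeric => *; lra.
  by rewrite ler_pM2r//; numeric => *; lra.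
Unshelve. all: by end_near. Qed.

End Transfer.


(** * Method of types *)

Section Types.
Variable R : realType.
Variables (N q : nat) (X : finType) (kap : X -> 'I_q) (h : R).
Hypotheses (N0 : (0 < N)%N) (h0 : 0 < h).

Definition cell_volume (k : 'I_q) : R := h * #|[pred x | kap x == k]|%:R.
Definition cell_count (y : {ffun 'I_N -> X}) (k : 'I_q) : nat := #|[pred i | kap (y i) == k]|.

Lemma cell_count_le y k : (cell_count y k < N.+1)%N.
Proof. by rewrite ltnS -[N in (_ <= N)%N]card_ord max_card. Qed.

Lemma sum_cell_count y : (\sum_k cell_count y k)%N = N.
Proof.
rewrite -[RHS](card_ord N) -sum1_card (partition_big (fun i => kap (y i)) xpredT)//=.
by apply: eq_bigr => k _; rewrite /cell_count -sum1_card.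
Qed.

Lemma cell_volume_gt0 x : 0 < cell_volume (kap x).
Proof. by rewrite mulr_gt0// ltr0n; apply/card_gt0P; exists x; rewrite inE. Qed.

Lemma cell_count_gt0 y i : (0 < cell_count y (kap (y i)))%N.
Proof. by apply/card_gt0P; exists i; rewrite inE. Qed.

(* Method of types: given the vector of cell counts, the lattice vectors carry the
   mass of a probability, and there are at most (N + 1)^q vectors of counts. *)
Lemma types_bound (S : pred {ffun 'I_N -> X}) (Phi : {ffun 'I_N -> X} -> R) (G : R) : 0 <= G ->
  (forall y, S y -> expR (Phi y) *
     \prod_i (cell_volume (kap (y i)) * N%:R / (cell_count y (kap (y i)))%:R) <= G) ->
  \sum_(y | S y) h ^+ N * expR (Phi y) <= (N.+1)%:R ^+ q * G.
Proof.
move=> G0 HG; have Np : 0 < N%:R :> R by rewrite ltr0n.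
(* The law with the cell frequencies given by [n], uniform inside each cell; its product weights
   have total mass at most 1. *)
pose g (n : {ffun 'I_q -> 'I_N.+1}) x := h * ((n (kap x) : nat)%:R / N%:R) / cell_volume (kap x).
have g0 n x : 0 <= g n x by rewrite !mulr_ge0 ?invr_ge0 ?(ltW h0)// ltW// cell_volume_gt0.
pose ty y : {ffun 'I_q -> 'I_N.+1} := [ffun k => Ordinal (cell_count_le y k)].
apply: (@le_trans _ _ (\sum_y (\prod_i g (ty y) (y i)) * G)).
  rewrite [leLHS]big_mkcond; apply: ler_sum => y _; case: ifPn => [Sy|_]; last first.
    by rewrite mulr_ge0// prodr_ge0.
  apply: le_trans (ler_wpM2l _ (HG y Sy)); last by rewrite prodr_ge0.
  rewrite mulrCA -big_split/= mulrC le_eqVlt; apply/orP; left; apply/eqP; congr (_ * _).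
  rewrite -[N in h ^+ N](card_ord N) -prodr_const; apply: eq_bigr => i _.
  rewrite /g ffunE/=; have v0 := cell_volume_gt0 (y i).
  have n0 : 0 < (cell_count y (kap (y i)))%:R :> R by rewrite ltr0n cell_count_gt0.
  by field; rewrite !lt0r_neq0.
rewrite -mulr_suml ler_wpM2r//.
have -> : N.+1%:R ^+ q = \sum_(n : {ffun 'I_q -> 'I_N.+1}) 1 :> R.
  by rewrite sumr_const card_ffun !card_ord -natrX.
rewrite (partition_big ty xpredT)//=; apply: ler_sum => n _.
have [y0 /eqP y0n|no] := pickP (fun y => ty y == n); last by rewrite big_pred0.
apply: (@le_trans _ _ (\sum_(y : {ffun 'I_N -> X}) \prod_(i < N) g n (y i))).
  rewrite big_mkcond; apply: ler_sum => y _; case: ifP => [/eqP ->//|_].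
  by rewrite prodr_ge0.
rewrite -(bigA_distr_bigA (fun (i : 'I_N) x => g n x))/= prodr_const card_ord.
rewrite exprn_ile1 ?sumr_ge0//.
rewrite (partition_big kap xpredT)//=.
apply: (@le_trans _ _ (\sum_k ((n k : nat)%:R / N%:R))).
  apply: ler_sum => k _.
  apply: (@le_trans _ _ (\sum_(x | kap x == k) h * ((n k : nat)%:R / N%:R) / cell_volume k)).
    by apply: ler_sum => x /eqP xk; rewrite /g xk.
  rewrite sumr_const -[leLHS]mulr_natr /cell_volume.
  set M := #|_|; have [->|M0] := posnP M; first by rewrite mulr0 divr_ge0.
  rewrite le_eqVlt; apply/orP; left; apply/eqP; field.
  by rewrite !lt0r_neq0// ltr0n.
rewrite -mulr_suml ler_pdivrMr// mul1r -natr_sum ler_nat -y0n.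
by rewrite (eq_bigr (cell_count y0)) ?sum_cell_count// => k _; rewrite ffunE.
Qed.

End Types.


Lemma measurable_lne_EFin (R : realType) (d : R -> R) : measurable_fun setT d ->
  measurable_fun setT (fun x => lne ((d x)%:E)).
Proof.
move=> md; rewrite (_ : (fun _ => _) = fun x => if 0 < d x then (ln (d x))%:E else -oo%E).
  apply: measurable_fun_ifT => //; first exact: measurable_fun_ltr.
  by apply/measurable_EFinP; exact: measurableT_comp (@measurable_ln R) md.
apply/funext => x; case: ltP => h; first by rewrite lne_EFin.
by rewrite le0_lneNy.
Qed.

(** * Empirical laws smoothed over cells *)

Section CellMixture.
Variable R : realType.
Local Notation leb := (@lebesgue_measure R).
Variables (I : finType) (b : pred I) (idx : I -> nat) (a w : R).
Hypotheses (w0 : 0 < w) (b0 : (0 < #|b|)%N).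
Let n : R := #|b|%:R.

Definition mixture_cell (i : I) : set R := `[a + w * (idx i)%:R, a + w * (idx i).+1%:R[%classic.

(** The average of the uniform laws on the cells of the sites of [b]: an empirical law smoothed at
    scale [w], which gives it a density. *)
Definition mixture_density (x : R) : R :=
  \sum_(i | b i) (n * w)^-1 * \1_(mixture_cell i) x.

Let n0 : 0 < n.
Proof. by rewrite ltr0n. Qed.

Let nw0 : 0 < n * w.
Proof. exact: mulr_gt0. Qed.

Lemma measurable_mixture_cell i : measurable (mixture_cell i).
Proof. exact: measurable_itv. Qed.

Lemma measurable_mixture_density : measurable_fun setT mixture_density.
Proof.
rewrite /mixture_density; under eq_fun do rewrite big_mkcond/=.
apply: measurable_sum => i; case: (b i) => //.
by apply: measurable_funM => //; apply: (@measurable_indic _ _ _ setT); exact: measurable_mixture_cell.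
Qed.

Lemma mixture_density_ge0 x : 0 <= mixture_density x.
Proof. by apply: sumr_ge0 => i _; rewrite mulr_ge0 ?invr_ge0 ?(ltW nw0)// indicE. Qed.

Lemma mixture_integral (f : R -> R) : (forall x, 0 <= f x) -> measurable_fun setT f ->
  (\int[leb]_x ((f x)%:E * (mixture_density x)%:E) =
   \sum_(i | b i) (n * w)^-1%:E * \int[leb]_(x in mixture_cell i) (f x)%:E)%E.
Proof.
move=> f0 mf.
transitivity (\int[leb]_x (\sum_(i <- index_enum I) (if b i then (n * w)^-1%:E * ((EFin \o f) \_ (mixture_cell i)) x else 0)))%E.
  apply: eq_integral => x _; rewrite -EFinM /mixture_density mulr_sumr -sumEFin big_mkcond.
  apply: eq_bigr => i _; case: (b i) => //.
  by rewrite patchE indicE; case: (x \in mixture_cell i); rewrite ?mulr1 ?mulr0 ?mule0//= mulrC EFinM.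
have mr i : measurable_fun setT ((EFin \o f) \_ (mixture_cell i)).
  apply/(measurable_restrictT _ (measurable_mixture_cell i)); apply: measurable_funTS.
  exact/measurable_EFinP.
have r0 i x : (0 <= ((EFin \o f) \_ (mixture_cell i)) x)%E.
  by rewrite patchE; case: ifP => //= _; rewrite lee_fin.
have nw1 : 0 <= (n * w)^-1 by rewrite invr_ge0 ltW.
rewrite ge0_integral_sum//.
- rewrite [RHS]big_mkcond; apply: eq_bigr => i _; case: (b i); last by rewrite integral0.
  rewrite ge0_integralZl//; last exact: mr.
  by rewrite -integral_mkcond.
- by move=> j; case: (b j) => //; apply: measurable_funeM; exact: mr.
- by move=> j x _; case: (b j) => //; rewrite mule_ge0// lee_fin.
Qed.

Lemma mixture_mass : (\int[leb]_x (mixture_density x)%:E = 1)%E.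
Proof.
have := @mixture_integral (fun=> 1) (fun=> ler01) (measurable_cst _).
under eq_integral do rewrite mul1e.
move=> ->; rewrite (eq_bigr (fun=> (n^-1)%:E)); last first.
  move=> i _; rewrite integral_cst ?mul1e; last exact: measurable_mixture_cell.
  rewrite [X in (_ * X)%E]lebesgue_cell ?(ltW w0)// -EFinM invfM -mulrA mulVf ?mulr1// lt0r_neq0//.
by rewrite sumEFin sumr_const -[X in X%:E]mulr_natr mulVf// lt0r_neq0.
Qed.

Definition cell_mixture : probR R :=
  density_law measurable_mixture_density mixture_density_ge0 mixture_mass.
Local Notation nu := cell_mixture.

Let cell_cst (i : I) (r : R) : (\int[leb]_(x in mixture_cell i) r%:E = (r * w)%:E)%E.
Proof.
rewrite integral_cst; last exact: measurable_mixture_cell.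
by rewrite [X in (_ * X)%E]lebesgue_cell ?(ltW w0).
Qed.

Let scale (r : R) : (n * w)^-1 * (r * w) = r / n.
Proof. by field; rewrite !lt0r_neq0. Qed.

Lemma cell_mixture_le (f : R -> R) (hi : I -> R) : (forall x, 0 <= f x) -> measurable_fun setT f ->
  (forall i x, b i -> mixture_cell i x -> f x <= hi i) ->
  (\int[nu]_x (f x)%:E <= ((\sum_(i | b i) hi i) / n)%:E)%E.
Proof.
move=> f0 mf H; rewrite (@density_law_change _ _ _ _ mixture_mass (EFin \o f)) //; last exact/measurable_EFinP.
rewrite mixture_integral// mulr_suml -sumEFin; apply: lee_sum => i bi.
rewrite -scale [leRHS]EFinM -(cell_cst i) lee_pmul2l ?lte_fin ?invr_gt0//.
apply: ge0_le_integral => //.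
- exact: measurable_mixture_cell.
- by move=> x _; rewrite lee_fin.
- by apply: measurable_funTS; exact/measurable_EFinP.
- by move=> x cx; rewrite lee_fin; exact: H.
Qed.

Lemma cell_mixture_ge (f : R -> R) (lo : I -> R) : (forall x, 0 <= f x) -> measurable_fun setT f ->
  (forall i x, b i -> mixture_cell i x -> lo i <= f x) ->
  (((\sum_(i | b i) lo i) / n)%:E <= \int[nu]_x (f x)%:E)%E.
Proof.
move=> f0 mf H; rewrite (@density_law_change _ _ _ _ mixture_mass (EFin \o f)) //; last exact/measurable_EFinP.
rewrite mixture_integral// mulr_suml -sumEFin; apply: lee_sum => i bi.
rewrite -scale [leLHS]EFinM lee_pmul2l ?lte_fin ?invr_gt0//.
apply: (@le_trans _ _ (Num.max (lo i) 0 * w)%:E).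
  by rewrite lee_fin ler_wpM2r ?(ltW w0)// le_max lexx.
rewrite -(cell_cst i); apply: ge0_le_integral => //.
- exact: measurable_mixture_cell.
- by move=> x _; rewrite lee_fin le_max lexx orbT.
- by apply: measurable_funTS; exact/measurable_EFinP.
- by move=> x cx; rewrite lee_fin ge_max f0 andbT; exact: H.
Qed.

Lemma cell_mixture_support (D : set R) : measurable D ->
  (forall i, b i -> mixture_cell i `<=` D) -> nu D = 1%E.
Proof.
move=> mD H; apply/eqP; rewrite eq_le probability_le1//=.
have <- : (\int[nu]_x (\1_D x)%:E = nu D)%E by rewrite integral_indic// setIT.
have -> : (1 = ((\sum_(i | b i) 1) / n)%:E :> \bar R)%E.
  by rewrite sumr_const divff// lt0r_neq0.
apply: cell_mixture_ge => [x||i x bi /(H i bi) Dx]; by rewrite ?indicE// mem_set.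
Qed.

Definition cell_mates (i : I) : nat := #|[pred j | b j && (idx j == idx i)]|.

Lemma mixture_cellP i j x : mixture_cell i x -> mixture_cell j x = (idx j == idx i) :> Prop.
Proof.
rewrite /mixture_cell /= !in_itv/= => /andP[i1 i2]; apply/propext; split=> [/andP[j1 j2]|/eqP ->]; last first.
  by rewrite i1.
have key k1 k2 : a + w * k1%:R <= x -> x < a + w * k2.+1%:R -> (k1 <= k2)%N.
  move=> x1 x2; have := le_lt_trans x1 x2.
  by rewrite ltrD2l ltr_pM2l// ltr_nat ltnS.
by rewrite eqn_leq (key _ _ j1 i2) (key _ _ i1 j2).
Qed.

Lemma mixture_densityE i x : mixture_cell i x -> mixture_density x = (cell_mates i)%:R / (n * w).
Proof.
move=> cx; rewrite /mixture_density /cell_mates -sum1_card natr_sum mulr_suml.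
rewrite big_mkcond [RHS]big_mkcond; apply: eq_bigr => j _; rewrite inE/=.
case: (b j) => //=; rewrite indicE.
have [e|e] := boolP (idx j == idx i).
  by rewrite mem_set ?mulr1 ?mul1r// (mixture_cellP j cx).
by rewrite memNset ?mulr0// (mixture_cellP j cx); exact/negP.
Qed.

Lemma cell_mates_gt0 i : b i -> (0 < cell_mates i)%N.
Proof. by move=> bi; apply/card_gt0P; exists i; rewrite inE bi eqxx. Qed.

(** The density is constant on each cell, so integrating its logarithm against the law is averaging
    over the sites. *)
Lemma cell_mixture_entropy :
  (entropy nu <= ((\sum_(i | b i) ln ((cell_mates i)%:R / (n * w))) / n)%:E)%E.
Proof.
set d := mixture_density; have md : measurable_fun setT d := measurable_mixture_density.
rewrite /cell_mixture (density_law_entropy measurable_mixture_density mixture_density_ge0 mixture_mass) -/d.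
(* On the support the density is at least 1 / (n w); adding [C] makes its logarithm nonnegative
   there, as [cell_mixture_le] requires. *)
pose C := `|ln (n * w)|; pose D := [set x | 0 < d x].
have mD : measurable D.
  have := measurable_fun_ltr (@measurable_cst _ _ _ _ setT (0 : R)) md.
  by move=> /(_ measurableT [set true] Logic.I); rewrite setTI.
have cD i : b i -> mixture_cell i `<=` D.
  move=> bi x cx; rewrite /D /= /d (mixture_densityE cx) divr_gt0// ltr0n; exact: cell_mates_gt0.
have dC x : D x -> 0 <= ln (d x) + C.
  move=> Dx; suff : - ln (n * w) <= ln (d x) by have := ler_norm (ln (n * w)); rewrite -/C; lra.
  rewrite -lnV ?posrE// ler_ln ?posrE ?invr_gt0//.
  have [i /andP[bi cx]] : exists i, b i && (x \in mixture_cell i).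
    apply/existsP; apply: contraT; rewrite negb_exists => /forallP no.
    move: Dx; rewrite /D /= /d /mixture_density big1 ?ltxx// => i bi.
    by move: (no i); rewrite bi/= indicE => /negbTE ->; rewrite mulr0.
  move: cx; rewrite inE => cx; rewrite /d (mixture_densityE cx).
  by rewrite ler_peMl ?invr_ge0 ?(ltW nw0)// ler1n cell_mates_gt0.
pose f x := (ln (d x) + C) * \1_D x.
have f0 x : 0 <= f x.
  rewrite /f indicE; have [Dx|nDx] := pselect (D x).
    by rewrite mem_set// mulr1 dC.
  by rewrite memNset// mulr0.
have mf : measurable_fun setT f.
  apply: measurable_funM; last exact: (@measurable_indic _ _ _ setT).
  by apply: measurable_funD => //; exact: measurableT_comp (@measurable_ln R) md.
have F := @cell_mixture_le f (fun i => ln ((cell_mates i)%:R / (n * w)) + C) f0 mf.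
have {}F : (\int[nu]_x (f x)%:E <= ((\sum_(i | b i) ln ((cell_mates i)%:R / (n * w))) / n + C)%:E)%E.
  apply: le_trans (F _) _.
    move=> i x bi cx; have Dx := cD i bi x cx.
    by rewrite /f indicE mem_set// mulr1 /d (mixture_densityE cx).
  by rewrite lee_fin big_split/= sumr_const -[C *+ _]mulr_natr mulrDl mulfK// lt0r_neq0.
have iF : nu.-integrable setT (EFin \o f).
  apply/integrableP; split; first exact/measurable_EFinP.
  under eq_integral do rewrite /= ger0_norm//.
  by apply: le_lt_trans F _; rewrite ltry.
have iC : nu.-integrable setT (EFin \o (fun=> C)) by apply: (@integrable_bounded _ nu _ `|C|).
apply: (@le_trans _ _ (\int[nu]_x ((f x)%:E - C%:E))%E); last first.
  have nT : (\int[nu]_x C%:E = C%:E)%E.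
    by rewrite integral_cst// [X in (_ * X)%E](@probability_setT _ _ _ nu) mule1.
  by rewrite integralB// nT leeBlDr// -EFinD.
apply: ae_le_integral_measurable.
- exact: measurable_lne_EFin.
- by apply: measurable_int (integrableB _ iF iC).
apply: (@filterS _ _ (ae_filter_ringOfSetsType nu)) (support_ae mD (cell_mixture_support mD cD)) => x Dx.
rewrite lne_EFin// /f indicE mem_set// mulr1 -EFinB lee_fin; lra.
Qed.

End CellMixture.


(** * Extraction of a configuration from the spherical integral *)

Section EnergyUpper.
Variable R : realType.
Variables (l : R -> R) (La B c : R).
Hypothesis lP : pair_potential l La B.
Hypotheses (La0 : 0 <= La) (c0 : 0 < c) (B0 : 0 <= B).

(** Sites outside the three classes are set to 0, at a Lipschitz cost proportional to their mass.
    Then [energy_class3] applies, and the pairs between P and Q, whose arguments are at least [M],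
    are linearised too. *)
Lemma energy_split_upper (N : nat) (u : 'I_N -> R) (P Q b : pred 'I_N) (e e1 dl M : R) :
  (0 < N)%N -> (forall i, 0 <= u i) -> \sum_i u i <= N%:R ->
  (forall i, P i -> ~~ Q i) -> (forall i, P i -> ~~ b i) -> (forall i, Q i -> ~~ b i) ->
  \sum_(i | ~~ [|| P i, Q i | b i]) u i <= e1 * N%:R -> 0 <= e -> 0 <= dl ->
  (forall x, 0 <= x <= dl -> `|l x - x / 2| <= e * x) ->
  (forall x, M <= x -> `|l x - B / 2 * x| <= e * x) ->
  (forall i j, b i -> b j -> c * u i * u j / N%:R <= dl) ->
  (forall i j, Q i -> b j -> c * u i * u j / N%:R <= dl) ->
  (forall i j, P i -> P j || Q j -> M <= c * u i * u j / N%:R) ->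
  forall so sQ sP, so = \sum_(i | b i) u i -> sQ = \sum_(i | Q i) u i -> sP = \sum_(i | P i) u i ->
  energy l c u <= c / N%:R * (so ^+ 2 / 4 + sQ * so / 2 + B / 4 * sP ^+ 2) +
    B / 2 * c / N%:R * sP * sQ +
    2^-1 * \sum_(i | Q i) \sum_(j | Q j) l (c * u i * u j / N%:R) +
    \sum_(i | b i) \sum_(j | P j) l (c * u j * u i / N%:R) + (La * c * e1 + 2 * e * c) * N%:R.
Proof.
move=> N0 u0 uN PQ Pb Qb We e0 dl0 ld lM hbb hQb hPP so sQ sP soE sQE sPE.
have Np : 0 < N%:R :> R by rewrite ltr0n.
pose F i := [|| P i, Q i | b i].
pose u' i := if F i then u i else 0.
have u'0 i : 0 <= u' i by rewrite /u'; case: ifP.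
have u'u i : F i -> u' i = u i by rewrite /u' => ->.
have FP i : P i -> F i by rewrite /F => ->.
have FQ i : Q i -> F i by rewrite /F => ->; rewrite orbT.
have Fb i : b i -> F i by rewrite /F => ->; rewrite !orbT.
have u'le i : u' i <= u i by rewrite /u'; case: ifP.
have u'N : \sum_i u' i <= N%:R by apply: le_trans uN; apply: ler_sum.
have Lc : 0 <= La * c by rewrite mulr_ge0// ltW.
have D : energy l c u - energy l c u' <= La * c * e1 * N%:R.
  apply: le_trans (ler_norm _) _; apply: le_trans (energy_diff lP La0 (ltW c0) u0 u'0) _.
  have -> : \sum_(i < N) `|u i - u' i| = \sum_(i | ~~ F i) u i.
    rewrite [RHS]big_mkcond; apply: eq_bigr => i _; rewrite /u'; case: (F i) => /=.
      by rewrite subrr normr0.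
    by rewrite subr0 ger0_norm.
  rewrite -[La * c * e1 * N%:R]mulrA; apply: ler_pM; [|exact: sumr_ge0| |exact: We].
    by apply: divr_ge0 => //; apply: mulr_ge0; [exact: divr_ge0|rewrite addr_ge0// sumr_ge0].
  rewrite ler_pdivrMr// -[La * c / 2 * _]mulrA ler_wpM2l//.
  by rewrite ler_pdivrMl//; lra.
have OE i : ~~ P i && ~~ Q i -> ~~ b i -> u' i = 0.
  by move=> /andP[p q] bi; rewrite /u' /F (negbTE p) (negbTE q) (negbTE bi).
have sumO (G : 'I_N -> R) : (forall i, ~~ b i -> ~~ P i && ~~ Q i -> G i = 0) ->
   \sum_(i | ~~ P i && ~~ Q i) G i = \sum_(i | b i) G i.
  move=> G0; rewrite big_mkcond [RHS]big_mkcond; apply: eq_bigr => i _.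
  have [bi|bi] := boolP (b i).
    have -> : ~~ P i by apply/negP => /Pb; rewrite bi.
    by have -> : ~~ Q i by apply/negP => /Qb; rewrite bi.
  by case: ifP => // /(G0 i bi).
have M0 := @energy_class3 R l B c (ltW c0) N P Q u' e dl M PQ u'0 e0 ld lM.
have z0 x : 0 * x = 0 :> R by rewrite mul0r.
have /M0 {}M0 : forall i j, ~~ P i && ~~ Q i -> ~~ P j && ~~ Q j -> c * u' i * u' j / N%:R <= dl.
  move=> i j Oi Oj; have [bi|/(OE i Oi) ->] := boolP (b i); last by rewrite mulr0 !mul0r.
  have [bj|/(OE j Oj) ->] := boolP (b j); last by rewrite mulr0 mul0r.
  by rewrite (u'u i (Fb i bi)) (u'u j (Fb j bj)); exact: hbb.
have /M0 {}M0 : forall i j, Q i -> ~~ P j && ~~ Q j -> c * u' i * u' j / N%:R <= dl.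
  move=> i j Qi Oj; have [bj|/(OE j Oj) ->] := boolP (b j); last by rewrite mulr0 mul0r.
  by rewrite (u'u i (FQ i Qi)) (u'u j (Fb j bj)); exact: hQb.
have /M0 {}M0 : forall i j, P i -> P j -> M <= c * u' i * u' j / N%:R.
  by move=> i j Pi Pj; rewrite !u'u ?FP//; apply: hPP => //; rewrite Pj.
have EP : \sum_(i | P i) u' i = sP by rewrite sPE; apply: eq_bigr => i /FP/u'u.
have EQ : \sum_(i | Q i) u' i = sQ by rewrite sQE; apply: eq_bigr => i /FQ/u'u.
have EO : \sum_(i | ~~ P i && ~~ Q i) u' i = so.
  by rewrite soE sumO => [|i bi Oi]; [apply: eq_bigr => i /Fb/u'u|exact: OE].
move: M0; rewrite EP EQ EO.
have -> : \sum_(i | ~~ P i && ~~ Q i) \sum_(j | P j) l (c * u' j * u' i / N%:R) =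
    \sum_(i | b i) \sum_(j | P j) l (c * u j * u i / N%:R).
  rewrite sumO => [|i bi Oi]; last first.
    by have [_ _ l0 _ _] := lP; apply: big1 => j _; rewrite (OE i Oi bi) mulr0 mul0r l0.
  by apply: eq_bigr => i bi; apply: eq_bigr => j Pj; rewrite (u'u i (Fb i bi)) (u'u j (FP j Pj)).
have -> : \sum_(i | Q i) \sum_(j | Q j) l (c * u' i * u' j / N%:R) =
    \sum_(i | Q i) \sum_(j | Q j) l (c * u i * u j / N%:R).
  by apply: eq_bigr => i Qi; apply: eq_bigr => j Qj; rewrite (u'u i (FQ i Qi)) (u'u j (FQ j Qj)).
have PQle : \sum_(i | P i) \sum_(j | Q j) l (c * u' i * u' j / N%:R) <= (B / 2 + e) * (c / N%:R * sP * sQ).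
  apply: (@le_trans _ _ (\sum_(i | P i) \sum_(j | Q j) (B / 2 + e) * (c * u i * u j / N%:R))).
    apply: ler_sum => i Pi; apply: ler_sum => j Qj; rewrite (u'u i (FP i Pi)) (u'u j (FQ j Qj)).
    have := lM _ (hPP i j Pi _); rewrite Qj orbT => /(_ isT)/ler_normlP[_]; lra.
  rewrite le_eqVlt; apply/orP; left; apply/eqP.
  rewrite [RHS](_ : _ = ((B / 2 + e) * (c / N%:R)) * (sP * sQ)); last by ring.
  rewrite sPE mulr_suml mulr_sumr; apply: eq_bigr => i _.
  by rewrite sQE !mulr_sumr; apply: eq_bigr => j _; ring.
have sP0 : 0 <= sP by rewrite sPE; apply: sumr_ge0.
have sQ0 : 0 <= sQ by rewrite sQE; apply: sumr_ge0.
have so0 : 0 <= so by rewrite soE; apply: sumr_ge0.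
have sS : sP + sQ + so <= N%:R.
  rewrite -EP -EQ -EO addrC; apply: le_trans u'N; rewrite (sum_class3 u' PQ).
  by rewrite le_eqVlt; apply/orP; left; apply/eqP; ring.
have E1 : e * (c / N%:R * sP * sQ) <= e * c * N%:R.
  rewrite -[e * c * N%:R]mulrA ler_wpM2l// -!mulrA ler_wpM2l ?(ltW c0)// ler_pdivrMl//.
  by apply: ler_pM => //; move: sP0 sQ0 so0 sS; clear -lP La0 c0 B0 => *; lra.
have E2 : e * c / 2 * (\sum_i u' i) ^+ 2 / N%:R <= e * c / 2 * N%:R.
  rewrite ler_pdivrMr// -[e * c / 2 * N%:R * N%:R]mulrA ler_wpM2l//.
    by rewrite divr_ge0// mulr_ge0// ltW.
  by rewrite -expr2 lerXn2r ?nnegrE ?sumr_ge0.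
have ec : 0 <= e * c * N%:R by rewrite !mulr_ge0 ?(ltW c0).
move/ler_normlP => [_]; move: PQle E1 E2 D ec.
rewrite (_ : B / 2 * c / N%:R * sP * sQ = B / 2 * (c / N%:R * sP * sQ)); last by ring.
set X1 := \sum_(i | P i) _; set X2 := \sum_(i | Q i) _; set X3 := \sum_(i | b i) _.
set Y := c / N%:R * (_ + _); set Z := c / N%:R * sP * sQ; set W := e * c / 2 * _ / _.
set A1 := energy l c u; set A2 := energy l c u'.
by clear; lra.
Qed.

End EnergyUpper.


Section ExtractArith.
Variable R : realType.

Lemma extract_quadratic (N c B so sQ sP a1 a2 a3 eta : R) : 0 < N -> 0 <= c -> 0 <= B ->
  0 <= so -> 0 <= sQ -> 0 <= sP -> a2 = sQ / N -> so / N <= a1 + eta -> sP / N <= a3 ->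
  0 <= a1 <= 1 -> a2 <= 1 -> 0 <= eta <= 1 ->
  c / N * (so ^+ 2 / 4 + sQ * so / 2 + B / 4 * sP ^+ 2) + B / 2 * c / N * sP * sQ <=
  N * (c / 4 * (a1 ^+ 2 + 2 * a1 * a2 + B * a3 ^+ 2) + B / 2 * c * a2 * a3 + 2 * c * eta).
Proof.
move=> N0 c0 B0 so0 sQ0 sP0 a2E oa pa /andP[a10 a11] a21 /andP[et0 et1].
pose o := so / N; pose p := sP / N.
have o0 : 0 <= o by rewrite divr_ge0// ltW.
have p0 : 0 <= p by rewrite divr_ge0// ltW.
have a20 : 0 <= a2 by rewrite a2E divr_ge0// ltW.
rewrite (_ : _ + _ = N * (c * (o ^+ 2 / 4 + a2 * o / 2 + B / 4 * p ^+ 2) + c * (B / 2 * (a2 * p)))); last first.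
  by rewrite a2E /o /p; field; rewrite lt0r_neq0.
rewrite ler_pM2l// (_ : c / 4 * _ + _ + _ = c * ((a1 ^+ 2 + 3 * eta) / 4 + (a1 * a2 + eta) / 2 + B / 4 * a3 ^+ 2) + c * (B / 2 * (a2 * a3)) + c * (3 / 4 * eta)); last by field.
have o2 : o ^+ 2 <= a1 ^+ 2 + 3 * eta.
  have : o ^+ 2 <= (a1 + eta) ^+ 2 by rewrite lerXn2r ?nnegrE ?addr_ge0.
  nra.
have ao : a2 * o <= a1 * a2 + eta.
  by have : a2 * o <= a2 * (a1 + eta); [rewrite ler_wpM2l|nra].
have p2 : B / 4 * p ^+ 2 <= B / 4 * a3 ^+ 2.
  by rewrite ler_wpM2l ?divr_ge0// lerXn2r ?nnegrE// (le_trans p0).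
have ap : c * (B / 2 * (a2 * p)) <= c * (B / 2 * (a2 * a3)).
  by rewrite ler_wpM2l// ler_wpM2l ?divr_ge0// ler_wpM2l.
have : 0 <= c * (3 / 4 * eta) by rewrite !mulr_ge0.
have : c * (o ^+ 2 / 4 + a2 * o / 2 + B / 4 * p ^+ 2) <= c * ((a1 ^+ 2 + 3 * eta) / 4 + (a1 * a2 + eta) / 2 + B / 4 * a3 ^+ 2).
  by rewrite ler_wpM2l//; lra.
lra.
Qed.

(** [cost] stands for the logarithm of cell volume over cell frequency. Over [b] it sums to at most
    - n times the averaged log-density plus n ln (N / n), and n ln (N / n) <= N - n. The remaining
    sites are a fraction at most [e2], at cost at most [Lg] each. *)
Lemma extract_entropy (I : finType) (b : pred I) (cost : I -> R) (n_ : I -> nat) (w Lg e2 : R) :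
  let N := #|I|%:R : R in let n := #|b|%:R : R in
  0 < n -> 0 < w <= 1 -> N - n <= e2 * N -> 0 <= Lg ->
  (forall i, b i -> (0 < n_ i <= #|b|)%N) ->
  (forall i, b i -> cost i <= ln (w * N / (n_ i)%:R)) -> (forall i, ~~ b i -> cost i <= Lg) ->
  \sum_i cost i <= N * (- ((\sum_(i | b i) ln ((n_ i)%:R / (n * w))) / n) + e2 * (ln w^-1 + Lg + 1)).
Proof.
move=> N n n0 /andP[w0 w1] Nn Lg0 nb cb cL; set H := _ / n.
have nN : n <= N by rewrite ler_nat max_card.
have N0 : 0 < N by exact: lt_le_trans nN.
have lw : 0 <= ln w^-1 by rewrite ln_ge0// invf_ge1.
have H1 : H <= ln w^-1.
  rewrite ler_pdivrMr// (_ : ln w^-1 * n = \sum_(i | b i) ln w^-1); last by rewrite sumr_const mulr_natr.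
  apply: ler_sum => i bi.
  have /andP[i1 i2] := nb i bi.
  have nw : 0 < n * w by exact: mulr_gt0.
  have q0 : 0 < (n_ i)%:R / (n * w) by rewrite divr_gt0// ltr0n.
  rewrite ler_ln ?posrE ?invr_gt0//.
  by rewrite ler_pdivrMr// mulrCA mulVf ?lt0r_neq0// mulr1 ler_nat.
have E : \sum_(i | b i) cost i <= - (n * H) + (N - n).
  apply: (@le_trans _ _ (\sum_(i | b i) (- ln ((n_ i)%:R / (n * w)) + (N / n - 1)))).
    apply: ler_sum => i bi; apply: le_trans (cb i bi) _.
    have /andP[i1 i2] := nb i bi; have i0 : 0 < (n_ i)%:R :> R by rewrite ltr0n.
    have -> : w * N / (n_ i)%:R = ((n_ i)%:R / (n * w))^-1 * (N / n).
      by field; rewrite !lt0r_neq0.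
    have nw : 0 < n * w by exact: mulr_gt0.
    have q0 : 0 < (n_ i)%:R / (n * w) by rewrite divr_gt0// ltr0n.
    have Nn0 : 0 < N / n by exact: divr_gt0.
    rewrite lnM ?posrE ?invr_gt0// lnV ?posrE// lerD2l.
    have := @expR_ge1Dx R (ln (N / n)); rewrite lnK ?posrE//; lra.
  rewrite big_split/= sumrN sumr_const -[_ *+ #|_|]mulr_natr /H.
  by rewrite le_eqVlt; apply/orP; left; apply/eqP; field; rewrite lt0r_neq0.
have F : \sum_(i | ~~ b i) cost i <= (N - n) * Lg.
  apply: (@le_trans _ _ (\sum_(i | ~~ b i) Lg)); first exact: ler_sum.
  rewrite sumr_const -[_ *+ _]mulr_natr mulrC ler_wpM2r//.
  rewrite /N /n -(cardC b) natrD addrC addKr ler_nat; apply: eq_leq; apply: eq_card => i.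
  by rewrite !inE.
rewrite (bigID b)/=; apply: le_trans (lerD E F) _.
have : (N - n) * H <= (N - n) * ln w^-1 by rewrite ler_wpM2l// subr_ge0.
have : (N - n) * (ln w^-1 + Lg + 1) <= e2 * N * (ln w^-1 + Lg + 1) by rewrite ler_wpM2r// !addr_ge0.
lra.
Qed.

Lemma sum_enum_val (N : nat) (A : pred 'I_N) (F : 'I_N -> R) :
  \sum_(j < #|A|) F (enum_val j) = \sum_(i | A i) F i.
Proof. by rewrite -(big_enum_val (op := +%R) F). Qed.

End ExtractArith.


Lemma cell_sqr (R : realType) (x y w : R) : `|y - x| <= w -> w <= 1 -> `|y ^+ 2 - x ^+ 2| <= w * (2 + x ^+ 2).
Proof.
move=> yx w1; have w0 : 0 <= w by apply: le_trans yx.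
rewrite subr_sqr normrM; apply: ler_pM => //.
have := sqr_ge0 (x - 1); have := sqr_ge0 (x + 1); move/ler_normlP: yx => [h1 h2].
rewrite ler_norml => ? ?; apply/andP; split; lra.
Qed.

Lemma extract_mass (R : realType) (N n so w e2 S rho : R) : 0 < N -> N - n <= e2 * N -> 0 <= e2 <= 1 / 2 ->
  n <= N -> 0 <= so <= N -> 0 <= w -> S = so + rho -> rho = w * (2 * n + so) ->
  [/\ 0 < n, rho / n <= 4 * w, so / N <= so / n & S / n <= so / N + 4 * w + 2 * e2].
Proof.
move=> N0 Nn /andP[e20 e22] nN /andP[so0 soN] w0 SE rE.
have h1 : e2 * N <= 1 / 2 * N by rewrite ler_wpM2r// ltW.
have n0 : 0 < n by lra.
have h2 : N <= 2 * n by lra.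
have r1 : rho / n <= 4 * w.
  rewrite ler_pdivrMr// rE; have : w * so <= w * (2 * n) by rewrite ler_wpM2l//; lra.
  lra.
have q1 : so / n <= so / N + 2 * e2.
  rewrite -lerBlDl (_ : so / n - so / N = so / n * ((N - n) / N)); last by field; rewrite !lt0r_neq0.
  apply: ler_pM; rewrite ?divr_ge0 ?subr_ge0 ?(ltW n0) ?(ltW N0)//.
    by rewrite ler_pdivrMr//; lra.
  by rewrite ler_pdivrMr.
split=> //; first by rewrite ler_wpM2l// lef_pV2 ?posrE.
by rewrite SE mulrDl; lra.
Qed.

Lemma final_arith (R : realType) (N X1 X2 q BP H W en cs qd bc er1 er2 er3 er4 er5 er6 : R) :
  X1 + X2 <= N * (qd + bc + er3) -> BP <= N * (W + H + er4) -> cs <= N * (- H + er5) ->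
  en <= X1 + X2 + N * q + BP + (er1 + er2) * N ->
  en + cs <= N * (qd + bc + q + W + (er1 + er2 + er3 + er4 + er5)).
Proof. by lra. Qed.

Section ExtractConfig.
Variable R : realType.
Variables (l : R -> R) (La B c : R).
Hypothesis lP : pair_potential l La B.
Hypotheses (La0 : 0 <= La) (c0 : 0 < c) (B0 : 0 <= B).

(** [transfer_value] without the constants - (1/2) ln (2 pi) - 1/2, and with c / 4 for theta^2. *)
Definition config_value (n0 : R) (k m : nat) (r : 'I_k -> R) (v : 'I_m -> R) (a1 W : R) : R :=
  c / 4 * (a1 ^+ 2 + 2 * a1 * (\sum_j v j) + B * (\sum_i r i) ^+ 2) +
  B / 2 * c * (\sum_j v j) * (\sum_i r i) +
  (2 * n0)^-1 * (\sum_i \sum_j l (c * n0 * v i * v j)) + W.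

Definition config (k m : nat) (r : 'I_k -> R) (v : 'I_m -> R) (nu : probR R) (Mb a1 W : R) : Prop :=
  [/\ [/\ forall i, 0 < r i, forall j, 0 < v j, 0 <= a1 & a1 + \sum_j v j + \sum_i r i = 1],
      nu [set x | `|x| <= Mb] = 1%E, (\int[nu]_x (x ^+ 2)%:E = a1%:E)%E
    & (W%:E <= \int[nu]_x (\sum_(i < k) l (c * r i * x ^+ 2))%:E - entropy nu)%E].

Section Fixed.
Variables (N : nat) (x cost : 'I_N -> R) (idx : 'I_N -> nat).
Variables (a w T G kap dl M e e1 e2 Lg k1 Mb : R).
Let u i := x i ^+ 2.
(** [b], [Q] and [P] are the bulk, middle and large sites, the window ]T, G T[ being left out. The
    threshold kap N / T is dual to T: middle times bulk is below kap N, and large times middle or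
    large is at least kap G N. *)
Let b : pred 'I_N := fun i => u i <= T.
Let Q : pred 'I_N := fun i => (G * T <= u i) && (u i < kap * N%:R / T).
Let P : pred 'I_N := fun i => kap * N%:R / T <= u i.
Hypotheses (N0 : (0 < N)%N) (w0 : 0 < w) (w4 : w <= 1 / 4) (T0 : 0 < T) (G1 : 1 < G).
Hypotheses (kap0 : 0 < kap) (GT : G * T <= kap * N%:R / T).
Hypotheses (bcell : forall i, b i -> mixture_cell idx a w i (x i))
  (bMb : forall i, b i -> mixture_cell idx a w i `<=` [set y | `|y| <= Mb]).
Hypotheses (costb : forall i, b i -> cost i <= ln (w * N%:R / (cell_mates b idx i)%:R))
  (costL : forall i, ~~ b i -> cost i <= Lg) (Lg0 : 0 <= Lg).
Hypotheses (uN : \sum_i u i <= k1 * N%:R) (k11 : k1 <= 1).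
Hypothesis We : \sum_(i | (T < u i) && (u i < G * T)) u i <= e1 * N%:R.
Hypotheses (e20 : 0 <= e2) (e22 : e2 <= 1 / 2) (nN : N%:R - #|b|%:R <= e2 * N%:R).
Hypotheses (e0 : 0 <= e) (dl0 : 0 <= dl).
Hypothesis ld : forall x, 0 <= x <= dl -> `|l x - x / 2| <= e * x.
Hypothesis lM : forall x, M <= x -> `|l x - B / 2 * x| <= e * x.
Hypotheses (TT : c * T ^+ 2 / N%:R <= dl) (ckap : c * kap <= dl) (M0 : M <= c * kap * G).
Hypothesis room : 4 * w + 2 * e2 < 1 - k1.

Ltac numeric := clear -lP La0 c0 B0 u b Q P cost N0 w0 w4 T0 G1 kap0 GT bcell bMb costb costL Lg0 uN k11 We e20 e22
  nN e0 dl0 ld lM TT ckap M0 room.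

(** The bulk becomes a cell mixture, while middle and large sites keep their relative masses u i /
    N. The window costs La c e1, the smoothing of the bulk terms proportional to [w], and the sites
    outside the bulk the term in [e2]. *)
Lemma extract_config : exists (k m : nat) (r : 'I_k -> R) (v : 'I_m -> R) (nu : probR R) (a1 W : R),
  config r v nu Mb a1 W /\
  energy l c u + \sum_i cost i <= N%:R * (config_value N%:R r v a1 W +
    (La * c * e1 + 2 * e * c + 8 * c * w + 4 * La * c * w + e2 * (ln w^-1 + Lg + 1))).
Proof.
move: (La0) (c0) (B0) (w0) (w4) (T0) (G1) (kap0) (e20) (e22) (k11) (room) => Lp cp Bp wp w4' Tp G1' kp e2p e22' k1' rm.
have c0' : 0 <= c by exact: ltW.
have Np : 0 < N%:R :> R by rewrite ltr0n.
have u0 i : 0 <= u i by exact: sqr_ge0.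
have TG : T < G * T by rewrite ltr_pMl.
have Pb i : P i -> ~~ b i by rewrite /P /b -ltNge => h; apply: lt_le_trans TG (le_trans GT h).
have Qb i : Q i -> ~~ b i by rewrite /Q /b -ltNge => /andP[h _]; apply: lt_le_trans TG h.
have PQ i : P i -> ~~ Q i by rewrite /P /Q negb_and -!leNgt => ->; rewrite orbT.
have uN1 : \sum_i u i <= N%:R by apply: le_trans uN _; rewrite ler_piMl// ltW.
pose so := \sum_(i | b i) u i; pose sQ := \sum_(i | Q i) u i; pose sP := \sum_(i | P i) u i.
have so0 : 0 <= so by apply: sumr_ge0.
have sQ0 : 0 <= sQ by apply: sumr_ge0.
have sP0 : 0 <= sP by apply: sumr_ge0.
have bO i : b i -> ~~ P i && ~~ Q i.
  by move=> bi; apply/andP; split; [apply/negP => /Pb|apply/negP => /Qb]; rewrite bi.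
have sS : so + sQ + sP <= k1 * N%:R.
  apply: le_trans uN; rewrite (sum_class3 u PQ) -/sP -/sQ.
  have : so <= \sum_(i | ~~ P i && ~~ Q i) u i.
    rewrite /so big_mkcond [leRHS]big_mkcond; apply: ler_sum => i _.
    by case: ifP => [/bO ->//|_]; case: ifP.
  by move=> h; rewrite -addrA [leRHS]addrC (addrC sP) lerD2r.
have k1N : k1 * N%:R <= N%:R by rewrite ler_piMl// ltW.
have soN : 0 <= so <= N%:R by rewrite so0; apply: le_trans k1N; apply: le_trans sS; rewrite -addrA lerDl addr_ge0.
pose n : R := #|b|%:R.
have nN' : n <= N%:R by rewrite ler_nat -[N in (_ <= N)%N]card_ord max_card.
pose rho i := w * (2 + u i).
have rhoE : \sum_(i | b i) rho i = w * (2 * n + so).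
  by rewrite /rho -mulr_sumr big_split/= sumr_const mulr_natr.
have e2h : 0 <= e2 <= 1 / 2 by rewrite e2p.
have [n0 rn so_n Sn] := extract_mass Np nN e2h nN' soN (ltW wp) erefl rhoE.
have b0 : (0 < #|b|)%N by rewrite -(ltr0n R).
pose nu := @cell_mixture R 'I_N b idx a w w0 b0.
have w1 : w <= 1 by move: w4; numeric => *; lra.
have cellsq i y : b i -> mixture_cell idx a w i y -> `|y ^+ 2 - u i| <= rho i.
  move=> bi cy; apply: cell_sqr => //.
  move: (bcell bi) cy; rewrite /mixture_cell /= !in_itv/= => /andP[x1 x2] /andP[y1 y2].
  move: x2 y2; rewrite -natr1 mulrDr mulr1 => x2 y2.
  by rewrite ler_norml; apply/andP; split; move: x1 x2 y1 y2; numeric => *; lra.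
have msq : measurable_fun setT (fun y : R => y ^+ 2) by apply: measurable_funX.
have sq0 (y : R) : 0 <= y ^+ 2 by exact: sqr_ge0.
have Ege : ((((\sum_(i | b i) (u i - rho i)) / n)%:E) <= \int[nu]_y (y ^+ 2)%:E)%E.
  by apply: cell_mixture_ge => // i y bi /(cellsq i y bi)/ler_normlP[]; numeric => *; lra.
have Ele : (\int[nu]_y (y ^+ 2)%:E <= ((\sum_(i | b i) (u i + rho i)) / n)%:E)%E.
  by apply: cell_mixture_le => // i y bi /(cellsq i y bi)/ler_normlP[_]; numeric => *; lra.
have Efin : (\int[nu]_y (y ^+ 2)%:E)%E \is a fin_num.
  rewrite ge0_fin_numE; first by apply: le_lt_trans Ele _; rewrite ltry.
  by apply: integral_ge0 => y _; rewrite lee_fin.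
pose a1 := fine (\int[nu]_y (y ^+ 2)%:E)%E.
have a1E : (\int[nu]_y (y ^+ 2)%:E = a1%:E)%E by rewrite fineK.
move: Ege Ele; rewrite a1E !lee_fin sumrB big_split/= mulrBl -/so => Ege Ele.
have a10 : 0 <= a1 by rewrite -lee_fin -a1E; apply: integral_ge0 => y _; rewrite lee_fin.
clearbody a1.
pose a2 := sQ / N%:R; pose p3 := sP / N%:R.
have a20 : 0 <= a2 by rewrite divr_ge0// ltW.
have p30 : 0 <= p3 by rewrite divr_ge0// ltW.
have k1E : so / N%:R + a2 + p3 <= k1 by rewrite -!mulrDl ler_pdivrMr.
(* Positive by [room]. Adding this mass as a large coordinate does not lower the value, since [l]
   and [B] are nonnegative. *)
pose rho0 := 1 - a1 - a2 - p3.
have rho00 : 0 < rho0 by rewrite /rho0; move: Ele Sn k1E rm; numeric => *; lra.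
(* Index 0 holds the spare mass. *)
pose r (i : 'I_(#|P|.+1)) : R := if unlift ord0 i is Some j then u (enum_val j) / N%:R else rho0.
have rF (F : R -> R) : \sum_i F (r i) = F rho0 + \sum_(i | P i) F (u i / N%:R).
  rewrite big_ord_recl {1}/r unlift_none; congr (_ + _).
  rewrite -(sum_enum_val P (fun i => F (u i / N%:R))); apply: eq_bigr => j _.
  by rewrite /r liftK.
pose v (j : 'I_#|Q|) : R := u (enum_val j) / N%:R.
have vS : \sum_j v j = a2.
  by rewrite /v (sum_enum_val Q (fun i => u i / N%:R)) -mulr_suml.
have rS : \sum_i r i = 1 - a1 - a2.
  by rewrite (rF id) -mulr_suml -/sP -/p3 /rho0; ring.
have GT0 : 0 < G * T by rewrite mulr_gt0//; apply: lt_trans G1'; exact: ltr01.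
have r_gt0 i : 0 < r i.
  rewrite /r; case: unliftP => [j _|_]//.
  rewrite divr_gt0//; have := enum_valP j; rewrite unfold_in /P => h.
  exact: lt_le_trans GT0 (le_trans GT h).
pose V := field l c P x.
have VE y : V y = \sum_(i | P i) l (c * (u i / N%:R) * y ^+ 2).
  by apply: eq_bigr => i _; congr l; rewrite /u; ring.
have Cf : La * c * (\sum_(j | P j) x j ^+ 2) / N%:R <= La * c.
  rewrite ler_pdivrMr//; apply: ler_wpM2l; first exact: mulr_ge0.
  by apply: le_trans k1N; apply: le_trans sS; rewrite -/sP lerDr addr_ge0.
have V0 y : 0 <= V y by have /andP[] := field_bound lP c0' P x y.
have mV : measurable_fun setT V.
  rewrite /V /field; under eq_fun do rewrite big_mkcond/=.
  apply: measurable_sum => j; case: (P j) => //.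
  apply: (measurable_potential_comp lP La0) => [y|].
    by rewrite divr_ge0// mulr_ge0 ?sqr_ge0// mulr_ge0 ?sqr_ge0.
  by apply: measurable_funM => //; apply: measurable_funM => //; apply: measurable_funX.
have VL i y : b i -> mixture_cell idx a w i y -> V (x i) - La * c * rho i <= V y.
  move=> bi cy; have := field_diff lP c0' P x (x i) y; rewrite -/V => D.
  have : `|V (x i) - V y| <= La * c * rho i.
    apply: le_trans D _; apply: ler_pM => //.
    - by rewrite divr_ge0// !mulr_ge0// sumr_ge0.
    - by rewrite distrC; exact: cellsq.
  by move/ler_normlP=> [_]; numeric => *; lra.
pose H : R := (\sum_(i | b i) ln ((cell_mates b idx i)%:R / (n * w))) / n.
(* A lower bound of the bulk functional: the field is taken at the sites, less its oscillation in a
   cell, and [H] bounds the entropy from above. *)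
pose W := (\sum_(i | b i) (V (x i) - La * c * rho i)) / n - H.
exists #|P|.+1, #|Q|, r, v, nu, a1, W; split.
  split.
  - split=> //.
    + move=> j; rewrite /v divr_gt0//; have := enum_valP j; rewrite unfold_in /Q => /andP[h _].
      exact: lt_le_trans GT0 h.
    + by rewrite vS rS; ring.
  - apply: cell_mixture_support => //.
    rewrite (_ : [set y | `|y| <= Mb] = `[- Mb, Mb]%classic); first exact: measurable_itv.
    by apply/seteqP; split=> y; rewrite /= in_itv/= ler_norml.
  - exact: a1E.
  - rewrite /W EFinB; apply: leeB; last exact: cell_mixture_entropy.
    apply: (@le_trans _ _ (\int[nu]_y (V y)%:E)%E).
      by apply: cell_mixture_ge => // i y; exact: VL.
    apply: ge0_le_integral => //.
    + by move=> y _; rewrite lee_fin.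
    + exact/measurable_EFinP.
    + apply/measurable_EFinP; apply: measurable_sum => i.
      apply: (measurable_potential_comp lP La0) => [y|]; last by apply: measurable_funM.
      by apply: mulr_ge0; [apply: mulr_ge0 => //; exact: ltW|exact: sq0].
    + move=> y _; rewrite lee_fin (rF (fun t => l (c * t * y ^+ 2))) -VE lerDr.
      have [l0 _ _ _ _] := lP; apply: l0; apply: mulr_ge0; last exact: sq0.
      by apply: mulr_ge0 => //; exact: ltW.
have We' : \sum_(i | ~~ [|| P i, Q i | b i]) u i <= e1 * N%:R.
  apply: le_trans We; rewrite le_eqVlt; apply/orP; left; apply/eqP; apply: eq_bigl => i.
  rewrite /P /Q /b !negb_or negb_and -!ltNge -leNgt.
  have [h1|h1] := ltP (u i) (G * T); have [h2|h2] := ltP (u i) (kap * N%:R / T); rewrite ?andbT ?andbF//=.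
    by move: (lt_le_trans h1 (le_trans GT h2)); rewrite ltxx.
have cle (y z Y Z : R) : 0 <= y -> 0 <= z -> y <= Y -> z <= Z -> c * y * z / N%:R <= c * Y * Z / N%:R.
  by move=> *; rewrite ler_wpM2r ?invr_ge0//; apply: mul3_le.
have hbb i j : b i -> b j -> c * u i * u j / N%:R <= dl.
  by move=> bi bj; apply: le_trans TT; rewrite expr2 mulrA; exact: cle.
have hQb i j : Q i -> b j -> c * u i * u j / N%:R <= dl.
  move=> /andP[_ Qi] bj; apply: le_trans ckap.
  have -> : c * kap = c * (kap * N%:R / T) * T / N%:R by field; rewrite !lt0r_neq0.
  by apply: cle => //; exact: ltW.
have hPP i j : P i -> P j || Q j -> M <= c * u i * u j / N%:R.
  move=> Pi Pj; apply: le_trans M0 _.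
  have -> : c * kap * G = c * (kap * N%:R / T) * (G * T) / N%:R by field; rewrite !lt0r_neq0.
  apply: cle => //; [|exact: ltW|].
    by rewrite divr_ge0 ?mulr_ge0// ltW.
  by case/orP: Pj => [|/andP[]//]; apply: le_trans.
have lE := @energy_split_upper R l La B c lP La0 c0 N u P Q b e e1 dl M N0 u0 uN1 PQ Pb Qb
  We' e0 dl0 ld lM hbb hQb hPP so sQ sP erefl erefl erefl.
have w41 : 0 <= 4 * w <= 1.
  by rewrite mulr_ge0 ?(ltW wp)//= mulrC -ler_pdivlMr.
have so_a : so / N%:R <= a1 + 4 * w by move: Ege so_n rn; numeric => *; lra.
have s3 : sP / N%:R <= 1 - a1 - a2 by move: rho00; rewrite /rho0 -/p3; numeric => *; lra.
have a11 : 0 <= a1 <= 1 by apply/andP; split=> //; move: rho00 a20 p30; rewrite /rho0; numeric => *; lra.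
have a21 : a2 <= 1 by move: rho00 a10 p30; rewrite /rho0; numeric => *; lra.
have qE := extract_quadratic Np c0' B0 so0 sQ0 sP0 (erefl a2) so_a s3 a11 a21 w41.
have cE : \sum_i cost i <= N%:R * (- H + e2 * (ln w^-1 + Lg + 1)).
  have w01 : 0 < w <= 1 by rewrite w0.
  have := @extract_entropy R 'I_N b cost (cell_mates b idx) w Lg e2.
  rewrite card_ord => /(_ n0 w01 nN Lg0 _ costb costL); apply.
  move=> i bi; rewrite cell_mates_gt0//=; apply: subset_leq_card.
  by apply/fintype.subsetP => j; rewrite inE => /andP[].
have BPE : \sum_(i | b i) \sum_(j | P j) l (c * u j * u i / N%:R) <= N%:R * (W + H + 4 * La * c * w).
  have -> : \sum_(i | b i) \sum_(j | P j) l (c * u j * u i / N%:R) = \sum_(i | b i) V (x i) by [].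
  set SV := \sum_(i | b i) V _; have SV0 : 0 <= SV by exact: sumr_ge0.
  have W1 : W + H = SV / n - La * c * (\sum_(i | b i) rho i / n).
    by rewrite /W subrK sumrB mulrBl -mulr_sumr -[in RHS]mulr_suml [in RHS]mulrA.
  have : La * c * (\sum_(i | b i) rho i / n) <= La * c * (4 * w).
    by rewrite ler_wpM2l ?mulr_ge0// -mulr_suml.
  move=> h; apply: (@le_trans _ _ (N%:R * (SV / n))); last first.
    by rewrite ler_wpM2l ?(ltW Np)// W1; move: h; numeric => *; lra.
  by rewrite mulrCA ler_peMr// ler_pdivlMr// mul1r.
have QQE : 2^-1 * \sum_(i | Q i) \sum_(j | Q j) l (c * u i * u j / N%:R) =
    N%:R * ((2 * N%:R)^-1 * (\sum_i \sum_j l (c * N%:R * v i * v j))).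
  rewrite mulrA (_ : N%:R * (2 * N%:R)^-1 = 2^-1); last by field; rewrite lt0r_neq0.
  congr (_ * _); rewrite -(sum_enum_val Q (fun i => \sum_(j | Q j) l (c * u i * u j / N%:R))).
  apply: eq_bigr => i _; rewrite -(sum_enum_val Q (fun j => l (c * u (enum_val i) * u j / N%:R))).
  apply: eq_bigr => j _; congr l; rewrite /v.
  by field; rewrite lt0r_neq0.
rewrite /config_value vS rS; move: lE; rewrite QQE.
set X1 := c / N%:R * (_ + _) in qE *; set X2 := B / 2 * c / N%:R * sP * sQ.
rewrite (_ : B / 2 * c / N%:R * sP * sQ = X2) in qE; last by [].
set q := (2 * N%:R)^-1 * _; set BP := \sum_(i | b i) _ in BPE *; set en := energy _ _ _.
rewrite (_ : 2 * c * (4 * w) = 8 * c * w) in qE; last by ring.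
move: qE BPE cE; clearbody X1 X2 q BP H W en.
exact: final_arith.
Qed.
End Fixed.
End ExtractConfig.


(** * Grouping lattice points into cells *)

Section LatticeCells.
Variable R : realType.
Variables (N p D : nat).
Hypotheses (N0 : (0 < N)%N) (D0 : (0 < D)%N) (pD : (p * D <= 4 * N ^ 4)%N).
Let h := lattice_step R N.
Let w : R := h * D%:R.
(** The index of the left end - p w of the inner cells; the lattice point of index 4 N^4 is 0. *)
Let k0 := (4 * N ^ 4 - p * D)%N.

(* 2p cells of D consecutive lattice points around the origin, and one cell for the rest. *)
Definition lattice_cell (k : 'I_(lattice_size N)) : 'I_(2 * p).+1 :=
  if (k0 <= k)%N && ((k - k0) %/ D < 2 * p)%N then inord ((k - k0) %/ D) else ord_max.

Lemma card_interval (L m : nat) : (#|[pred k : 'I_L | (m <= k < m + D)%N]| <= D)%N.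
Proof.
set A := [pred k : 'I_L | _]; rewrite cardE -(size_map val) -[leqRHS](size_iota m).
apply: uniq_leq_size; first by rewrite (map_inj_uniq val_inj) enum_uniq.
by move=> _ /mapP[k + ->]; rewrite mem_enum mem_iota inE.
Qed.

Lemma lattice_ptE (k : nat) : (k0 <= k)%N ->
  lattice_pt R N k = - (p%:R * w) + h * (k - k0)%:R.
Proof.
move=> kk; have -> : (k = k0 + (k - k0))%N by rewrite subnKC.
rewrite addKn /lattice_pt natrD /k0 natrB// natrM natrM natrX /w /h /lattice_step.
by field; rewrite pnatr_eq0 -lt0n.
Qed.

Lemma lattice_pt_inner (k : nat) : `|lattice_pt R N k| < p%:R * w ->
  (k0 <= k)%N /\ ((k - k0) %/ D < 2 * p)%N.
Proof.
have h0 : 0 < h by exact: lattice_step_gt0.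
have D0' : 0 < D%:R :> R by rewrite ltr0n.
have p0 : lattice_pt R N k0 = - (p%:R * w) by rewrite lattice_ptE// subnn mulr0 addr0.
rewrite ltr_norml => /andP[k1 k2].
have kk : (k0 <= k)%N.
  rewrite leqNgt; apply/negP => /ltnW kk; move: k1; rewrite -p0 /lattice_pt ltrD2l ltr_pM2l// ltr_nat.
  by rewrite ltnNge kk.
split=> //; rewrite ltn_divLR// -(ltr_nat R) !natrM.
move: k2; rewrite lattice_ptE// /w => k2.
rewrite -(ltr_pM2l h0); lra.
Qed.

Lemma lattice_cell_inner (k : 'I_(lattice_size N)) : `|lattice_pt R N k| < p%:R * w ->
  nat_of_ord (lattice_cell k) = ((k - k0) %/ D)%N.
Proof. by move=> /lattice_pt_inner[k1 k2]; rewrite /lattice_cell k1 k2 /= inordK// ltnS ltnW. Qed.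

Lemma cell_volume_inner (k : 'I_(lattice_size N)) : `|lattice_pt R N k| < p%:R * w ->
  cell_volume lattice_cell h (lattice_cell k) <= w.
Proof.
move=> kp; have [k1 k2] := lattice_pt_inner kp; have h0 : 0 < h by exact: lattice_step_gt0.
rewrite /cell_volume /w ler_pM2l// ler_nat; set c := ((k - k0) %/ D)%N.
apply: leq_trans (card_interval _ (k0 + c * D)); apply: subset_leq_card; apply/fintype.subsetP => j.
rewrite !inE => /eqP jk; have : nat_of_ord (lattice_cell j) = c by rewrite jk lattice_cell_inner.
rewrite /lattice_cell; case: ifP => [/andP[j1 j2]|_ /= cE]; last by move: k2; rewrite -/c -cE ltnn.
rewrite inordK ?ltnS ?(ltnW j2)// => jc.
rewrite -[X in (_ <= X)%N](subnKC j1) -[X in (X < _)%N](subnKC j1) leq_add2l -addnA ltn_add2l -jc.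
by rewrite leq_trunc_div/= -mulSnr ltn_ceil.
Qed.

Lemma cell_volume_le (k : 'I_(2 * p).+1) : cell_volume lattice_cell h k <= 8 * N%:R.
Proof.
have h0 : 0 < h by exact: lattice_step_gt0.
rewrite -(@lattice_span R N)// /cell_volume ler_pM2l// ler_nat.
by rewrite -[leqRHS]card_ord max_card.
Qed.

Definition cell_index (k : nat) : nat := ((k - k0) %/ D)%N.

Lemma inner_cell (k : nat) : `|lattice_pt R N k| < p%:R * w ->
  - (p%:R * w) + w * (cell_index k)%:R <= lattice_pt R N k < - (p%:R * w) + w * (cell_index k).+1%:R.
Proof.
move=> /lattice_pt_inner[k1 k2]; have h0 : 0 < h by exact: lattice_step_gt0.
rewrite lattice_ptE// lerD2l ltrD2l /w -!mulrA ler_pM2l// ltr_pM2l// -!natrM ler_nat ltr_nat.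
by rewrite /cell_index mulnC leq_trunc_div mulnC ltn_ceil.
Qed.

Lemma inner_cell_bound (k : nat) (x : R) : (cell_index k < 2 * p)%N ->
  - (p%:R * w) + w * (cell_index k)%:R <= x < - (p%:R * w) + w * (cell_index k).+1%:R ->
  `|x| <= p%:R * w.
Proof.
move=> kp /andP[x1 x2]; have h0 : 0 < h by exact: lattice_step_gt0.
have w0 : 0 < w by rewrite mulr_gt0// ltr0n.
have i0 : 0 <= w * (cell_index k)%:R by rewrite mulr_ge0// ltW.
have i1 : w * (cell_index k).+1%:R <= w * (2 * p%:R) by rewrite ler_pM2l// -natrM ler_nat.
by rewrite ler_norml; apply/andP; split; lra.
Qed.

End LatticeCells.

Section ExtractLattice.
Variable R : realType.
Variables (l : R -> R) (La B c : R).
Hypothesis lP : pair_potential l La B.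
Hypotheses (La0 : 0 <= La) (c0 : 0 < c) (B0 : 0 <= B).

(** [cost] is the logarithm of the factor of a site in [types_bound]. A bulk site lies in a cell of
    volume at most [w] that contains all its [cell_mates]; any other site costs at most ln (8 N^2),
    the whole lattice having length 8 N. *)
Lemma extract_lattice (N p D : nat) (y : lattice_vec N) (T G kap dl M e e1 e2 k1 w : R) :
  (0 < N)%N -> (0 < D)%N -> (p * D <= 4 * N ^ 4)%N -> w = lattice_step R N * D%:R -> w <= 1 / 4 ->
  1 <= T -> T < p%:R * w -> 1 < G -> 0 < kap -> G * T <= kap * N%:R / T ->
  sqnorm (coords R y) <= k1 * N%:R -> k1 <= 1 ->
  \sum_(i | (T < coords R y i ^+ 2) && (coords R y i ^+ 2 < G * T)) coords R y i ^+ 2 <= e1 * N%:R ->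
  T^-1 <= e2 -> e2 <= 1 / 2 -> 0 <= e -> 0 <= dl ->
  (forall x, 0 <= x <= dl -> `|l x - x / 2| <= e * x) ->
  (forall x, M <= x -> `|l x - B / 2 * x| <= e * x) ->
  c * T ^+ 2 / N%:R <= dl -> c * kap <= dl -> M <= c * kap * G -> 4 * w + 2 * e2 < 1 - k1 ->
  let kp := @lattice_cell N p D in
  exists (k m : nat) (r : 'I_k -> R) (v : 'I_m -> R) (nu : probR R) (a1 W : R),
  config l c r v nu (p%:R * w) a1 W /\
  expR (energy l c (fun i => coords R y i ^+ 2)) *
    \prod_i (cell_volume kp (lattice_step R N) (kp (y i)) * N%:R / (cell_count kp y (kp (y i)))%:R) <=
  expR (N%:R * (config_value l B c N%:R r v a1 W +
    (La * c * e1 + 2 * e * c + 8 * c * w + 4 * La * c * w + e2 * (ln w^-1 + ln (8 * N%:R ^+ 2) + 1)))).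
Proof.
move=> N0 D0 pD wE w4 T1 Tpw G1 kap0 GT yk k11 We Te e2h e0 dl0 ld lM TT ck MG room kp.
pose x := coords R y; pose b : pred 'I_N := fun i => x i ^+ 2 <= T.
pose h := lattice_step R N; have h0 : 0 < h by exact: lattice_step_gt0.
have Np : 0 < N%:R :> R by rewrite ltr0n.
have N1 : 1 <= N%:R :> R by rewrite ler1n.
have w0 : 0 < w by rewrite wE mulr_gt0// ltr0n.
have T0 : 0 < T by lra.
pose idx (i : 'I_N) := cell_index N p D (y i).
pose cost i := ln (cell_volume kp h (kp (y i)) * N%:R / (cell_count kp y (kp (y i)))%:R).
have inner i : b i -> `|lattice_pt R N (y i)| < p%:R * (h * D%:R).
  move=> bi; rewrite -wE; apply: le_lt_trans Tpw.
  have [x1|x1] := leP `|x i| 1; first by apply: le_trans x1 T1.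
  apply: le_trans bi; rewrite -(real_normK (num_real (x i))) expr2 ler_peMl//; exact: ltW.
have inn i : b i -> (cell_index N p D (y i) < 2 * p)%N by move=> /inner /(lattice_pt_inner N0 D0 pD)[].
have volp i : 0 < cell_volume kp h (kp (y i)) by exact: cell_volume_gt0.
have cntp i : 0 < (cell_count kp y (kp (y i)))%:R :> R by rewrite ltr0n cell_count_gt0.
have cost_pos i : 0 < cell_volume kp h (kp (y i)) * N%:R / (cell_count kp y (kp (y i)))%:R.
  by rewrite divr_gt0// mulr_gt0.
have bcell i : b i -> mixture_cell idx (- (p%:R * w)) w i (x i).
  move=> /inner /(inner_cell N0 D0 pD); rewrite -wE => H.
  by rewrite /mixture_cell /= in_itv.
have bMb i : b i -> mixture_cell idx (- (p%:R * w)) w i `<=` [set z | `|z| <= p%:R * w].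
  move=> bi z; rewrite /mixture_cell /= in_itv/= wE; exact: (inner_cell_bound N0 D0 (inn i bi)).
have costb i : b i -> cost i <= ln (w * N%:R / (cell_mates b idx i)%:R).
  move=> bi; have m0 : 0 < (cell_mates b idx i)%:R :> R by rewrite ltr0n cell_mates_gt0.
  rewrite ler_ln ?posrE//; last by rewrite divr_gt0// mulr_gt0.
  apply: ler_pM.
  - by apply: mulr_ge0; exact: ltW.
  - by rewrite invr_ge0 ltW.
  - by apply: ler_wpM2r; [exact: ltW|rewrite wE; apply: cell_volume_inner => //; exact: inner].
  - rewrite lef_pV2 ?posrE// ler_nat; apply: subset_leq_card; apply/fintype.subsetP => j.
  rewrite !inE => /andP[bj /eqP ij]; apply/eqP/val_inj.
  rewrite /= (lattice_cell_inner N0 D0 pD (inner j bj)) (lattice_cell_inner N0 D0 pD (inner i bi)).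
  exact: ij.
have costL i : ~~ b i -> cost i <= ln (8 * N%:R ^+ 2).
  move=> _; rewrite ler_ln ?posrE//; last by rewrite mulr_gt0// exprn_gt0.
  rewrite ler_pdivrMr// (_ : 8 * N%:R ^+ 2 * _ = 8 * N%:R * (N%:R * (cell_count kp y (kp (y i)))%:R)); last by ring.
  apply: ler_pM; rewrite ?(ltW (volp i)) ?(ltW Np)//; first exact: cell_volume_le.
  by rewrite ler_peMr ?(ltW Np)// ler1n cell_count_gt0.
have Lg0 : 0 <= ln (8 * N%:R ^+ 2) :> R.
  by rewrite ln_ge0//; have : 1 <= N%:R ^+ 2 :> R; [exact: exprn_ege1|lra].
have e20 : 0 <= e2 by apply: le_trans Te; rewrite invr_ge0 ltW.
(* Markov: at most N / T sites have squared coordinate above T. *)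
have nN : N%:R - #|b|%:R <= e2 * N%:R :> R.
  have yN : sqnorm x <= N%:R by apply: le_trans yk _; rewrite ler_piMl// ltW.
  have E : N%:R - #|b|%:R = (#|[pred i | ~~ b i]|)%:R :> R.
    rewrite -[N in N%:R - _]card_ord -(cardC b) natrD addrC addKr.
    by congr (_%:R); apply: eq_card => i; rewrite !inE.
  rewrite E; apply: (@le_trans _ _ (T^-1 * N%:R)); last by rewrite ler_wpM2r// ltW.
  rewrite ler_pdivlMl//; apply: le_trans yN.
  rewrite /sqnorm (bigID b)/= ler_wpDl ?sumr_ge0//; first by move=> i _; exact: sqr_ge0.
  rewrite mulrC mulr_natl -sumr_const; apply: ler_sum => i.
  by rewrite inE /b -ltNge => /ltW.
have [k [m [r [v [nu [a1 [W [cf H]]]]]]]] := extract_config lP La0 c0 B0 N0 w0 w4 T0 G1 kap0 GT bcell bMb costb costL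
  Lg0 yk k11 We e20 e2h nN e0 dl0 ld lM TT ck MG room.
exists k, m, r, v, nu, a1, W; split=> //.
have -> : \prod_i (cell_volume kp (lattice_step R N) (kp (y i)) * N%:R / (cell_count kp y (kp (y i)))%:R) =
   expR (\sum_i cost i).
  by rewrite expR_sumr; apply: eq_bigr => i _; rewrite /cost lnK// posrE.
by rewrite -expRD ler_expR.
Qed.

End ExtractLattice.


Section Windows.
Variable R : realType.

(* The windows are disjoint, so one of them carries at most the average mass. *)
Lemma light_window (N J : nat) (u : 'I_N -> R) (G T S : R) : (0 < J)%N -> 1 < G -> 0 < T ->
  (forall i, 0 <= u i) -> \sum_i u i <= S ->
  exists2 j : nat, (j < J)%N &
    \sum_(i | (G ^+ j * T < u i) && (u i < G * (G ^+ j * T))) u i <= J%:R^-1 * S.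
Proof.
move=> J0 G1 T0 u0 uS; apply: contrapT => no.
have G0 : 0 < G by lra.
have Jp : 0 < J%:R :> R by rewrite ltr0n.
pose win (j : 'I_J) i := (G ^+ j * T < u i) && (u i < G * (G ^+ j * T)).
have H (j : 'I_J) : J%:R^-1 * S < \sum_(i | win j i) u i.
  by rewrite ltNge; apply/negP => h; apply: no; exists (nat_of_ord j).
have order j j' i : win j i -> win j' i -> (j <= j')%N.
  move=> /andP[h1 _] /andP[_ h2]; move: (lt_trans h1 h2).
  by rewrite mulrA -exprS ltr_pM2r// ltr_eXn2l// ltnS.
have : \sum_(j < J) J%:R^-1 * S < \sum_(j < J) \sum_(i | win j i) u i.
  apply: ltr_sum => //; apply/hasP; exists (Ordinal J0) => //; exact: mem_index_enum.
rewrite sumr_const card_ord -[_ *+ J]mulr_natl mulrA divff ?lt0r_neq0// mul1r ltNge => /negP; apply.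
apply: le_trans uS; rewrite (eq_bigr (fun j => \sum_i (if win j i then u i else 0))); last first.
  by move=> j _; rewrite big_mkcond.
rewrite exchange_big/=; apply: ler_sum => i _.
have [j0 wj0|no0] := pickP (fun j => win j i); last first.
  by rewrite big1 // => j _; rewrite no0.
rewrite (bigD1 j0)//= wj0 big1 ?addr0// => j jj0; case: ifP => // wj.
case/negP: jj0; apply/eqP/val_inj/eqP; rewrite eqn_leq.
by rewrite (order _ _ _ wj wj0) (order _ _ _ wj0 wj).
Qed.

End Windows.

Section Extract.
Variable R : realType.
Variables (l : R -> R) (La B c : R).
Hypothesis lP : pair_potential l La B.
Hypotheses (La0 : 0 <= La) (c0 : 0 < c) (B0 : 0 <= B).
Local Notation sq_energy := (fun y => energy l c (fun i => y i ^+ 2)).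

Lemma sphere_exp_ge1 N (U : probability (N.-tuple (measurableTypeR R)) R) : (0 < N)%N ->
  uniform_on_sphere U -> 1 <= sphere_exp U sq_energy.
Proof.
move=> N0 Uu.
rewrite -[leLHS](sphere_mean_cst Uu (@ler01 R)); apply: sphere_mean_le => //.
- by split=> [|e|]; [exact: measurable_cst|exact: ler01|exists 1].
- exact: (sphere_bounded_exp (Phi := sq_energy) (@measurable_sq_energy _ _ _ _ _ lP La0 c0 N) (@energy_regular _ _ _ _ _ lP La0 (ltW c0) N)).
move=> e _; rewrite -[leLHS]expR0 ler_expR.
by apply: (energy_ge0 lP (ltW c0)) => i; exact: sqr_ge0.
Qed.

Lemma ln_le_quartic (q NN : R) : NN = q ^+ 4 -> 1 <= q -> ln NN <= 4 * q /\ ln NN <= 8 * Num.sqrt q.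
Proof.
move=> -> q1; have q0 : 0 < q by lra.
have ll (x : R) : 0 < x -> ln x <= x.
  by move=> x0; have := @expR_ge1Dx R (ln x); rewrite lnK ?posrE//; lra.
rewrite lnXn// -[ln q *+ 4]mulr_natl; split; first by rewrite ler_wpM2l//; exact: ll.
have s0 : 0 < Num.sqrt q by rewrite sqrtr_gt0.
rewrite -{1}[q]sqr_sqrtr ?(ltW q0)// lnXn// -[ln _ *+ 2]mulr_natl mulrA -natrM.
by rewrite ler_wpM2l//; exact: ll.
Qed.

(** With q = N^(1/4), at most a fraction 1 / q of the sites is outside the bulk. Each costs O(log
    N), and log N <= 8 sqrt q. *)
Lemma cell_entropy_error (q NN om w e : R) : NN = q ^+ 4 -> 1 <= q -> 0 < e -> 0 < w -> w^-1 <= 2 * om ->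
  (2 * om + 9) * (2 / e) <= q -> (32 / e) ^+ 2 <= q ->
  q^-1 * (ln w^-1 + ln (8 * NN ^+ 2) + 1) <= e.
Proof.
move=> NE q1 e0 w0 wo h1 h2; have q0 : 0 < q by lra.
have NN0 : 0 < NN by rewrite NE exprn_gt0.
have [_ lN] := ln_le_quartic NE q1.
have ll (x : R) : 0 < x -> ln x <= x.
  by move=> x0; have := @expR_ge1Dx R (ln x); rewrite lnK ?posrE//; lra.
have lw : ln w^-1 <= 2 * om by apply: le_trans wo; apply: ll; rewrite invr_gt0.
have l8 : ln 8 <= 8 :> R by exact: ll.
rewrite lnM ?posrE ?exprn_gt0// lnXn// -[ln NN *+ 2]mulr_natl.
rewrite ler_pdivrMl//; set s := Num.sqrt q in lN.
have s0 : 0 < s by rewrite sqrtr_gt0.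
have qs : q = s * s by rewrite -expr2 sqr_sqrtr// ltW.
have s32 : 32 / e <= s.
  rewrite -(@ler_pXn2r _ 2) ?nnegrE ?divr_ge0 ?(ltW s0) ?(ltW e0)//.
  by rewrite [leRHS]expr2 -qs.
have : 32 * s <= e * q.
  by rewrite qs mulrA ler_wpM2r ?(ltW s0)// mulrC -ler_pdivrMr.
have : 2 * (2 * om + 9) <= q * e.
  by rewrite -ler_pdivrMr// -mulrA mulrCA.
lra.
Qed.

Lemma succ_le_expR (N : nat) (q : R) : (0 < N)%N -> 1 <= q -> ln N%:R <= 4 * q -> N.+1%:R <= expR (5 * q).
Proof.
move=> N0 q1 lN; have N1 : 1 <= N%:R :> R by rewrite ler1n.
have Np : 0 < N%:R :> R by lra.
have e2 : 2 <= expR q by have := @expR_ge1Dx R q; lra.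
rewrite -natr1 (_ : 5 * q = q + 4 * q); last by ring.
have : 2 * N%:R <= expR q * expR (4 * q).
  by apply: ler_pM => //; rewrite -[leLHS](@lnK R) ?posrE// ler_expR.
rewrite expRD; lra.
Qed.

(** Cells of N^3 / om lattice points have width 1 / om up to a factor 2 whatever N is: the lattice
    refines while the cells stay. *)
Lemma cell_width (N om : nat) : (0 < N)%N -> (0 < om)%N -> 2 * om%:R <= N%:R :> R ->
  (2 * om%:R)^-1 <= lattice_step R N * (N ^ 3 %/ om)%:R <= om%:R^-1.
Proof.
move=> N0 o0 h; have om0 : 0 < om%:R :> R by rewrite ltr0n.
have Np : 1 <= N%:R :> R by rewrite ler1n.
have N3 : 0 < N%:R ^+ 3 :> R by rewrite exprn_gt0// ltr0n.
have d1 : (N ^ 3 %/ om)%:R * om%:R <= N%:R ^+ 3 :> R by rewrite -natrM -natrX ler_nat leq_trunc_div.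
have d2 : N%:R ^+ 3 <= ((N ^ 3 %/ om)%:R + 1) * om%:R :> R.
  by rewrite natr1 -natrM -natrX ler_nat ltnW// ltn_ceil.
have d3 : N%:R <= N%:R ^+ 3 :> R by rewrite exprS ler_peMr ?ler0n// exprn_ege1.
rewrite /lattice_step; apply/andP; split.
  rewrite ler_pdivlMl// ler_pdivrMr ?mulr_gt0//; lra.
by rewrite ler_pdivrMl// ler_pdivlMr.
Qed.

(** For [t] of order N^(1/4) there are O(N^(1/4)) cells, so the bound (N + 1)^(2 p + 1) on the
    number of types is exp (o(N)). *)
Lemma cell_number (N om : nat) (t : R) : (0 < N)%N -> (0 < om)%N -> 2 * om%:R <= N%:R :> R -> 1 <= t <= N%:R ->
  let D := (N ^ 3 %/ om)%N in let p := (Num.truncn (2 * om%:R * t)).+1 in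
  [/\ t < p%:R * (lattice_step R N * D%:R), (p * D <= 4 * N ^ 4)%N & (2 * p).+1%:R <= 9 * om%:R * t].
Proof.
move=> N0 o0 h /andP[t1 tN] D p; have om1 : 1 <= om%:R :> R by rewrite ler1n.
have /andP[w1 w2] := cell_width N0 o0 h.
have x0 : 0 <= 2 * om%:R * t by rewrite !mulr_ge0//; lra.
have p1 : 2 * om%:R * t < p%:R by exact: truncnS_gt.
have p2 : p%:R <= 2 * om%:R * t + 1.
  by rewrite /p -natr1 lerD2r; have /andP[] := truncn_itv x0.
have ot : 1 <= om%:R * t by apply: le_trans om1 _; rewrite ler_peMr ?ler0n.
split.
- apply: (@lt_le_trans _ _ (p%:R * (2 * om%:R)^-1)); last by rewrite ler_wpM2l.
  by rewrite ltr_pdivlMr ?mulr_gt0//; lra.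
- rewrite -(ler_nat R) natrM [leRHS]natrM natrX.
  have d1 : D%:R * om%:R <= N%:R ^+ 3 :> R by rewrite -natrM -natrX ler_nat leq_trunc_div.
  apply: (@le_trans _ _ (4 * om%:R * t * D%:R)); first by rewrite ler_wpM2r//; lra.
  rewrite (_ : 4 * om%:R * t * D%:R = 4 * (t * (D%:R * om%:R))); last by ring.
  rewrite ler_wpM2l// exprS; apply: ler_pM => //; lra.
- by rewrite -natr1 natrM; lra.
Qed.

Lemma ln_chain (S a X M g m : R) : 0 < S -> S <= expR a * X -> X <= M * expR g -> M <= expR m ->
  ln S <= a + m + g.
Proof.
move=> S0 H1 H2 H3; rewrite -ler_expR lnK ?posrE//; apply: le_trans H1 _.
rewrite -addrA expRD ler_wpM2l ?expR_ge0//; apply: le_trans H2 _.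
by rewrite expRD ler_wpM2r ?expR_ge0.
Qed.

Lemma extract_contradiction (NN lS S v0 eps e V err : R) : 0 < NN -> S = NN / 2 * (v0 + 1) ->
  V = NN^-1 * lS + 2^-1 * v0 + 2^-1 - eps -> err <= 4 * e -> eps = 20 * e -> 0 < e ->
  lS <= - S + e * NN + e * NN + NN * (V + err) -> False.
Proof.
move=> N0 -> -> er -> e0.
have -> : NN * (NN^-1 * lS + 2^-1 * v0 + 2^-1 - 20 * e + err) = lS + NN / 2 * (v0 + 1) - 20 * (NN * e) + NN * err.
  by field; rewrite lt0r_neq0.
have : NN * err <= NN * (4 * e) by rewrite ler_wpM2l// ltW.
have : 0 < NN * e by rewrite mulr_gt0.
lra.
Qed.

(** By contradiction: if every configuration had a smaller value, [extract_lattice] would bound each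
    type-weighted term, [types_bound] the whole lattice sum, and by [sphere_upper] the free energy
    would fall below itself. *)
Lemma extract (eps : R) : 0 < eps -> \forall N \near \oo,
  forall (U : probability (N.-tuple (measurableTypeR R)) R), uniform_on_sphere U ->
  exists (k m : nat) (r : 'I_k -> R) (v : 'I_m -> R) (nu : probR R) (Mb a1 W : R),
  config l c r v nu Mb a1 W /\
  N%:R^-1 * ln (sphere_exp U sq_energy) + 2^-1 * ln (2 * pi) + 2^-1 - eps <=
    config_value l B c N%:R r v a1 W.
Proof.
move=> eps0; move: (La0) (c0) (B0) => Lp cp Bp.
pose e := eps / 20; have ep : 0 < e by rewrite divr_gt0.
pose ee := e / (2 * c); have eep : 0 < ee by rewrite divr_gt0// mulr_gt0.
have [_ _ _ /(_ _ eep)[dl dl0 ld] /(_ _ eep)[M M0 lM]] := lP.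
have C9 : 0 <= 9 * La * c by rewrite !mulr_ge0// ltW.
have [sk [sr [sr0 sk1 _ SU]]] := sphere_upper C9 ep.
pose k1 := sk + sr; have k11 : k1 < 1 by [].
(* [kap] satisfies c kap = dl, and [G] makes c kap G = dl + M. *)
pose kap := dl / c; have kap0 : 0 < kap by rewrite divr_gt0.
pose G := 1 + M / dl; have G1 : 1 < G by rewrite ltrDl divr_gt0.
have MG : M <= c * kap * G.
  rewrite /kap mulrCA divff ?lt0r_neq0// mulr1 /G mulrDr mulr1 mulrCA divff ?lt0r_neq0// mulr1; move: dl0; clear -lP La0 c0 B0 => *; lra.
have ck : c * kap <= dl by rewrite /kap mulrCA divff ?lt0r_neq0// mulr1.
(* The cell width is at most 1 / om: below 1 / 4, small against the errors proportional to [w], and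
   using at most a quarter of the room 1 - k1. *)
pose X := 4 + (8 * c + 4 * La * c) / e + 16 / (1 - k1).
have k1p : 0 < 1 - k1 by rewrite subr_gt0.
have X1 : 0 <= (8 * c + 4 * La * c) / e by rewrite divr_ge0 ?(ltW ep)// addr_ge0 ?mulr_ge0 ?(ltW c0).
have X2 : 0 <= 16 / (1 - k1) by rewrite divr_ge0// ltW.
pose om := (Num.truncn X).+1; have omX : X <= om%:R by exact/ltW/truncnS_gt.
have om0 : 0 < om%:R :> R by rewrite ltr0n.
have om4 : om%:R^-1 <= 1 / 4 :> R by rewrite div1r lef_pV2 ?posrE//; move: omX X1 X2; rewrite /X; clear -lP La0 c0 B0 => *; lra.
have ome : (8 * c + 4 * La * c) * om%:R^-1 <= e.
  by rewrite ler_pdivrMr// (mulrC e) -ler_pdivrMr//; move: omX X1 X2; rewrite /X; clear -lP La0 c0 B0 => *; lra.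
have omk : 4 * om%:R^-1 <= (1 - k1) / 4.
  have : 16 / (1 - k1) <= om%:R by move: omX X1 X2; rewrite /X; clear -lP La0 c0 B0 => *; lra.
  rewrite ler_pdivrMr// => h; rewrite ler_pdivrMr//; move: h; clear -lP La0 c0 B0 => *; lra.
clearbody om; clear X X1 X2 omX.
(* Among J windows one has mass at most N / J, and La c / J <= e. *)
pose J := (Num.truncn (La * c / e)).+1.
have JE : La * c * J%:R^-1 <= e.
  by rewrite ler_pdivrMr ?ltr0n// (mulrC e) -ler_pdivrMr//; exact/ltW/truncnS_gt.
have J0 : (0 < J)%N by [].
clearbody J.
have GJ0 : 0 < G ^+ J by rewrite exprn_gt0//; exact: lt_trans G1.
have GJ1 : 1 <= G ^+ J by rewrite exprn_ege1// ltW.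
near=> N => U Uu.
have q1 : 1 <= N%:R `^ 4^-1 :> R by near: N; exact: quartic_root_near.
have q2 : 4 <= N%:R `^ 4^-1 :> R by near: N; exact: quartic_root_near.
have q3 : 16 / (1 - k1) <= N%:R `^ 4^-1 by near: N; exact: quartic_root_near.
have q4 : (2 * om%:R + 9) * (2 / e) <= N%:R `^ 4^-1 by near: N; exact: quartic_root_near.
have q5 : (32 / e) ^+ 2 <= N%:R `^ 4^-1 by near: N; exact: quartic_root_near.
have q6 : G ^+ J <= N%:R `^ 4^-1 by near: N; exact: quartic_root_near.
have q7 : G * (G ^+ J) ^+ 2 / kap <= (N%:R `^ 4^-1) ^+ 2 by near: N; exact: quartic_root_sqr_near.
have q8 : 45 * om%:R * G ^+ J / e <= (N%:R `^ 4^-1) ^+ 2 by near: N; exact: quartic_root_sqr_near.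
have N2 : 2 * om%:R <= N%:R :> R by near: N; exact: nbhs_infty_ger.
have N0 : (0 < N)%N by near: N; exact: nbhs_infty_gt.
have SUN : sphere_exp U sq_energy <= expR (- sphere_entropy R N + e * N%:R) *
    \sum_(y : lattice_vec N | shell sk sr y) lattice_step R N ^+ N * expR (sq_energy (coords R y)).
  have H : forall U : probability (N.-tuple (measurableTypeR R)) R, uniform_on_sphere U ->
    forall Phi : ('I_N -> R) -> R,
    measurable_fun setT (fun e : N.-tuple (measurableTypeR R) => Phi (dilate 1 e)) ->
    regular (9 * La * c) Phi ->
    sphere_exp U Phi <= expR (- sphere_entropy R N + e * N%:R) *
    \sum_(y : lattice_vec N | shell sk sr y) lattice_step R N ^+ N * expR (Phi (coords R y)).
    by near: N; exact: SU.
  exact: (H U Uu sq_energy (@measurable_sq_energy _ _ _ _ _ lP La0 c0 N) (@energy_regular _ _ _ _ _ lP La0 (ltW c0) N)).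
have NQ := quartic_root_sqr R N.
set q : R := N%:R `^ 4^-1 in q1 q2 q3 q4 q5 q6 q7 q8 NQ.
have Np : 0 < N%:R :> R by rewrite ltr0n.
have N1 : 1 <= N%:R :> R by rewrite ler1n.
have q0 : 0 < q by exact: lt_le_trans q1.
have G0 : 0 < G by exact: lt_trans G1.
(* The top of all the windows: the cells cover the bulk whichever window is chosen. *)
pose TJ := G ^+ J * q.
have TJ0 : 0 < TJ by exact: mulr_gt0.
have TJ1 : 1 <= TJ by rewrite -[1]mulr1; apply: ler_pM.
have TJN : TJ <= N%:R.
  rewrite -NQ (_ : q ^+ 4 = q * q * (q * q)); last by ring.
  by apply: le_trans (_ : q * q <= _); [rewrite ler_wpM2r// ltW|rewrite ler_peMr ?mulr_ge0 ?(ltW q0)// -[1]mulr1 ler_pM].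
have omn : (0 < om)%N by rewrite -(ltr0n R).
pose D := (N ^ 3 %/ om)%N; pose w : R := lattice_step R N * D%:R.
have /andP[w1 w2] := cell_width N0 omn N2; rewrite -/D -/w in w1 w2.
have w0 : 0 < w by apply: lt_le_trans w1; rewrite invr_gt0 mulr_gt0.
have D0 : (0 < D)%N by rewrite -(ltr0n R); move: w0; rewrite /w pmulr_rgt0// lattice_step_gt0.
have TJ1N : 1 <= TJ <= N%:R by rewrite TJ1.
pose p := (Num.truncn (2 * om%:R * TJ)).+1.
have [p1 p2 p3] := cell_number N0 omn N2 TJ1N; rewrite -/D -/p -/w in p1 p2 p3.
have w4 : w <= 1 / 4 by exact: le_trans om4.
pose v0 : R := ln (2 * pi).
set SE := sphere_exp U sq_energy in SUN *.
have SE1 : 1 <= SE by exact: sphere_exp_ge1.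
have SE0 : 0 < SE by exact: lt_le_trans SE1.
pose V := N%:R^-1 * ln SE + 2^-1 * v0 + 2^-1 - eps.
have e2E : q^-1 * (ln w^-1 + ln (8 * N%:R ^+ 2) + 1) <= e.
  have om20 : 0 < 2 * om%:R :> R by exact: mulr_gt0.
  have wo : w^-1 <= 2 * om%:R by rewrite -[leRHS]invrK lef_pV2 ?posrE ?invr_gt0.
  exact: (cell_entropy_error (esym NQ) q1 ep w0 wo q4 q5).
have wer : 8 * c * w + 4 * La * c * w <= e.
  by rewrite -mulrDl; apply: le_trans ome; rewrite ler_wpM2l// addr_ge0 ?mulr_ge0// ltW.
have q2h : q^-1 <= 1 / 2 by rewrite div1r lef_pV2 ?posrE//; apply: le_trans q2; rewrite ler_nat.
have room : 4 * w + 2 * q^-1 < 1 - k1.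
  have h1 : 4 * w <= (1 - k1) / 4 by apply: le_trans omk; rewrite ler_wpM2l.
  have h2 : 2 * q^-1 <= (1 - k1) / 8.
    by rewrite ler_pdivrMr//; move: q3; rewrite ler_pdivrMr//; clear -lP La0 c0 B0 => *; lra.
  by move: h1 h2 k1p; clear -lP La0 c0 B0 => *; lra.
apply: contrapT => no.
have Gy (y : lattice_vec N) : shell sk sr y ->
  expR (sq_energy (coords R y)) *
    \prod_i (cell_volume (@lattice_cell N p D) (lattice_step R N) (@lattice_cell N p D (y i)) * N%:R /
       (cell_count (@lattice_cell N p D) y (@lattice_cell N p D (y i)))%:R) <= expR (N%:R * (V + 4 * e)).
  move=> shy.
  have yk : sqnorm (coords R y) <= k1 * N%:R.
    by move: shy => /ler_normlP[_]; rewrite /k1 mulrDl -lerBlDl.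
  have yN : \sum_i coords R y i ^+ 2 <= N%:R by apply: le_trans yk _; rewrite ler_piMl// ltW.
  (* The window, hence the splitting into classes, depends on [y]; the cells do not. *)
  have [j jJ We] := light_window J0 G1 q0 (fun i => sqr_ge0 (coords R y i)) yN.
  pose T := G ^+ j * q; rewrite -/T in We.
  have Gj : 1 <= G ^+ j by rewrite exprn_ege1// ltW.
  have GjJ : G ^+ j <= G ^+ J by rewrite ler_eXn2l// ltnW.
  have qT : q <= T by rewrite /T ler_peMl// ltW.
  have T1 : 1 <= T by exact: le_trans qT.
  have T0 : 0 < T by exact: lt_le_trans T1.
  have TTJ : T <= TJ by rewrite /T /TJ ler_wpM2r// ltW.
  have Tp : T < p%:R * w by exact: le_lt_trans p1.
  have GTT : G * T ^+ 2 <= kap * N%:R.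
    rewrite -NQ /T exprMn mulrA (_ : kap * q ^+ 4 = kap * q ^+ 2 * q ^+ 2); last by ring.
    rewrite ler_wpM2r ?sqr_ge0//; apply: le_trans (_ : G * (G ^+ J) ^+ 2 <= _).
      by rewrite ler_wpM2l ?(ltW G0)// lerXn2r// nnegrE exprn_ge0// ltW.
    by move: q7; rewrite ler_pdivrMr// (mulrC kap).
  have GT : G * T <= kap * N%:R / T by rewrite ler_pdivlMr// -mulrA -expr2.
  have TT : c * T ^+ 2 / N%:R <= dl.
    rewrite ler_pdivrMr//; apply: (@le_trans _ _ (c * (G * T ^+ 2))).
      by rewrite ler_wpM2l ?(ltW cp)// ler_peMl ?sqr_ge0// ltW.
    apply: (@le_trans _ _ (c * (kap * N%:R))); first by rewrite ler_wpM2l// ltW.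
    by rewrite mulrA ler_wpM2r.
  have Te : T^-1 <= q^-1 by rewrite lef_pV2 ?posrE.
  have [k [m [r [v [nu [a1 [W [cf H]]]]]]]] := extract_lattice lP La0 c0 B0 N0 D0 p2 (erefl w) w4 T1 Tp G1 kap0 GT
    yk (ltW k11) We Te q2h (ltW eep) (ltW dl0) ld lM TT ck MG room.
  apply: le_trans H _; rewrite ler_expR ler_pM2l//.
  have cV : config_value l B c N%:R r v a1 W <= V.
    rewrite leNgt; apply/negP => /ltW cV; apply: no.
    by exists k, m, r, v, nu, (p%:R * w), a1, W.
  have eec : 2 * ee * c <= e.
    by rewrite /ee (_ : 2 * (e / (2 * c)) * c = e)//; field; rewrite lt0r_neq0.
  by move: cV eec JE e2E wer; clear -lP La0 c0 B0 => *; lra.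
have tb := @types_bound R N _ _ (@lattice_cell N p D) (lattice_step R N) N0 (lattice_step_gt0 R N0)
   (shell sk sr) (fun y => sq_energy (coords R y)) _ (expR_ge0 _) Gy.
have cnt : N.+1%:R ^+ (2 * p).+1 <= expR (e * N%:R).
  have [lN _] := ln_le_quartic (esym NQ) q1.
  have N5 := succ_le_expR N0 q1 lN.
  apply: (@le_trans _ _ (expR (5 * q) ^+ (2 * p).+1)); first by rewrite lerXn2r ?nnegrE ?expR_ge0.
  rewrite -expRM_natr ler_expR; apply: (@le_trans _ _ (5 * q * (9 * om%:R * TJ))).
    by rewrite ler_wpM2l// mulr_ge0// ltW.
  have -> : 5 * q * (9 * om%:R * TJ) = 45 * om%:R * G ^+ J * q ^+ 2 by rewrite /TJ; ring.
  rewrite -[X in e * X]NQ.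
  rewrite (_ : e * q ^+ 4 = q ^+ 2 * e * q ^+ 2); last by ring.
  by rewrite ler_wpM2r ?sqr_ge0// -ler_pdivrMr.
have SEB : ln SE <= - sphere_entropy R N + e * N%:R + e * N%:R + N%:R * (V + 4 * e).
  exact: ln_chain SE0 SUN tb cnt.
apply: (@extract_contradiction N%:R (ln SE) (sphere_entropy R N) v0 eps e V (4 * e)) => //.
by rewrite /e mulrC divfK.
Unshelve. all: by end_near. Qed.

End Extract.


(** * The pair potential of a symmetric law *)

Section CoshBounds.
Variable R : realType.

(** Twice the hyperbolic cosine. By symmetry of the law its integral is twice the moment generating
    function, and its series has nonnegative terms only. *)
Definition cosh2 (x : R) : R := expR x + expR (- x).

Let b (x : R) (k : nat) : R := exp_coeff x k + exp_coeff (- x) k.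

Let cosh2_cvg (x : R) : series (b x) @ \oo --> cosh2 x.
Proof.
have -> : series (b x) = series (exp_coeff x) \+ series (exp_coeff (- x)).
  by apply/funext => n; rewrite /series /= -big_split.
by apply: cvgD; exact: is_cvg_series_exp_coeff.
Qed.

Let bE (x : R) (k : nat) : b x k = if odd k then 0 else 2 * x ^+ k / k`!%:R.
Proof.
rewrite /b /exp_coeff /= exprNn; case: (boolP (odd k)) => ok; rewrite -signr_odd ?ok ?(negbTE ok).
  by rewrite expr1 mulN1r mulNr subrr.
by rewrite expr0 mul1r; ring.
Qed.

Let b_ge0 (x : R) (k : nat) : 0 <= b x k.
Proof.
rewrite bE; case: ifPn => // ek; rewrite divr_ge0// mulr_ge0//.
by rewrite exprn_even_ge0.
Qed.

Lemma cosh2_ge (x : R) : 2 + x ^+ 2 <= cosh2 x.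
Proof.
have c1 : (fun=> 2 + x ^+ 2) @ \oo --> 2 + x ^+ 2 by exact: cvg_cst.
have := ler_cvg_to c1 (@cosh2_cvg x); apply.
near=> n; have n3 : (3 <= n)%N by near: n; exact: nbhs_infty_ge.
rewrite -(subnKC n3) /series /= big_mkord big_split_ord /=.
rewrite (_ : \sum_(i < 3) _ = 2 + x ^+ 2); first by rewrite lerDl sumr_ge0.
by rewrite !big_ord_recr big_ord0 /= !bE /= expr0 fact0 (_ : (2`! = 2)%N)//; field.
Unshelve. all: by end_near. Qed.

(** Every term of degree at least 4 gains a factor u^4; the terms of degree 0 and 2 are kept. *)
Lemma cosh2_dilate (u x : R) : 0 <= u <= 1 -> cosh2 (u * x) <= 2 + (u * x) ^+ 2 + u ^+ 4 * cosh2 x.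
Proof.
move=> /andP[u0 u1].
have c2 : (fun n => 2 + (u * x) ^+ 2 + u ^+ 4 * series (b x) n) @ \oo --> 2 + (u * x) ^+ 2 + u ^+ 4 * cosh2 x.
  by apply: cvgD; [exact: cvg_cst|apply: cvgMr; exact: cosh2_cvg].
have := ler_cvg_to (@cosh2_cvg (u * x)) c2; apply; apply: nearW => n.
pose d k : R := if k == 0%N then 2 else if k == 2%N then (u * x) ^+ 2 else 0.
have d0 k : 0 <= d k by rewrite /d; case: ifP => // _; case: ifP => // _; exact: sqr_ge0.
have dS : \sum_(k < n) d k <= 2 + (u * x) ^+ 2.
  apply: (@le_trans _ _ (\sum_(k < 3 + n) d k)).
    by rewrite addnC big_split_ord/= lerDl sumr_ge0.
  rewrite big_split_ord/= [X in _ + X]big1 => [|i _]; last by rewrite /d.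
  by rewrite !big_ord_recl big_ord0 /d /=; lra.
apply: (@le_trans _ _ (\sum_(k < n) d k + u ^+ 4 * series (b x) n)); last by rewrite lerD2r.
rewrite /series /= !big_mkord mulr_sumr -big_split/=; apply: ler_sum => k _.
have bu : b (u * x) k = u ^+ k * b x k by rewrite !bE exprMn; case: ifP => _; [rewrite mulr0|ring].
case: k bu => -[|[|[|[|k]]]] kn /= bu.
- by rewrite bE /= expr0 /d /= fact0 divr1 mulr1 lerDl mulr_ge0// exprn_ge0.
- by rewrite bu [b x 1]bE /= !mulr0 addr0.
- rewrite bE /= /d /= (_ : 2 * (u * x) ^+ 2 / 2`!%:R = (u * x) ^+ 2); last by rewrite (_ : 2`!%N = 2%N)//; field.
  by rewrite lerDl mulr_ge0// exprn_ge0.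
- by rewrite bu [b x 3]bE /= !mulr0 addr0.
- rewrite bu /d /= add0r ler_wpM2r//.
  by apply: ler_wiXn2l.
Qed.

End CoshBounds.

Section Potential.
Variables (R : realType) (mu : probR R).
Hypotheses (mu_sym : symmetric_law mu) (mu_var : unit_variance mu) (A_fin : (psi_bound mu < +oo)%E).
Local Open Scope ereal_scope.

Let measurable_oppR : measurable_fun setT (fun x : measurableTypeR R => - x : measurableTypeR R)%R.
Proof. exact: measurable_funN. Qed.

Lemma integral_symmetric (f : measurableTypeR R -> \bar R) : (forall x, 0 <= f x) -> measurable_fun setT f ->
  \int[mu]_x f (- x)%R = \int[mu]_x f x.
Proof.
move=> f0 mf.
have := @ge0_integral_pushforward _ _ _ _ R _ measurable_oppR mu setT f measurableT mf (fun x _ => f0 x).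
rewrite preimage_setT => <-; apply: eq_measure_integral => A mA _.
exact: mu_sym.
Qed.

Definition mgf (u : R) : \bar R := \int[mu]_t (expR (u * t))%:E.

Let measurable_exp (u : R) : measurable_fun setT (fun t : measurableTypeR R => (expR (u * t))%:E).
Proof. by apply/measurable_EFinP; apply: measurableT_comp => //; exact: measurable_funM. Qed.

Lemma mgfN u : mgf (- u) = mgf u.
Proof.
rewrite /mgf -[RHS](integral_symmetric _ (measurable_exp u)); last by move=> t; rewrite lee_fin expR_ge0.
by apply: eq_integral => t _; rewrite mulNr mulrN.
Qed.

Lemma mgf_cosh2 u : 2%:E * mgf u = \int[mu]_t (cosh2 (u * t))%:E.
Proof.
have -> : 2%:E * mgf u = mgf u + mgf (- u).
  by rewrite mgfN -mule2n mule_natl.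
rewrite /mgf -(ge0_integralD _ measurableT _ (measurable_exp u) _ (measurable_exp (- u))).
- by apply: eq_integral => t _; rewrite /cosh2 EFinD mulNr.
- by move=> t _; rewrite lee_fin expR_ge0.
- by move=> t _; rewrite lee_fin expR_ge0.
Qed.

(** Positive and negative parts have equal integrals. Were these infinite, [fine] would still return
    0, which is the value that the definition of the variance uses. *)
Lemma mean0 : fine 'E_mu[(fun x : measurableTypeR R => x : R)] = 0%R.
Proof.
pose f : measurableTypeR R -> \bar R := fun x => (x : R)%:E.
have mf : measurable_fun setT f by exact/measurable_EFinP.
have E : \int[mu]_x f^\- x = \int[mu]_x f^\+ x.
  rewrite -(@integral_symmetric (f^\+)).
  - by apply: eq_integral => x _; rewrite funeposE funenegE /f.
  - by move=> x; exact: funepos_ge0.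
  - exact: measurable_funepos.
have -> : 'E_mu[(fun x : measurableTypeR R => x : R)] = \int[mu]_x f x by rewrite unlock.
rewrite integralE E.
by case: (\int[mu]_x f^\+ x) => [r| |] //=; rewrite subrr.
Qed.

Lemma second_moment : \int[mu]_t (t ^+ 2)%:E = 1.
Proof.
rewrite -mu_var /variance unlock /= mean0 unlock.
apply: eq_integral => x _; transitivity (((x : R) - 0) * ((x : R) - 0))%:E; last by [].
by rewrite subr0 expr2.
Qed.

Let mgf_ge0 u : 0 <= mgf u.
Proof. by apply: integral_ge0 => t _; rewrite lee_fin expR_ge0. Qed.

Let integral_sqr u : \int[mu]_t (2 + (u * t) ^+ 2)%:E = (2 + u ^+ 2)%:E.
Proof.
have msq : measurable_fun setT (fun t : measurableTypeR R => ((t : R) ^+ 2)%:E).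
  by apply/measurable_EFinP; apply: measurable_funX.
transitivity (\int[mu]_t (2%:E + (u ^+ 2)%:E * (t ^+ 2)%:E)).
  by apply: eq_integral => t _; rewrite exprMn.
rewrite ge0_integralD//; first last.
- exact: measurable_funeM.
- by move=> t _; rewrite -EFinM lee_fin mulr_ge0// sqr_ge0.
rewrite integral_cst// [X in _ * X](@probability_setT _ _ _ mu) mule1.
rewrite ge0_integralZl ?lee_fin ?sqr_ge0//; last by move=> t _; rewrite lee_fin sqr_ge0.
by rewrite second_moment mule1.
Qed.

Let measurable_cosh2 u : measurable_fun setT (fun t : measurableTypeR R => (cosh2 (u * t))%:E).
Proof.
apply/measurable_EFinP; apply: measurable_funD.
  by apply: measurableT_comp => //; exact: measurable_funM.
by apply: measurableT_comp => //; apply: measurable_funN; exact: measurable_funM.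
Qed.

Let measurable_sqr u : measurable_fun setT (fun t : measurableTypeR R => (2 + (u * t) ^+ 2)%:E).
Proof.
by apply/measurable_EFinP; apply: measurable_funD => //; apply: measurable_funX; exact: measurable_funM.
Qed.

Lemma mgf_ge u : (1 + u ^+ 2 / 2)%:E <= mgf u.
Proof.
have : \int[mu]_t (2 + (u * t) ^+ 2)%:E <= 2%:E * mgf u.
  rewrite mgf_cosh2; apply: ge0_le_integral => //.
  - by move=> t _; rewrite lee_fin addr_ge0// sqr_ge0.
  - by move=> t _; rewrite lee_fin cosh2_ge.
rewrite integral_sqr (_ : (2 + u ^+ 2)%:E = 2%:E * (1 + u ^+ 2 / 2)%:E); last first.
  by rewrite -EFinM; congr EFin; field.
by rewrite lee_pmul2l.
Qed.

Lemma mgf_fin u : mgf u \is a fin_num.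
Proof.
rewrite ge0_fin_numE//.
have [->|u0] := eqVneq u 0%R.
  rewrite /mgf; under eq_integral do rewrite mul0r expR0.
  by rewrite integral_cst// [X in _ * X](@probability_setT _ _ _ mu) mule1 ltry.
rewrite ltey; apply/eqP => mu_oo; move: A_fin; rewrite /psi_bound.
have : psi mu u <= ereal_sup (range (psi mu)) by apply: ereal_sup_ubound; exists u.
rewrite /psi (negbTE u0) /log_mgf -/(mgf u) mu_oo /= mulyr gtr0_sg ?mul1e; last first.
  by rewrite invr_gt0 exprn_even_gt0.
by rewrite leye_eq => /eqP ->; rewrite mulry gtr0_sg// mul1e ltxx.
Qed.

Lemma mgf_le u : (0 <= u <= 1)%R -> mgf u <= (1 + u ^+ 2 / 2 + u ^+ 4 * fine (mgf 1))%:E.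
Proof.
move=> u01; have u4 : (0 <= u ^+ 4)%R by rewrite exprn_ge0//; case/andP: u01.
have : 2%:E * mgf u <= \int[mu]_t ((2 + (u * t) ^+ 2)%:E + (u ^+ 4)%:E * (cosh2 (1 * t))%:E).
  rewrite mgf_cosh2; apply: ge0_le_integral => //.
  - by move=> t _; rewrite lee_fin addr_ge0// expR_ge0.
  - by apply: emeasurable_funD => //; exact: measurable_funeM.
  - by move=> t _; rewrite lee_fin mul1r; exact: cosh2_dilate.
rewrite ge0_integralD//; first last.
- exact: measurable_funeM.
- by move=> t _; rewrite -EFinM lee_fin mulr_ge0// addr_ge0// expR_ge0.
- by move=> t _; rewrite lee_fin addr_ge0// sqr_ge0.
rewrite ge0_integralZl//; last by move=> t _; rewrite lee_fin addr_ge0// expR_ge0.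
rewrite integral_sqr -mgf_cosh2 -(fineK (mgf_fin 1)) -(fineK (mgf_fin u)) -!EFinM -EFinD !lee_fin.
by move: (fine (mgf 1)) (fine (mgf u)) => D Y /=; lra.
Qed.

Definition potential (x : R) : R := fine (log_mgf mu (Num.sqrt x)).

Let mgf_ge1 u : (1 <= fine (mgf u))%R.
Proof.
rewrite -lee_fin fineK ?mgf_fin//; apply: le_trans (mgf_ge u).
by rewrite lee_fin lerDl divr_ge0// sqr_ge0.
Qed.

Let log_mgfE u : log_mgf mu u = (ln (fine (mgf u)))%:E.
Proof.
rewrite /log_mgf -/(mgf u) -{1}(fineK (mgf_fin u)) lne_EFin//.
exact: lt_le_trans (mgf_ge1 u).
Qed.

Lemma log_mgf_potential u : log_mgf mu u = (potential (u ^+ 2))%:E.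
Proof.
rewrite /potential sqrtr_sqr !log_mgfE /=.
by have [|/ltW] := ger0P u; rewrite ?mgfN.
Qed.

Lemma potential_sqr u : potential (u ^+ 2) = ln (fine (mgf u)).
Proof. by apply: EFin_inj; rewrite -log_mgf_potential log_mgfE. Qed.

(** With x = u^2, the moment generating function lies between 1 + x / 2 and 1 + x / 2 + D x^2, so
    its logarithm is x / 2 + O(x^2). *)
Lemma potential_near0 (e : R) : (0 < e)%R ->
  exists2 d, (0 < d)%R & forall x, (0 <= x <= d)%R -> (`|potential x - x / 2| <= e * x)%R.
Proof.
move=> e0; pose D : R := fine (mgf 1); have D1 : (1 <= D)%R by exact: mgf_ge1.
exists (Num.min 1 (e / D))%R; first by rewrite lt_min ltr01 divr_gt0//; lra.
move=> x /andP[x0]; rewrite le_min => /andP[x1 xe].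
have xE : x = (Num.sqrt x ^+ 2)%R by rewrite sqr_sqrtr.
set u := Num.sqrt x in xE.
have u0 : (0 <= u)%R by exact: sqrtr_ge0.
have u1 : (0 <= u <= 1)%R by rewrite u0 -sqrtr1 ler_sqrt.
have ub := mgf_le u1; have lb := mgf_ge u.
move: ub lb; rewrite -(fineK (mgf_fin u)) !lee_fin -/D => ub lb.
have m0 : (0 < fine (mgf u))%R by exact: lt_le_trans (mgf_ge1 u).
have E4 : (u ^+ 4 = x * x)%R by rewrite {1 2}xE; ring.
have Dx : (D * x <= e)%R by rewrite mulrC -ler_pdivlMr; last exact: lt_le_trans D1.
rewrite -xE E4 in ub lb; rewrite {1}xE potential_sqr.
move: D D1 (fine (mgf u)) m0 ub lb xe Dx => D D1 Y m0 ub lb xe Dx.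
have l1 : (ln Y <= Y - 1)%R.
  by have := @expR_ge1Dx R (ln Y); rewrite lnK ?posrE//; lra.
have l2 : (x / 2 - x * x / 4 <= ln Y)%R.
  rewrite -ler_expR lnK ?posrE//; apply: le_trans lb.
  have x10 : (0 <= x <= 1)%R by rewrite x0.
  have := @expR_ge1Dx R (- (x / 2 - x * x / 4)); rewrite expRN => h.
  have y0 : (0 < 1 - (x / 2 - x * x / 4))%R by nra.
  have h' : (expR (x / 2 - x * x / 4) <= (1 - (x / 2 - x * x / 4))^-1)%R.
    by rewrite -[leLHS]invrK lef_pV2 ?posrE ?invr_gt0 ?expR_gt0.
  apply: le_trans h' _; rewrite -[leLHS]mul1r ler_pdivrMr//; nra.
have Dxx : (D * x * x <= e * x)%R by rewrite ler_wpM2r.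
have xx : (x * x / 4 <= D * x * x)%R by nra.
rewrite ler_norml; apply/andP; split; lra.
Qed.

Lemma pair_potentialP (B : R) :
  2%:E * psi mu x @[x --> +oo%R] --> B%:E ->
  [lipschitz (fine (log_mgf mu (Num.sqrt x)) : R^o) | x in [set x : R^o | (0 <= x)%R]] ->
  exists2 La, (0 <= La)%R & pair_potential potential La B.
Proof.
move=> limB lip.
have [K0 [_ HL]] := lip; pose La := (`|K0| + 1)%R.
have La0 : (0 <= La)%R by rewrite addr_ge0.
have H := HL La (le_lt_trans (ler_norm K0) (ltr_pwDr ltr01 (lexx _))).
exists La => //; split.
- by move=> x x0; rewrite -(sqr_sqrtr x0) potential_sqr ln_ge0.
- by move=> x y x0 y0; exact: (H (x, y)).
- have -> : (0 = 0 ^+ 2 :> R)%R by rewrite expr0n.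
  rewrite potential_sqr /mgf expr0n /=.
  under eq_integral do rewrite mul0r expR0.
  by rewrite integral_cst// [X in (_ * X)%E](@probability_setT _ _ _ mu) mule1 ln1.
- exact: potential_near0.
move=> e e0; have e2 : (0 < 2 * e)%R by rewrite mulr_gt0.
have /fine_cvgP[_ /cvgrPdist_le/(_ _ e2)[K [_ HK]]] := limB.
pose M := (`|K| + 1)%R; have M0 : (0 < M)%R by rewrite ltr_wpDl.
exists (M ^+ 2)%R; first by rewrite exprn_gt0.
move=> z Mz; have z0 : (0 < z)%R by apply: lt_le_trans Mz; rewrite exprn_gt0.
have zE : z = (Num.sqrt z ^+ 2)%R by rewrite sqr_sqrtr// ltW.
have s0 : (0 < Num.sqrt z)%R by rewrite sqrtr_gt0.
have Ks : (K < Num.sqrt z)%R.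
  apply: (@lt_le_trans _ _ M); first by apply: le_lt_trans (ler_norm K) _; rewrite ltrDl.
  by rewrite -(@ler_pXn2r _ 2) ?nnegrE ?(ltW M0) ?(ltW s0)// -zE.
have := HK _ Ks; rewrite /= /psi gt_eqF// log_mgf_potential -zE -!EFinM /= => h.
have E : (potential z - B / 2 * z = - (z / 2) * (B - 2 * (potential z * z^-1)))%R.
  by field; rewrite lt0r_neq0.
rewrite E normrM normrN (ger0_norm (_ : 0 <= z / 2)%R) ?divr_ge0 ?(ltW z0)//.
rewrite (_ : e * z = z / 2 * (2 * e))%R; last by field.
by rewrite ler_wpM2l// divr_ge0// ltW.
Qed.

End Potential.


(** * Independence and the Wigner matrix *)

Section LayerCake.
Variables (d : measure_display) (T : measurableType d) (R : realType) (P : probability T R).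
Local Notation leb := (@lebesgue_measure R).
Local Open Scope ereal_scope.

(** [h] is the integral over t >= 0 of the indicators of t < h, and the two integrals are exchanged.
    Factorisation on the level sets of [h] therefore gives factorisation of the expectation. *)
Lemma layer_cake (h g : T -> R) : (forall w, (0 <= h w)%R) -> (forall w, (0 <= g w)%R) ->
  measurable_fun setT h -> measurable_fun setT g ->
  \int[P]_w (h w * g w)%:E =
  \int[leb]_(t in `[0%R, +oo[) \int[P]_w ((\1_[set w | (t < h w)%R] w * g w)%R)%:E.
Proof.
move=> h0 g0 mh mg.
pose f (x : T * measurableTypeR R) : \bar R := (\1_[set y : T * measurableTypeR R | (0 <= y.2 < h y.1)%R] x * g x.1)%:E.
have mS : measurable [set y : T * measurableTypeR R | (0 <= y.2 < h y.1)%R].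
  rewrite (_ : [set y | _] = [set y : T * measurableTypeR R | (0 <= y.2)%R] `&` [set y : T * measurableTypeR R | (y.2 < h y.1)%R]); last first.
    by apply/seteqP; split=> y /= => [/andP[]|[-> ->]].
  have m2 : measurable_fun setT (fun y : T * measurableTypeR R => y.2 : R) by exact: measurable_snd.
  have m1 : measurable_fun setT (fun y : T * measurableTypeR R => h y.1) by exact: measurableT_comp mh measurable_fst.
  apply: measurableI.
    have := measurable_fun_ler (@measurable_cst _ _ _ _ setT (0 : R)%R) m2.
    by move=> /(_ measurableT [set true] Logic.I); rewrite setTI.
  have := measurable_fun_ltr m2 m1.
  by move=> /(_ measurableT [set true] Logic.I); rewrite setTI.
have mf : measurable_fun setT f.
  apply/measurable_EFinP; apply: measurable_funM; first exact: (@measurable_indic _ _ _ setT).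
  exact: measurableT_comp mg measurable_fst.
have f0 x : 0 <= f x by rewrite lee_fin mulr_ge0// indicE.
transitivity (\int[P]_w \int[leb]_t f (w, t)).
  apply: eq_integral => w _.
  have -> : \int[leb]_t f (w, t) = \int[leb]_(t in `[0%R, h w[) (g w)%:E.
    rewrite [RHS]integral_mkcond; apply: eq_integral => t _.
    rewrite patchE /f indicE; case: ifPn => ht.
      by rewrite mem_set ?mul1r//; move: ht; rewrite inE /= in_itv.
    by rewrite memNset ?mul0r//= => H; move/negP: ht; apply; rewrite inE /= in_itv.
  rewrite integral_cst//.
  rewrite [X in _ * X]lebesgue_measure_itv /= lte_fin EFinM muleC; congr (_ * _).
  by case: ltP => [_|hw]; [rewrite oppr0 adde0|apply/eqP; rewrite eqe eq_le h0 hw].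
rewrite (@fubini_tonelli _ _ _ _ R P leb f mf f0).
rewrite [RHS]integral_mkcond; apply: eq_integral => t _; rewrite patchE.
case: ifPn => ht.
  apply: eq_integral => w _; rewrite /f !indicE; congr (_ %:R * _)%:E; congr nat_of_bool.
  by move: ht; rewrite !inE /= in_itv/= andbT => t0; apply/idP/idP; rewrite !inE /= t0.
rewrite integral0_eq// => w _; rewrite /f indicE memNset ?mul0r//= => /andP[t0 _].
by move/negP: ht; apply; rewrite inE /= in_itv/= t0.
Qed.

Lemma integral_prod_layer (h g : T -> R) : (forall w, (0 <= h w)%R) -> (forall w, (0 <= g w)%R) ->
  measurable_fun setT h -> measurable_fun setT g ->
  (forall t, \int[P]_w ((\1_[set w | (t < h w)%R] w * g w)%R)%:E = P [set w | (t < h w)%R] * \int[P]_w (g w)%:E) ->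
  \int[P]_w (h w * g w)%:E = \int[P]_w (h w)%:E * \int[P]_w (g w)%:E.
Proof.
move=> h0 g0 mh mg H; rewrite layer_cake//.
have mt t : measurable [set w | (t < h w)%R] by rewrite -[X in measurable X]setTI; have := measurable_fun_ltr (@measurable_cst _ _ _ _ setT t) mh; move=> /(_ measurableT [set true] Logic.I).
have -> : \int[P]_w (h w)%:E = \int[leb]_(t in `[0%R, +oo[) P [set w | (t < h w)%R].
  transitivity (\int[P]_w (h w * 1)%:E); first by apply: eq_integral => w _; rewrite mulr1.
  rewrite (layer_cake h0 (fun=> ler01) mh (measurable_cst _)).
  apply: eq_integral => t _; under eq_integral do rewrite mulr1.
  by rewrite (integral_indic _ measurableT (mt t)) setIT.
rewrite -ge0_integralZr//=.
- by apply: eq_integral => t _.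
- apply: measurable_funTS.
  have mS : measurable [set y : T * measurableTypeR R | (y.2 < h y.1)%R].
    have m2 : measurable_fun setT (fun y : T * measurableTypeR R => y.2 : R) by exact: measurable_snd.
    have m1 : measurable_fun setT (fun y : T * measurableTypeR R => h y.1) by exact: measurableT_comp mh measurable_fst.
    have := measurable_fun_ltr m2 m1.
    by move=> /(_ measurableT [set true] Logic.I); rewrite setTI.
  apply: eq_measurable_fun (measurable_fun_ysection P mS) => t _ /=.
  by congr (P _); apply/seteqP; split=> w; rewrite /ysection /= ?inE.
- by apply: integral_ge0 => w _; rewrite lee_fin.
Qed.

(** Independence is given for events. By induction the functions are exchanged for level sets one at
    a time; [J] collects the indices that carry an event. *)
Lemma mutually_independent_prod (I : finType) (D J : {set I}) (Y : I -> T -> measurableTypeR R)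
  (f : I -> R -> R) (A : I -> set (measurableTypeR R)) (s : seq I) :
  mutually_independent P D Y -> (forall i, i \in D -> measurable_fun setT (Y i)) ->
  (forall i x, (0 <= f i x)%R) -> (forall i, measurable_fun setT (f i)) -> 
  uniq s -> {subset s <= D} -> J \subset D -> {in s, forall i, i \notin J} ->
  (forall i, i \in J -> measurable (A i)) ->
  \int[P]_w ((\prod_(i <- s) f i (Y i w)) * \1_(\bigcap_(i in [set` J]) (Y i @^-1` A i)) w)%:E =
  (\prod_(i <- s) \int[P]_w (f i (Y i w))%:E) * \prod_(i in J) P (Y i @^-1` A i).
Proof.
move=> indep mY f0 mf; elim: s J A => [|k s IH] J A.
  move=> _ _ JD _ mA; rewrite big_nil mul1e -indep//.
  under eq_integral do rewrite big_nil mul1r.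
  rewrite integral_indic// ?setIT//.
  apply: fin_bigcap_measurable => // i iJ; rewrite -[X in measurable X]setTI.
  by apply: (mY i (fintype.subsetP JD i iJ)) => //; exact: mA.
rewrite /= => /andP[ks us] sD JD sJ mA.
have kD : k \in D by apply: sD; rewrite mem_head.
have kJ : k \notin J by apply: sJ; rewrite mem_head.
have sD' : {subset s <= D} by move=> i si; apply: sD; rewrite inE si orbT.
have sJ' : {in s, forall i, i \notin J} by move=> i si; apply: sJ; rewrite inE si orbT.
rewrite big_cons.
under eq_integral do rewrite big_cons -mulrA.
rewrite -muleA -(IH J A)//; apply: integral_prod_layer.
- by move=> w.
- by move=> w; rewrite mulr_ge0// ?prodr_ge0// indicE.
- exact: measurableT_comp (mf k) (mY k kD).
- apply: measurable_funM.
    elim: (s) (sD') => [|i s' IHs] sD''; first by under eq_fun do rewrite big_nil; exact: measurable_cst.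
    under eq_fun do rewrite big_cons; apply: measurable_funM; last by apply: IHs => j js; apply: sD''; rewrite inE js orbT.
    by apply: measurableT_comp (mf i) (mY i _); apply: sD''; rewrite mem_head.
  apply: (@measurable_indic _ _ _ setT).
  apply: fin_bigcap_measurable => // i iJ; rewrite -[X in measurable X]setTI.
  by apply: (mY i (fintype.subsetP JD i iJ)) => //; exact: mA.
move=> t.
(* The level set of [f k] becomes the event at the new index [k]. *)
pose A' i := if i == k then [set x : measurableTypeR R | (t < f k x)%R] else A i.
have mt : measurable [set x : measurableTypeR R | (t < f k x)%R].
  rewrite -[X in measurable X]setTI; have := measurable_fun_ltr (@measurable_cst _ _ _ _ setT t) (mf k).
  by move=> /(_ measurableT [set true] Logic.I).
have A'J i : i \in J -> A' i = A i by move=> iJ; rewrite /A'; case: eqP => // ik; move: kJ; rewrite -ik iJ.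
transitivity (\int[P]_w ((\prod_(i <- s) f i (Y i w)) * \1_(\bigcap_(i in [set` k |: J]) (Y i @^-1` A' i)) w)%:E).
  apply: eq_integral => w _; rewrite mulrCA; congr (_ * _)%:E.
  rewrite !indicE -natrM mulnb -in_setI; congr (nat_of_bool (w \in _))%:R.
  apply/seteqP; split=> v /=.
    move=> [tk H] i /=; rewrite !inE => /orP[/eqP->|iJ]; first by rewrite /A' eqxx.
    by rewrite A'J//; exact: H.
  move=> H; split; first by have := H k; rewrite /= !inE eqxx /= /A' eqxx; apply.
  by move=> i /= iJ; rewrite -(A'J _ iJ); apply: H; rewrite /= !inE iJ orbT.
rewrite (IH (k |: J) A')//.
- rewrite (big_setU1 _ kJ)/= {1}/A' eqxx muleCA; congr (_ * _).
  rewrite IH//; congr (_ * _); apply: eq_bigr => i iJ; by rewrite A'J.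
- by apply/fintype.subsetP => i; rewrite !inE => /orP[/eqP->//|]; exact: (fintype.subsetP JD).
- move=> i si; rewrite !inE negb_or sJ'// andbT; apply: contraNneq ks => <-; exact: si.
- by move=> i; rewrite !inE => /orP[/eqP->|iJ]; [rewrite /A' eqxx|rewrite A'J//; exact: mA].
Qed.

Lemma mutually_independent_expectation (I : finType) (D : {set I}) (Y : I -> T -> measurableTypeR R)
  (f : I -> R -> R) :
  mutually_independent P D Y -> (forall i, i \in D -> measurable_fun setT (Y i)) ->
  (forall i x, (0 <= f i x)%R) -> (forall i, measurable_fun setT (f i)) -> 
  \int[P]_w (\prod_(i in D) f i (Y i w))%:E = \prod_(i in D) \int[P]_w (f i (Y i w))%:E.
Proof.
move=> indep mY f0 mf.
have := @mutually_independent_prod I D finset.set0 Y f (fun=> setT) (enum D) indep mY f0 mf (enum_uniq _).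
rewrite big_enum /= big_set0 mule1 => <-.
- apply: eq_integral => w _; rewrite big_enum /= indicE mem_set ?mulr1// => i /=; by rewrite inE.
- by move=> i; rewrite mem_enum.
- by apply/fintype.subsetP => i; rewrite inE.
- by move=> i _; rewrite inE.
- by move=> i; rewrite inE.
Qed.

End LayerCake.


Section WignerMoment.
Variable R : realType.

Lemma sum_symmetric (N : nat) (F : 'I_N -> 'I_N -> R) : (forall i j, F i j = F j i) ->
  \sum_i \sum_j F i j =
  \sum_(p in [set p : 'I_N * 'I_N | (p.1 <= p.2)%N]%SET) (if p.1 == p.2 then 1 else 2) * F p.1 p.2.
Proof.
move=> Fs; rewrite pair_big /= (bigID (fun p : 'I_N * 'I_N => (p.1 <= p.2)%N)) /=.
rewrite [X in _ + X](_ : _ = \sum_(p : 'I_N * 'I_N | (p.1 < p.2)%N) F p.1 p.2); last first.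
  rewrite (reindex_inj (h := fun p : 'I_N * 'I_N => (p.2, p.1))) /=; last by move=> [? ?] [? ?] [-> ->].
  by apply: eq_big => [p|p _]; [rewrite ltnNge|exact: Fs].
rewrite [X in X + _](bigID (fun p : 'I_N * 'I_N => p.1 == p.2)) /=.
rewrite [RHS](eq_bigl (fun p : 'I_N * 'I_N => (p.1 <= p.2)%N)) => [|p]; last by rewrite inE.
rewrite [RHS](bigID (fun p : 'I_N * 'I_N => p.1 == p.2)) /= -addrA; congr (_ + _).
  by apply: eq_bigr => p /andP[_ ->]; rewrite mul1r.
rewrite [X in _ + X](eq_bigl (fun p : 'I_N * 'I_N => (p.1 <= p.2)%N && (p.1 != p.2))) => [|p]; last first.
  by rewrite ltn_neqAle andbC.
by rewrite -big_split /=; apply: eq_bigr => p /andP[_ /negPf->]; rewrite mulrDl mul1r.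
Qed.

Lemma ln_sandwich (q z y : R) : 0 < z -> 0 < y -> expR (- q) * z <= y -> y <= expR q * z ->
  `|ln y - ln z| <= q.
Proof.
move=> z0 y0; rewrite -ler_ln ?posrE ?mulr_gt0 ?expR_gt0// lnM ?posrE ?expR_gt0// expRK => h1.
rewrite -ler_ln ?posrE ?mulr_gt0 ?expR_gt0// lnM ?posrE ?expR_gt0// expRK => h2.
by rewrite ler_norml lerBrDr h1 lerBlDr.
Qed.

Lemma has_law_mgf (d : measure_display) (T : measurableType d) (P : probability T R)
    (mu : probR R) (Y : T -> measurableTypeR R) (s a : R) : s != 0 ->
  has_law P (fun w => s * Y w : R) mu ->
  (\int[P]_w (expR (a * Y w))%:E = mgf mu (a / s))%E.
Proof.
move=> s0 [mY lawY].
transitivity (\int[P]_w (expR (a / s * (s * Y w)))%:E)%E.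
  by apply: eq_integral => w _; rewrite mulrA divfK.
have mf : measurable_fun setT (fun t : measurableTypeR R => (expR (a / s * t))%:E).
  by apply/measurable_EFinP; apply: measurableT_comp => //; exact: measurable_funM.
have := @ge0_integral_pushforward _ _ _ _ R _ mY P setT _ measurableT mf (fun x _ => expR_ge0 _).
rewrite preimage_setT => <-; apply: eq_measure_integral => A mA _.
exact: lawY.
Qed.

Lemma half_compare (b e x f g r : R) : `|f - b * (2^-1 * x)| <= e * (2^-1 * x) -> `|g - b * x| <= e * x ->
  0 <= r -> `|f - 2^-1 * g| <= e * x + r.
Proof. by rewrite !ler_norml => /andP[? ?] /andP[? ?] r0; apply/andP; split; lra. Qed.

Lemma half_compare_small (La x f g r z : R) : 0 <= g -> g <= La * x -> 0 <= f -> f <= La * (2^-1 * x) -> 0 <= z ->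
  La * x <= r -> `|f - 2^-1 * g| <= z + r.
Proof. by move=> *; rewrite ler_norml; apply/andP; split; lra. Qed.

Lemma le_of_sqr_le (s M : R) : 0 <= M -> s ^+ 2 <= 2 * M -> s <= 2 * M + 1.
Proof. by move=> M0; rewrite expr2; have [s1|s1] := leP s 1 => H; [lra|nra]. Qed.

Variables (mu : probR R) (B La theta : R).
Hypotheses (mu_sym : symmetric_law mu) (mu_var : unit_variance mu) (A_fin : (psi_bound mu < +oo)%E).
Local Notation l := (potential mu).
Local Notation c := (4 * theta ^+ 2).
Hypothesis lP : pair_potential l La B.
Hypotheses (La0 : 0 <= La) (theta0 : 0 < theta).

(** The logarithm of the average over the matrix. Off the diagonal an entry occurs twice in the
    quadratic form but once here; on the diagonal the variance 2 / N leaves the factor 1 / 2 inside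
    [l]. *)
Definition wigner_energy (N : nat) (u : 'I_N -> R) : R :=
  \sum_(p in [set p : 'I_N * 'I_N | (p.1 <= p.2)%N]%SET)
    l ((if p.1 == p.2 then 2^-1 else 1) * (c * u p.1 * u p.2 / N%:R)).

(** On the diagonal l (x / 2) stands against l x / 2. For large x both are B x / 4 up to o(x), and
    for bounded x = s^2 both are O(s). *)
Lemma potential_half (e : R) : 0 < e -> exists2 C, 0 <= C &
  forall s, 0 <= s -> `|l (2^-1 * s ^+ 2) - 2^-1 * l (s ^+ 2)| <= e * s ^+ 2 + C * s.
Proof.
move=> e0; have [l0 lip l00 _ linf] := lP; have [M M0 HM] := linf e e0.
exists (La * (2 * M + 1)) => [|s s0]; first by rewrite mulr_ge0// addr_ge0// mulr_ge0// ltW.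
have s2 : 0 <= s ^+ 2 := sqr_ge0 s.
have es2 : 0 <= e * s ^+ 2 by rewrite mulr_ge0// ltW.
have [sM|sM] := leP (2 * M) (s ^+ 2).
  apply: half_compare (HM _ _) (HM _ _) _; rewrite ?mulr_ge0 ?addr_ge0 ?mulr_ge0// ?(ltW M0)//.
    by rewrite ler_pdivlMl.
  by apply: le_trans sM; rewrite ler_peMl// ?ler1n// ltW.
have /andP[p1 p2] := potential_le lP s2.
have /andP[p3 p4] : 0 <= l (2^-1 * s ^+ 2) <= La * (2^-1 * s ^+ 2) by apply: (potential_le lP); rewrite mulr_ge0.
have sM' : s <= 2 * M + 1 := le_of_sqr_le (ltW M0) (ltW sM).
have : La * s ^+ 2 <= La * (2 * M + 1) * s by rewrite -mulrA ler_wpM2l// expr2 ler_wpM2r.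
exact: half_compare_small p1 p2 p3 p4 es2.
Qed.

(** Only the diagonal differs. With s_i = sqrt (c / N) u_i, the quadratic errors add up to at most
    eps N since sum u_i^2 <= N^2, and the linear ones to C sqrt (c N). Concentrated vectors are thus
    covered as well. *)
Lemma wigner_energyP (eps : R) : 0 < eps -> exists2 C, 0 <= C & forall (N : nat) (u : 'I_N -> R),
  (0 < N)%N -> (forall i, 0 <= u i) -> \sum_i u i = N%:R ->
  `|wigner_energy u - energy l c u| <= eps * N%:R + C * Num.sqrt N%:R.
Proof.
move=> eps0; have c0 : 0 < c by rewrite mulr_gt0// exprn_gt0.
have [C C0 HC] := potential_half (divr_gt0 eps0 c0).
exists (C * Num.sqrt c) => [|N u N0 u0 us]; first by rewrite mulr_ge0.
have n0 : 0 < N%:R :> R by rewrite ltr0n.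
rewrite /energy sum_symmetric => [|i j]; last by congr l; rewrite -mulrA -(mulrA c) (mulrC (u i)); ring.
rewrite mulr_sumr /wigner_energy -sumrB (bigID (fun p : 'I_N * 'I_N => p.1 == p.2)) /=.
rewrite [X in _ + X]big1 ?addr0 => [|p /andP[_ pp]]; last by rewrite !(negPf pp) mul1r mulKf ?subrr// pnatr_eq0.
pose s i := Num.sqrt (c / N%:R) * u i.
have s0 i : 0 <= s i by rewrite mulr_ge0.
have sE i : s i ^+ 2 = c * u i * u i / N%:R.
  by rewrite exprMn sqr_sqrtr ?divr_ge0 ?ltW//; ring.
rewrite (eq_bigr (fun p : 'I_N * 'I_N => l (2^-1 * s p.1 ^+ 2) - 2^-1 * l (s p.1 ^+ 2))); last first.
  by move=> [i j] /= /andP[_ /eqP <-]; rewrite eqxx mul1r sE.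
rewrite (reindex_onto (fun i : 'I_N => (i, i)) (fun p => p.1)) /=; last by move=> [i j] /= /andP[_ /eqP->].
rewrite (eq_bigl xpredT) => [|i]; last by rewrite inE /= leqnn !eqxx.
apply: le_trans (ler_norm_sum _ _ _) _.
apply: (@le_trans _ _ (\sum_i (eps / c * s i ^+ 2 + C * s i))); first by apply: ler_sum => i _; exact: HC.
rewrite big_split /= -!mulr_sumr us; apply: lerD.
  have -> : \sum_i s i ^+ 2 = c / N%:R * \sum_i u i ^+ 2.
    by rewrite mulr_sumr; apply: eq_bigr => i _; rewrite sE; ring.
  have -> : eps * N%:R = eps / c * (c / N%:R * (N%:R * N%:R)) by field; rewrite !gt_eqF.
  rewrite !ler_wpM2l ?divr_ge0 ?(ltW c0) ?(ltW eps0)// -us mulr_sumr; apply: ler_sum => i _.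
  by rewrite expr2 ler_wpM2r//; rewrite (bigD1 i)//= lerDl sumr_ge0.
rewrite -[leRHS]mulrA ler_wpM2l// sqrtrM ?(ltW c0)// -mulrA ler_wpM2l//.
by rewrite sqrtrV ?(ltW n0)// -{2}(sqr_sqrtr (ltW n0)) expr2 mulKf// gt_eqF// sqrtr_gt0.
Qed.

Variables (N : nat) (d : measure_display) (T : measurableType d) (P : probability T R) (X : T -> 'M[R]_N).
Hypotheses (N0 : (0 < N)%N) (XW : wigner_matrix P mu X).

Lemma wigner_measurable (i j : 'I_N) : (i <= j)%N -> measurable_fun setT (fun w => X w i j : measurableTypeR R).
Proof.
have [_ _ offd diag] := XW; have n0 : 0 < N%:R :> R by rewrite ltr0n.
have scal (s : R) : 0 < s -> measurable_fun setT (fun w => s * X w i j : measurableTypeR R) ->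
    measurable_fun setT (fun w => X w i j : measurableTypeR R).
  move=> s0 ms; have := measurable_funM (@measurable_cst _ _ _ _ setT s^-1) ms.
  by apply: eq_measurable_fun => w _; rewrite /= mulKf ?gt_eqF.
rewrite leq_eqVlt => /orP[/eqP/val_inj ij|ij]; last first.
  by apply: (scal (Num.sqrt N%:R)); [rewrite sqrtr_gt0|exact: (offd _ _ ij).1].
by apply: (scal (Num.sqrt (N%:R / 2))); [rewrite sqrtr_gt0 divr_gt0|rewrite -ij; exact: (diag _).1].
Qed.

Let coef (e : N.-tuple (measurableTypeR R)) (p : 'I_N * 'I_N) : R :=
  (if p.1 == p.2 then 1 else 2) * (N%:R * theta * (tnth e p.1 * tnth e p.2)).

Lemma quad_form_sum (w : T) (e : N.-tuple (measurableTypeR R)) :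
  N%:R * theta * quad_form (X w) e =
  \sum_(p in [set p : 'I_N * 'I_N | (p.1 <= p.2)%N]%SET) coef e p * X w p.1 p.2.
Proof.
have [sX _ _ _] := XW.
rewrite /quad_form sum_symmetric => [|i j]; last by rewrite -{1}(sX w) mxE; ring.
rewrite mulr_sumr; apply: eq_bigr => p _; rewrite /coef; move: (if _ then _ else _) => k; ring.
Qed.

Lemma wigner_moment (e : N.-tuple (measurableTypeR R)) :
  (\int[P]_w (expR (N%:R * theta * quad_form (X w) e))%:E =
   (expR (wigner_energy (fun i => dilate 1 e i ^+ 2)))%:E)%E.
Proof.
have [_ indep offd diag] := XW; have n0 : 0 < N%:R :> R by rewrite ltr0n.
pose D := [set p : 'I_N * 'I_N | (p.1 <= p.2)%N]%SET.
under eq_integral do rewrite quad_form_sum expR_sum.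
rewrite (@mutually_independent_expectation _ _ R P _ D (fun p w => X w p.1 p.2) (fun p x => expR (coef e p * x)) indep); first last.
- by move=> p; apply: measurableT_comp => //; exact: measurable_funM.
- by move=> p x; exact: expR_ge0.
- by move=> p; rewrite inE; exact: wigner_measurable.
rewrite /wigner_energy expR_sum -prodEFin; apply: eq_bigr => p; rewrite inE => pD.
have nz : 0 < Num.sqrt N%:R :> R by rewrite sqrtr_gt0.
have mgfE (u x : R) : u ^+ 2 = x -> mgf mu u = (expR (l x))%:E.
  move=> <-; rewrite potential_sqr// lnK ?fineK ?mgf_fin// posrE -lte_fin fineK ?mgf_fin//.
  by apply: lt_le_trans (mgf_ge mu_sym mu_var u); rewrite lte_fin ltr_pwDl// divr_ge0// sqr_ge0.
have uE i : dilate 1 e i ^+ 2 = N%:R * tnth e i ^+ 2 :> R by rewrite /dilate mul1r exprMn sqr_sqrtr// ltW.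
rewrite /coef !uE; case: eqVneq => [pp|pp].
  rewrite -pp (@has_law_mgf _ _ P mu _ (Num.sqrt (N%:R / 2))) ?diag//; last by rewrite gt_eqF// sqrtr_gt0 divr_gt0.
  apply: mgfE; rewrite exprMn exprVn sqr_sqrtr ?divr_ge0 ?ltW//; field; by rewrite gt_eqF.
rewrite (@has_law_mgf _ _ P mu _ (Num.sqrt N%:R)) ?gt_eqF//; last by apply: offd; rewrite ltn_neqAle pp.
apply: mgfE; rewrite exprMn exprVn sqr_sqrtr ?ltW//; field; by rewrite gt_eqF.
Qed.

Variable U : probability (N.-tuple (measurableTypeR R)) R.
Hypothesis UU : uniform_on_sphere U.
Local Notation sq_energy := (fun y => energy l c (fun i => y i ^+ 2)).

Lemma measurable_wigner_energy :
  measurable_fun setT (fun e : N.-tuple (measurableTypeR R) => wigner_energy (fun i => dilate 1 e i ^+ 2)).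
Proof.
rewrite /wigner_energy; under eq_fun do rewrite -big_enum; apply: measurable_sum => p.
have mt k : measurable_fun setT (fun e : N.-tuple (measurableTypeR R) => dilate 1 e k ^+ 2).
  by apply: measurable_funX; apply: measurable_funM => //; exact: measurable_tnthR.
apply: (measurable_potential_comp lP La0) => [e|].
  by rewrite mulr_ge0//; [case: ifP|rewrite divr_ge0// mulr_ge0 ?sqr_ge0// mulr_ge0 ?sqr_ge0// mulr_ge0// sqr_ge0].
by do 4 (apply: measurable_funM => //).
Qed.

Lemma annealed_integralE :
  annealed_integral P X U theta =
  ((N%:R^-1)%:E * lne (\int[U]_(e in @unit_sphere R N)
      (expR (wigner_energy (fun i => dilate 1 e i ^+ 2)))%:E))%E.
Proof.
rewrite /annealed_integral; congr (_ * lne _)%E.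
pose f (x : T * N.-tuple (measurableTypeR R)) : \bar R :=
  (expR (\sum_(p in [set p : 'I_N * 'I_N | (p.1 <= p.2)%N]%SET) coef x.2 p * X x.1 p.1 p.2))%:E.
have mf : measurable_fun setT f.
  apply/measurable_EFinP; apply: measurableT_comp => //.
  rewrite (_ : (fun _ => _) = (fun x : T * N.-tuple (measurableTypeR R) =>
    \sum_(p : 'I_N * 'I_N) (if (p.1 <= p.2)%N then coef x.2 p * X x.1 p.1 p.2 else 0))); last first.
    by apply/funext => x; rewrite -big_mkcond; apply: eq_bigl => p; rewrite inE.
  apply: measurable_sum => p; case: (boolP (p.1 <= p.2)%N) => [pD|_]; last exact: measurable_cst.
  have mt k : measurable_fun setT (fun x : T * N.-tuple (measurableTypeR R) => tnth x.2 k : R).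
    exact: measurableT_comp (measurable_tnthR k) measurable_snd.
  apply: measurable_funM; first by do 3 (apply: measurable_funM => //).
  exact: measurableT_comp (wigner_measurable pD) measurable_fst.
transitivity (\int[P]_w \int[U]_e f (w, e))%E.
  by apply: eq_integral => w _; apply: eq_integral => e _; rewrite quad_form_sum.
rewrite (fubini_tonelli f mf) => [|x]; last by rewrite lee_fin expR_ge0.
transitivity (\int[U]_e (expR (wigner_energy (fun i => dilate 1 e i ^+ 2)))%:E)%E.
  by apply: eq_integral => e _; rewrite -wigner_moment; apply: eq_integral => w _; rewrite quad_form_sum.
have mS : measurable (@unit_sphere R N) := @measurable_sphere R N.
have mE : measurable_fun setT (fun e : N.-tuple (measurableTypeR R) =>
    (expR (wigner_energy (fun i => dilate 1 e i ^+ 2)))%:E).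
  by apply/measurable_EFinP; apply: measurableT_comp => //; exact: measurable_wigner_energy.
rewrite (@ge0_negligible_integral _ _ _ U setT (~` @unit_sphere R N))//.
- by rewrite setTD setCK.
- exact: measurableC.
- by have := probability_setC U mS; rewrite (proj1 UU) subee.
Qed.

Lemma annealed_compare (q : R) : (forall e, @unit_sphere R N e ->
    `|wigner_energy (fun i => dilate 1 e i ^+ 2) - sq_energy (dilate 1 e)| <= q) ->
  exists2 F : R, annealed_integral P X U theta = F%:E &
    `|F - N%:R^-1 * ln (sphere_exp U sq_energy)| <= N%:R^-1 * q.
Proof.
move=> H; have n0 : 0 < N%:R :> R by rewrite ltr0n.
have c0 : 0 < c by rewrite mulr_gt0// exprn_gt0.
pose E (e : N.-tuple (measurableTypeR R)) := sq_energy (dilate 1 e).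
pose W (e : N.-tuple (measurableTypeR R)) := wigner_energy (fun i => dilate 1 e i ^+ 2).
have bE : sphere_bounded (fun e => expR (E e)).
  exact: (sphere_bounded_exp (Phi := sq_energy) (@measurable_sq_energy _ _ _ _ _ lP La0 c0 N) (@energy_regular _ _ _ _ _ lP La0 (ltW c0) N)).
have bW : sphere_bounded (fun e => expR (W e)).
  split; [|by move=> e; exact: expR_ge0|].
    by apply: measurableT_comp => //; exact: measurable_wigner_energy.
  have [_ _ [M HM]] := bE; exists (expR q * M) => e Se.
  apply: (@le_trans _ _ (expR q * expR (E e))); last by rewrite ler_wpM2l ?expR_ge0 ?HM.
  by rewrite -expRD ler_expR; have := H e Se; rewrite ler_norml -/(W e) -/(E e) => /andP[_]; rewrite lerBlDr.
have qm : sphere_mean U (fun e => expR (- q) * expR (E e)) <= sphere_mean U (fun e => expR (W e)).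
  apply: (sphere_mean_le UU) => //; first by apply: (sphere_boundedM _ bE); apply: sphere_bounded_cst; exact: expR_ge0.
  by move=> e Se; rewrite -expRD ler_expR; have := H e Se; rewrite ler_norml lerBrDr => /andP[].
have qp : sphere_mean U (fun e => expR (W e)) <= sphere_mean U (fun e => expR q * expR (E e)).
  apply: (sphere_mean_le UU) => //; first by apply: (sphere_boundedM _ bE); apply: sphere_bounded_cst; exact: expR_ge0.
  by move=> e Se; rewrite -expRD ler_expR; have := H e Se; rewrite ler_norml lerBlDr => /andP[].
rewrite sphere_meanZ ?expR_ge0// -/(sphere_exp U sq_energy) in qm.
rewrite sphere_meanZ ?expR_ge0// -/(sphere_exp U sq_energy) in qp.
have Z0 : 0 < sphere_exp U sq_energy.
  exact: lt_le_trans ltr01 (sphere_exp_ge1 lP La0 c0 N0 UU).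
have S0 : 0 < sphere_mean U (fun e => expR (W e)) by apply: lt_le_trans qm; rewrite mulr_gt0 ?expR_gt0.
exists (N%:R^-1 * ln (sphere_mean U (fun e => expR (W e)))).
  by rewrite annealed_integralE (sphere_bounded_EFin UU bW) lne_EFin.
rewrite -mulrBr normrM (@ger0_norm _ N%:R^-1) ?invr_ge0// ler_wpM2l ?invr_ge0//.
exact: ln_sandwich.
Qed.

End WignerMoment.


(** * Upper and lower limits along filters *)

Section UpperLowerLimits.
Variables (R : realType) (T : choiceType) (X : filteredType T).
Implicit Types (F : set_system X) (f g : X -> \bar R).
Local Open Scope ereal_scope.

Lemma limf_einf_ge F f (c : \bar R) : (\forall x \near F, c <= f x) -> c <= limf_einf f F.
Proof.
move=> Fc; rewrite limf_einfE; apply: le_trans (ereal_sup_ubound _); last by exists [set x | c <= f x].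
by apply: le_ereal_inf_tmp => _ [x /= ? <-].
Qed.

Lemma limf_esup_le F f (c : \bar R) : (\forall x \near F, f x <= c) -> limf_esup f F <= c.
Proof.
move=> Fc; rewrite limf_esupE; apply: le_trans (ereal_inf_lbound _) _; first by exists [set x | f x <= c].
by apply: ub_ereal_sup => _ [x /= ? <-].
Qed.

Lemma limf_einf_le_esup F f g : ProperFilter F -> (forall x, f x <= g x) -> limf_einf f F <= limf_esup g F.
Proof.
move=> FF fg; rewrite limf_einfE limf_esupE; apply: ub_ereal_sup => _ [V FV <-].
apply: le_ereal_inf_tmp => _ [W FW <-].
have [x [Vx Wx]] := filter_ex (filterI FV FW).
apply: (@le_trans _ _ (f x)); first by apply: ereal_inf_lbound; exists x.
by apply: le_trans (fg x) _; apply: ereal_sup_ubound; exists x.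
Qed.

Lemma limf_einf_le F f (c : \bar R) : ProperFilter F -> (\forall x \near F, f x <= c) -> limf_einf f F <= c.
Proof.
move=> FF Fc; rewrite limf_einfE; apply: ub_ereal_sup => _ [V FV <-].
have [x [Vx fx]] := filter_ex (filterI FV Fc).
by apply: le_trans fx; apply: ereal_inf_lbound; exists x.
Qed.

Lemma limf_einf_shift_le F f g (e : R) : Filter F -> (\forall x \near F, f x <= g x + e%:E) ->
  limf_einf f F <= limf_einf g F + e%:E.
Proof.
move=> FF fg; rewrite !limf_einfE; apply: ub_ereal_sup => _ [V FV <-].
rewrite -leeBlDr//; apply: (@le_trans _ _ (ereal_inf [set g x | x in V `&` [set x | f x <= g x + e%:E]])).
  apply: le_ereal_inf_tmp => _ [x [Vx /= fgx] <-].
  have : ereal_inf [set f x | x in V] <= g x + e%:E by apply: le_trans fgx; apply: ereal_inf_lbound; exists x.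
  by rewrite -leeBlDr.
by apply: ereal_sup_ubound; exists (V `&` [set x | f x <= g x + e%:E]) => //; exact: filterI.
Qed.

Lemma limf_esup_shift_le F f g (e : R) : Filter F -> (\forall x \near F, f x <= g x + e%:E) ->
  limf_esup f F <= limf_esup g F + e%:E.
Proof.
move=> FF fg; rewrite !limf_esupE -leeBlDr//; apply: le_ereal_inf_tmp => _ [V FV <-]; rewrite leeBlDr//.
apply: (@le_trans _ _ (ereal_sup [set f x | x in V `&` [set x | f x <= g x + e%:E]])).
  by apply: ereal_inf_lbound; exists (V `&` [set x | f x <= g x + e%:E]) => //; exact: filterI.
apply: ub_ereal_sup => _ [x [Vx /= fgx] <-]; apply: le_trans fgx _.
by apply: leeD => //; apply: ereal_sup_ubound; exists x.
Qed.

End UpperLowerLimits.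

Section LimitComparison.
Variables (R : realType) (I : Type) (T : choiceType) (X : filteredType T).
Variables (F : set_system X) (D : set I) (f : X -> I -> nat -> \bar R) (A : nat -> \bar R).
Hypothesis FF : ProperFilter F.
Local Open Scope ereal_scope.
Hypothesis upper : forall e : R, (0 < e)%R ->
  \forall p \near F, forall a, D a -> \forall N \near \oo, f p a N <= A N + e%:E.
Hypothesis lower : forall e : R, (0 < e)%R ->
  \forall N0 \near \oo, exists2 a, D a & \forall p \near F, \forall N \near \oo, A N0 - e%:E <= f p a N.

Let S := ereal_sup [set limf_einf (fun p => limn_einf (f p a)) F | a in D].
Let U := limf_esup (fun p => ereal_sup [set limn_esup (f p a) | a in D]) F.

(** [lower] gives limsup A <= S and [upper] gives S <= liminf A, so A converges to S. Moreover S <=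
    U by comparing lower with upper limits, and U <= limsup A by [upper]. *)
Lemma limit_comparison : limn_esup A = U /\ limn_einf A = S.
Proof.
have ooF : ProperFilter (\oo : set_system nat) := eventually_filter.
have AS : limn_esup A <= S.
  apply/lee_addgt0Pr => e e0; apply: limf_esup_le.
  apply: filterS (lower e0) => N [a Da H]; rewrite -leeBlDr//.
  apply: le_trans (ereal_sup_ubound _); last by exists a.
  apply: limf_einf_ge; apply: filterS H => p H.
  exact: limf_einf_ge.
have SA : S <= limn_einf A.
  apply: ub_ereal_sup => _ [a Da <-]; apply/lee_addgt0Pr => e e0; apply: limf_einf_le.
  apply: filterS (upper e0) => p /(_ a Da) H; exact: limf_einf_shift_le.
have iA := limn_einf_sup A.
have UA : U <= limn_esup A.
  apply/lee_addgt0Pr => e e0; apply: limf_esup_le.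
  apply: filterS (upper e0) => p H; apply: ub_ereal_sup => _ [a Da <-].
  by apply: limf_esup_shift_le; exact: H.
have SU : S <= U.
  apply: ub_ereal_sup => _ [a Da <-]; apply: limf_einf_le_esup => p.
  by apply: le_trans (limn_einf_sup _) _; apply: ereal_sup_ubound; exists a.
split; apply/eqP; rewrite eq_le.
  by rewrite UA (le_trans AS SU).
by rewrite SA (le_trans iA AS).
Qed.

End LimitComparison.

Section DeltaKFilter.
Variable R : realType.

Lemma deltaK_proper : ProperFilter (@deltaK_filter R).
Proof.
apply: filter_from_proper => [|e e0].
  apply: filter_from_filter => [|e1 e2 /= e10 e20]; first by exists 1 => /=.
  have m0 : 0 < Num.min e1 e2 by rewrite lt_min e10.
  exists (Num.min e1 e2) => //= p [/andP[p0 pe] pK pd].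
  have [m1 m2] : Num.min e1 e2 <= e1 /\ Num.min e1 e2 <= e2 by rewrite !ge_min !lexx orbT.
  split; split; rewrite ?p0 /=; [exact: lt_le_trans pe m1| |exact: lt_le_trans pd m1
    |exact: lt_le_trans pe m2| |exact: lt_le_trans pd m2];
    by apply: le_lt_trans pK; rewrite lef_pV2.
have v0 : 0 < e^-1 by rewrite invr_gt0.
pose q := 2 * (e^-1 + 2); have q0 : 0 < q by rewrite /q; lra.
(* K just above 1 / e, and delta so small that delta K < e. *)
exists (e / q, e^-1 + 1) => /=; split; last 2 first.
- by rewrite ltrDl.
- by rewrite mulrAC -mulrA gtr_pMr// ltr_pdivrMr// /q; lra.
- by rewrite divr_gt0//= gtr_pMr// invf_lt1// /q; lra.
Qed.

Lemma deltaK_near (e : R) (Q : R -> R -> Prop) : 0 < e ->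
  (forall delta K, 0 < delta < e -> e^-1 < K -> delta * K < e -> Q delta K) ->
  \forall p \near @deltaK_filter R, Q p.1 p.2.
Proof. by move=> e0 H; exists e => //= p [p1 p2 p3]; exact: H. Qed.

End DeltaKFilter.


(** * Comparison of the free energy with the functional *)

Section FreeEnergy.
Variable R : realType.

Lemma near_div_sqrt (C e : R) : 0 <= C -> 0 < e -> \forall N \near \oo, C * Num.sqrt N%:R <= e * N%:R.
Proof.
move=> C0 e0; near=> N.
have : (C / e) ^+ 2 <= N%:R by near: N; exact: nbhs_infty_ger.
rewrite -{1}(sqr_sqrtr (ler0n R N)) ler_sqr ?nnegrE ?sqrtr_ge0 ?divr_ge0 ?(ltW e0)// => H.
rewrite -{2}(sqr_sqrtr (ler0n R N)) expr2 mulrA ler_wpM2r ?sqrtr_ge0//.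
by rewrite mulrC -ler_pdivrMr.
Unshelve. all: by end_near. Qed.

Lemma value_arith (F f z V e : R) : f + z + 2^-1 - e / 3 <= V -> `|F - f| <= e / 3 ->
  F - e <= V - z - 2^-1 - e / 3.
Proof. by move=> h; rewrite ler_norml => /andP[_]; lra. Qed.

Variables (mu : probR R) (B La theta : R).
Hypotheses (mu_sym : symmetric_law mu) (mu_var : unit_variance mu) (A_fin : (psi_bound mu < +oo)%E).
Local Notation l := (potential mu).
Local Notation c := (4 * theta ^+ 2).
Hypothesis lP : pair_potential l La B.
Hypotheses (La0 : 0 <= La) (theta0 : 0 < theta) (B0 : 0 <= B).
Local Notation sq_energy := (fun y => energy l c (fun i => y i ^+ 2)).
Variables (disp : nat -> measure_display) (Omega : forall N : nat, measurableType (disp N))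
  (P : forall N : nat, probability (Omega N) R) (X : forall N : nat, Omega N -> 'M[R]_N)
  (XW : forall N : nat, (0 < N)%N -> wigner_matrix (P N) mu (@X N))
  (U : forall N : nat, probability (N.-tuple (measurableTypeR R)) R)
  (UU : forall N : nat, (0 < N)%N -> uniform_on_sphere (U N)).

Let s N := N%:R^-1 * ln (sphere_exp (U N) sq_energy).

Let c0 : 0 < c. Proof. by rewrite mulr_gt0// exprn_gt0. Qed.

Lemma annealed_near (e : R) : 0 < e -> \forall N \near \oo,
  exists2 F : R, annealed_integral (P N) (@X N) (U N) theta = F%:E & `|F - s N| <= e.
Proof.
move=> e0; have e2 : 0 < e / 2 by rewrite divr_gt0.
have [C C0 HC] := wigner_energyP lP La0 theta0 e2.
near=> N.
have N0 : (0 < N)%N by near: N; exact: nbhs_infty_gt.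
have n0 : 0 < N%:R :> R by rewrite ltr0n.
have CN : C * Num.sqrt N%:R <= e / 2 * N%:R by near: N; exact: near_div_sqrt.
have [F FE HF] := @annealed_compare _ mu B La theta mu_sym mu_var A_fin lP La0 theta0 N _ _ _ _ N0 (XW N0) (U N) (UU N0)
  (e / 2 * N%:R + C * Num.sqrt N%:R) (fun y Sy => HC N (fun i => dilate 1 y i ^+ 2) N0 (fun i => sqr_ge0 _)
    (etrans (sqnorm_dilate 1 Sy) (etrans (congr1 (fun z => z * N%:R) (expr1n _ 2)) (mul1r _)))).
exists F => //; apply: le_trans HF _.
by rewrite ler_pdivrMl// (mulrC N%:R e); apply: le_trans (lerD (lexx _) CN) _; rewrite -mulrDl -splitr.
Unshelve. all: by end_near. Qed.

Let LE u : log_mgf mu u = (l (u ^+ 2))%:E. Proof. exact: log_mgf_potential. Qed.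

Lemma functional_le_annealed (e : R) : 0 < e ->
  \forall p \near @deltaK_filter R, forall a, @simplex3 R a -> \forall N \near \oo,
    (FN_functional mu B theta N a.1.1 a.1.2 a.2 p.1 p.2 <=
     annealed_integral (P N) (@X N) (U N) theta + e%:E)%E.
Proof.
move=> e0; have e2 : 0 < e / 2 by rewrite divr_gt0.
have [d /andP[d0 _] H] := FN_upper lP La0 theta0 B0 LE e2.
apply: (deltaK_near d0 (Q := fun delta K => forall a, @simplex3 R a -> \forall N \near \oo,
    (FN_functional mu B theta N a.1.1 a.1.2 a.2 delta K <=
     annealed_integral (P N) (@X N) (U N) theta + e%:E)%E)).
move=> delta K h1 h2 h3 a Sa; near=> N.
have N0 : (0 < N)%N by near: N; exact: nbhs_infty_gt.
have [F -> HF] : exists2 F : R, annealed_integral (P N) (@X N) (U N) theta = F%:E & `|F - s N| <= e / 2.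
  by near: N; exact: annealed_near.
have : forall V : probability (N.-tuple (measurableTypeR R)) R, uniform_on_sphere V -> (FN_functional mu B theta N a.1.1 a.1.2 a.2 delta K <=
    (N%:R^-1 * ln (sphere_exp V sq_energy) + e / 2)%:E)%E by near: N; exact: (H delta K h1 h2 h3 a Sa).
move=> /(_ _ (UU N0)) /le_trans; apply; rewrite -EFinD lee_fin -/(s N).
move: HF; rewrite ler_norml => /andP[+ _]; rewrite lerBrDl lerBlDr => HF.
by apply: le_trans (lerD HF (lexx _)) _; rewrite -addrA -splitr.
Unshelve. all: by end_near. Qed.

(** The masses of the configuration extracted in dimension M serve as alpha for every large N; they
    may vary with M, which the supremum over alpha allows. *)
Lemma annealed_le_functional (e : R) : 0 < e -> \forall M \near \oo,
  exists2 a, @simplex3 R a & \forall p \near @deltaK_filter R, \forall N \near \oo,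
    (annealed_integral (P M) (@X M) (U M) theta - e%:E <=
     FN_functional mu B theta N a.1.1 a.1.2 a.2 p.1 p.2)%E.
Proof.
move=> e0; have e3 : 0 < e / 3 by rewrite divr_gt0.
near=> M.
have M0 : (0 < M)%N by near: M; exact: nbhs_infty_gt.
have m0 : 0 < M%:R :> R by rewrite ltr0n.
have [F -> HF] : exists2 F : R, annealed_integral (P M) (@X M) (U M) theta = F%:E & `|F - s M| <= e / 3.
  by near: M; exact: annealed_near.
have : forall V : probability (M.-tuple (measurableTypeR R)) R, uniform_on_sphere V -> exists (k m : nat) (r : 'I_k -> R) (v : 'I_m -> R) (nu : probR R) (Mb a1 W : R),
    config l c r v nu Mb a1 W /\ M%:R^-1 * ln (sphere_exp V sq_energy) + 2^-1 * ln (2 * pi) + 2^-1 - e / 3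
      <= config_value l B c M%:R r v a1 W by near: M; exact: (extract lP La0 c0 B0 e3).
move=> /(_ _ (UU M0)) [k [m [r [v [nu [Mb [a1 [W []]]]]]]]].
move=> [[r0 v0 a10 a_sum] nuM nu2 nuW] val.
have [d d0 H] := FN_lower_near lP La0 theta0 LE r0 v0 m0 nuM nu2 nuW.
exists ((a1, \sum_j v j), \sum_i r i).
  by split => //=; apply: sumr_ge0 => i _; exact: ltW.
apply: (deltaK_near d0 (Q := fun delta K => \forall N \near \oo, (F%:E - e%:E <=
     FN_functional mu B theta N a1 (\sum_j v j) (\sum_i r i) delta K)%E)).
move=> delta K h1 h2 _; apply: filterS (H delta K h1 h2 _ e3) => N; apply: le_trans.
rewrite -EFinB lee_fin; move: val HF; rewrite /config_value -/(s M) /transfer_value.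
have -> : c / 4 = theta ^+ 2 by field.
exact: value_arith.
Unshelve. all: by end_near. Qed.

End FreeEnergy.

Local Open Scope ereal_scope.

Theorem proposition1 (R : realType)
  (mu : probR R)
  (mu_sym : symmetric_law mu) (mu_var : unit_variance mu)
  (A_fin : psi_bound mu < +oo) (A_gt1 : 1 < psi_bound mu)
  (B : R) (B_ge0 : (0 <= B)%R)
  (B_pinfty : 2%:E * psi mu x @[x --> +oo%R] --> B%:E)
  (B_ninfty : 2%:E * psi mu x @[x --> -oo%R] --> B%:E)
  (L_sqrt_lip : [lipschitz (fine (log_mgf mu (Num.sqrt x)) : R^o)
                 | x in [set x : R^o | (0 <= x)%R]])
  (disp : nat -> measure_display)
  (Omega : forall N : nat, measurableType (disp N))
  (P : forall N : nat, probability (Omega N) R)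
  (X : forall N : nat, Omega N -> 'M[R]_N)
  (X_wigner : forall N : nat, (0 < N)%N -> wigner_matrix (P N) mu (X N))
  (dist : probR R -> probR R -> R)
  (dist_metric : is_distance dist) (dist_weak : weak_compatible dist)
  (sigma : probR R) (sigma_sc : semicircle_law sigma)
  (kappa : R) (kappa_gt0 : (0 < kappa)%R)
  (conc : limn_esup (fun N : nat => (N%:R^-1)%:E *
     lne (P N [set w | (N%:R `^ (- kappa) <
                        dist (empirical_measure (X N w)) sigma)%R])) = -oo)
  (U : forall N : nat, probability (N.-tuple (measurableTypeR R)) R)
  (U_unif : forall N : nat, (0 < N)%N -> uniform_on_sphere (U N))
  (theta : R) (theta_gt0 : (0 < theta)%R) :
  limn_esup (fun N : nat => annealed_integral (P N) (X N) (U N) theta) =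
    limf_esup (fun p : R * R =>
      ereal_sup [set limn_esup (fun N : nat =>
                   FN_functional mu B theta N a.1.1 a.1.2 a.2 p.1 p.2)
                | a in @simplex3 R]) (@deltaK_filter R)
  /\
  limn_einf (fun N : nat => annealed_integral (P N) (X N) (U N) theta) =
    ereal_sup [set limf_einf (fun p : R * R =>
                 limn_einf (fun N : nat =>
                   FN_functional mu B theta N a.1.1 a.1.2 a.2 p.1 p.2))
                 (@deltaK_filter R)
              | a in @simplex3 R].

Proof.
have [La La0 lP] := pair_potentialP mu_sym mu_var A_fin B_pinfty L_sqrt_lip.
apply: (limit_comparison (f := fun p a N => FN_functional mu B theta N a.1.1 a.1.2 a.2 p.1 p.2)).
- exact: deltaK_proper.
- by move=> e e0; exact: (functional_le_annealed mu_sym mu_var A_fin lP La0 theta_gt0 B_ge0 X_wigner U_unif e0).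
- by move=> e e0; exact: (annealed_le_functional mu_sym mu_var A_fin lP La0 theta_gt0 B_ge0 X_wigner U_unif e0).
Qed.
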